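(* Let $B\subset\mathbb{R}^3$ be the ball of radius $R$. For given $\mathbf{f}\in\mathbf{L}_2(B)$ consider the problem of finding $\mathbf{v}\in\mathbf{H}^2(B)$ with $$\nabla\operatorname{div}\mathbf{v}+\lambda\mathbf{v}=\mathbf{f}\ \text{ in }B,\qquad \gamma_{\mathbf{n}}\mathbf{v}=0.$$ (1) For $\lambda=0$ the homogeneous problem has countably many linearly independent solutions $\mathbf{q}_\kappa^{\pm}(\mathbf{x})$, and the inhomogeneous problem is solvable if and only if $(\mathbf{f},\mathbf{q}_\kappa^{\pm})=0$ for all $\kappa$, that is, $\mathbf{f}_{\mathcal{B}}=0$, or equivalently $\operatorname{rot}\mathbf{f}=0$. (2) For $\lambda=\nu_{n,m}^2$ with fixed $n\geq 0$, $m\in\mathbb{N}$, the homogeneous problem has $2n+1$ linearly independent solutions $\mathbf{q}_\kappa(\mathbf{x})$, $\kappa=(n,m,k)$, $k=-n,\dots,n$, and the inhomogeneous problem is solvable if and only if $(\mathbf{f},\mathbf{q}_\kappa)=0$ for these $\kappa$; that is, the problem is Fredholm solvable.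
   Context: $\mathbf{L}_2(B)$ is the space of square-integrable vector functions with inner product $(\mathbf{u},\mathbf{v})=\int_B\mathbf{u}\cdot\overline{\mathbf{v}}\,dx$; $\mathbf{H}^2(B)$ is the Sobolev space of vector functions of order 2; $\gamma_{\mathbf{n}}\mathbf{v}$ is the trace of the normal component $\mathbf{n}\cdot\mathbf{v}$ on the sphere $\partial B$; $\operatorname{rot}$ is the curl, taken in the sense of distributions. Let $\psi_n(z)=(-z)^n\left(\frac{d}{z\,dz}\right)^n\frac{\sin z}{z}$, $n\ge0$; let $\alpha_{n,m}>0$ ($m\in\mathbb{N}$) be the positive zeros of $\psi_n'$ and $\rho_{n,m}>0$ the positive zeros of $\psi_n$, and $\nu_{n,m}=\alpha_{n,m}/R$. For $\kappa=(n,m,k)$, $n\ge 0$, $m\in\mathbb{N}$, $|k|\le n$, set $\mathbf{q}_\kappa=\nabla g_\kappa$ with $g_\kappa(r,\theta,\varphi)=c_\kappa\psi_n(\alpha_{n,m}r/R)Y_n^k(\theta,\varphi)$, $Y_n^k$ real spherical harmonics, $c_\kappa$ chosen so that $\|\mathbf{q}_\kappa\|=1$; then $-\nabla\operatorname{div}\mathbf{q}_\kappa=\nu_{n,m}^2\mathbf{q}_\kappa$, $\gamma_{\mathbf{n}}\mathbf{q}_\kappa=0$. For $n\ge1$, $m\in\mathbb{N}$, $|k|\le n$, $\mathbf{q}_\kappa^{\pm}$ are orthonormal eigenfunctions of the curl in $B$: $\operatorname{rot}\mathbf{q}_\kappa^{\pm}=\pm(\rho_{n,m}/R)\mathbf{q}_\kappa^{\pm}$,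 $\gamma_{\mathbf{n}}\mathbf{q}_\kappa^{\pm}=0$. The system of all $\mathbf{q}_\kappa,\mathbf{q}_\kappa^+,\mathbf{q}_\kappa^-$ is a complete orthonormal system in $\mathbf{L}_2(B)$, and $\mathbf{f}_{\mathcal{B}}=\sum_{\kappa,\,n\ge1}[(\mathbf{f},\mathbf{q}_\kappa^+)\mathbf{q}_\kappa^++(\mathbf{f},\mathbf{q}_\kappa^-)\mathbf{q}_\kappa^-]$ is the projection of $\mathbf{f}$ onto the orthogonal complement of $\{\nabla h:h\in H^1(B)\}$.
   Formalization: In (2), solvability in H² for every f in L₂ is false if f_B is not in H²; it is proved for f_B in H² (shown necessary), and for all f in L₂ with v, div v, ∇div v in L₂ and γ_n v = 0 instead of v in H². *)

(* Defs.v *)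
From HB Require Import structures.
From mathcomp Require Import all_boot all_order all_algebra.
From mathcomp Require Import finmap complex.
From mathcomp Require Import all_classical all_reals all_analysis.

Set Implicit Arguments.
Unset Strict Implicit.
Unset Printing Implicit Defensive.

Import Order.TTheory GRing.Theory Num.Theory numFieldNormedType.Exports.

Local Open Scope classical_set_scope.
Local Open Scope ring_scope.
Local Open Scope complex_scope.

(* Points of the space are triples, so that the Lebesgue measure is the product
   measure of the library. The norm that the library puts on R * R * R is the
   maximum norm: only its topology is used, and balls are defined with the
   Euclidean norm enorm. *)
Notation R3 R := (R * R * R)%type.

(* Complex scalar and vector functions. They are total on R3 R; only their
   values in the ball matter, and only up to a null set. *)
Notation sfield R := (R3 R -> R[i]).
Notation vfield R := (R3 R -> 'rV[R[i]]_3).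

Definition coord (R : realType) (x : R3 R) (j : 'I_3) : R :=
  tnth [tuple x.1.1; x.1.2; x.2] j.

Definition evec (R : realType) (j : 'I_3) : R3 R :=
  ((j == 0)%:R, (j == 1)%:R, (j == 2%:R)%:R).

Definition enorm (R : realType) (x : R3 R) : R :=
  Num.sqrt (\sum_j coord x j ^+ 2).

Definition eball (R : realType) (r : R) : set (R3 R) := [set x | enorm x < r].

Definition leb3 (R : realType) :
    {measure set (measurableTypeR R * measurableTypeR R * measurableTypeR R)
       -> \bar R} :=
  ((@lebesgue_measure R \x @lebesgue_measure R) \x @lebesgue_measure R)%E.

(* Equality almost everywhere in the ball of radius r. *)
Definition ae_eq_ball (R : realType) (r : R) (T : Type) (f g : R3 R -> T) :=
  {ae @leb3 R, forall x, eball r x -> f x = g x}.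

Definition cintegral (R : realType) (r : R) (f : sfield R) : R[i] :=
  Rintegral (@leb3 R) (eball r) (fun x => complex.Re (f x)) +i*
  Rintegral (@leb3 R) (eball r) (fun x => complex.Im (f x)).

Definition L2s (R : realType) (r : R) (u : sfield R) : Prop :=
  [/\ measurable_fun (eball r : set (measurableTypeR R * measurableTypeR R
                                     * measurableTypeR R))
        (fun x => complex.Re (u x)),
      measurable_fun (eball r : set (measurableTypeR R * measurableTypeR R
                                     * measurableTypeR R))
        (fun x => complex.Im (u x)) &
      (@leb3 R).-integrable (eball r)
        (fun x => (complex.Re (u x) ^+ 2 + complex.Im (u x) ^+ 2)%:E)].

Definition vcomp (R : realType) (v : vfield R) (j : 'I_3) : sfield R :=
  fun x => v x 0 j.

Definition L2 (R : realType) (r : R) (v : vfield R) : Prop :=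
  forall j, L2s r (vcomp v j).

Definition inner (R : realType) (r : R) (u v : vfield R) : R[i] :=
  cintegral r (fun x => \sum_j u x 0 j * conjc (v x 0 j)).

Definition pd (R : realType) (j : 'I_3) (f : R3 R -> R) : R3 R -> R :=
  fun x => 'D_(evec R j) f x.

Fixpoint Cn (R : realType) (n : nat) (f : R3 R -> R) : Prop :=
  if n is n'.+1 then
    continuous f /\
    forall j, (forall x, derivable f x (evec R j)) /\ Cn n' (pd j f)
  else continuous f.

(* Real-valued, infinitely differentiable, compact support in the open ball. *)
Definition test_fun (R : realType) (r : R) (phi : R3 R -> R) : Prop :=
  (forall n, Cn n phi) /\
  exists2 s, s < r & forall x, s <= enorm x -> phi x = 0.

(* Derivatives in the sense of distributions in the ball. These four relations
   are meant for square-integrable arguments, for which all integrals below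
   converge; users add the L2 conditions. *)
Definition weak_pd (R : realType) (r : R) (j : 'I_3) (u w : sfield R) : Prop :=
  forall phi, test_fun r phi ->
    cintegral r (fun x => u x * (pd j phi x)%:C) =
    - cintegral r (fun x => w x * (phi x)%:C).

Definition weak_grad (R : realType) (r : R) (h : sfield R) (p : vfield R) :
    Prop :=
  forall j, weak_pd r j h (vcomp p j).

Definition weak_div (R : realType) (r : R) (v : vfield R) (d : sfield R) :
    Prop :=
  forall phi, test_fun r phi ->
    cintegral r (fun x => \sum_j v x 0 j * (pd j phi x)%:C) =
    - cintegral r (fun x => d x * (phi x)%:C).

(* The indices i + 1 and i + 2 in 'I_3 are taken modulo 3:
   (rot v)_i = d_(i+1) v_(i+2) - d_(i+2) v_(i+1). *)
Definition weak_rot (R : realType) (r : R) (v w : vfield R) : Prop :=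
  forall phi, test_fun r phi -> forall i : 'I_3,
    cintegral r (fun x => v x 0 (i + 1) * (pd (i + 2%:R) phi x)%:C
                        - v x 0 (i + 2%:R) * (pd (i + 1) phi x)%:C) =
    cintegral r (fun x => w x 0 i * (phi x)%:C).

(* The Sobolev space H^k(B), for scalar and then for vector functions. *)
Fixpoint Hks (R : realType) (r : R) (k : nat) (u : sfield R) : Prop :=
  L2s r u /\
  if k is k'.+1 then forall j, exists2 w, weak_pd r j u w & Hks r k' w
  else True.

Definition Hk (R : realType) (r : R) (k : nat) (v : vfield R) : Prop :=
  forall j, Hks r k (vcomp v j).

(* gamma_n v = 0. For v and div v in L_2, the normal trace gamma_n v is the
   functional on traces of functions h in H^1(B) that is given by Green's
   formula <gamma_n v, h> = int_B (v . grad h + (div v) h) dx. *)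
Definition normal_trace0 (R : realType) (r : R) (v : vfield R) : Prop :=
  exists d, [/\ L2s r d, weak_div r v d &
    forall h p, L2s r h -> L2 r p -> weak_grad r h p ->
      cintegral r (fun x => \sum_j v x 0 j * p x 0 j + d x * h x) = 0].

(* grad div v + lam v = f in B and gamma_n v = 0, with div v and grad div v
   taken in the sense of distributions and lying in L_2. *)
Definition solves (R : realType) (r : R) (lam : R) (f v : vfield R) : Prop :=
  [/\ L2 r v, normal_trace0 r v &
      exists d g, [/\ L2s r d, L2 r g, weak_div r v d, weak_grad r d g &
        ae_eq_ball r (fun x => g x + lam%:C *: v x) f]].

(* For lam <> 0 the two classes of solutions differ: the component of v that is
   orthogonal to all gradients is f_B / lam, so v in H^2(B) requires
   f_B in H^2(B). For lam = 0 solvability forces f_B = 0. *)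
Definition solves_H2 (R : realType) (r : R) (lam : R) (f v : vfield R) : Prop :=
  Hk r 2 v /\ solves r lam f v.

Definition lin_indep (R : realType) (r : R) (I : choiceType)
    (q : I -> vfield R) : Prop :=
  forall (A : {fset I}) (b : I -> R[i]),
    ae_eq_ball r (fun x => \sum_(i <- A) b i *: q i x) (fun=> 0) ->
    forall i, i \in A -> b i = 0.

Definition orthonormal_sys (R : realType) (r : R) (I : choiceType)
    (q : I -> vfield R) : Prop :=
  forall i j, inner r (q i) (q j) = (i == j)%:R.

Definition complete_sys (R : realType) (r : R) (I : choiceType)
    (q : I -> vfield R) : Prop :=
  forall f, L2 r f -> (forall i, inner r f (q i) = 0) ->
    ae_eq_ball r f (fun=> 0).

(* w is the sum of the series sum_i (f, q_i) q_i, as an unconditional sum in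
   the norm of L_2(B). *)
Definition fourier_sum (R : realType) (r : R) (I : choiceType)
    (q : I -> vfield R) (f w : vfield R) : Prop :=
  L2 r w /\
  forall e : R, 0 < e -> exists A0 : {fset I}, forall A : {fset I},
    (A0 `<=` A)%fset ->
    let rest := fun x => w x - \sum_(i <- A) inner r f (q i) *: q i x in
    complex.Re (inner r rest rest) < e.

Definition psi (R : realType) (n : nat) (z : R) : R :=
  (- z) ^+ n *
  iter n (fun (h : R -> R) w => derive1 h w / w) (fun w => sin w / w) z.

(* a enumerates the positive zeros of f in increasing order. The enumeration
   starts at 0. *)
Definition pos_zeros (R : realType) (f : R -> R) (a : nat -> R) : Prop :=
  (forall m m', (m < m')%N -> a m < a m') /\
  (forall x, (0 < x /\ f x = 0) <-> exists m, a m = x).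

Definition legendre (R : realType) (n : nat) : {poly R} :=
  (2%:R ^+ n * n`!%:R)^-1 *: (('X^2 - 1) ^+ n)^`(n).

(* Real spherical harmonics as functions of the direction
   w = (sin t cos p, sin t sin p, cos t), up to normalization:
   sin^k(t) P_n^(k)(cos t) cos(k p) for k >= 0, and
   sin^|k|(t) P_n^(|k|)(cos t) sin(|k| p) for k < 0,
   where sin^l(t) exp(i l p) = (w_1 + i w_2)^l. *)
Definition sph_harm (R : realType) (n : nat) (k : int) (w : R3 R) : R :=
  let e := (w.1.1 +i* w.1.2) ^+ `|k|%N in
  (legendre R n)^`(`|k|%N).[w.2] *
  (if (0 <= k)%R then complex.Re e else complex.Im e).

(* g_kappa; its value at the origin is irrelevant. *)
Definition gpot (R : realType) (r : R) (alpha : nat -> nat -> R)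
    (c : nat -> nat -> int -> R) (n m : nat) (k : int) (x : R3 R) : R :=
  let s := enorm x in
  c n m k * psi n (alpha n m * s / r) *
  sph_harm n k (x.1.1 / s, x.1.2 / s, x.2 / s).

(* q_kappa = grad g_kappa *)
Definition qgrad (R : realType) (r : R) (alpha : nat -> nat -> R)
    (c : nat -> nat -> int -> R) (n m : nat) (k : int) : vfield R :=
  fun x => \row_j (pd j (gpot r alpha c n m k) x)%:C.

(* Triples (n, m, k) with n >= n0 and |k| <= n: n0 = 0 for the gradient fields
   and n0 = 1 for the eigenfields of the curl. *)
Definition kappa (n0 : nat) : Type :=
  {p : nat * nat * int | (n0 <= p.1.1)%N && (`|p.2| <= p.1.1)%N}.
HB.instance Definition _ n0 := Choice.on (kappa n0).

Definition at_kappa (T : Type) (n0 : nat) (q : nat -> nat -> int -> T)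
    (p : kappa n0) : T :=
  q (sval p).1.1 (sval p).1.2 (sval p).2.

(* q^+ is qpm false and q^- is qpm true, so that the sign is (-1) ^+ s. *)
Definition curl_sys (R : realType) (qpm : bool -> nat -> nat -> int -> vfield R)
    (i : bool * kappa 1) : vfield R :=
  at_kappa (qpm i.1) i.2.

Definition full_sys (R : realType) (q : nat -> nat -> int -> vfield R)
    (qpm : bool -> nat -> nat -> int -> vfield R)
    (i : kappa 0 + (bool * kappa 1)) : vfield R :=
  match i with
  | inl p => at_kappa q p
  | inr sp => curl_sys qpm sp
  end.

(* j = 0, ..., 2n is mapped to k = -n, ..., n *)
Definition kord (n : nat) (j : 'I_(n.*2.+1)) : int := (j : nat)%:Z - n%:Z.

(* Main.v *)
(** Testing the equation against the basis fields diagonalizes it: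
    (f, q_kappa) = (lambda - nu^2) (v, q_kappa) and (f, q^+-) = lambda (v, q^+-).
    So the stated conditions are necessary, and a solution of the gradient part is
    v = sum (f, q_kappa) / (lambda - nu^2) q_kappa. This series converges in H^2
    because of the estimate ||D^2 u|| + ||D^3 u|| <= C (||grad u|| + ||grad Lap u||)
    for smooth u with vanishing normal derivative, which follows from Bochner's
    identity applied to u and to its rotational derivatives.

    The fields q^+- are only given as weak eigenfields of the curl. The explicit
    eigenfields rot rot (x u) + l rot (x u), with u = H_n(l^2 |x|^2) P(x) for a
    solid harmonic P and psi_n(z) = z^n H_n(z^2), are orthogonal to all basis fields
    except the finitely many q^+- with the same eigenvalue; counting dimensions, these
    q^+- are combinations of the explicit fields, hence smooth.

    The kernel for lambda = nu_{n,m}^2 has dimension exactly 2n+1 because psi_n' and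
    psi_k' have no common positive zero for n <> k: a common zero z would be algebraic
    with exp(2iz) in Q(iz), which is excluded by Hermite-Pade approximation of
    the exponential function (Lindemann). *)
Require Import Defs.
From HB Require Import structures.
From mathcomp Require Import all_boot all_order all_algebra.
From mathcomp Require Import finmap complex.
From mathcomp Require Import all_classical all_reals all_analysis.
From mathcomp Require Import measurable_realfun perm ring lra zify.
(* The library's [vector.coord] would otherwise hide [coord]. *)
Require Import Defs.

Set Implicit Arguments.
Unset Strict Implicit.
Unset Printing Implicit Defensive.

Import Order.TTheory GRing.Theory Num.Theory numFieldNormedType.Exports.

Local Open Scope classical_set_scope.
Local Open Scope ring_scope.
Local Open Scope complex_scope.

(** * Smooth functions *)

(** Boundary conditions are expressed inside the ball, by [vb]: a smooth function is at most a
    constant times r^2 - |x|^2. Integration by parts up to the sphere uses interior cutoffs; their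
    derivatives are large near the sphere, and this factor compensates them. One such argument
    serves smooth fields, weak gradients and weak curls. Smooth functions are made into a
    commutative ring with commuting derivations, so that the vector identities can be checked by
    [ring]. Identities in spherical coordinates are multiplied by |x|^2, which keeps them valid at
    the origin. The a priori estimate has to reach third derivatives of the potential u because the
    solution is grad u and must lie in H^2. The distance from lambda to the other values nu^2 is
    controlled by a finiteness statement: below any bound lie only finitely many zeros of all the
    psi_n' together. The same statement for psi_n makes the eigenspaces of the curl
    finite-dimensional, so that dimensions can be counted. *)

Lemma derive_line (R : realType) (f : R3 R -> R) (x v : R3 R) :
  ('D_v f x = 'D_1 (fun t : R => f (t *: v + x)) 0) *
  (derivable f x v = derivable (fun t : R => f (t *: v + x)) 0 1).
Proof.
rewrite /derive /derivable.
have -> : (fun h : R => h^-1 *: (((fun t : R => f (t *: v + x)) \o shift 0) (h *: 1)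
   - f (0 *: v + x))) = (fun h : R => h^-1 *: ((f \o shift x) (h *: v) - f x)).
  by apply/funext => h /=; rewrite addr0 scale0r add0r /GRing.scale/= mulr1.
by [].
Qed.

(** Derivatives are only directional here, so the chain rule is obtained by restricting [f] to the
    line through [x] with direction [v], where the one-variable rule applies. *)
Lemma is_derive_comp (R : realType) (f : R3 R -> R) (h : R -> R) (x v : R3 R)
    (df dh : R) :
  is_derive x v f df -> is_derive (f x) 1 h dh ->
  is_derive x v (h \o f) (dh * df).
Proof.
move=> [fx fd] hd.
have [lE lD] := derive_line f x v; have [cE cD] := derive_line (h \o f) x v.
have g1 : is_derive (0 : R) 1 (fun t : R => f (t *: v + x)) df.
  by split; [rewrite -lD | rewrite -lE].
have hd' : is_derive (f (0 *: v + x)) 1 h dh by rewrite scale0r add0r.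
have [g2 g3] := @is_derive1_comp R h (fun t : R => f (t *: v + x)) 0 dh df hd' g1.
by split; [rewrite cD | rewrite cE].
Qed.

Lemma coordD (R : realType) (x y : R3 R) i : coord (x + y) i = coord x i + coord y i.
Proof. by case: i => -[|[|[|]]] //. Qed.

Lemma coordZ (R : realType) (t : R) (x : R3 R) i : coord (t *: x) i = t * coord x i.
Proof. by case: i => -[|[|[|]]] //. Qed.

Lemma coord_evec (R : realType) (i j : 'I_3) : coord (evec R j) i = (i == j)%:R.
Proof. by case: i => -[|[|[|]]] //= ?; case: j => -[|[|[|]]]. Qed.

Lemma coord3_continuous (R : realType) i : continuous (fun x : R3 R => coord x i).
Proof.
case: i => -[|[|[|]]] //= hi x; rewrite /coord /tnth /=.
- by apply: (@continuous_comp _ _ _ fst fst); [exact: cvg_fst | exact: cvg_fst].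
- by apply: (@continuous_comp _ _ _ fst snd); [exact: cvg_fst | exact: cvg_snd].
- exact: cvg_snd.
Qed.

Lemma is_derive_coord (R : realType) (x v : R3 R) i :
  is_derive x v (fun x : R3 R => coord x i) (coord v i).
Proof.
have cv : (fun h : R => h^-1 *: (((fun x : R3 R => coord x i) \o shift x) (h *: v) - coord x i))
    @ 0^' --> coord v i.
  apply: (@cvg_trans _ ((fun=> coord v i) @ (0 : R)^')); last exact: cvg_cst.
  apply: near_eq_cvg; near=> h.
  have h0 : h != 0 by near: h; exact: nbhs_dnbhs_neq.
  by rewrite /= coordD coordZ addrK /GRing.scale/= mulrA mulVf// mul1r.
split; first by apply/cvg_ex; exists (coord v i).
exact: cvg_lim cv.
Unshelve. all: by end_near.
Qed.

(* A version of [Cn] that also records the symmetry of second derivatives. *)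
Fixpoint Sn (R : realType) (n : nat) (f : R3 R -> R) : Prop :=
  if n is n'.+1 then
    [/\ continuous f,
        forall j, (forall x, derivable f x (evec R j)) /\ Sn n' (pd j f) &
        (0 < n')%N -> forall i j, pd i (pd j f) = pd j (pd i f)]
  else continuous f.

Lemma Sn_continuous (R : realType) n (f : R3 R -> R) : Sn n f -> continuous f.
Proof. by case: n => [|n] // []. Qed.

Lemma SnW (R : realType) n (f : R3 R -> R) : Sn n.+1 f -> Sn n f.
Proof.
elim: n f => [|n IH] f; first by case.
case=> cf df sf; split; [exact: cf | move=> j | by move=> _; apply: sf].
by have [d1 d2] := df j; split; [exact: d1 | exact: IH].
Qed.

Lemma Sn_Cn (R : realType) n (f : R3 R -> R) : Sn n f -> Cn n f.
Proof.
elim: n f => [|n IH] f; first by [].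
case=> cf df _; split; [exact: cf | move=> j].
by have [d1 d2] := df j; split; [exact: d1 | exact: IH].
Qed.

Lemma pdD (R : realType) j (f g : R3 R -> R) :
  (forall x, derivable f x (evec R j)) -> (forall x, derivable g x (evec R j)) ->
  pd j (f + g) = pd j f + pd j g.
Proof. by move=> df dg; apply/funext => x; exact: (deriveD (df x) (dg x)). Qed.

Lemma pdN (R : realType) j (f : R3 R -> R) :
  (forall x, derivable f x (evec R j)) -> pd j (- f) = - pd j f.
Proof. by move=> df; apply/funext => x; exact: (deriveN (df x)). Qed.

Lemma pdM (R : realType) j (f g : R3 R -> R) :
  (forall x, derivable f x (evec R j)) -> (forall x, derivable g x (evec R j)) ->
  pd j (f * g) = f * pd j g + g * pd j f.
Proof. by move=> df dg; apply/funext => x; exact: (deriveM (df x) (dg x)). Qed.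

Lemma pd_comp (R : realType) j (f : R3 R -> R) (h h' : R -> R) :
  (forall x, derivable f x (evec R j)) -> (forall x : R, is_derive x 1 h (h' x)) ->
  (forall x, derivable (h \o f) x (evec R j)) /\
  pd j (h \o f) = (h' \o f) * pd j f.
Proof.
move=> df dh.
have H x : is_derive x (evec R j) (h \o f) (h' (f x) * pd j f x).
  exact: (is_derive_comp (derivableP (df x)) (dh (f x))).
by split=> [x|]; [case: (H x) | apply/funext=> x; case: (H x)].
Qed.

Lemma SnD (R : realType) n (f g : R3 R -> R) : Sn n f -> Sn n g -> Sn n (f + g).
Proof.
elim: n f g => [|n IH] f g; first by move=> cf cg x; apply: continuousD; [exact: cf|exact: cg].
case=> cf df sf [cg dg sg]; split.
- by move=> x; apply: continuousD; [exact: cf|exact: cg].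
- move=> j; have [df1 df2] := df j; have [dg1 dg2] := dg j; split.
    by move=> x; apply: derivableD.
  rewrite pdD; [exact: IH|exact: df1|exact: dg1].
- case: n IH df sf dg sg => [|n] IH df sf dg sg; [move=> ?; discriminate | move=> _ i j].
  have [dfi [_ dfi2 _]] := df i; have [dfj [_ dfj2 _]] := df j.
  have [dgi [_ dgi2 _]] := dg i; have [dgj [_ dgj2 _]] := dg j.
  rewrite (pdD dfi dgi) (pdD dfj dgj) (pdD (dfj2 i).1 (dgj2 i).1).
  rewrite (pdD (dfi2 j).1 (dgi2 j).1) (sf isT i j) (sg isT i j); reflexivity.
Qed.

Lemma SnN (R : realType) n (f : R3 R -> R) : Sn n f -> Sn n (- f).
Proof.
elim: n f => [|n IH] f; first by move=> cf x; apply: continuousN; exact: cf.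
case=> cf df sf; split.
- by move=> x; apply: continuousN; exact: cf.
- move=> j; have [df1 df2] := df j; split; first by move=> x; apply: derivableN.
  rewrite pdN; [exact: IH|exact: df1].
- case: n IH df sf => [|n] IH df sf; [move=> ?; discriminate | move=> _ i j].
  have [dfi [_ dfi2 _]] := df i; have [dfj [_ dfj2 _]] := df j.
  rewrite (pdN dfi) (pdN dfj) (pdN (dfj2 i).1) (pdN (dfi2 j).1) (sf isT i j); reflexivity.
Qed.

Lemma derivableM3 (R : realType) j (f g : R3 R -> R) :
  (forall x, derivable f x (evec R j)) -> (forall x, derivable g x (evec R j)) ->
  forall x, derivable (f * g) x (evec R j).
Proof. by move=> df dg x; apply: derivableM. Qed.

Lemma SnM (R : realType) n (f g : R3 R -> R) : Sn n f -> Sn n g -> Sn n (f * g).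
Proof.
elim: n f g => [|n IH] f g; first by move=> cf cg x; apply: continuousM; [exact: cf|exact: cg].
(* The product rule multiplies first derivatives, known to order [n], by [f] and [g] themselves;
   [SnW] lowers these to the same order. *)
move=> Sf Sg; have Sf' := SnW Sf; have Sg' := SnW Sg; case: Sf Sg => cf df sf [cg dg sg]; split.
- by move=> x; apply: continuousM; [exact: cf|exact: cg].
- move=> j; have [df1 df2] := df j; have [dg1 dg2] := dg j; split.
    exact: derivableM3.
  rewrite pdM; [apply: SnD; exact: IH|exact: df1|exact: dg1].
- case: n IH Sf' Sg' df sf dg sg => [|n] IH Sf' Sg' df sf dg sg; [move=> ?; discriminate | move=> _ i j].
  have [dfi [_ dfi2 _]] := df i; have [dfj [_ dfj2 _]] := df j.
  have [dgi [_ dgi2 _]] := dg i; have [dgj [_ dgj2 _]] := dg j.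
  rewrite (pdM dfi dgi) (pdM dfj dgj).
  rewrite (pdD (derivableM3 dfi (dgj2 i).1) (derivableM3 dgi (dfj2 i).1)).
  rewrite (pdD (derivableM3 dfj (dgi2 j).1) (derivableM3 dgj (dfi2 j).1)).
  rewrite (pdM dfi (dgj2 i).1) (pdM dgi (dfj2 i).1).
  rewrite (pdM dfj (dgi2 j).1) (pdM dgj (dfi2 j).1) (sf isT i j) (sg isT i j).
  move: (pd j (pd i f)) (pd j (pd i g)) (pd i f) (pd i g) (pd j f) (pd j g).
  by move=> a b c d e h; ring.
Qed.

(** The family [h] lists all derivatives of the outer function. All levels [k] are treated at once
    because differentiation passes from [h k] to [h k.+1]. *)
Lemma Sn_comp (R : realType) (h : nat -> R -> R) n k (f : R3 R -> R) :
  (forall k (x : R), is_derive x 1 (h k) (h k.+1 x)) -> Sn n f -> Sn n (h k \o f).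
Proof.
move=> dh.
have ch m : continuous (h m).
  move=> x; apply: differentiable_continuous; apply/derivable1_diffP.
  by case: (dh m x).
elim: n k f => [|n IH] k f.
  by move=> cf x; apply: continuous_comp; [exact: cf | exact: ch].
move=> Sf; have Sf' := SnW Sf; case: Sf => cf df sf; split.
- by move=> x; apply: continuous_comp; [exact: cf | exact: ch].
- move=> j; have [df1 df2] := df j; have [p1 p2] := pd_comp df1 (dh k); split; first exact: p1.
  by rewrite p2; apply: SnM; [exact: IH | exact: df2].
- case: n IH Sf' df sf => [|n] IH Sf' df sf; [move=> ?; discriminate | move=> _ i j].
  have [dfi [_ dfi2 _]] := df i; have [dfj [_ dfj2 _]] := df j.
  have [p1 ->] := pd_comp dfi (dh k); have [q1 ->] := pd_comp dfj (dh k).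
  have [r1 r2] := pd_comp dfi (dh k.+1); have [s1 s2] := pd_comp dfj (dh k.+1).
  rewrite (pdM r1 (dfj2 i).1) (pdM s1 (dfi2 j).1) r2 s2 (sf isT i j).
  move: (pd j (pd i f)) (h k.+1 \o f) (h k.+2 \o f) (pd i f) (pd j f).
  by move=> a b c d e; ring.
Qed.

Lemma pd_cst (R : realType) j (c : R) : pd j (fun=> c : R) = (fun=> 0).
Proof. by apply/funext => x; rewrite /pd derive_cst. Qed.

Lemma Sn_cst (R : realType) n (c : R) : Sn n (fun=> c).
Proof.
elim: n c => [|n IH] c; first by move=> x; exact: cst_continuous.
split; first by move=> x; exact: cst_continuous.
- by move=> j; rewrite pd_cst; split=> // x; exact: derivable_cst.
- by move=> _ i j; rewrite !pd_cst.
Qed.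

Lemma pd_coord (R : realType) i j :
  pd j (fun x : R3 R => coord x i) = (fun=> (i == j)%:R).
Proof.
by apply/funext => x; have [_] := is_derive_coord x (evec R j) i; rewrite coord_evec.
Qed.

Lemma Sn_coord (R : realType) n i : Sn n (fun x : R3 R => coord x i).
Proof.
case: n => [|n]; first exact: coord3_continuous.
split; first exact: coord3_continuous.
- move=> j; rewrite pd_coord; split; last exact: Sn_cst.
  by move=> x; case: (is_derive_coord x (evec R j) i).
- by move=> _ j k; rewrite !pd_coord !pd_cst.
Qed.

Lemma pdB_at (R : realType) j (f g : R3 R -> R) x :
  derivable f x (evec R j) -> derivable g x (evec R j) ->
  pd j (fun y => f y - g y) x = pd j f x - pd j g x.
Proof. exact: deriveB. Qed.

Lemma pdM_at (R : realType) j (f g : R3 R -> R) x :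
  derivable f x (evec R j) -> derivable g x (evec R j) ->
  pd j (fun y => f y * g y) x = f x * pd j g x + g x * pd j f x.
Proof. exact: deriveM. Qed.

(* The ring of smooth functions and its derivations *)
Local Opaque pd.

Definition smooth_pred (R : realType) : {pred R3 R -> R} :=
  fun f => `[< forall n, Sn n f >].

Lemma smooth_closed (R : realType) : GRing.subring_closed (@smooth_pred R).
Proof.
split.
- by apply/asboolP => n; exact: Sn_cst.
- move=> f g /asboolP Sf /asboolP Sg; apply/asboolP => n.
  by apply: SnD => //; apply: SnN.
- move=> f g /asboolP Sf /asboolP Sg; apply/asboolP => n; exact: SnM.
Qed.

HB.instance Definition _ (R : realType) :=
  GRing.isSubringClosed.Build _ (@smooth_pred R) (@smooth_closed R).

Record smooth (R : realType) :=
  Smooth { smooth_fun :> R3 R -> R; smoothP : smooth_fun \in @smooth_pred R }.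

HB.instance Definition _ (R : realType) := [isSub for @smooth_fun R].
HB.instance Definition _ (R : realType) := [Choice of smooth R by <:].
HB.instance Definition _ (R : realType) :=
  [SubChoice_isSubComNzRing of smooth R by <:].

Lemma smooth_ext (R : realType) (f g : smooth R) : (forall x, f x = g x) -> f = g.
Proof. by move=> fg; apply/val_inj/funext. Qed.

Lemma smooth_Sn (R : realType) (f : smooth R) n : Sn n f.
Proof. by move: n; apply/asboolP; exact: (smoothP f). Qed.

Lemma smooth_derivable (R : realType) (f : smooth R) j x : derivable f x (evec R j).
Proof. by have [_ /(_ j)[+ _] _] := smooth_Sn f 1; exact. Qed.

Arguments smooth_derivable {R} f j x.

Lemma smooth_continuous (R : realType) (f : smooth R) : continuous f.
Proof. exact: Sn_continuous (smooth_Sn f 0). Qed.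

Lemma sd_subproof (R : realType) (j : 'I_3) (f : smooth R) :
  pd j f \in @smooth_pred R.
Proof. by apply/asboolP => n; have [_ /(_ j)[_ +] _] := smooth_Sn f n.+1. Qed.

(** Taking the derivations from an opaque existence proof keeps [sd] from unfolding to [pd] during
    conversion; [sdE] is the access to its values. [sC], [sX], [scomp] and [bdist] are sealed in the
    same way. *)
Lemma sd_spec (R : realType) :
  {D : 'I_3 -> smooth R -> smooth R | forall j f, smooth_fun (D j f) = pd j f}.
Proof. by exists (fun j f => Smooth (sd_subproof j f)). Qed.

Definition sd (R : realType) := sval (sd_spec R).

Lemma sdE (R : realType) (j : 'I_3) (f : smooth R) : smooth_fun (sd j f) = pd j f.
Proof. exact: (svalP (sd_spec R) j f). Qed.

Lemma sdB (R : realType) j : additive (@sd R j).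
Proof.
move=> f g; apply: smooth_ext => x.
change (smooth_fun (sd j (f - g)) x = smooth_fun (sd j f) x - smooth_fun (sd j g) x).
rewrite (sdE j (f - g)) (sdE j f) (sdE j g).
exact: (pdB_at (smooth_derivable f j x) (smooth_derivable g j x)).
Qed.

HB.instance Definition _ (R : realType) j :=
  GRing.isZmodMorphism.Build _ _ (@sd R j) (@sdB R j).

Lemma sdM (R : realType) j (f g : smooth R) : sd j (f * g) = f * sd j g + g * sd j f.
Proof.
apply: smooth_ext => x.
change (smooth_fun (sd j (f * g)) x =
  f x * smooth_fun (sd j g) x + g x * smooth_fun (sd j f) x).
rewrite (sdE j (f * g)) (sdE j f) (sdE j g).
exact: (pdM_at (smooth_derivable f j x) (smooth_derivable g j x)).
Qed.

Lemma sd_comm (R : realType) i j (f : smooth R) : sd i (sd j f) = sd j (sd i f).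
Proof.
have [_ _ /(_ isT i j) E] := smooth_Sn f 2.
have E2 k l : smooth_fun (sd k (sd l f)) = pd k (pd l f).
  by rewrite (sdE k (sd l f)); congr (pd k _); exact: sdE.
have H : smooth_fun (sd i (sd j f)) = smooth_fun (sd j (sd i f)).
  exact: (etrans (E2 i j) (etrans E (esym (E2 j i)))).
by apply: smooth_ext => x; exact: (congr1 (fun h => h x) H).
Qed.

Lemma sC_exists (R : realType) (c : R) : {g : smooth R | smooth_fun g = fun=> c}.
Proof.
have H : (fun=> c) \in @smooth_pred R by apply/asboolP => n; exact: Sn_cst.
by exists (Smooth H).
Qed.

Definition sC (R : realType) (c : R) : smooth R := sval (sC_exists c).

Lemma sCE (R : realType) (c : R) x : sC c x = c.
Proof. by rewrite /sC (svalP (sC_exists c)). Qed.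

Lemma sC_zmod (R : realType) : additive (@sC R).
Proof.
move=> a b; apply: smooth_ext => x.
have -> : (sC a - sC b) x = sC a x - sC b x by [].
by rewrite !sCE.
Qed.

Lemma sC_monoid (R : realType) : GRing.monoid_morphism (@sC R).
Proof.
split; first by apply: smooth_ext => x; rewrite sCE.
move=> a b; apply: smooth_ext => x.
have -> : (sC a * sC b) x = sC a x * sC b x by [].
by rewrite !sCE.
Qed.

HB.instance Definition _ (R : realType) :=
  GRing.isZmodMorphism.Build _ _ (@sC R) (@sC_zmod R).
HB.instance Definition _ (R : realType) :=
  GRing.isMonoidMorphism.Build _ _ (@sC R) (@sC_monoid R).

Lemma sd_sC (R : realType) j (c : R) : sd j (sC c) = 0.
Proof.
apply: smooth_ext => x; rewrite sdE /sC (svalP (sC_exists c)) pd_cst.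
reflexivity.
Qed.

Lemma sX_exists (R : realType) i :
  {g : smooth R | smooth_fun g = fun x => coord x i}.
Proof.
have H : (fun x => coord x i) \in @smooth_pred R.
  by apply/asboolP => n; exact: Sn_coord.
by exists (Smooth H).
Qed.

Definition sX (R : realType) i : smooth R := sval (sX_exists R i).

Lemma sXE (R : realType) i x : sX R i x = coord x i.
Proof. by rewrite /sX (svalP (sX_exists R i)). Qed.

Lemma sd_sX (R : realType) i j : sd j (sX R i) = (i == j)%:R.
Proof.
apply: smooth_ext => x; rewrite sdE /sX (svalP (sX_exists R i)) pd_coord.
by case: (i == j).
Qed.

Definition ev (R : realType) (x : R3 R) (f : smooth R) : R := f x.

Lemma ev_zmod (R : realType) x : additive (@ev R x). Proof. by []. Qed.

Lemma ev_monoid (R : realType) x : GRing.monoid_morphism (@ev R x). Proof. by []. Qed.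

HB.instance Definition _ (R : realType) x :=
  GRing.isZmodMorphism.Build _ _ (@ev R x) (@ev_zmod R x).
HB.instance Definition _ (R : realType) x :=
  GRing.isMonoidMorphism.Build _ _ (@ev R x) (@ev_monoid R x).

Definition tower (R : realType) (h : nat -> R -> R) :=
  forall k (x : R), is_derive x 1 (h k) (h k.+1 x).

Lemma scomp_exists (R : realType) (h : nat -> R -> R) (dh : tower h) k (f : smooth R) :
  {g : smooth R | smooth_fun g = h k \o f}.
Proof.
have H : h k \o f \in @smooth_pred R.
  by apply/asboolP => n; apply: Sn_comp => //; exact: smooth_Sn.
by exists (Smooth H).
Qed.

Definition scomp (R : realType) (h : nat -> R -> R) (dh : tower h) k (f : smooth R) :
  smooth R := sval (scomp_exists dh k f).

Lemma scompE (R : realType) (h : nat -> R -> R) (dh : tower h) k (f : smooth R) x :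
  scomp dh k f x = h k (f x).
Proof. by rewrite /scomp (svalP (scomp_exists dh k f)). Qed.

Lemma sd_scomp (R : realType) (h : nat -> R -> R) (dh : tower h) k j (f : smooth R) :
  sd j (scomp dh k f) = scomp dh k.+1 f * sd j f.
Proof.
apply: val_inj; change (smooth_fun (sd j (scomp dh k f)) =
  smooth_fun (scomp dh k.+1 f) * smooth_fun (sd j f)).
rewrite (sdE j (scomp dh k f)) (sdE j f) /scomp.
rewrite (svalP (scomp_exists dh k f)) (svalP (scomp_exists dh k.+1 f)).
by rewrite (pd_comp (smooth_derivable f j) (dh k)).2.
Qed.

Lemma sum3 (V : nmodType) (F : 'I_3 -> V) :
  \sum_(i < 3) F i = F 0 + F 1 + F 2%:R.
Proof.
rewrite !big_ord_recl big_ord0 addr0 addrA.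
by congr (F _ + F _ + F _); apply: val_inj.
Qed.

Lemma ord3_ind (P : 'I_3 -> Prop) : P 0 -> P 1 -> P 2%:R -> forall i, P i.
Proof.
move=> P0 P1 P2 [[|[|[|//]]] hi].
- by have -> : Ordinal hi = 0 by exact: val_inj.
- by have -> : Ordinal hi = 1 by exact: val_inj.
- by have -> : Ordinal hi = 2%:R by exact: val_inj.
Qed.

Lemma smfD (R : realType) (f g : smooth R) x : (f + g) x = f x + g x.
Proof. by []. Qed.

Lemma smfN (R : realType) (f : smooth R) x : (- f) x = - f x.
Proof. by []. Qed.

Lemma smfM (R : realType) (f g : smooth R) x : (f * g) x = f x * g x.
Proof. by []. Qed.

Lemma smf0 (R : realType) x : (0 : smooth R) x = 0.
Proof. by []. Qed.

Lemma smf1 (R : realType) x : (1 : smooth R) x = 1.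
Proof. by []. Qed.

Lemma smf_nat (R : realType) n x : (n%:R : smooth R) x = n%:R.
Proof. by rewrite -[LHS]/(ev x _) rmorph_nat. Qed.

Lemma smfX (R : realType) (f : smooth R) n x : (f ^+ n) x = f x ^+ n.
Proof. by rewrite -[LHS]/(ev x _) rmorphXn. Qed.

Lemma smf_sum (R : realType) (I : Type) (s : seq I) (P : pred I) (F : I -> smooth R) x :
  (\sum_(i <- s | P i) F i) x = \sum_(i <- s | P i) F i x.
Proof. by rewrite -[LHS]/(ev x _) rmorph_sum. Qed.

Definition smfE := (smfD, smfN, smfM, smf0, smf1, smf_nat, smfX, smf_sum, sCE, sXE).

Lemma sd1 (R : realType) j : sd j (1 : smooth R) = 0.
Proof. by rewrite -(rmorph1 (@sC R)) sd_sC. Qed.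

Lemma sd_nat (R : realType) j n : sd j (n%:R : smooth R) = 0.
Proof. by rewrite -(rmorph_nat (@sC R)) sd_sC. Qed.

Lemma sdD (R : realType) j (f g : smooth R) : sd j (f + g) = sd j f + sd j g.
Proof. exact: raddfD. Qed.

Lemma sdN (R : realType) j (f : smooth R) : sd j (- f) = - sd j f.
Proof. exact: raddfN. Qed.

Lemma sd_sum (R : realType) j (I : Type) (s : seq I) (P : pred I) (F : I -> smooth R) :
  sd j (\sum_(i <- s | P i) F i) = \sum_(i <- s | P i) sd j (F i).
Proof. exact: raddf_sum. Qed.

(** * Integration on the ball *)

Notation M3 R := (measurableTypeR R * measurableTypeR R * measurableTypeR R)%type.

Definition box3 (R : realType) (c : R3 R) (e : R) : set (R3 R) :=
  (ball c.1.1 e `*` ball c.1.2 e) `*` ball c.2 e.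

Lemma measurable_box3 (R : realType) (c : R3 R) (e : R) :
  measurable (box3 c e : set (M3 R)).
Proof.
have mb (x : R) : measurable (ball x e : set (measurableTypeR R)).
  by apply: open_measurable; exact: ball_open.
by apply: measurableX => //; apply: measurableX.
Qed.

(** The product sigma-algebra is generated by rectangles, so an open set is written as the countable
    union of the boxes with rational centre and radius that it contains. *)
Lemma open_measurable3 (R : realType) (U : set (R3 R)) :
  open U -> measurable (U : set (M3 R)).
Proof.
move=> oU.
pose B (q : (rat * rat * rat) * rat) : set (R3 R) :=
  box3 (ratr q.1.1.1, ratr q.1.1.2, ratr q.1.2) (ratr q.2).
pose F q := if `[< B q `<=` U >] then B q else set0.
have -> : U = \bigcup_q F q.
  apply/seteqP; split => [x Ux|x [q _]]; last first.
    by rewrite /F; case: asboolP => // BU Bx; exact: BU.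
  have /nbhs_ballP[e /= e0 eU] := open_nbhs_nbhs (conj oU Ux).
  (* A box of radius below [e / 2] that contains [x] lies in the box of radius [e] around [x]. *)
  have e20 : 0 < e / 2%:R by rewrite divr_gt0.
  have [d dP] := rat_in_itvoo e20; rewrite in_itv/= in dP.
  case/andP: dP => d0 de.
  have cex (y : R) : exists q : rat, `|ratr q - y| < ratr d :> R.
    have /rat_in_itvoo[q] : y - ratr d < y + ratr d :> R by lra.
    rewrite in_itv/= => /andP[q1 q2]; exists q.
    by rewrite ltr_norml; apply/andP; split; lra.
  have [c1 c1P] := cex x.1.1; have [c2 c2P] := cex x.1.2; have [c3 c3P] := cex x.2.
  exists ((c1, c2, c3), d) => //; rewrite /F asboolT.
    by split; [split|].
  move=> y [[y1 y2] y3]; apply: eU; rewrite /B /= in y1 y2 y3.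
  have tri (a b c : R) : `|b - a| < ratr d -> `|b - c| < ratr d -> `|a - c| < e.
    move=> h1 h2; have -> : a - c = (b - c) - (b - a) by ring.
    by apply: le_lt_trans (ler_normB _ _) _; lra.
  by split; [split|]; rewrite /ball /=; apply: tri; eassumption.
apply: countable_bigcupT_measurable; first exact: countableP.
by move=> q; rewrite /F; case: asboolP => // _; exact: measurable_box3.
Qed.

Lemma continuous_measurable3 (R : realType) (f : R3 R -> R) :
  continuous f -> measurable_fun (setT : set (M3 R)) f.
Proof.
move=> /continuousP cf; apply: (measurability _ (RGenOpens.measurableE R)).
move=> _ [_ [a [b ->] <-]]; rewrite setTI; apply: open_measurable3.
exact/cf/interval_open.
Qed.

Lemma bsupp_integrable d (T : measurableType d) (R : realType)
    (m : {measure set T -> \bar R}) (A : set T) (f : T -> R) (M : R) :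
  measurable A -> (m A < +oo)%E -> measurable_fun setT f ->
  (forall x, `|f x| <= M) -> (forall x, ~ A x -> f x = 0) ->
  m.-integrable setT (EFin \o f).
Proof.
move=> mA fA mf fM f0.
have -> : EFin \o f = (EFin \o f) \_ A.
  apply/funext => x; rewrite /patch; case: ifPn => // /negP xA.
  by rewrite /= f0// => Ax; apply: xA; rewrite inE.
apply/(integrable_mkcond _ mA); apply: measurable_bounded_integrable => //.
  exact: measurable_funS mf.
exists M; split; first exact: num_real.
by move=> x Mx y _ /=; exact: le_trans (fM y) (ltW Mx).
Qed.

Lemma integral_derive0 (R : realType) (g g' : R -> R) (a : R) :
  0 < a -> (forall x : R, is_derive x 1 g (g' x)) -> continuous g' ->
  (forall x, a <= `|x| -> g x = 0 /\ g' x = 0) ->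
  (\int[@lebesgue_measure R]_x (g' x)%:E = 0)%E.
Proof.
move=> a0 dg cg g0.
have cont : continuous g.
  move=> x; apply: differentiable_continuous; apply/derivable1_diffP.
  by case: (dg x).
have -> : (fun x => (g' x)%:E) = (fun x => (g' x)%:E) \_ `[- a, a]%classic.
  apply/funext => x; rewrite /patch; case: ifPn => // /negP xA.
  rewrite (g0 x _).2//; rewrite leNgt; apply/negP => xa; apply: xA.
  by rewrite inE /= in_itv/=; move: xa; rewrite ltr_norml => /andP[/ltW-> /ltW->].
rewrite -integral_mkcond (@continuous_FTC2 R g' g); last first.
- by move=> x _; rewrite derive1E; case: (dg x).
- split.
  + by move=> x _; case: (dg x).
  + by apply: cvg_at_right_filter; exact: cont.
  + by apply: cvg_at_left_filter; exact: cont.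
- by apply: continuous_subspaceT.
- by rewrite -subr_gt0 opprK addr_gt0.
by rewrite (g0 a _).1 ?(g0 (- a) _).1 ?sube0// ?normrN ?ger0_norm// ltW.
Qed.

Lemma is_derive_curve (R : realType) (f : R3 R -> R) (j : 'I_3) (gam : R -> R3 R)
    (z d : R) :
  (forall h, h *: evec R j + gam z = gam (h + z)) ->
  is_derive (gam z) (evec R j) f d -> is_derive z 1 (f \o gam) d.
Proof.
move=> hg [df eq_d].
have E : (fun h : R => h^-1 *: (((f \o gam) \o shift z) (h *: 1) - (f \o gam) z)) =
    (fun h : R => h^-1 *: ((f \o shift (gam z)) (h *: evec R j) - f (gam z))).
  by apply/funext => h /=; rewrite hg /GRing.scale /= mulr1.
by split; [rewrite /derivable E | rewrite /derive E].
Qed.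

Lemma evec_shift (R : realType) (h x y z : R) :
  [/\ h *: evec R 0 + (x, y, z) = (h + x, y, z),
      h *: evec R 1 + (x, y, z) = (x, h + y, z) &
      h *: evec R 2%:R + (x, y, z) = (x, y, h + z)].
Proof.
split; [transitivity (h * 1 + x, h * 0 + y, h * 0 + z)
       |transitivity (h * 0 + x, h * 1 + y, h * 0 + z)
       |transitivity (h * 0 + x, h * 0 + y, h * 1 + z)] => //;
by rewrite mulr1 mulr0 !add0r.
Qed.

Lemma line_continuous (R : realType) (v p : R3 R) :
  continuous (fun t : R => t *: v + p).
Proof.
move=> t; have c1 : {for t, continuous (fun t : R => t *: v)}.
  by apply: continuousZr_tmp; exact: cvg_id.
by have := continuousD c1 (@cst_continuous _ _ p t).
Qed.

Arguments line_continuous {R} v p.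

Lemma leb_sym_fin (R : realType) (a : R) :
  (@lebesgue_measure R `[(- a)%R, a]%classic < +oo)%E.
Proof. by rewrite lebesgue_measure_itv /=; case: ifP => // _; rewrite -EFinD ltry. Qed.

Lemma leb3_prod (R : realType) (A : set (measurableTypeR R * measurableTypeR R))
    (C : set (measurableTypeR R)) : measurable A -> measurable C ->
  @leb3 R (A `*` C) =
  ((@lebesgue_measure R \x @lebesgue_measure R) A * @lebesgue_measure R C)%E.
Proof. by move=> mA mC; exact: product_measure1E. Qed.

(** A named copy of the planar measure, made to carry the sigma-finite instance that Fubini's
    theorem requires when the third coordinate is split off. *)
Definition leb2 (R : realType) : set (measurableTypeR R * measurableTypeR R) -> \bar R :=
  (@lebesgue_measure R \x @lebesgue_measure R)%E.

HB.instance Definition _ (R : realType) := Measure.on (@leb2 R).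

Lemma leb2_sigma_finite (R : realType) : sigma_finite setT (@leb2 R).
Proof.
pose I (n : nat) := `[(- n%:R)%R, n%:R]%classic : set (measurableTypeR R).
have mI n : measurable (I n) by exact: measurable_itv.
exists (fun n => I n `*` I n).
  apply/esym/seteqP; split=> // -[x y] _.
  exists (Num.truncn (`|x| + `|y|)).+1 => //.
  have h : `|x| + `|y| < (Num.truncn (`|x| + `|y|)).+1%:R by exact: truncnS_gt.
  by split; rewrite /I /= in_itv/= -ler_norml; move: (normr_ge0 x) (normr_ge0 y) h; lra.
move=> n; split; first exact: measurableX.
rewrite /leb2 product_measure1E//; apply: lte_mul_pinfty => //.
  by rewrite ge0_fin_numE//; exact: leb_sym_fin.
exact: leb_sym_fin.
Qed.

HB.instance Definition _ (R : realType) :=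
  Measure_isSigmaFinite.Build _ _ _ (@leb2 R) (@leb2_sigma_finite R).

Lemma leb3_fubini_z (R : realType) (f : M3 R -> \bar R) :
  (@leb3 R).-integrable setT f ->
  (\int[@leb3 R]_x f x = \int[@lebesgue_measure R]_z \int[@leb2 R]_p f (p, z))%E.
Proof.
by move=> h; have := @integral21_prod_meas1 _ _ _ _ R (@leb2 R) (@lebesgue_measure R) f h.
Qed.

Lemma leb3_fubini_p (R : realType) (f : M3 R -> \bar R) :
  (@leb3 R).-integrable setT f ->
  (\int[@leb3 R]_x f x = \int[@leb2 R]_p \int[@lebesgue_measure R]_z f (p, z))%E.
Proof.
by move=> h; have := @integral12_prod_meas1 _ _ _ _ R (@leb2 R) (@lebesgue_measure R) f h.
Qed.

(** Fubini's theorem makes the [j]-th variable the innermost one, and there the fundamental theorem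
    of calculus gives zero. Bounded support and the bound [M] provide integrability. *)
Lemma integral_pd0 (R : realType) (j : 'I_3) (f f' : R3 R -> R) (a M : R) :
  0 < a -> continuous f' -> (forall x, is_derive x (evec R j) f (f' x)) ->
  (forall x i, a <= `|coord x i| -> f x = 0 /\ f' x = 0) ->
  (forall x, `|f' x| <= M) ->
  (\int[@leb3 R]_x (f' x)%:E = 0)%E.
Proof.
move=> a0 cf' df f0 f'M.
pose I := `[- a, a]%classic : set (measurableTypeR R).
have mI : measurable I by exact: measurable_itv.
have nI (t : R) : ~ I t -> a <= `|t|.
  move=> h; rewrite leNgt; apply/negP => ta; apply: h.
  by rewrite /I /= in_itv/=; move: ta; rewrite ltr_norml => /andP[/ltW-> /ltW->].
have mf' := continuous_measurable3 cf'.
have leb2fin : (@leb2 R (I `*` I) < +oo)%E.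
  by rewrite /leb2 product_measure1E//; apply: lte_mul_pinfty => //;
     [rewrite ge0_fin_numE//; exact: leb_sym_fin | exact: leb_sym_fin].
have off3 x : ~ ((I `*` I) `*` I) x -> f' x = 0.
  move=> h; have [h1|/nI h1] := pselect (I x.1.1); last exact: (f0 x 0 h1).2.
  have [h2|/nI h2] := pselect (I x.1.2); last exact: (f0 x 1 h2).2.
  have [h3|/nI h3] := pselect (I x.2); last exact: (f0 x 2%:R h3).2.
  by case: h; split; [split|].
have int3 : (@leb3 R).-integrable setT (EFin \o f').
  apply: (@bsupp_integrable _ _ _ _ ((I `*` I) `*` I) f' M) => //.
    by apply: measurableX => //; exact: measurableX.
  rewrite leb3_prod//; last exact: measurableX.
  apply: lte_mul_pinfty => //; last exact: leb_sym_fin.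
  by rewrite ge0_fin_numE.
have cont_comp (gam : R -> R3 R) : continuous gam -> continuous (f' \o gam).
  by move=> cg t; apply: continuous_comp; [exact: cg | exact: cf'].
have int2 z : (@leb2 R).-integrable setT
    (EFin \o (fun p : measurableTypeR R * measurableTypeR R => f' (p, z))).
  apply: (@bsupp_integrable _ _ _ _ (I `*` I) _ M) => //.
  - exact: measurableX.
  - exact: (measurable_fun_pair1 z mf').
  - move=> p h; apply: off3 => -[h1 _]; exact: h h1.
elim/ord3_ind: j df => df.
- apply: (etrans (leb3_fubini_z int3)); apply: integral0_eq => z _.
  apply: (etrans (esym (integral21_prod_meas1 (int2 z)))).
  apply: integral0_eq => y _; rewrite /fubini_G.
  apply: (@integral_derive0 R (fun x => f (x, y, z)) (fun x => f' (x, y, z)) a a0).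
  + move=> x; apply: (@is_derive_curve R f 0 (fun x => (x, y, z)) _ _ _ (df _)).
    by move=> h; case: (evec_shift h x y z).
  + apply: (cont_comp (fun x => (x, y, z))).
    suff -> : (fun x => (x, y, z)) = (fun t : R => t *: evec R 0 + (0, y, z)) by exact: line_continuous.
    by apply/funext => x; case: (evec_shift x 0 y z) => -> _ _; rewrite addr0.
  + by move=> x xa; exact: (f0 (x, y, z) 0 xa).
- apply: (etrans (leb3_fubini_z int3)); apply: integral0_eq => z _.
  apply: (etrans (esym (integral12_prod_meas1 (int2 z)))).
  apply: integral0_eq => x _; rewrite /fubini_F.
  apply: (@integral_derive0 R (fun y => f (x, y, z)) (fun y => f' (x, y, z)) a a0).
  + move=> y; apply: (@is_derive_curve R f 1 (fun y => (x, y, z)) _ _ _ (df _)).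
    by move=> h; case: (evec_shift h x y z).
  + apply: (cont_comp (fun y => (x, y, z))).
    suff -> : (fun y => (x, y, z)) = (fun t : R => t *: evec R 1 + (x, 0, z)) by exact: line_continuous.
    by apply/funext => y; case: (evec_shift y x 0 z) => _ -> _; rewrite addr0.
  + by move=> y ya; exact: (f0 (x, y, z) 1 ya).
- apply: (etrans (leb3_fubini_p int3)); apply: integral0_eq => p _.
  apply: (@integral_derive0 R (fun z => f (p, z)) (fun z => f' (p, z)) a a0).
  + move=> z; apply: (@is_derive_curve R f 2%:R (fun z => (p, z)) _ _ _ (df _)).
    by case: p => x y h; case: (evec_shift h x y z).
  + apply: (cont_comp (fun z => (p, z))).
    suff -> : (fun z => (p, z)) = (fun t : R => t *: evec R 2%:R + (p, 0)) by exact: line_continuous.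
    by case: p => x y; apply/funext => z; case: (evec_shift z x y 0) => _ _ ->; rewrite addr0.
  + by move=> z za; exact: (f0 (p, z) 2%:R za).
Qed.

(** * Integrable and square-integrable functions on the ball *)

Definition bint (R : realType) (r : R) (f : R3 R -> R) : Prop :=
  (@leb3 R).-integrable (eball r) (EFin \o f).

Definition rint (R : realType) (r : R) (f : R3 R -> R) : R :=
  Rintegral (@leb3 R) (eball r) f.

Definition mfb (R : realType) (r : R) (f : R3 R -> R) : Prop :=
  measurable_fun (eball r : set (M3 R)) f.

Definition rL2 (R : realType) (r : R) (f : R3 R -> R) : Prop :=
  mfb r f /\ bint r (fun x => f x ^+ 2).

Definition bdm (R : realType) (r : R) (f : R3 R -> R) : Prop :=
  mfb r f /\ exists M : R, forall x, eball r x -> `|f x| <= M.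

Lemma enorm_sqr (R : realType) (x : R3 R) :
  enorm x ^+ 2 = coord x 0 ^+ 2 + coord x 1 ^+ 2 + coord x 2%:R ^+ 2.
Proof.
by rewrite /enorm sum3 sqr_sqrtr// !addr_ge0// sqr_ge0.
Qed.

Lemma enorm_ge0 (R : realType) (x : R3 R) : 0 <= enorm x.
Proof. exact: sqrtr_ge0. Qed.

Lemma coord_le_enorm (R : realType) (x : R3 R) i : `|coord x i| <= enorm x.
Proof.
rewrite -ler_sqr ?nnegrE ?enorm_ge0// real_normK ?num_real// enorm_sqr.
move: (sqr_ge0 (coord x 0)) (sqr_ge0 (coord x 1)) (sqr_ge0 (coord x 2%:R)).
by elim/ord3_ind: i => *; lra.
Qed.

Lemma enorm_continuous (R : realType) : continuous (@enorm R).
Proof.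
move=> x; apply: (@continuous_comp _ _ _ (fun x : R3 R => \sum_j coord x j ^+ 2)
  (@Num.sqrt R)); last exact: sqrt_continuous.
have -> : (fun x : R3 R => \sum_j coord x j ^+ 2) =
  (fun x => coord x 0 * coord x 0 + coord x 1 * coord x 1 + coord x 2%:R * coord x 2%:R).
  by apply/funext => y; rewrite sum3 !expr2.
have c i : {for x, continuous (fun x : R3 R => coord x i)}.
  exact: (@coord3_continuous R i x).
exact: (continuousD (continuousD (continuousM (c 0) (c 0)) (continuousM (c 1) (c 1)))
  (continuousM (c 2%:R) (c 2%:R))).
Qed.

Lemma measurable_eball (R : realType) (r : R) : measurable (eball r : set (M3 R)).
Proof.
apply: open_measurable3.
have -> : eball r = @enorm R @^-1` `]-oo, r[%classic.
  by apply/seteqP; split=> x; rewrite /eball /= in_itv.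
by apply: open_comp; [move=> x _; exact: enorm_continuous | exact: interval_open].
Qed.
#[local] Hint Resolve measurable_eball : core.

Lemma cube_compact (R : realType) (a : R) :
  compact ((`[- a, a]%classic `*` `[- a, a]%classic) `*` `[- a, a]%classic : set (R3 R)).
Proof. by apply: compact_setX; [apply: compact_setX|]; exact: segment_compact. Qed.

Lemma cubeP (R : realType) (a : R) (x : R3 R) : (forall i, `|coord x i| <= a) ->
  ((`[- a, a]%classic `*` `[- a, a]%classic) `*` `[- a, a]%classic : set (R3 R)) x.
Proof.
move=> h; have h0 := h 0; have h1 := h 1; have h2 := h 2%:R.
by split; [split|]; rewrite /= in_itv/= -ler_norml.
Qed.

Lemma eball_cube (R : realType) (r : R) (x : R3 R) :
  eball r x -> forall i, `|coord x i| <= r.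
Proof. by move=> h i; apply: le_trans (coord_le_enorm x i) (ltW h). Qed.

Lemma leb3_eball_fin (R : realType) (r : R) : (@leb3 R (eball r) < +oo)%E.
Proof.
pose I := `[- r, r]%classic : set (measurableTypeR R).
have mI : measurable I by exact: measurable_itv.
apply: (@le_lt_trans _ _ (@leb3 R ((I `*` I) `*` I))).
  apply: le_measure; rewrite ?inE//; first by apply: measurableX => //; exact: measurableX.
  by move=> x /eball_cube/cubeP.
rewrite leb3_prod//; last exact: measurableX.
apply: lte_mul_pinfty => //; last exact: leb_sym_fin.
rewrite ge0_fin_numE// product_measure1E//; apply: lte_mul_pinfty => //.
  by rewrite ge0_fin_numE//; exact: leb_sym_fin.
exact: leb_sym_fin.
Qed.

Lemma cube_bounded (R : realType) (f : R3 R -> R) (a : R) : continuous f ->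
  exists2 M, 0 <= M & forall x, (forall i, `|coord x i| <= a) -> `|f x| <= M.
Proof.
move=> cf.
have : compact (f @` ((`[- a, a]%classic `*` `[- a, a]%classic) `*` `[- a, a]%classic)).
  apply: continuous_compact; last exact: cube_compact.
  by apply: continuous_subspaceT.
move/compact_bounded => [M [_ hM]]; exists (Num.max 0 (M + 1)).
  by rewrite le_max lexx.
move=> x /cubeP hx; rewrite le_max; apply/orP; right.
by apply: (hM (M + 1)); [rewrite ltrDl | exists x].
Qed.

Lemma continuous_mfb (R : realType) (r : R) (f : R3 R -> R) : continuous f -> mfb r f.
Proof. by move=> /continuous_measurable3; exact: measurable_funS. Qed.

Lemma continuous_bdm (R : realType) (r : R) (f : R3 R -> R) : continuous f -> bdm r f.
Proof.
move=> cf; split; first exact: continuous_mfb.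
by have [M _ hM] := cube_bounded r cf; exists M => x /eball_cube/hM.
Qed.

Lemma smooth_bdm (R : realType) (r : R) (f : smooth R) : bdm r f.
Proof. by apply: continuous_bdm; exact: smooth_continuous. Qed.

Lemma bint_le (R : realType) (r : R) (f g : R3 R -> R) : mfb r f -> bint r g ->
  (forall x, eball r x -> `|f x| <= g x) -> bint r f.
Proof.
move=> mf ig fg; apply: le_integrable ig => //.
  by apply/measurable_EFinP.
by move=> x Bx /=; rewrite lee_fin; apply: le_trans (fg x Bx) (ler_norm _).
Qed.

Lemma bint_mfb (R : realType) (r : R) (f : R3 R -> R) : bint r f -> mfb r f.
Proof. by move=> /integrableP[/measurable_EFinP]. Qed.

Lemma bintD (R : realType) (r : R) (f g : R3 R -> R) :
  bint r f -> bint r g -> bint r (fun x => f x + g x).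
Proof. by move=> i1 i2; rewrite /bint; apply: (integrableD _ i1 i2). Qed.

Lemma bintZ (R : realType) (r : R) (c : R) (f : R3 R -> R) :
  bint r f -> bint r (fun x => c * f x).
Proof. by move=> i1; have := integrableZl (measurable_eball r) c i1. Qed.

Lemma bintN (R : realType) (r : R) (f : R3 R -> R) :
  bint r f -> bint r (fun x => - f x).
Proof.
by move=> /(bintZ (-1)); congr (bint r _); apply/funext => x; rewrite mulN1r.
Qed.

Lemma bintB (R : realType) (r : R) (f g : R3 R -> R) :
  bint r f -> bint r g -> bint r (fun x => f x - g x).
Proof. by move=> i1 i2; apply: bintD => //; exact: bintN. Qed.

Lemma bint_norm (R : realType) (r : R) (f : R3 R -> R) :
  bint r f -> bint r (fun x => `|f x|).
Proof. by move=> /integrable_abse; rewrite /bint; apply. Qed.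

Lemma bint_sum (R : realType) (r : R) (I : Type) (s : seq I) (f : I -> R3 R -> R) :
  (forall i, bint r (f i)) -> bint r (fun x => \sum_(i <- s) f i x).
Proof.
move=> h; elim: s => [|a s IH].
  have -> : (fun x => \sum_(i <- [::]) f i x) = (fun=> 0) by apply/funext => x; rewrite big_nil.
  by rewrite /bint; have := @integrable0 _ _ _ (@leb3 R) (eball r).
have -> : (fun x => \sum_(i <- a :: s) f i x) = (fun x => f a x + \sum_(i <- s) f i x).
  by apply/funext => x; rewrite big_cons.
exact: bintD.
Qed.

Lemma bdm_rL2 (R : realType) (r : R) (f : R3 R -> R) : bdm r f -> rL2 r f.
Proof.
move=> [mf [M hM]]; split=> //; apply: measurable_bounded_integrable => //.
- exact: leb3_eball_fin.
- by apply: measurable_funX.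
exists (M ^+ 2); split; first exact: num_real.
move=> y My x Bx /=; rewrite normrX; apply: le_trans (ltW My).
by rewrite lerXn2r ?nnegrE ?hM// (le_trans _ (hM x Bx)).
Qed.

Lemma smooth_rL2 (R : realType) (r : R) (f : smooth R) : rL2 r f.
Proof. by apply: bdm_rL2; exact: smooth_bdm. Qed.

Lemma rL2M (R : realType) (r : R) (u v : R3 R -> R) :
  rL2 r u -> rL2 r v -> bint r (fun x => u x * v x).
Proof.
move=> [mu iu] [mv iv]; apply: bint_le (bintD iu iv) _.
  exact: measurable_funM.
move=> x _; rewrite ler_norml.
by have := sqr_ge0 (u x + v x); have := sqr_ge0 (u x - v x); have := sqr_ge0 (u x);
   have := sqr_ge0 (v x); lra.
Qed.

Lemma rL2_bint (R : realType) (r : R) (u : R3 R -> R) : rL2 r u -> bint r u.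
Proof.
move=> hu; have h1 : rL2 r (fun=> 1).
  by apply: bdm_rL2; apply: continuous_bdm => x; exact: cst_continuous.
by have := rL2M hu h1; congr (bint r _); apply/funext => x; rewrite mulr1.
Qed.

Lemma rL2D (R : realType) (r : R) (u v : R3 R -> R) :
  rL2 r u -> rL2 r v -> rL2 r (fun x => u x + v x).
Proof.
move=> hu hv; split; first by apply: measurable_funD; [case: hu | case: hv].
have := bintD (bintD hu.2 hv.2) (bintZ 2%:R (rL2M hu hv)).
by congr (bint r _); apply/funext => x; ring.
Qed.

Lemma rL2_bdm (R : realType) (r : R) (u g : R3 R -> R) :
  rL2 r u -> bdm r g -> rL2 r (fun x => u x * g x).
Proof.
move=> [mu iu] [mg [M hM]]; split; first exact: measurable_funM.
apply: bint_le (bintZ (M ^+ 2) iu) _.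
  by apply: measurable_funX; exact: measurable_funM.
move=> x Bx; have gM : g x ^+ 2 <= M ^+ 2.
  have g0 : 0 <= `|g x| by []; have h := hM x Bx.
  by rewrite -(real_normK (num_real (g x))) !expr2; nra.
rewrite (ger0_norm (sqr_ge0 _)) exprMn mulrC; exact: ler_wpM2r (sqr_ge0 _) _ _ gM.
Qed.

Lemma rL2Z (R : realType) (r : R) (c : R) (u : R3 R -> R) :
  rL2 r u -> rL2 r (fun x => c * u x).
Proof.
move=> [mu iu]; split; first by apply: measurable_funM => //; exact: measurable_cst.
have := bintZ (c ^+ 2) iu; congr (bint r _).
by apply/funext => x; rewrite exprMn.
Qed.

Lemma rL2N (R : realType) (r : R) (u : R3 R -> R) :
  rL2 r u -> rL2 r (fun x => - u x).
Proof.
by move=> /(rL2Z (-1)); congr (rL2 r _); apply/funext => x; rewrite mulN1r.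
Qed.

Lemma rL2B (R : realType) (r : R) (u v : R3 R -> R) :
  rL2 r u -> rL2 r v -> rL2 r (fun x => u x - v x).
Proof. by move=> hu hv; apply: rL2D => //; exact: rL2N. Qed.

Lemma rL2_0 (R : realType) (r : R) : rL2 r (fun=> 0).
Proof. by apply: bdm_rL2; apply: continuous_bdm => x; exact: cst_continuous. Qed.

Lemma rL2_sum (R : realType) (r : R) (I : Type) (s : seq I) (f : I -> R3 R -> R) :
  (forall i, rL2 r (f i)) -> rL2 r (fun x => \sum_(i <- s) f i x).
Proof.
move=> h; elim: s => [|a s IH].
  have -> : (fun x => \sum_(i <- [::]) f i x) = (fun=> 0) by apply/funext => x; rewrite big_nil.
  exact: rL2_0.
have -> : (fun x => \sum_(i <- a :: s) f i x) = (fun x => f a x + \sum_(i <- s) f i x).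
  by apply/funext => x; rewrite big_cons.
exact: rL2D.
Qed.

Lemma rintD (R : realType) (r : R) (f g : R3 R -> R) : bint r f -> bint r g ->
  rint r (fun x => f x + g x) = rint r f + rint r g.
Proof. by move=> i1 i2; rewrite /rint RintegralD. Qed.

Lemma rintZ (R : realType) (r : R) (c : R) (f : R3 R -> R) : bint r f ->
  rint r (fun x => c * f x) = c * rint r f.
Proof. by move=> i1; rewrite /rint RintegralZl. Qed.

Lemma rintN (R : realType) (r : R) (f : R3 R -> R) : bint r f ->
  rint r (fun x => - f x) = - rint r f.
Proof.
move=> i1; rewrite -mulN1r -rintZ//; congr (rint r _).
by apply/funext => x; rewrite mulN1r.
Qed.

Lemma rintB (R : realType) (r : R) (f g : R3 R -> R) : bint r f -> bint r g ->
  rint r (fun x => f x - g x) = rint r f - rint r g.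
Proof. by move=> i1 i2; rewrite rintD ?rintN//; exact: bintN. Qed.

Lemma rint0 (R : realType) (r : R) : rint r (fun=> 0) = 0.
Proof.
have h0 := rL2_bint (rL2_0 r).
have -> : (fun=> 0) = (fun x : R3 R => 0 * ((fun=> 0) : R3 R -> R) x) by apply/funext => x; rewrite mul0r.
by rewrite (rintZ 0 h0) mul0r.
Qed.

Lemma rint_sum (R : realType) (r : R) (I : Type) (s : seq I) (f : I -> R3 R -> R) :
  (forall i, bint r (f i)) ->
  rint r (fun x => \sum_(i <- s) f i x) = \sum_(i <- s) rint r (f i).
Proof.
move=> h; elim: s => [|a s IH].
  by rewrite big_nil -[RHS](rint0 r); congr (rint r _); apply/funext => x; rewrite big_nil.
rewrite big_cons -IH -rintD//; last exact: bint_sum.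
by congr (rint r _); apply/funext => x; rewrite big_cons.
Qed.

Lemma eq_rint (R : realType) (r : R) (f g : R3 R -> R) :
  (forall x, eball r x -> f x = g x) -> rint r f = rint r g.
Proof. by move=> fg; apply: eq_Rintegral => x; rewrite inE; exact: fg. Qed.

Lemma le_rint (R : realType) (r : R) (f g : R3 R -> R) : bint r f -> bint r g ->
  (forall x, eball r x -> f x <= g x) -> rint r f <= rint r g.
Proof. by move=> i1 i2 fg; apply: le_Rintegral. Qed.

Lemma rint_ge0 (R : realType) (r : R) (f : R3 R -> R) :
  (forall x, eball r x -> 0 <= f x) -> 0 <= rint r f.
Proof. by move=> h; apply: Rintegral_ge0. Qed.

Lemma rint_pd0 (R : realType) (r : R) (j : 'I_3) (f f' : R3 R -> R) (s : R) :
  s < r -> continuous f' -> (forall x, is_derive x (evec R j) f (f' x)) ->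
  (forall x, s <= enorm x -> f x = 0 /\ f' x = 0) -> rint r f' = 0.
Proof.
move=> sr cf' df f0.
pose a := Num.max s 1.
have a0 : 0 < a by rewrite lt_max ltr01 orbT.
have [M M0 hM] := cube_bounded a cf'.
have I0 : (\int[@leb3 R]_x (f' x)%:E = 0)%E.
  apply: (@integral_pd0 R j f f' a M) => //.
    move=> x i ai; apply: f0; apply: le_trans (coord_le_enorm x i).
    by apply: le_trans ai; rewrite le_max lexx.
  move=> x; have [h|/existsNP[i hi]] := pselect (forall i, `|coord x i| <= a); first exact: hM.
  rewrite (f0 x _).2 ?normr0//; apply: le_trans (coord_le_enorm x i).
  by move/negP: hi; rewrite -ltNge => /ltW; apply: le_trans; rewrite le_max lexx.
rewrite /rint /Rintegral integral_mkcond.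
have -> : (fun x => (f' x)%:E) \_ (eball r) = (fun x => (f' x)%:E).
  apply/funext => x; rewrite /patch; case: ifPn => // /negP xA.
  rewrite (f0 x _).2//; apply: le_trans (ltW sr) _; rewrite leNgt; apply/negP => h.
  by apply: xA; rewrite inE.
by rewrite I0.
Qed.

(** The strict inequality gives a neighbourhood of [x] on the line where [phi] vanishes. This is why
    [s] is replaced by the midpoint [(s + r) / 2] wherever a derivative of a test function must
    vanish near the sphere. *)
Lemma test_pd0 (R : realType) (phi : R3 R -> R) (s : R) (j : 'I_3) (x : R3 R) :
  (forall x, s <= enorm x -> phi x = 0) -> s < enorm x -> pd j phi x = 0.
Proof.
move=> h sx.
have near0 : \forall t \near (0 : R), phi (t *: evec R j + x) = 0.
  have cl : {for (0 : R), continuous (fun t : R => enorm (t *: evec R j + x))}.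
    by apply: continuous_comp; [exact: line_continuous | exact: enorm_continuous].
  have /cl : nbhs (enorm ((0 : R) *: evec R j + x)) [set y | s < y].
    by rewrite scale0r add0r; apply: open_nbhs_nbhs; split; [exact: open_gt|].
  by move=> H; near=> t; apply/h/ltW; near: t; exact: H.
Local Transparent pd.
rewrite /pd derive_line -derive1E.
transitivity (derive1 (fun=> 0 : R) (0 : R)); last by rewrite derive1_cst.
rewrite !derive1E; exact: near_eq_derive.
Unshelve. all: by end_near.
Qed.
Local Opaque pd.

Lemma rint_dct (R : realType) (r : R) (F : nat -> R3 R -> R) (f g : R3 R -> R) :
  (forall n, mfb r (F n)) -> mfb r f -> bint r g ->
  (forall x, eball r x -> F n x @[n --> \oo] --> f x) ->
  (forall n x, eball r x -> `|F n x| <= g x) ->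
  rint r (F n) @[n --> \oo] --> rint r f.
Proof.
move=> mF mf ig Ff Fg.
have iF n : bint r (F n) := bint_le (mF n) ig (Fg n).
have Ff' : {ae @leb3 R, forall x, eball r x ->
    (EFin \o F n) x @[n --> \oo] --> (EFin \o f) x}.
  by apply: aeW => x Bx; apply: cvg_EFin; [near=> n | exact: Ff].
have Fg' : {ae @leb3 R, forall x n, eball r x ->
    (`|(EFin \o F n) x| <= (EFin \o g) x)%E}.
  by apply: aeW => x n Bx /=; rewrite lee_fin; exact: Fg.
have [if_ _ cv] := @dominated_convergence _ _ _ (@leb3 R) (eball r) (measurable_eball r)
  (fun n => EFin \o F n) (EFin \o f) (EFin \o g) (fun n => (measurable_EFinP _ _).2 (mF n))
  ((measurable_EFinP _ _).2 mf)
  Ff' ig Fg'.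
rewrite /rint /Rintegral.
have fin : (\int[@leb3 R]_(x in eball r) (f x)%:E)%E \is a fin_num.
  exact: integrable_fin_num.
by move: cv => /=; rewrite -[X in _ --> X](fineK fin) => /fine_cvg.
Unshelve. all: by end_near.
Qed.

Lemma rint_dct0 (R : realType) (r : R) (F : nat -> R3 R -> R) (f g : R3 R -> R) :
  (forall n, mfb r (F n)) -> mfb r f -> bint r g ->
  (forall x, eball r x -> F n x @[n --> \oo] --> f x) ->
  (forall n x, eball r x -> `|F n x| <= g x) ->
  (forall n, rint r (F n) = 0) -> rint r f = 0.
Proof.
move=> mF mf ig Ff Fg F0; have cv := rint_dct mF mf ig Ff Fg.
have E : (fun n => rint r (F n)) = (fun=> 0) by apply/funext.
rewrite E in cv; exact: (cvg_unique (@Rhausdorff R) cv (cvg_cst 0)).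
Qed.

(** * Integration by parts up to the sphere *)

Lemma pow_expN_le (R : realType) n (y : R) : 0 <= y ->
  y ^+ n * expR (- y) <= n.+1%:R ^+ n.
Proof.
move=> y0; rewrite expRN ler_pdivrMr ?expR_gt0//.
have h1 : y / n.+1%:R <= expR (y / n.+1%:R).
  by apply: le_trans (expR_ge1Dx _); rewrite lerDr.
have h2 : (y / n.+1%:R) ^+ n <= expR y.
  apply: (@le_trans _ _ (expR (y / n.+1%:R) ^+ n)).
    by rewrite lerXn2r ?nnegrE ?divr_ge0 ?expR_ge0.
  rewrite -expRM_natl ler_expR mulrC -mulrA ler_piMr// mulrC ler_pdivrMr//.
  by rewrite mul1r ler_nat.
by move: h2; rewrite expr_div_n ler_pdivrMr ?exprn_gt0// mulrC.
Qed.

(** The power [n] is arbitrary so that in the induction each factor ['X] of the polynomial can be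
    moved into it. *)
Lemma horner_expN_le (R : realType) (Q : {poly R}) n :
  exists C : R, forall y, 0 <= y -> `|Q.[y]| * y ^+ n * expR (- y) <= C.
Proof.
elim/poly_ind: Q n => [|Q c IH] n.
  by exists 0 => y _; rewrite horner0 normr0 !mul0r.
have [C hC] := IH n.+1; exists (C + `|c| * n.+1%:R ^+ n) => y y0.
have h1 := hC y y0; have h2 := pow_expN_le n y0.
rewrite hornerMXaddC.
have h3 : `|Q.[y] * y + c| <= `|Q.[y]| * y + `|c|.
  by apply: le_trans (ler_normD _ _) _; rewrite normrM (ger0_norm y0).
apply: (@le_trans _ _ ((`|Q.[y]| * y + `|c|) * y ^+ n * expR (- y))).
  by rewrite ler_wpM2r ?expR_ge0// ler_wpM2r ?exprn_ge0.
rewrite mulrDl mulrDl; apply: lerD; first by rewrite -(mulrA _ y) -exprS.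
by rewrite -mulrA ler_wpM2l.
Qed.

(* The derivatives of [exp (- 1 / t)] (extended by [0]), which serves as a smooth cutoff profile. *)
Fixpoint flat_poly (R : realType) (k : nat) : {poly R} :=
  if k is k'.+1 then 'X^2 * (flat_poly R k' - (flat_poly R k')^`()) else 1.

Definition flat (R : realType) (k : nat) (t : R) : R :=
  if t <= 0 then 0 else (flat_poly R k).[t^-1] * expR (- t^-1).

(** Vanishing to second order at 0 makes every member of the family differentiable there, with
    derivative 0, across the case distinction in [flat]. *)
Lemma flat_quadratic (R : realType) k :
  exists C : R, forall t, `|flat k t| <= C * t ^+ 2.
Proof.
have [C hC] := horner_expN_le (flat_poly R k) 2.
exists `|C| => t; rewrite /flat; case: ifPn => [|].
  by rewrite normr0 mulr_ge0 ?sqr_ge0.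
rewrite -ltNge => t0; have := hC t^-1 (ltW _); rewrite invr_gt0 => /(_ t0) h.
rewrite normrM (ger0_norm (expR_ge0 _)) -ler_pdivrMr ?exprn_gt0//.
by rewrite -exprVn mulrAC; apply: le_trans h (ler_norm C).
Qed.

Lemma is_derive0_quadratic (R : realType) (f : R -> R) (C : R) :
  (forall t, `|f t| <= C * t ^+ 2) -> is_derive (0 : R) 1 f 0.
Proof.
move=> hf.
have f0 : f 0 = 0.
  by apply/eqP; rewrite -normr_le0; have := hf 0; rewrite expr0n mulr0.
have C0 : 0 <= C by have := hf 1; rewrite expr1n mulr1; apply: le_trans.
have cv : (fun h : R => h^-1 *: ((f \o shift 0) (h *: 1) - f 0)) @ 0^' --> (0 : R).
  apply/cvgr0Pnorm_lt => e e0; near=> h.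
  have h0 : h != 0 by near: h; exact: nbhs_dnbhs_neq.
  rewrite /= addr0 f0 subr0 /GRing.scale/= mulr1 normrM normfV.
  rewrite mulrC ltr_pdivrMr ?normr_gt0//; apply: le_lt_trans (hf h) _.
  rewrite -real_normK ?num_real// expr2 mulrA ltr_pM2r ?normr_gt0//.
  have hs : `|h| < e / (C + 1).
    near: h; apply: dnbhs0_lt; rewrite divr_gt0// ltr_wpDl//.
  rewrite ltr_pdivlMr in hs; last by rewrite ltr_wpDl.
  by apply: le_lt_trans hs; rewrite mulrC ler_wpM2l// lerDl.
split; first by apply/cvg_ex; exists (0 : R).
exact: cvg_lim cv.
Unshelve. all: by end_near.
Qed.

Lemma flat_tower (R : realType) : tower (@flat R).
Proof.
move=> k t; have [t0|t0|->] := ltgtP t 0.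
- have -> : flat k.+1 t = 0 by rewrite /flat ltW.
  apply: (near_eq_is_derive _ (is_derive_cst (0 : R) t 1)).
  near=> s; rewrite /flat ltW//; near: s; exact: lt_nbhsl.
- have tn0 : t != 0 by rewrite gt_eqF.
  have d1 : is_derive t 1 (fun s : R => s^-1) (- t ^- 2).
    have := is_deriveV tn0 (is_derive_id t 1).
    by rewrite /GRing.scale /= mulr1.
  have d2 := is_derive1_comp (is_derive_poly (flat_poly R k) t^-1) d1.
  have dN : is_derive t 1 (fun s : R => - s^-1) (- (- t ^- 2)) := is_deriveN d1.
  have d3 := @is_derive1_comp R expR (fun s => - s^-1) t _ _ (is_derive_expR _) dN.
  have d4 := is_deriveM d2 d3.
  have d5 := is_derive_eq d4 (_ : _ = flat k.+1 t).
  apply: near_eq_is_derive (d5 _); last first.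
    rewrite /flat leNgt t0 /= /GRing.scale /=.
    by rewrite hornerM hornerXn hornerD hornerN exprVn; ring.
  near=> s; rewrite /flat leNgt.
  by have -> : 0 < s by near: s; exact: lt_nbhsr.
- have [C hC] := flat_quadratic R k.
  have -> : flat k.+1 0 = 0 :> R by rewrite /flat lexx.
  exact: is_derive0_quadratic hC.
Unshelve. all: by end_near.
Qed.

Lemma eta_exists (R : realType) (r : R) :
  {e : smooth R | e = sC (r ^+ 2) - \sum_i sX R i ^+ 2}.
Proof. by exists (sC (r ^+ 2) - \sum_i sX R i ^+ 2). Qed.

(** Inside the ball this is the distance to the sphere times a factor between [r] and [2 * r];
    unlike the distance it is a polynomial, hence smooth. *)
Definition bdist (R : realType) (r : R) : smooth R := sval (eta_exists r).

Lemma eta_def (R : realType) (r : R) : bdist r = sC (r ^+ 2) - \sum_i sX R i ^+ 2.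
Proof. exact: (svalP (eta_exists r)). Qed.

(** Cutoffs that vanish where [bdist r] is at most [1 / k.+1] and tend to 1 at every point of the
    ball. *)
Definition chi (R : realType) (r : R) (k : nat) : smooth R :=
  scomp (@flat_tower R) 0 (sC k.+1%:R * bdist r - 1).

Arguments chi : simpl never.

Lemma etaE (R : realType) (r : R) x : bdist r x = r ^+ 2 - enorm x ^+ 2.
Proof.
by rewrite enorm_sqr eta_def sum3 !smfE.
Qed.

Lemma eta_gt0 (R : realType) (r : R) x : eball r x -> 0 < bdist r x.
Proof.
move=> h; rewrite etaE subr_gt0 ltrXn2r// ?nnegrE ?enorm_ge0//.
Qed.

Lemma sd_eta (R : realType) (r : R) j : sd j (bdist r) = - (2%:R * sX R j).
Proof.
rewrite eta_def sdB sd_sC sub0r sum3 !sdD !expr2 !sdM !sd_sX.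
by elim/ord3_ind: j; rewrite /=; ring.
Qed.

Lemma chiE (R : realType) (r : R) k x : chi r k x = flat 0 (k.+1%:R * bdist r x - 1).
Proof. by rewrite /chi scompE !smfE. Qed.

Lemma sd_chi (R : realType) (r : R) k j x :
  sd j (chi r k) x = - (2%:R * k.+1%:R * flat 1 (k.+1%:R * bdist r x - 1)) * coord x j.
Proof.
rewrite /chi sd_scomp sdB sdM sd_sC sd_eta sd1 ?smfE scompE ?smfE; ring.
Qed.

Lemma chi_test (R : realType) (r : R) k (a : smooth R) : 0 < r ->
  test_fun r (chi r k * a).
Proof.
move=> r0; split; first by move=> n; apply: Sn_Cn; exact: smooth_Sn.
pose s := Num.sqrt (r ^+ 2 - k.+1%:R^-1); exists s.
  have [h|h] := leP (r ^+ 2 - k.+1%:R^-1) 0; first by rewrite /s ler0_sqrtr.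
  rewrite -(@ltr_pXn2r _ 2)// ?nnegrE ?sqrtr_ge0 ?ltW// sqr_sqrtr ?ltW//.
  by rewrite ltrBlDr ltrDl invr_gt0.
move=> x sx; rewrite -[LHS]/(chi r k x * a x) chiE.
have h : r ^+ 2 - k.+1%:R^-1 <= enorm x ^+ 2.
  have [h|h] := leP (r ^+ 2 - k.+1%:R^-1) 0; first exact: le_trans h (sqr_ge0 _).
  by rewrite -(sqr_sqrtr (ltW h)) lerXn2r ?nnegrE ?sqrtr_ge0 ?enorm_ge0.
have : k.+1%:R * bdist r x - 1 <= 0.
  have h2 : bdist r x <= k.+1%:R^-1 by rewrite etaE; move: (_^-1) h => q h; lra.
  by rewrite subr_le0 -ler_pdivlMl// mulr1.
by rewrite /flat => ->; rewrite mul0r.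
Qed.

(** A derivative of [chi r k] has size of order [k] close to the sphere. If it is multiplied by
    [bdist r], the product stays bounded and tends to 0 at every point of the ball, so dominated
    convergence removes the second term. *)
Lemma cut_limit (R : realType) (r : R) (P Q : R3 R -> R) : bint r P -> bint r Q ->
  (forall k, rint r (fun x => chi r k x * P x +
     k.+1%:R * bdist r x * flat 1 (k.+1%:R * bdist r x - 1) * Q x) = 0) ->
  rint r P = 0.
Proof.
move=> iP iQ; have mP := bint_mfb iP; have mQ := bint_mfb iQ.
pose Y k x := (k.+1%:R * bdist r x - 1)^-1.
have flatE k x : 0 < k.+1%:R * bdist r x - 1 ->
    chi r k x = expR (- Y k x) /\
    k.+1%:R * bdist r x * flat 1 (k.+1%:R * bdist r x - 1) =
      (Y k x + Y k x ^+ 2) * expR (- Y k x).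
  move=> t0; rewrite chiE /flat leNgt t0 /= hornerC mul1r; split=> //.
  rewrite derivC subr0 mulr1 hornerXn /Y mulrA; congr (_ * _).
  move: (bdist r x) t0 => e t0; field; rewrite gt_eqF// nat1r//.
(* With y = [Y k x] the second factor is (y + y^2) exp(-y). It is at most 2 + 9 = 11 by
   [pow_expN_le] for the exponents 1 and 2, and it tends to 0 with y. *)
apply: (@rint_dct0 _ _ (fun k x => chi r k x * P x +
    k.+1%:R * bdist r x * flat 1 (k.+1%:R * bdist r x - 1) * Q x) _ (fun x => `|P x| + 11%:R * `|Q x|)) => //.
- move=> k; apply: measurable_funD; apply: measurable_funM => //.
    by apply: continuous_mfb; exact: smooth_continuous.
  have -> : (fun x => k.+1%:R * bdist r x * flat 1 (k.+1%:R * bdist r x - 1)) =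
      (sC k.+1%:R * bdist r * scomp (@flat_tower R) 1 (sC k.+1%:R * bdist r - 1)).
    by apply/funext => x; rewrite !smfE scompE !smfE.
  by apply: continuous_mfb; exact: smooth_continuous.
- by apply: bintD; [exact: bint_norm | apply: bintZ; exact: bint_norm].
- move=> x Bx; have e0 := eta_gt0 Bx.
  have tpos : \forall k \near \oo, 0 < k.+1%:R * bdist r x - 1.
    near=> k; rewrite subr_gt0 -ltr_pdivrMr//.
    apply: lt_le_trans (truncnS_gt _) _; rewrite ler_nat ltnS.
    by near: k; exact: nbhs_infty_ge.
  have Y0 : Y k x @[k --> \oo] --> 0.
    apply/cvgr0Pnorm_lt => e e1; near=> k.
    have tk : 0 < k.+1%:R * bdist r x - 1 by near: k.
    rewrite /Y normfV gtr0_norm// invf_plt ?posrE// ltrBrDr -ltr_pdivrMr//.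
    apply: lt_le_trans (truncnS_gt _) _; rewrite ler_nat ltnS.
    by near: k; exact: nbhs_infty_ge.
  have E0 : expR (- Y k x) @[k --> \oo] --> (1 : R).
    rewrite -expR0 -oppr0; apply: continuous_cvg; first exact: continuous_expR.
    exact: cvgN.
  have cv : (expR (- Y k x) * P x + (Y k x + Y k x ^+ 2) * expR (- Y k x) * Q x)
      @[k --> \oo] --> 1 * P x + (0 + 0 ^+ 2) * 1 * Q x.
    apply: cvgD; first by apply: cvgMr_tmp.
    apply: cvgMr_tmp; apply: cvgM => //; apply: cvgD => //.
    by rewrite expr2; under eq_fun do rewrite expr2; exact: cvgM.
  rewrite expr0n addr0 !mul0r addr0 mul1r in cv.
  apply: cvg_trans cv; apply: near_eq_cvg; near=> k.
  have tk : 0 < k.+1%:R * bdist r x - 1 by near: k.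
  by have [-> ->] := flatE k x tk.
- move=> k x Bx; apply: le_trans (ler_normD _ _) _; rewrite !normrM.
  have [t0|t0] := ltP 0 (k.+1%:R * bdist r x - 1); last first.
    by rewrite chiE /flat t0 !normr0 !mul0r mulr0 mul0r addr0 addr_ge0// mulr_ge0.
  have [c1 c2] := flatE k x t0; rewrite -!normrM c1 c2.
  have y0 : 0 <= Y k x by rewrite invr_ge0 ltW.
  have h1 := pow_expN_le 1 y0; have h2 := pow_expN_le 2 y0.
  have h3 : expR (- Y k x) <= 1 by rewrite -expR0 ler_expR oppr_le0.
  apply: lerD; rewrite !normrM.
    by rewrite (ger0_norm (expR_ge0 _)) ler_piMl.
  rewrite (ger0_norm (expR_ge0 _)) ger0_norm ?addr_ge0 ?sqr_ge0//.
  rewrite ler_wpM2r//; move: h1 h2; rewrite mulrDl expr1; lra.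
Unshelve. all: by end_near.
Qed.

(* Vanishing at the boundary sphere, to first order. *)
Definition vb (R : realType) (r : R) (f : smooth R) : Prop :=
  exists C : R, forall x, eball r x -> `|f x| <= C * bdist r x.

Lemma vbD (R : realType) (r : R) (f g : smooth R) : vb r f -> vb r g -> vb r (f + g).
Proof.
move=> [C hC] [D hD]; exists (C + D) => x Bx; rewrite smfD mulrDl.
by apply: le_trans (ler_normD _ _) _; apply: lerD; [exact: hC | exact: hD].
Qed.

Lemma vbM (R : realType) (r : R) (f g : smooth R) : vb r g -> vb r (f * g).
Proof.
move=> [C hC]; have [_ [M hM]] := smooth_bdm r f.
exists (M * C) => x Bx; rewrite smfM normrM -mulrA.
by apply: ler_pM => //; [exact: hM | exact: hC].
Qed.

Lemma vbMr (R : realType) (r : R) (f g : smooth R) : vb r f -> vb r (f * g).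
Proof. by rewrite mulrC; exact: vbM. Qed.

Lemma vbN (R : realType) (r : R) (f : smooth R) : vb r f -> vb r (- f).
Proof. by move=> /(vbM (- 1)); rewrite mulN1r. Qed.

Lemma vbB (R : realType) (r : R) (f g : smooth R) : vb r f -> vb r g -> vb r (f - g).
Proof. by move=> hf hg; apply: vbD => //; exact: vbN. Qed.

Lemma vb0 (R : realType) (r : R) : vb r 0.
Proof. by exists 0 => x _; rewrite smf0 normr0 mul0r. Qed.

Lemma vb_eta (R : realType) (r : R) : vb r (bdist r).
Proof. by exists 1 => x Bx; rewrite mul1r ger0_norm// ltW// eta_gt0. Qed.

Lemma vb_sum (R : realType) (r : R) (I : Type) (s : seq I) (F : I -> smooth R) :
  (forall i, vb r (F i)) -> vb r (\sum_(i <- s) F i).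
Proof. by move=> h; elim/big_ind : _ => //; [exact: vb0 | exact: vbD]. Qed.

(** Since |x|^2 = r^2 - [bdist r], division by |x|^2 is harmless at the sphere. This undoes the
    factor |x|^2 that [lagrange] and [s2_lap] carry. *)
Lemma vb_s2 (R : realType) (r : R) (f : smooth R) : 0 < r ->
  vb r ((\sum_i sX R i ^+ 2) * f) -> vb r f.
Proof.
move=> r0 h.
have -> : f = sC (r ^+ 2)^-1 * ((\sum_i sX R i ^+ 2) * f + bdist r * f).
  rewrite -mulrDl eta_def addrC subrK mulrA -rmorphM /= mulVf ?rmorph1 ?mul1r//.
  by rewrite expf_neq0// gt_eqF.
apply: vbM; apply: vbD; [exact: h | apply: vbMr; exact: vb_eta].
Qed.

Lemma vb_quot (R : realType) (r : R) (f : smooth R) : vb r f ->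
  bdm r (fun x => f x / bdist r x).
Proof.
move=> [C hC]; split.
  apply: measurable_funM; first by apply: continuous_mfb; exact: smooth_continuous.
  apply: (@measurable_comp _ _ _ (M3 R) (measurableTypeR R) (measurableTypeR R) `]0, +oo[%classic (@GRing.inv R) _ (bdist r)) => //.
  - by move=> _ [x Bx <-]; rewrite /= in_itv/= andbT; exact: eta_gt0.
  - apply: open_continuous_measurable_fun; first exact: interval_open.
    by move=> t; rewrite inE /= in_itv/= andbT => t0; apply: inv_continuous; rewrite gt_eqF.
  - by apply: continuous_mfb; exact: smooth_continuous.
exists C => x Bx; have e0 := eta_gt0 Bx.
by rewrite normrM normfV (gtr0_norm e0) ler_pdivrMr// hC.
Qed.

Definition rweak_pd (R : realType) (r : R) (j : 'I_3) (u w : R3 R -> R) : Prop :=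
  forall phi, test_fun r phi ->
    rint r (fun x => u x * pd j phi x) = - rint r (fun x => w x * phi x).

Lemma test_continuous (R : realType) (r : R) (phi : R3 R -> R) :
  test_fun r phi -> continuous phi.
Proof. by case=> /(_ 0%N). Qed.

Lemma test_pd_continuous (R : realType) (r : R) (phi : R3 R -> R) j :
  test_fun r phi -> continuous (pd j phi).
Proof. by case=> /(_ 1%N) [_ /(_ j)[_]]. Qed.

Lemma test_is_derive (R : realType) (r : R) (phi : R3 R -> R) j x :
  test_fun r phi -> is_derive x (evec R j) phi (pd j phi x).
Proof. by case=> /(_ 1%N) [_ /(_ j)[+ _]] _ => /(_ x)/derivableP. Qed.

Lemma smooth_is_derive (R : realType) (f : smooth R) j x :
  is_derive x (evec R j) f (sd j f x).
Proof. by rewrite sdE; exact: derivableP (smooth_derivable f j x). Qed.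

Lemma smooth_rweak_pd (R : realType) (r : R) (j : 'I_3) (u : smooth R) :
  rweak_pd r j u (sd j u).
Proof.
move=> phi tphi.
have cphi := test_continuous tphi; have cpd := test_pd_continuous (j := j) tphi.
have bp : bdm r phi by exact: continuous_bdm.
have bd : bdm r (pd j phi) by exact: continuous_bdm.
apply/eqP; rewrite -addr_eq0 -rintD; last 2 first.
- by apply: rL2M; [exact: smooth_rL2 | exact: bdm_rL2].
- by apply: rL2M; [exact: smooth_rL2 | exact: bdm_rL2].
apply/eqP; case: (tphi) => _ [s sr phi0].
apply: (@rint_pd0 R r j (fun x => u x * phi x) _ ((s + r) / 2%:R)).
- by rewrite ltr_pdivrMr// mulr_natr mulr2n ltrD2r.
- move=> x; exact: (continuousD (continuousM (@smooth_continuous _ u x) (cpd x))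
    (continuousM (@smooth_continuous _ (sd j u) x) (cphi x))).
- move=> x; have := is_deriveM (smooth_is_derive u j x) (test_is_derive j x tphi).
  by move=> H; apply: (is_derive_eq H); rewrite /GRing.scale /= (mulrC (phi x)).
- move=> x sx; have sx' : s < enorm x.
    by apply: lt_le_trans sx; rewrite ltr_pdivlMr// mulr_natr mulr2n ltrD2l.
  by rewrite (phi0 x (ltW sx')) (test_pd0 j phi0 sx') !mulr0 addr0.
Qed.

(** Each weak identity is tested with [chi r k * a j]. The terms with a derivative of the cutoff add
    up to the flux sum in the last hypothesis, so only this sum over all [j] and [i] must have the
    factor [bdist r]; a single [a j] may be nonzero on the sphere. *)
Lemma sphere_parts (R : realType) (r : R) (J : finType) (U : 'I_3 -> J -> R3 R -> R)
    (W : J -> R3 R -> R) (a : J -> smooth R) (Q : R3 R -> R) :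
  0 < r -> (forall i j, rL2 r (U i j)) -> (forall j, rL2 r (W j)) ->
  (forall j phi, test_fun r phi ->
     rint r (fun x => \sum_i U i j x * pd i phi x + W j x * phi x) = 0) ->
  bint r Q ->
  (forall x, eball r x ->
     \sum_j \sum_i U i j x * coord x i * a j x = bdist r x * Q x) ->
  rint r (fun x => \sum_j (\sum_i U i j x * sd i (a j) x + W j x * a j x)) = 0.
Proof.
move=> r0 hU hW hw iQ hQ.
have iUW j (s : 'I_3 -> R3 R -> R) (t : R3 R -> R) :
    (forall i, rL2 r (s i)) -> rL2 r t ->
    bint r (fun x => \sum_i U i j x * s i x + W j x * t x).
  move=> hs ht; apply: bintD; last exact: rL2M.
  by apply: bint_sum => i; exact: rL2M.
apply: (@cut_limit _ _ _ (fun x => - 2%:R * Q x)).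
- by apply: bint_sum => j; apply: iUW => [i|]; exact: smooth_rL2.
- exact: bintZ.
move=> k; pose phi j : smooth R := chi r k * a j.
have tp j : test_fun r (phi j) by exact: chi_test.
have E : rint r (fun x => \sum_j (\sum_i U i j x * pd i (phi j) x + W j x * phi j x)) = 0.
  rewrite rint_sum; first by apply: big1 => j _; exact: hw.
  move=> j; apply: iUW => [i|]; last exact: smooth_rL2.
  by rewrite -sdE; exact: smooth_rL2.
rewrite -[RHS]E.
apply: eq_rint => x Bx.
have -> : k.+1%:R * bdist r x * flat 1 (k.+1%:R * bdist r x - 1) * (- 2%:R * Q x) =
    - (2%:R * k.+1%:R * flat 1 (k.+1%:R * bdist r x - 1)) * (bdist r x * Q x) by ring.
rewrite -hQ// !mulr_sumr -big_split; apply: eq_bigr => j _; cbv beta.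
rewrite [LHS]/=.
have Ep i : pd i (phi j) x = chi r k x * sd i (a j) x + a j x * sd i (chi r k) x.
  by rewrite -(sdE i (phi j)) /phi sdM.
have Ej : phi j x = chi r k x * a j x by [].
rewrite !sum3 !Ep Ej !sd_chi; ring.
Qed.

Lemma sphere_parts_scalar (R : realType) (r : R) (U : 'I_3 -> R3 R -> R)
    (W : R3 R -> R) (a : smooth R) :
  0 < r -> (forall i, rL2 r (U i)) -> rL2 r W -> vb r a ->
  (forall phi, test_fun r phi ->
     rint r (fun x => \sum_i U i x * pd i phi x + W x * phi x) = 0) ->
  rint r (fun x => \sum_i U i x * sd i a x + W x * a x) = 0.
Proof.
move=> r0 hU hW va hw.
have := @sphere_parts R r 'I_1 (fun i _ => U i) (fun=> W) (fun=> a)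
  (fun x => (\sum_i U i x * coord x i) * (a x / bdist r x)) r0 (fun i _ => hU i)
  (fun=> hW) (fun _ => hw).
move=> H; rewrite -[RHS]H.
- by apply: eq_rint => x _; rewrite big_ord1.
- apply: rL2_bint; apply: rL2_bdm; last exact: vb_quot.
  apply: rL2_sum => i; apply: rL2_bdm => //; apply: continuous_bdm.
  exact: coord3_continuous.
- move=> x Bx; rewrite big_ord1 -mulr_suml.
  by field; rewrite gt_eqF// eta_gt0.
Qed.

Lemma sphere_parts_grad (R : realType) (r : R) (h : R3 R -> R) (p : 'I_3 -> R3 R -> R)
    (F : 'I_3 -> smooth R) :
  0 < r -> rL2 r h -> (forall j, rL2 r (p j)) -> (forall j, rweak_pd r j h (p j)) ->
  vb r (\sum_j sX R j * F j) ->
  rint r (fun x => \sum_j (h x * sd j (F j) x + p j x * F j x)) = 0.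
Proof.
move=> r0 hh hp hw hF.
(* The three components of the weak gradient are read as three divergence identities, the [j]-th for
   the field [h] times the [j]-th unit vector. *)
pose U (i j : 'I_3) x := if i == j then h x else 0.
have sU (f : 'I_3 -> R) (j : 'I_3) x : \sum_i U i j x * f i = h x * f j.
  rewrite (bigD1 j)//= /U eqxx big1 ?addr0// => i /negbTE ->.
  by rewrite mul0r.
have := @sphere_parts R r 'I_3 U p F
  (fun x => h x * ((\sum_j sX R j * F j) x / bdist r x)) r0 _ hp _ _ _.
move=> H; rewrite -[RHS]H.
- by apply: eq_rint => x _; apply: eq_bigr => j _; rewrite sU.
- by move=> i j; rewrite /U; case: eqP => // _; exact: rL2_0.
- move=> j phi tphi.
  have bp : bdm r phi by apply: continuous_bdm; exact: test_continuous tphi.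
  have bd : bdm r (pd j phi) by apply: continuous_bdm; exact: test_pd_continuous tphi.
  under eq_fun do rewrite sU.
  by rewrite rintD ?hw ?addNr//; apply: rL2M => //; exact: bdm_rL2.
- by apply: rL2_bint; apply: rL2_bdm => //; exact: vb_quot.
- move=> x Bx; rewrite smf_sum.
  under eq_bigr do under eq_bigr do rewrite -mulrA.
  under eq_bigr do rewrite sU.
  under [in RHS]eq_bigr do rewrite smfM sXE.
  rewrite -mulr_sumr; field; rewrite gt_eqF// eta_gt0//.
Qed.

Lemma divergence_theorem (R : realType) (r : R) (F : 'I_3 -> smooth R) :
  0 < r -> vb r (\sum_j sX R j * F j) -> rint r (\sum_j sd j (F j)) = 0.
Proof.
move=> r0 hF.
have h1 : rL2 r (1 : smooth R) by exact: smooth_rL2.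
rewrite -[RHS](@sphere_parts_grad R r (1 : smooth R) (fun=> (0 : smooth R)) F) => //.
- apply: eq_rint => x _; rewrite smf_sum; apply: eq_bigr => j _.
  by rewrite smf1 smf0 mul1r mul0r addr0.
- by move=> j; exact: smooth_rL2.
- by move=> j; rewrite -(sd1 R j); exact: smooth_rweak_pd.
Qed.

(** * An a priori estimate for the Neumann problem *)

Lemma smooth_bint (R : realType) (r : R) (f : smooth R) : bint r f.
Proof. exact: rL2_bint (smooth_rL2 r f). Qed.

Lemma sintD (R : realType) (r : R) (f g : smooth R) :
  rint r (f + g) = rint r f + rint r g.
Proof. exact: rintD (smooth_bint r f) (smooth_bint r g). Qed.

Lemma sintB (R : realType) (r : R) (f g : smooth R) :
  rint r (f - g) = rint r f - rint r g.
Proof. exact: rintB (smooth_bint r f) (smooth_bint r g). Qed.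

Lemma sintZ (R : realType) (r c : R) (f : smooth R) :
  rint r (sC c * f) = c * rint r f.
Proof.
rewrite -(rintZ c (smooth_bint r f)); apply: eq_rint => x _.
by rewrite smfM smfE.
Qed.

Lemma le_sint (R : realType) (r : R) (f g : smooth R) :
  (forall x, eball r x -> f x <= g x) -> rint r f <= rint r g.
Proof. exact: le_rint (smooth_bint r f) (smooth_bint r g). Qed.

Definition lap (R : realType) (u : smooth R) : smooth R := \sum_i sd i (sd i u).
Definition G2 (R : realType) (u : smooth R) : smooth R := \sum_i sd i u ^+ 2.
Definition D2 (R : realType) (u : smooth R) : smooth R := \sum_i G2 (sd i u).
Definition D3 (R : realType) (u : smooth R) : smooth R := \sum_i D2 (sd i u).
Definition eul (R : realType) (u : smooth R) : smooth R := \sum_i sX R i * sd i u.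
(** The components of x cross grad, with indices modulo 3. They generate the rotations: they
    annihilate radial functions and commute with [lap] and [eul]. *)
Definition ang (R : realType) (a : 'I_3) (u : smooth R) : smooth R :=
  sX R (a + 1) * sd (a + 2%:R) u - sX R (a + 2%:R) * sd (a + 1) u.
Definition s2 (R : realType) : smooth R := \sum_i sX R i ^+ 2.

Lemma ord3E : (0 + 1 = 1 :> 'I_3) * (0 + 2%:R = 2%:R :> 'I_3) * (1 + 1 = 2%:R :> 'I_3) *
  (1 + 2%:R = 0 :> 'I_3) * (2%:R + 1 = 0 :> 'I_3) * (2%:R + 2%:R = 1 :> 'I_3).
Proof. by do !split; apply: val_inj. Qed.

Lemma angE (R : realType) (u : smooth R) :
  (ang 0 u = sX R 1 * sd 2%:R u - sX R 2%:R * sd 1 u) *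
  (ang 1 u = sX R 2%:R * sd 0 u - sX R 0 * sd 2%:R u) *
  (ang 2%:R u = sX R 0 * sd 1 u - sX R 1 * sd 0 u).
Proof. by rewrite /ang !ord3E. Qed.

Definition sdO (R : realType) :=
  (@sd_comm R 1 0, @sd_comm R 2%:R 0, @sd_comm R 2%:R 1).

Definition sdX3 (R : realType) :=
  (@sd_sX R 0 0, @sd_sX R 0 1, @sd_sX R 0 2%:R, @sd_sX R 1 0, @sd_sX R 1 1,
   @sd_sX R 1 2%:R, @sd_sX R 2%:R 0, @sd_sX R 2%:R 1, @sd_sX R 2%:R 2%:R).

Lemma ord3_eqE : ((((0 : 'I_3) == 1) = false) * (((0 : 'I_3) == 2%:R) = false) *
  (((1 : 'I_3) == 0) = false) * (((1 : 'I_3) == 2%:R) = false) *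
  (((2%:R : 'I_3) == 0) = false) * (((2%:R : 'I_3) == 1) = false))%type.
Proof. by []. Qed.

Lemma bochner (R : realType) (u : smooth R) :
  \sum_i sd i (\sum_j sd j u * sd i (sd j u) - sd i u * lap u) = D2 u - lap u ^+ 2.
Proof.
rewrite /lap /D2 /G2 !sum3 !sdB !sdD !sdM !sdD !sdO; ring.
Qed.

(** The gradient split into radial and tangential parts; the factor |x|^2 keeps both parts smooth at
    the origin. *)
Lemma lagrange (R : realType) (u v : smooth R) :
  s2 R * (\sum_j sd j u * sd j v) = eul u * eul v + \sum_a ang a u * ang a v.
Proof. rewrite /s2 /eul !sum3 !angE; ring. Qed.

Lemma sd_eul (R : realType) j (u : smooth R) :
  sd j (eul u) = sd j u + \sum_i sX R i * sd i (sd j u).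
Proof.
rewrite /eul sum3 !sdD !sdM sum3.
by elim/ord3_ind: j; rewrite !sdX3 !ord3_eqE ?eqxx /= !sdO; ring.
Qed.

(** The Laplacian in spherical coordinates, times |x|^2; the sum over [a] is the angular
    Laplacian. *)
Lemma s2_lap (R : realType) (u : smooth R) :
  s2 R * lap u = eul (eul u) + eul u + \sum_a ang a (ang a u).
Proof.
rewrite /s2 /lap [eul (eul u)]/eul !sum3 !sd_eul !angE !sdB !sdM !sdX3 !ord3_eqE.
rewrite /eul !sum3 !eqxx /= !sdO; ring.
Qed.

Lemma flux_bochner (R : realType) (u : smooth R) :
  \sum_i sX R i * (\sum_j sd j u * sd i (sd j u) - sd i u * lap u) =
  \sum_j sd j u * sd j (eul u) - G2 u - eul u * lap u.
Proof. rewrite /G2 !sum3 !sd_eul /eul !sum3 !sdO; ring. Qed.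

Lemma div_radial (R : realType) (g : smooth R) :
  \sum_i sd i (sX R i * g) = 3%:R * g + eul g.
Proof. rewrite /eul !sum3 !sdM !sdX3 !eqxx /=; ring. Qed.

Lemma eul_G2 (R : realType) (u : smooth R) :
  eul (G2 u) = 2%:R * \sum_i \sum_j sX R i * (sd j u * sd i (sd j u)).
Proof. rewrite /eul /G2 !sum3 !sdD !expr2 !sdM; ring. Qed.

Lemma s2_le (R : realType) (r : R) x : eball r x -> s2 R x <= r ^+ 2.
Proof.
move=> /eta_gt0; rewrite eta_def -/(s2 R) smfD smfN smfE subr_gt0.
exact: ltW.
Qed.

Lemma s2_def (R : realType) (r : R) : s2 R = sC (r ^+ 2) - bdist r.
Proof. by rewrite eta_def -/(s2 R) opprB addrC subrK. Qed.

Lemma G2_ge0 (R : realType) (u : smooth R) x : 0 <= G2 u x.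
Proof. by rewrite /G2 smf_sum; apply: sumr_ge0 => i _; rewrite smfX sqr_ge0. Qed.

Lemma D2_ge0 (R : realType) (u : smooth R) x : 0 <= D2 u x.
Proof. by rewrite /D2 smf_sum; apply: sumr_ge0 => i _; exact: G2_ge0. Qed.

Lemma D3_ge0 (R : realType) (u : smooth R) x : 0 <= D3 u x.
Proof. by rewrite /D3 smf_sum; apply: sumr_ge0 => i _; exact: D2_ge0. Qed.

Lemma comp_le_G2 (R : realType) (u : smooth R) x i : sd i u x ^+ 2 <= G2 u x.
Proof.
rewrite /G2 smf_sum (bigD1 i) // smfX lerDl; apply: sumr_ge0 => k _.
by rewrite smfX sqr_ge0.
Qed.

Lemma comp_le_D2 (R : realType) (u : smooth R) x i j : sd i (sd j u) x ^+ 2 <= D2 u x.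
Proof.
apply: le_trans (comp_le_G2 _ _ _) _.
by rewrite /D2 smf_sum (bigD1 j)//= lerDl; apply: sumr_ge0 => k _; exact: G2_ge0.
Qed.

(* Young's inequality for the radial derivative of the squared gradient. *)
Lemma eul_G2_ge (R : realType) (r : R) (c : R) (u : smooth R) x : 0 < r -> 0 < c ->
  eball r x -> - (D2 u x / 2%:R) - 2%:R * c ^+ 2 / r ^+ 2 * G2 u x <= c / r ^+ 2 * eul (G2 u) x.
Proof.
move=> r0 c0 Bx; have hs := s2_le Bx.
have -> : eul (G2 u) x = 2%:R * \sum_i \sum_j coord x i * (sd j u x * sd i (sd j u) x).
  rewrite eul_G2 smfM smf_nat smf_sum; congr (_ * _); apply: eq_bigr => i _.
  by rewrite smf_sum; apply: eq_bigr => j _; rewrite !smfM smfE.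
have h : \sum_i \sum_j (sd i (sd j u) x ^+ 2 / 2%:R +
    2%:R * c ^+ 2 / r ^+ 4 * (coord x i ^+ 2 * sd j u x ^+ 2) +
    c / r ^+ 2 * (2%:R * (coord x i * (sd j u x * sd i (sd j u) x)))) >= 0.
  apply: sumr_ge0 => i _; apply: sumr_ge0 => j _.
  set a := sd i (sd j u) x; set b := coord x i * sd j u x.
  have -> : a ^+ 2 / 2%:R + 2%:R * c ^+ 2 / r ^+ 4 * (coord x i ^+ 2 * sd j u x ^+ 2) +
     c / r ^+ 2 * (2%:R * (coord x i * (sd j u x * a))) =
     (a + 2%:R * c / r ^+ 2 * b) ^+ 2 / 2%:R.
    by rewrite /b; field; rewrite gt_eqF.
  by rewrite divr_ge0 ?sqr_ge0.
have e1 : \sum_i \sum_j coord x i ^+ 2 * sd j u x ^+ 2 = s2 R x * G2 u x.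
  rewrite /s2 /G2 !smf_sum mulr_suml; apply: eq_bigr => i _.
  by rewrite mulr_sumr; apply: eq_bigr => j _; rewrite !smfX smfE.
have e2 : \sum_i \sum_j sd i (sd j u) x ^+ 2 = D2 u x.
  rewrite /D2 smf_sum exchange_big; apply: eq_bigr => j _.
  by rewrite /G2 smf_sum; apply: eq_bigr => i _; rewrite smfX.
have e3 : 2%:R * c ^+ 2 / r ^+ 4 * (s2 R x * G2 u x) <= 2%:R * c ^+ 2 / r ^+ 2 * G2 u x.
  have -> : 2%:R * c ^+ 2 / r ^+ 2 * G2 u x =
      2%:R * c ^+ 2 / r ^+ 4 * (r ^+ 2 * G2 u x) by field; rewrite gt_eqF.
  rewrite ler_wpM2l//; first by rewrite divr_ge0 ?mulr_ge0 ?exprn_ge0// ltW.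
  by rewrite ler_wpM2r// G2_ge0.
have e4 : \sum_i \sum_j (sd i (sd j u) x ^+ 2 / 2%:R +
    2%:R * c ^+ 2 / r ^+ 4 * (coord x i ^+ 2 * sd j u x ^+ 2) +
    c / r ^+ 2 * (2%:R * (coord x i * (sd j u x * sd i (sd j u) x)))) =
  D2 u x / 2%:R + 2%:R * c ^+ 2 / r ^+ 4 * (s2 R x * G2 u x) +
    c / r ^+ 2 * (2%:R * \sum_i \sum_j coord x i * (sd j u x * sd i (sd j u) x)).
  rewrite -e1 -e2 mulr_suml !mulr_sumr -!big_split; apply: eq_bigr => i _.
  by rewrite /= mulr_suml !mulr_sumr -!big_split.
rewrite e4 in h; lra.
Qed.

(** The radial field c |grad u|^2 x / r^2 is added to the field of Bochner's identity, so that for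
    the right [c] the flux vanishes on the sphere. Its divergence contains the radial derivative of
    |grad u|^2, which [eul_G2_ge] bounds at the cost of half of [D2 u]. *)
Lemma bochner_integral (R : realType) (r c : R) (u : smooth R) : 0 < r -> 0 < c ->
  vb r (\sum_j sd j u * sd j (eul u) - G2 u - eul u * lap u + sC (c / r ^+ 2) * s2 R * G2 u) ->
  rint r (D2 u) <= 2%:R * rint r (lap u ^+ 2) +
    2%:R * (2%:R * c ^+ 2 - 3%:R * c) / r ^+ 2 * rint r (G2 u).
Proof.
move=> r0 c0 hv.
pose F i := \sum_j sd j u * sd i (sd j u) - sd i u * lap u
  + sC (c / r ^+ 2) * (sX R i * G2 u).
have hF : \sum_i sX R i * F i = \sum_j sd j u * sd j (eul u) - G2 u - eul u * lap u
    + sC (c / r ^+ 2) * s2 R * G2 u.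
  rewrite -flux_bochner /s2 mulr_sumr mulr_suml -big_split; apply: eq_bigr => i _.
  rewrite /F /=; ring.
have hD : \sum_i sd i (F i) = D2 u - lap u ^+ 2 + sC (c / r ^+ 2) * (3%:R * G2 u + eul (G2 u)).
  rewrite -bochner -div_radial mulr_sumr -big_split; apply: eq_bigr => i _.
  by rewrite /F /= sdD; congr (_ + _); rewrite sdM sd_sC mulr0 addr0.
have := @divergence_theorem R r F r0; rewrite hF hD => /(_ hv) h0.
have h1 : rint r (sC 2%:R^-1 * D2 u - sC ((2%:R * c ^+ 2 - 3%:R * c) / r ^+ 2) * G2 u - lap u ^+ 2)
    <= rint r (D2 u - lap u ^+ 2 + sC (c / r ^+ 2) * (3%:R * G2 u + eul (G2 u))).
  apply: le_sint => x Bx; have := eul_G2_ge u r0 c0 Bx.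
  rewrite !(smfD, smfN, smfM, smfX, smfE).
  move: (D2 u x) (G2 u x) (eul (G2 u) x) (lap u x ^+ 2) => d g e l.
  have -> : 2%:R * c ^+ 2 / r ^+ 2 = 2%:R * (c ^+ 2 / r ^+ 2) by rewrite mulrA.
  have -> : (2%:R * c ^+ 2 - 3%:R * c) / r ^+ 2 = 2%:R * (c ^+ 2 / r ^+ 2) - 3%:R * (c / r ^+ 2).
    by field; rewrite gt_eqF.
  move: (c ^+ 2 / r ^+ 2) (c / r ^+ 2) => p q; lra.
rewrite h0 !sintB !sintZ in h1.
have -> : 2%:R * (2%:R * c ^+ 2 - 3%:R * c) / r ^+ 2 =
  2%:R * ((2%:R * c ^+ 2 - 3%:R * c) / r ^+ 2) by rewrite mulrA.
move: h1; move: (_ / r ^+ 2) (rint r (D2 u)) (rint r (G2 u)) (rint r (lap u ^+ 2)).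
move=> p d g l h1; nra.
Qed.

(** When the radial derivative vanishes on the sphere, the flux there reduces to (c - 1) |grad u|^2,
    hence [c = 1]. The coefficient of [rint r (G2 u)] is then negative and the term is dropped. *)
Lemma neumann_D2 (R : realType) (r : R) (u : smooth R) : 0 < r ->
  vb r (eul u) -> (forall a, vb r (ang a (eul u))) ->
  rint r (D2 u) <= 2%:R * rint r (lap u ^+ 2).
Proof.
move=> r0 h0 h1.
have := @bochner_integral R r 1 u r0 ltr01.
rewrite mul1r => H.
apply: (le_trans (H _)).
  have -> : \sum_j sd j u * sd j (eul u) - G2 u - eul u * lap u + sC (r ^+ 2)^-1 * s2 R * G2 u =
      \sum_j sd j u * sd j (eul u) - eul u * lap u - (sC (r ^+ 2)^-1 * bdist r) * G2 u.
    rewrite (s2_def r) mulrBr -rmorphM /= mulVf ?rmorph1; last by rewrite expf_neq0// gt_eqF.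
    by ring.
  apply: vbB; last by apply: vbMr; apply: vbM; exact: vb_eta.
  apply: vbB; last exact: vbMr.
  apply: vb_s2 => //; rewrite -/(s2 R) lagrange; apply: vbD; first exact: vbMr.
  by apply: vb_sum => a; apply: vbM; exact: h1.
rewrite gerDl expr1n; apply: mulr_le0_ge0; last by apply: rint_ge0 => x _; exact: G2_ge0.
by rewrite -mulrA pmulr_rle0// pmulr_lle0 ?invr_gt0 ?exprn_gt0//; lra.
Qed.

(** When the tangential derivatives vanish on the sphere, [lagrange] and [s2_lap] reduce r^2 times
    the flux to (c - 2) times the square of [eul u], hence [c = 2]. The gradient term stays, with
    the coefficient 2 (8 - 6) = 4. *)
Lemma dirichlet_D2 (R : realType) (r : R) (u : smooth R) : 0 < r ->
  (forall a, vb r (ang a u)) -> (forall a, vb r (ang a (ang a u))) ->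
  rint r (D2 u) <= 2%:R * rint r (lap u ^+ 2) + 4%:R / r ^+ 2 * rint r (G2 u).
Proof.
move=> r0 h1 h2.
have := @bochner_integral R r 2%:R u r0 (ltr0Sn _ _).
have -> : 2%:R * (2%:R * 2%:R ^+ 2 - 3%:R * 2%:R) = 4%:R :> R by ring.
apply.
apply: vb_s2 => //; rewrite -/(s2 R).
have -> : s2 R * (\sum_j sd j u * sd j (eul u) - G2 u - eul u * lap u +
     sC (2%:R / r ^+ 2) * s2 R * G2 u) =
  s2 R * (\sum_j sd j u * sd j (eul u)) - eul u * (s2 R * lap u) +
  (2%:R * sC (r ^+ 2)^-1 * s2 R - 1) * (s2 R * \sum_j sd j u * sd j u).
  have -> : G2 u = \sum_j sd j u * sd j u by rewrite /G2; apply: eq_bigr => j _; rewrite expr2.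
  by rewrite rmorphM rmorph_nat; ring.
rewrite !lagrange s2_lap (s2_def r) mulrBr -!mulrA -rmorphM /= mulVf ?rmorph1; last first.
  by rewrite expf_neq0// gt_eqF.
set A := \sum_a ang a u * ang a (eul u); set B := \sum_a ang a (ang a u).
set C := \sum_a ang a u * ang a u.
have -> : eul u * eul (eul u) + A - eul u * (eul (eul u) + eul u + B) +
    (2%:R * 1 - 2%:R * (sC (r ^+ 2)^-1 * bdist r) - 1) * (eul u * eul u + C) =
  A - eul u * B + (2%:R * 1 - 2%:R * (sC (r ^+ 2)^-1 * bdist r) - 1) * C
   - (2%:R * eul u * eul u * sC (r ^+ 2)^-1) * bdist r by ring.
apply: vbB; last by apply: vbM; exact: vb_eta.
apply: vbD; last by apply: vbM; apply: vb_sum => a; exact: vbMr.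
apply: vbB; first by apply: vb_sum => a; exact: vbMr.
by apply: vbM; apply: vb_sum => a.
Qed.

Lemma angM (R : realType) a (f g : smooth R) : ang a (f * g) = f * ang a g + g * ang a f.
Proof. rewrite /ang !sdM; ring. Qed.

Lemma ang_bdist (R : realType) (r : R) a : ang a (bdist r) = 0.
Proof. rewrite /ang !sd_eta; ring. Qed.

Lemma ang_lap (R : realType) a (u : smooth R) : lap (ang a u) = ang a (lap u).
Proof.
rewrite /lap !sum3; elim/ord3_ind: a; rewrite !angE.
all: rewrite !sdB !sdD !sdM !sdD !sdM !sdX3 !ord3_eqE ?eqxx /= ?raddf0 ?sd1 ?sd_nat !sdO; ring.
Qed.

Lemma ang_eul (R : realType) a (u : smooth R) : eul (ang a u) = ang a (eul u).
Proof.
rewrite /eul !sum3; elim/ord3_ind: a; rewrite !angE.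
all: rewrite !sdB !sdD !sdM !sdX3 !ord3_eqE ?eqxx /= !sdO; ring.
Qed.

Lemma lap_eul (R : realType) (u : smooth R) : lap (eul u) = 2%:R * lap u + eul (lap u).
Proof.
rewrite /lap /eul !sum3 !sdD !sdM !sdD !sdM !sdX3 !ord3_eqE ?eqxx /= ?raddf0 ?sd1 ?sd_nat !sdO; ring.
Qed.

Lemma lap_bdist (R : realType) (r : R) (u : smooth R) :
  lap (bdist r * u) = bdist r * lap u - 4%:R * eul u - 6%:R * u.
Proof.
rewrite /lap /eul !sum3 !sdM !sdD !sdM !sd_eta !sdN !sdM !sdX3 !eqxx /= ?sd_nat ?mulr0; ring.
Qed.

(** * Pointwise bounds for third derivatives *)

Lemma sd_sd_ang (R : realType) a j k (u : smooth R) :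
  ang a (sd j (sd k u)) = sd j (sd k (ang a u))
   - (j == a + 1)%:R * sd (a + 2%:R) (sd k u) + (j == a + 2%:R)%:R * sd (a + 1) (sd k u)
   - (k == a + 1)%:R * sd j (sd (a + 2%:R) u) + (k == a + 2%:R)%:R * sd j (sd (a + 1) u).
Proof.
have nat0 i (b : bool) : sd i (b%:R : smooth R) = 0 by exact: sd_nat.
rewrite /ang !(sdB, sdD, sdM, sd_sX, nat0).
rewrite !(eq_sym j) !(eq_sym k) (sd_comm k (a + 2%:R)) (sd_comm k (a + 1)).
rewrite (sd_comm j (a + 2%:R)) (sd_comm j (a + 1)); ring.
Qed.

Lemma sd_sd_eul (R : realType) j k (u : smooth R) :
  eul (sd j (sd k u)) = sd j (sd k (eul u)) - 2%:R * sd j (sd k u).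
Proof.
have H (v : smooth R) i : eul (sd i v) = sd i (eul v) - sd i v.
  by rewrite sd_eul addrC addrA addNr add0r.
by rewrite !H sdB; ring.
Qed.

Lemma sd_sd_bdist (R : realType) (r : R) j k (u : smooth R) :
  bdist r * sd j (sd k u) = sd j (sd k (bdist r * u)) + 2%:R * sX R j * sd k u
    + 2%:R * sX R k * sd j u + 2%:R * (k == j)%:R * u.
Proof.
rewrite !sdM !sdD !sdM !sd_eta !sdN !sdM !sd_sX sd_nat; ring.
Qed.

Lemma sqr_sum5_le (R : realType) (a b c d e : R) :
  (a + b + c + d + e) ^+ 2 <= 5%:R * (a ^+ 2 + b ^+ 2 + c ^+ 2 + d ^+ 2 + e ^+ 2).
Proof.
rewrite -subr_ge0.
have -> : 5%:R * (a ^+ 2 + b ^+ 2 + c ^+ 2 + d ^+ 2 + e ^+ 2) - (a + b + c + d + e) ^+ 2 =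
  (a - b) ^+ 2 + (a - c) ^+ 2 + (a - d) ^+ 2 + (a - e) ^+ 2 + (b - c) ^+ 2 + (b - d) ^+ 2
  + (b - e) ^+ 2 + (c - d) ^+ 2 + (c - e) ^+ 2 + (d - e) ^+ 2 by ring.
by rewrite !addr_ge0// sqr_ge0.
Qed.

Lemma sqr_bool_le (R : realType) (b : bool) (s t m : R) :
  0 <= m -> t ^+ 2 <= m -> (s * (b%:R * t)) ^+ 2 <= s ^+ 2 * m.
Proof.
move=> m0 tm; case: b; rewrite ?mul1r ?mul0r ?mulr0.
  by rewrite exprMn ler_wpM2l ?sqr_ge0.
by rewrite expr0n mulr_ge0 ?sqr_ge0.
Qed.

Lemma ang_D2_le (R : realType) a j k (u : smooth R) x :
  ang a (sd j (sd k u)) x ^+ 2 <= 5%:R * (sd j (sd k (ang a u)) x ^+ 2 + 4%:R * D2 u x).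
Proof.
rewrite sd_sd_ang !(smfD, smfN, smfM, smf_nat).
set A := sd j _ x; set B := sd (a + 2%:R) _ x; set C := sd (a + 1) _ x.
set D := sd j _ x; set E := sd j _ x.
have hB : B ^+ 2 <= D2 u x by exact: comp_le_D2.
have hC : C ^+ 2 <= D2 u x by exact: comp_le_D2.
have hD : D ^+ 2 <= D2 u x by exact: comp_le_D2.
have hE : E ^+ 2 <= D2 u x by exact: comp_le_D2.
have h0 := D2_ge0 u x.
have := sqr_bool_le (j == a + 1) (- 1) h0 hB; have := sqr_bool_le (j == a + 2%:R) 1 h0 hC.
have := sqr_bool_le (k == a + 1) (- 1) h0 hD; have := sqr_bool_le (k == a + 2%:R) 1 h0 hE.
rewrite !mulN1r !mul1r sqrrN expr1n !mul1r => h1 h2 h3 h4.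
apply: le_trans (sqr_sum5_le _ _ _ _ _) _; rewrite ler_wpM2l//; lra.
Qed.

Lemma D2_sum (R : realType) (u : smooth R) x : D2 u x = \sum_j \sum_k sd j (sd k u) x ^+ 2.
Proof.
rewrite /D2 smf_sum exchange_big; apply: eq_bigr => j _.
by rewrite /G2 smf_sum; apply: eq_bigr => i _; rewrite smfX.
Qed.

Lemma D3_sum (R : realType) (u : smooth R) x :
  D3 u x = \sum_j \sum_k G2 (sd j (sd k u)) x.
Proof.
rewrite /D3 smf_sum; under eq_bigr do rewrite D2_sum.
rewrite exchange_big; apply: eq_bigr => j _; rewrite exchange_big; apply: eq_bigr => k _.
rewrite /G2 smf_sum; apply: eq_bigr => i _.
by rewrite smfX (sd_comm k) (sd_comm j i).
Qed.

(** [lagrange] is applied to every second derivative of [u], followed by the commutators of [eul]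
    and [ang] with second derivatives. The weight |x|^2 degenerates at the origin, where
    [bdist_D3_le] takes over. *)
Lemma s2_D3_le (R : realType) (u : smooth R) x :
  s2 R x * D3 u x <= 10%:R * (D2 (eul u) x + \sum_a D2 (ang a u) x) + 700%:R * D2 u x.
Proof.
rewrite D3_sum mulr_sumr; under eq_bigr do rewrite mulr_sumr.
have L j k : s2 R x * G2 (sd j (sd k u)) x <= 2%:R * sd j (sd k (eul u)) x ^+ 2 +
   8%:R * sd j (sd k u) x ^+ 2 +
   \sum_a 5%:R * (sd j (sd k (ang a u)) x ^+ 2 + 4%:R * D2 u x).
  have -> : s2 R x * G2 (sd j (sd k u)) x =
      eul (sd j (sd k u)) x ^+ 2 + \sum_a ang a (sd j (sd k u)) x ^+ 2.
    have -> : G2 (sd j (sd k u)) = \sum_i sd i (sd j (sd k u)) * sd i (sd j (sd k u)).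
      by rewrite /G2; apply: eq_bigr => i _; rewrite expr2.
    rewrite -smfM lagrange smfD smfM [X in _ + X = _]smf_sum expr2; congr (_ + _).
  apply: lerD; last by apply: ler_sum => a _; exact: ang_D2_le.
  rewrite sd_sd_eul !(smfD, smfN, smfM, smf_nat).
  move: (sd j (sd k (eul u)) x) (sd j (sd k u) x) => p q.
  have := sqr_ge0 (p + 2%:R * q); lra.
apply: (@le_trans _ _ (\sum_j \sum_k (2%:R * sd j (sd k (eul u)) x ^+ 2 +
   8%:R * sd j (sd k u) x ^+ 2 +
   \sum_a 5%:R * (sd j (sd k (ang a u)) x ^+ 2 + 4%:R * D2 u x)))).
  by apply: ler_sum => j _; apply: ler_sum => k _; exact: L.
(* The sum over [a] contributes 20 [D2 u x] for each of 3 axes and 9 pairs of indices, that is 540;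
   together with the 8 this stays below 700. *)
have -> : \sum_j \sum_k (2%:R * sd j (sd k (eul u)) x ^+ 2 +
   8%:R * sd j (sd k u) x ^+ 2 +
   \sum_a 5%:R * (sd j (sd k (ang a u)) x ^+ 2 + 4%:R * D2 u x)) =
   2%:R * D2 (eul u) x + 8%:R * (\sum_j \sum_k sd j (sd k u) x ^+ 2) +
   5%:R * \sum_a D2 (ang a u) x + 540%:R * D2 u x.
  rewrite (D2_sum (eul u)) (eq_bigr _ (fun a _ => D2_sum (ang a u) x)).
  move: (D2 u x) => d; rewrite !sum3; ring.
rewrite -D2_sum.
have := D2_ge0 u x; have := D2_ge0 (eul u) x.
have : 0 <= \sum_a D2 (ang a u) x by apply: sumr_ge0 => a _; exact: D2_ge0.
lra.
Qed.

Lemma eul_sqr_le (R : realType) (r : R) (u : smooth R) x : eball r x ->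
  eul u x ^+ 2 + \sum_a ang a u x ^+ 2 <= r ^+ 2 * G2 u x.
Proof.
move=> Bx; apply: (@le_trans _ _ (s2 R x * G2 u x)); last first.
  by rewrite ler_wpM2r ?G2_ge0// s2_le.
have -> : G2 u = \sum_i sd i u * sd i u.
  by rewrite /G2; apply: eq_bigr => i _; rewrite expr2.
rewrite -smfM lagrange smfD smfM [X in _ <= _ + X]smf_sum expr2 lerD2l.
by apply: ler_sum => a _; rewrite smfM expr2.
Qed.

Lemma eul_sqr_le1 (R : realType) (r : R) (u : smooth R) x : eball r x ->
  eul u x ^+ 2 <= r ^+ 2 * G2 u x.
Proof.
move=> Bx; apply: le_trans (eul_sqr_le u Bx); rewrite lerDl.
by apply: sumr_ge0 => a _; exact: sqr_ge0.
Qed.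

Lemma ang_sqr_le (R : realType) (r : R) (u : smooth R) x : eball r x ->
  \sum_a ang a u x ^+ 2 <= r ^+ 2 * G2 u x.
Proof. by move=> Bx; apply: le_trans (eul_sqr_le u Bx); rewrite lerDr sqr_ge0. Qed.

Lemma G2_sum (R : realType) (u : smooth R) x : G2 u x = \sum_i sd i u x ^+ 2.
Proof. by rewrite /G2 smf_sum; apply: eq_bigr => i _; rewrite smfX. Qed.

Lemma D2_G2 (R : realType) (u : smooth R) x : D2 u x = \sum_i G2 (sd i u) x.
Proof. by rewrite /D2 smf_sum. Qed.

Lemma D3_D2 (R : realType) (u : smooth R) x : D3 u x = \sum_i D2 (sd i u) x.
Proof. by rewrite /D3 smf_sum. Qed.

Lemma G2_eul_le (R : realType) (r : R) (u : smooth R) x : eball r x ->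
  G2 (eul u) x <= 2%:R * G2 u x + 2%:R * r ^+ 2 * D2 u x.
Proof.
move=> Bx; rewrite D2_G2 !G2_sum !mulr_sumr -big_split; apply: ler_sum => j _ /=.
rewrite sd_eul -/(eul (sd j u)) smfD -mulrA.
have := eul_sqr_le1 (sd j u) Bx; have := sqr_ge0 (sd j u x - eul (sd j u) x).
move: (sd j u x) (eul (sd j u) x) (r ^+ 2 * G2 _ x) => p q t; lra.
Qed.

Lemma bdist_le (R : realType) (r : R) x : eball r x -> 0 <= bdist r x <= r ^+ 2.
Proof. by move=> Bx; rewrite (ltW (eta_gt0 Bx)) etaE gerBl sqr_ge0. Qed.

(** Each [bdist r * sd i u] vanishes on the sphere, so [dirichlet_D2] can control its second
    derivatives, and these contain [bdist r] times the third derivatives of [u]. The bound is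
    effective away from the sphere. *)
Lemma bdist_D3_le (R : realType) (r : R) (u : smooth R) x : eball r x ->
  bdist r x ^+ 2 * D3 u x <= 4%:R * \sum_i D2 (bdist r * sd i u) x +
    32%:R * r ^+ 2 * D2 u x + 48%:R * G2 u x.
Proof.
move=> Bx.
have L i j k : bdist r x ^+ 2 * sd j (sd k (sd i u)) x ^+ 2 <=
   4%:R * sd j (sd k (bdist r * sd i u)) x ^+ 2 +
   16%:R * (coord x j ^+ 2 * sd k (sd i u) x ^+ 2) + 16%:R * (coord x k ^+ 2 * sd j (sd i u) x ^+ 2) +
   16%:R * ((k == j)%:R * sd i u x ^+ 2).
  rewrite -exprMn -smfM sd_sd_bdist !(smfD, smfM, smfE).
  have -> : (k == j)%:R * sd i u x ^+ 2 = ((k == j)%:R * sd i u x) ^+ 2.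
    by case: (k == j); rewrite ?mul1r ?mul0r ?expr0n.
  have -> : (2%:R * (k == j)%:R * sd i u x) = 2%:R * ((k == j)%:R * sd i u x) by rewrite mulrA.
  rewrite -!exprMn.
  move: (sd j (sd k (bdist r * sd i u)) x) => a.
  rewrite -!(mulrA 2%:R).
  move: (coord x j * _) (coord x k * _) ((k == j)%:R * _) => b c d.
  have := sqr_sum5_le a (2%:R * b) (2%:R * c) (2%:R * d) 0.
  have := sqr_ge0 (a - 2%:R * b); have := sqr_ge0 (a - 2%:R * c); have := sqr_ge0 (a - 2%:R * d).
  have := sqr_ge0 (b - c); have := sqr_ge0 (b - d); have := sqr_ge0 (c - d); lra.
have hs := s2_le Bx.
have s2E : s2 R x = \sum_j coord x j ^+ 2.
  by rewrite /s2 smf_sum; apply: eq_bigr => j _; rewrite smfX smfE.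
have M i : bdist r x ^+ 2 * D2 (sd i u) x <= 4%:R * D2 (bdist r * sd i u) x +
    32%:R * (r ^+ 2 * G2 (sd i u) x) + 48%:R * sd i u x ^+ 2.
  apply: (@le_trans _ _ (\sum_j \sum_k (4%:R * sd j (sd k (bdist r * sd i u)) x ^+ 2 +
   16%:R * (coord x j ^+ 2 * sd k (sd i u) x ^+ 2) + 16%:R * (coord x k ^+ 2 * sd j (sd i u) x ^+ 2) +
   16%:R * ((k == j)%:R * sd i u x ^+ 2)))).
    rewrite D2_sum mulr_sumr; apply: ler_sum => j _; rewrite mulr_sumr.
    by apply: ler_sum => k _; exact: L.
  have -> : \sum_j \sum_k (4%:R * sd j (sd k (bdist r * sd i u)) x ^+ 2 +
   16%:R * (coord x j ^+ 2 * sd k (sd i u) x ^+ 2) + 16%:R * (coord x k ^+ 2 * sd j (sd i u) x ^+ 2) +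
   16%:R * ((k == j)%:R * sd i u x ^+ 2)) =
   4%:R * D2 (bdist r * sd i u) x + 32%:R * (s2 R x * G2 (sd i u) x) + 48%:R * sd i u x ^+ 2.
    have bT : true%:R = 1 :> R by [].
    have bF : false%:R = 0 :> R by [].
    by rewrite D2_sum s2E G2_sum !sum3 !ord3_eqE !eqxx !bT !bF; ring.
  rewrite lerD2r lerD2l ler_wpM2l//.
  by rewrite ler_wpM2r// G2_ge0.
rewrite D3_D2 mulr_sumr.
apply: (le_trans (ler_sum _ (fun i _ => M i))).
by rewrite !big_split -!mulr_sumr /= -D2_G2 -G2_sum mulrA.
Qed.

Lemma lap_bdist_le (R : realType) (r : R) (u : smooth R) x : eball r x ->
  \sum_i lap (bdist r * sd i u) x ^+ 2 <=
  3%:R * r ^+ 4 * G2 (lap u) x + 48%:R * r ^+ 2 * D2 u x + 108%:R * G2 u x.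
Proof.
move=> Bx; rewrite D2_G2 !G2_sum !mulr_sumr -!big_split; apply: ler_sum => i _ /=.
have -> : lap (bdist r * sd i u) = bdist r * sd i (lap u) - 4%:R * eul (sd i u) - 6%:R * sd i u.
  rewrite lap_bdist; congr (_ * _ - _ - _); rewrite /lap sd_sum; apply: eq_bigr => j _.
  by rewrite !(sd_comm i).
rewrite !(smfD, smfN, smfM, smf_nat).
have := eul_sqr_le1 (sd i u) Bx; have /andP[e0 e1] := bdist_le Bx.
have h : (bdist r x * sd i (lap u) x) ^+ 2 <= r ^+ 4 * sd i (lap u) x ^+ 2.
  rewrite exprMn ler_wpM2r ?sqr_ge0//.
  have -> : r ^+ 4 = (r ^+ 2) ^+ 2 by rewrite -exprM.
  by rewrite lerXn2r ?nnegrE ?sqr_ge0.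
move: h; rewrite -(mulrA 3%:R) -(mulrA 48%:R); move: (r ^+ 4 * _) (r ^+ 2 * _) (bdist r x * _) (eul (sd i u) x) (sd i u x).
move=> p q a b c h hq.
have := sqr_ge0 (a + 4%:R * b); have := sqr_ge0 (a + 6%:R * c); have := sqr_ge0 (4%:R * b - 6%:R * c).
lra.
Qed.

Lemma G2_bdist_le (R : realType) (r : R) (u : smooth R) x : eball r x ->
  \sum_i G2 (bdist r * sd i u) x <= 2%:R * r ^+ 4 * D2 u x + 8%:R * r ^+ 2 * G2 u x.
Proof.
move=> Bx; have hs := s2_le Bx; have /andP[e0 e1] := bdist_le Bx.
have s2E : s2 R x = \sum_j coord x j ^+ 2.
  by rewrite /s2 smf_sum; apply: eq_bigr => j _; rewrite smfX smfE.
rewrite D2_G2 (G2_sum u) !mulr_sumr -big_split; apply: ler_sum => i _ /=.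
apply: (@le_trans _ _ (2%:R * r ^+ 4 * G2 (sd i u) x + 8%:R * (s2 R x * sd i u x ^+ 2))); last first.
  by rewrite lerD2l -mulrA ler_wpM2l// ler_wpM2r ?sqr_ge0.
rewrite s2E !G2_sum mulr_suml !mulr_sumr -big_split; apply: ler_sum => j _ /=.
rewrite sdM sd_eta !(smfD, smfN, smfM, smfE).
have h : (bdist r x * sd j (sd i u) x) ^+ 2 <= r ^+ 4 * sd j (sd i u) x ^+ 2.
  rewrite exprMn ler_wpM2r ?sqr_ge0//.
  have -> : r ^+ 4 = (r ^+ 2) ^+ 2 by rewrite -exprM.
  by rewrite lerXn2r ?nnegrE ?sqr_ge0.
rewrite -exprMn -(mulrA 2%:R (r ^+ 4)).
have -> : sd i u x * - (2%:R * coord x j) = - (2%:R * (coord x j * sd i u x)) by ring.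
move: h; move: (r ^+ 4 * _) (bdist r x * _) (coord x j * _) => p a b h.
have := sqr_ge0 (a + 2%:R * b); lra.
Qed.

Lemma lap_eul_le (R : realType) (r : R) (u : smooth R) x : eball r x ->
  lap (eul u) x ^+ 2 <= 8%:R * lap u x ^+ 2 + 2%:R * r ^+ 2 * G2 (lap u) x.
Proof.
move=> Bx; rewrite lap_eul smfD smfM smf_nat -mulrA.
have := eul_sqr_le1 (lap u) Bx; have := sqr_ge0 (2%:R * lap u x - eul (lap u) x).
move: (r ^+ 2 * _) (lap u x) (eul _ x) => p a b; lra.
Qed.

Lemma sint_sum (R : realType) (r : R) (I : Type) (s : seq I) (F : I -> smooth R) :
  rint r (\sum_(i <- s) F i) = \sum_(i <- s) rint r (F i).
Proof.
rewrite -rint_sum; last by move=> i; exact: smooth_bint.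
by apply: eq_rint => x _; rewrite smf_sum.
Qed.

Lemma sint_ge0 (R : realType) (r : R) (f : smooth R) : (forall x, 0 <= f x) -> 0 <= rint r f.
Proof. by move=> h; apply: rint_ge0 => x _. Qed.

(** Green's formula turns the integral of the squared Laplacian into minus the pairing of grad u
    with grad lap u, to which Young's inequality applies. *)
Lemma neumann_lap (R : realType) (r : R) (u : smooth R) : 0 < r -> vb r (eul u) ->
  2%:R * rint r (lap u ^+ 2) <= rint r (G2 u) + rint r (G2 (lap u)).
Proof.
move=> r0 hu; have := @divergence_theorem R r (fun i => lap u * sd i u) r0.
have -> : \sum_j sX R j * (lap u * sd j u) = lap u * eul u.
  by rewrite /eul mulr_sumr; apply: eq_bigr => j _; rewrite mulrCA.
move=> /(_ (vbM _ hu)) h0.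
have h1 : rint r (sC 2%:R * lap u ^+ 2 - G2 u - G2 (lap u)) <=
    rint r (sC 2%:R * \sum_j sd j (lap u * sd j u)).
  apply: le_sint => x _.
  have -> : \sum_j sd j (lap u * sd j u) = lap u ^+ 2 + \sum_j sd j (lap u) * sd j u.
    rewrite expr2 {3}/lap mulr_sumr -big_split; apply: eq_bigr => j _ /=.
    by rewrite sdM [sd j u * _]mulrC.
  have E : (\sum_j sd j (lap u) * sd j u) x = \sum_j (sd j (lap u) * sd j u) x.
    by rewrite smf_sum.
  rewrite !(smfD, smfN, smfM, smfX, sCE) E !G2_sum.
  have : 0 <= \sum_j (sd j u x + sd j (lap u) x) ^+ 2.
    by apply: sumr_ge0 => j _; exact: sqr_ge0.
  have -> : \sum_j (sd j u x + sd j (lap u) x) ^+ 2 = \sum_j sd j u x ^+ 2 +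
     \sum_j sd j (lap u) x ^+ 2 + 2%:R * \sum_j (sd j (lap u) * sd j u) x.
    by rewrite !sum3 !smfM; ring.
  move: (\sum_j sd j u x ^+ 2) (\sum_j sd j (lap u) x ^+ 2) (\sum_j (_ * _) x) (lap u x ^+ 2) => a b c d; lra.
rewrite sintZ h0 mulr0 !sintB sintZ in h1; lra.
Qed.

Ltac nonneg :=
  repeat first [exact: ler0n | exact: ler01 | assumption | apply: addr_ge0 | apply: mulr_ge0 | rewrite invr_ge0].

(** Rotational derivatives of [u] satisfy the Neumann condition again and the radial derivative
    satisfies a Dirichlet condition, so the second-order estimates apply to them and yield third
    derivatives of [u]. The hypotheses on [ang] are tangential derivatives of the Neumann condition;
    for separated solutions they are read off an explicit radial factor. *)
Lemma neumann_D3 (R : realType) (r : R) : 0 < r -> exists2 C : R, 0 <= C & forall u : smooth R,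
  vb r (eul u) -> (forall a, vb r (ang a (eul u))) ->
  (forall a b, vb r (ang b (ang a (eul u)))) ->
  rint r (D2 u) + rint r (D3 u) <= C * (rint r (G2 u) + rint r (G2 (lap u))).
Proof.
move=> r0; have r20 : 0 < r ^+ 2 by rewrite exprn_gt0.
have r40 : 0 < r ^+ 4 by rewrite exprn_gt0.
have r2' := ltW r20; have r4' := ltW r40.
pose cE := 32%:R + 4%:R * r ^+ 2 + 8%:R / r ^+ 2.
pose cB := 6%:R * r ^+ 4 + 96%:R * r ^+ 2 + 216%:R + 4%:R / r ^+ 2 * (2%:R * r ^+ 4 + 8%:R * r ^+ 2).
have cE0 : 0 <= cE by rewrite /cE; nonneg.
have cB0 : 0 <= cB by rewrite /cB; nonneg.
pose c6 := r ^+ 2 * (10%:R * (cE + 2%:R * r ^+ 2) + 700%:R) + 4%:R * cB + 32%:R * r ^+ 2 + 48%:R.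
have c60 : 0 <= c6.
  by rewrite /c6; nonneg.
exists (1 + 4%:R / 3%:R / r ^+ 4 * c6).
  by nonneg.
move=> u h0 h1 h2.
set A := rint r (G2 (lap u)); set B := rint r (G2 u).
have A0 : 0 <= A by apply: sint_ge0 => x; exact: G2_ge0.
have B0 : 0 <= B by apply: sint_ge0 => x; exact: G2_ge0.
set S := B + A; have S0 : 0 <= S by rewrite addr_ge0.
have hL := neumann_lap r0 h0; rewrite -/A -/B -/S in hL.
have hT : rint r (D2 u) <= S by apply: le_trans (neumann_D2 r0 h0 h1) hL.
have hLa : \sum_a rint r (D2 (ang a u)) <= 2%:R * r ^+ 2 * S.
  apply: (@le_trans _ _ (\sum_a 2%:R * rint r (lap (ang a u) ^+ 2))).
    apply: ler_sum => a _; apply: neumann_D2 => // [|b]; rewrite ang_eul; first exact: h1.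
    exact: h2.
  rewrite -mulr_sumr -sint_sum -mulrA ler_wpM2l//.
  apply: (@le_trans _ _ (rint r (sC (r ^+ 2) * G2 (lap u)))).
    apply: le_sint => x Bx; rewrite smf_sum smfM sCE.
    by under eq_bigr do rewrite ang_lap smfX; exact: ang_sqr_le.
  by rewrite sintZ ler_wpM2l ?sqr_ge0// lerDr.
have hE : rint r (D2 (eul u)) <= cE * S.
  apply: (le_trans (dirichlet_D2 r0 h1 (fun a => h2 a a))).
  have e1 : rint r (lap (eul u) ^+ 2) <= 8%:R * rint r (lap u ^+ 2) + 2%:R * r ^+ 2 * A.
    rewrite -!sintZ -sintD; apply: le_sint => x Bx.
    by rewrite !(smfD, smfM, smfX, sCE); exact: lap_eul_le.
  have e2 : rint r (G2 (eul u)) <= 2%:R * B + 2%:R * r ^+ 2 * rint r (D2 u).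
    rewrite -!sintZ -sintD; apply: le_sint => x Bx.
    by rewrite !(smfD, smfM, smfX, sCE); exact: G2_eul_le.
  have e3 : 4%:R / r ^+ 2 * rint r (G2 (eul u)) <= 4%:R / r ^+ 2 * (2%:R * S + 2%:R * r ^+ 2 * S).
    apply: ler_wpM2l; first by nonneg.
    apply: le_trans e2 _; apply: lerD.
      by rewrite ler_wpM2l// lerDl.
    by apply: ler_wpM2l => //; nonneg.
  have e4 : r ^+ 2 * A <= r ^+ 2 * S by apply: ler_wpM2l => //; rewrite lerDr.
  have -> : cE * S = 24%:R * S + 4%:R * (r ^+ 2 * S) + 4%:R / r ^+ 2 * (2%:R * S + 2%:R * r ^+ 2 * S).
    by rewrite /cE; field; rewrite gt_eqF.
  rewrite -mulrA in e1; lra.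
have hB : \sum_i rint r (D2 (bdist r * sd i u)) <= cB * S.
  apply: (@le_trans _ _ (\sum_i (2%:R * rint r (lap (bdist r * sd i u) ^+ 2) +
     4%:R / r ^+ 2 * rint r (G2 (bdist r * sd i u))))).
    apply: ler_sum => i _; apply: dirichlet_D2 => // a.
      by rewrite angM ang_bdist mulr0 addr0; apply: vbMr; exact: vb_eta.
    by rewrite angM ang_bdist mulr0 addr0 angM ang_bdist mulr0 addr0; apply: vbMr; exact: vb_eta.
  rewrite big_split -!mulr_sumr -!sint_sum /=.
  have e1 : rint r (\sum_i lap (bdist r * sd i u) ^+ 2) <=
      3%:R * r ^+ 4 * A + 48%:R * r ^+ 2 * rint r (D2 u) + 108%:R * B.
    rewrite -!sintZ -!sintD; apply: le_sint => x Bx.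
    rewrite smf_sum !(smfD, smfM, sCE); under eq_bigr do rewrite smfX.
    exact: lap_bdist_le.
  have e2 : rint r (\sum_i G2 (bdist r * sd i u)) <=
      2%:R * r ^+ 4 * rint r (D2 u) + 8%:R * r ^+ 2 * B.
    rewrite -!sintZ -!sintD; apply: le_sint => x Bx.
    by rewrite smf_sum !(smfD, smfM, sCE); exact: G2_bdist_le.
  have f1 : r ^+ 4 * A <= r ^+ 4 * S by apply: ler_wpM2l => //; rewrite lerDr.
  have f2 : r ^+ 2 * rint r (D2 u) <= r ^+ 2 * S by apply: ler_wpM2l.
  have f3 : B <= S by rewrite lerDl.
  have e3 : 4%:R / r ^+ 2 * rint r (\sum_i G2 (bdist r * sd i u)) <=
     4%:R / r ^+ 2 * (2%:R * (r ^+ 4 * S) + 8%:R * (r ^+ 2 * S)).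
    apply: ler_wpM2l; first by nonneg.
    apply: le_trans e2 _.
    rewrite -(mulrA 2%:R (r ^+ 4)) -(mulrA 8%:R (r ^+ 2)).
    by apply: lerD; (apply: ler_wpM2l; first exact: ler0n); apply: ler_wpM2l.
  have -> : cB * S = 6%:R * (r ^+ 4 * S) + 96%:R * (r ^+ 2 * S) + 216%:R * S +
     4%:R / r ^+ 2 * (2%:R * (r ^+ 4 * S) + 8%:R * (r ^+ 2 * S)).
    by rewrite /cB; field; rewrite gt_eqF.
  rewrite -(mulrA 3%:R) -(mulrA 48%:R) in e1; lra.
have hD : 3%:R / 4%:R * r ^+ 4 * rint r (D3 u) <= c6 * S.
  apply: (@le_trans _ _ (rint r (sC (r ^+ 2) * (sC 10%:R * (D2 (eul u) + \sum_a D2 (ang a u)) +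
      sC 700%:R * D2 u) + (sC 4%:R * \sum_i D2 (bdist r * sd i u) +
      sC (32%:R * r ^+ 2) * D2 u + sC 48%:R * G2 u)))).
    rewrite -sintZ; apply: le_sint => x Bx.
    have Es1 : (\sum_a D2 (ang a u)) x = \sum_a D2 (ang a u) x by rewrite smf_sum.
    have Es2 : (\sum_i D2 (bdist r * sd i u)) x = \sum_i D2 (bdist r * sd i u) x.
      by rewrite smf_sum.
    rewrite !(smfD, smfM, sCE) Es1 Es2.
    have k1 := s2_D3_le u x; have k2 := bdist_D3_le u Bx.
    (* With b = [bdist r x] one has [s2 R x] = r^2 - b, and r^2 (r^2 - b) + b^2 = (b - r^2 / 2)^2 +
       3/4 r^4: the two degenerate weights together are bounded below. *)
    have k3 : 3%:R / 4%:R * r ^+ 4 * D3 u x <= (r ^+ 2 * s2 R x + bdist r x ^+ 2) * D3 u x.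
      rewrite ler_wpM2r ?D3_ge0// (s2_def r) smfD smfN sCE.
      have -> : r ^+ 4 = (r ^+ 2) ^+ 2 by rewrite -exprM.
      have := sqr_ge0 (r ^+ 2 - 2%:R * bdist r x); lra.
    apply: le_trans k3 _; rewrite mulrDl -mulrA; apply: lerD => //.
    by apply: ler_wpM2l.
  have Es1 : rint r (\sum_a D2 (ang a u)) = \sum_a rint r (D2 (ang a u)) by rewrite sint_sum.
  have Es2 : rint r (\sum_i D2 (bdist r * sd i u)) = \sum_i rint r (D2 (bdist r * sd i u)).
    by rewrite sint_sum.
  rewrite sintD !sintZ !sintD !sintZ !sintD Es1 Es2.
  have -> : c6 * S = r ^+ 2 * (10%:R * (cE * S + 2%:R * r ^+ 2 * S) + 700%:R * S)
     + (4%:R * (cB * S) + 32%:R * r ^+ 2 * S + 48%:R * S) by rewrite /c6; ring.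
  have f2 : 32%:R * r ^+ 2 * rint r (D2 u) <= 32%:R * r ^+ 2 * S.
    by apply: ler_wpM2l => //; nonneg.
  have f3 : B <= S by rewrite lerDl.
  apply: lerD; last by rewrite -/B; lra.
  apply: ler_wpM2l => //; lra.
have -> : (1 + 4%:R / 3%:R / r ^+ 4 * c6) * S = S + 4%:R / 3%:R / r ^+ 4 * (c6 * S).
  by rewrite mulrDl mul1r mulrA.
apply: lerD => //.
have -> : rint r (D3 u) = 4%:R / 3%:R / r ^+ 4 * (3%:R / 4%:R * r ^+ 4 * rint r (D3 u)).
  by field; rewrite gt_eqF.
by apply: ler_wpM2l => //; nonneg.
Qed.

(** * Spherical Bessel functions and their zeros *)

(** This is the double factorial (2 n - 1)!!. *)
Definition dfac (n : nat) : nat := \prod_(i < n) (2 * i + 1)%N.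

Lemma dfacS n : dfac n.+1 = (dfac n * (2 * n + 1))%N.
Proof. by rewrite /dfac big_ord_recr. Qed.

Lemma dfac_gt0 n : (0 < dfac n)%N.
Proof. by elim: n => [|n IH]; rewrite ?dfacS ?muln_gt0 ?IH /dfac ?big_ord0// addn1. Qed.

(* Coefficients of the entire function [H n] with [psi n z = z ^ n * H n (z ^ 2)]. *)
Definition hcoef (R : realType) (n k : nat) : R :=
  (- 1) ^+ k / (2%:R ^+ k * k`!%:R * (dfac (n + k).+1)%:R).

Definition H (R : realType) (n : nat) (y : R) : R := limn (pseries (@hcoef R n) y).

Lemma hcoefS (R : realType) n k :
  k.+1%:R * hcoef R n k.+1 = - (2%:R^-1) * hcoef R n.+1 k.
Proof.
rewrite /hcoef addSnnS exprS factS natrM exprS.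
have k1 : 1 + k%:R != 0 :> R by rewrite nat1r pnatr_eq0.
by field; rewrite ?k1 ?pnatr_eq0 -?lt0n ?fact_gt0 ?dfac_gt0 ?expf_neq0 ?pnatr_eq0.
Qed.

Lemma hcoef_rec (R : realType) n k :
  hcoef R n.+2 k - (2 * n + 3)%:R * hcoef R n.+1 k.+1 + hcoef R n k.+1 = 0.
Proof.
rewrite /hcoef; set m := (n + k)%N.
have -> : (n.+2 + k).+1 = m.+3 by rewrite /m; lia.
have -> : (n.+1 + k.+1).+1 = m.+3 by rewrite /m; lia.
have -> : (n + k.+1).+1 = m.+2 by rewrite /m; lia.
rewrite (dfacS m.+2) !exprS factS !natrM.
have -> : (2 * m.+2 + 1)%:R = (2 * n + 3)%:R + 2%:R * k.+1%:R :> R.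
  by rewrite -natrM -natrD; congr (_%:R); rewrite /m; lia.
have k1 : 1 + k%:R != 0 :> R by rewrite nat1r pnatr_eq0.
have k2 : (2 * n + 3)%:R + 2%:R * (1 + k%:R) != 0 :> R.
  by rewrite nat1r -natrM -natrD pnatr_eq0; lia.
field; rewrite ?pnatr_eq0 -?lt0n ?fact_gt0 ?dfac_gt0 ?expf_neq0 ?pnatr_eq0 ?k1 ?k2//.
by move: k2; rewrite natrD natrM => ->.
Qed.

Lemma hcoef_rec0 (R : realType) n :
  - (2 * n + 3)%:R * hcoef R n.+1 0 + hcoef R n 0 = 0.
Proof.
rewrite /hcoef !addn0 (dfacS n.+1) natrM expr0 fact0 mul1r.
have -> : (2 * n.+1 + 1)%:R = (2 * n + 3)%:R :> R by congr (_%:R); lia.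
field; rewrite -?natrM -?natrD ?pnatr_eq0 -?lt0n ?dfac_gt0//; lia.
Qed.

Lemma norm_hcoef_le (R : realType) n k : `|hcoef R n k| <= k`!%:R^-1.
Proof.
rewrite /hcoef normrM normrX normrN1 expr1n mul1r normfV ger0_norm; last first.
  by rewrite !mulr_ge0 ?exprn_ge0.
rewrite lef_pV2 ?posrE ?mulr_gt0 ?exprn_gt0 ?ltr0n ?fact_gt0 ?dfac_gt0//.
rewrite -natrX -!natrM ler_nat -[leqLHS]mul1n -[leqLHS]muln1.
by rewrite leq_mul// ?dfac_gt0// leq_mul// expn_gt0.
Qed.

Lemma cvg_hseries (R : realType) n (y : R) : cvgn (pseries (@hcoef R n) y).
Proof.
apply: normed_cvg; apply: (@series_le_cvg _ _ (exp_coeff `|y|)) => [k|k|k|].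
- exact: normr_ge0.
- by rewrite /exp_coeff /= divr_ge0 ?exprn_ge0.
- rewrite /= normrM normrX /exp_coeff /= mulrC ler_wpM2l ?exprn_ge0//.
  exact: norm_hcoef_le.
- exact: is_cvg_series_exp_coeff.
Qed.

Arguments cvg_hseries : clear implicits.

Lemma hcoef_diffs (R : realType) n :
  pseries_diffs (@hcoef R n) = (fun k => - (2%:R^-1) * hcoef R n.+1 k).
Proof. by apply/funext => k; rewrite /pseries_diffs hcoefS. Qed.

Lemma pseriesZ (R : realType) (c : R) (f : nat -> R) y :
  pseries (fun k => c * f k) y = (fun n => c * pseries f y n).
Proof.
apply/funext => n; rewrite /pseries /series /= mulr_sumr.
by apply: eq_bigr => i _; rewrite mulrA.
Qed.

Lemma is_derive_H (R : realType) n (y : R) :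
  is_derive y 1 (H n) (- (2%:R^-1) * H n.+1 y).
Proof.
have cZ (c : R) m x : cvgn (pseries (fun k => c * hcoef R m k) x).
  by rewrite pseriesZ; apply: is_cvgM; [exact: is_cvg_cst | exact: cvg_hseries].
have d2 : pseries_diffs (pseries_diffs (@hcoef R n)) = (fun k => 4%:R^-1 * hcoef R n.+2 k).
  rewrite hcoef_diffs; apply/funext => k; rewrite /pseries_diffs mulrCA hcoefS; by field.
have := @pseries_snd_diffs R (@hcoef R n) (`|y| + 1) y (cvg_hseries R n _).
rewrite d2 hcoef_diffs => /(_ (cZ _ _ _) (cZ _ _ _)).
have -> : `|y| < `| `|y| + 1| by rewrite (ger0_norm (addr_ge0 _ _))// ltrDl.
move=> /(_ isT) h; apply: (is_derive_eq h); rewrite pseriesZ.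
by apply/cvg_lim => //; apply: cvgM; [exact: cvg_cst | exact: cvg_hseries].
Qed.

Lemma H_rec (R : realType) n (y : R) :
  y * H n.+2 y - (2 * n + 3)%:R * H n.+1 y + H n y = 0.
Proof.
have c0 : pseries (@hcoef R n) y k.+1 @[k --> \oo] --> H n y.
  by rewrite (cvg_shiftS (pseries (@hcoef R n) y)); exact: (cvg_hseries R n y).
have c1 : pseries (@hcoef R n.+1) y k.+1 @[k --> \oo] --> H n.+1 y.
  by rewrite (cvg_shiftS (pseries (@hcoef R n.+1) y)); exact: (cvg_hseries R n.+1 y).
have c2 : pseries (@hcoef R n.+2) y k @[k --> \oo] --> H n.+2 y.
  exact: (cvg_hseries R n.+2 y).
have cv : (fun k => y * pseries (@hcoef R n.+2) y k
    - (2 * n + 3)%:R * pseries (@hcoef R n.+1) y k.+1 + pseries (@hcoef R n) y k.+1) @ \oo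
    --> y * H n.+2 y - (2 * n + 3)%:R * H n.+1 y + H n y.
  by apply: cvgD => //; apply: cvgB; apply: cvgM => //; exact: cvg_cst.
move: cv; set F := (X in X @ _ --> _); have -> : F = fun=> 0.
  apply/funext => k; rewrite /F /= /pseries /series /=.
  rewrite 2!(big_nat_recl _ _ _ (leq0n k)) !expr0 !mulr1 !mulrDr !mulr_sumr opprD addrACA.
  set a := \sum_(0 <= i < k) _; set b := \sum_(0 <= i < k) _; set c := \sum_(0 <= i < k) _.
  have e0 := hcoef_rec0 R n.
  have e1 : a - b + c = 0.
    rewrite /a /b /c -sumrB -big_split big1// => i _ /=.
    have := hcoef_rec R n i; move=> h.
    transitivity ((hcoef R n.+2 i - (2 * n + 3)%:R * hcoef R n.+1 i.+1 + hcoef R n i.+1) * y ^+ i.+1).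
      by rewrite !exprS; ring.
    by rewrite h mul0r.
  by move: e0 e1; clear; lra.
move=> cv; exact: (cvg_unique (@Rhausdorff R) cv (cvg_cst 0)).
Qed.

Lemma fact_dfac k : (2 ^ k * k`! * dfac k.+1 = k.*2.+1`!)%N.
Proof.
elim: k => [|k IH]; first by rewrite dfacS /dfac big_ord0.
have -> : k.+1.*2.+1 = k.*2.+3 by lia.
rewrite (factS k.*2.+2) (factS k.*2.+1) -IH dfacS expnS (factS k); nia.
Qed.

Lemma sin_H (R : realType) (z : R) : sin z = z * H 0 (z ^+ 2).
Proof.
have c0 : pseries (@hcoef R 0) (z ^+ 2) @ \oo --> H 0 (z ^+ 2) := cvg_hseries R 0 _.
have c1 : (fun n => z * pseries (@hcoef R 0) (z ^+ 2) n) @ \oo --> z * H 0 (z ^+ 2).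
  by apply: cvgM => //; exact: cvg_cst.
rewrite -(cvg_lim (@Rhausdorff R) (@cvg_sin_coeff' R z)) -(cvg_lim (@Rhausdorff R) c1).
congr (limn _); apply/funext => n.
rewrite /pseries /series /= mulr_sumr; apply: eq_bigr => k _.
rewrite /hcoef /sin_coeff' add0n -fact_dfac !natrM natrX -exprM mul2n.
rewrite exprS -exprnP; move: (_ ^-1) => q; ring.
Qed.

Lemma cos_H (R : realType) (z : R) : cos z = H 0 (z ^+ 2) - z ^+ 2 * H 1 (z ^+ 2).
Proof.
have d1 : is_derive z 1 (fun z : R => z ^+ 2) (2%:R * z).
  have -> : (fun z : R => z ^+ 2) = id * id by apply/funext => w; rewrite expr2.
  apply: (is_derive_eq (is_deriveM (is_derive_id z 1) (is_derive_id z 1))).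
  by rewrite /GRing.scale /= !mulr1 mulr2n mulrDl mul1r.
have d2 := @is_derive1_comp R (@H R 0) (fun z : R => z ^+ 2) z _ _ (is_derive_H 0 _) d1.
have d3 := is_deriveM (is_derive_id z 1) d2.
have E : sin = (id * (@H R 0 \o (fun z : R => z ^+ 2))) :> (R -> R).
  by apply/funext => w; rewrite sin_H.
have [_] := is_derive_sin z; rewrite E => <-; have [_ ->] := d3.
by rewrite /GRing.scale /=; field.
Qed.

Lemma H_at0 (R : realType) n : H n (0 : R) = (dfac n.+1)%:R^-1.
Proof.
have E : pseries (@hcoef R n) 0 k.+1 @[k --> \oo] --> ((dfac n.+1)%:R^-1 : R).
  apply: cvg_near_cst; near=> k; rewrite /pseries /series /= big_nat_recl//.
  rewrite expr0 mulr1 big1 ?addr0; last by move=> i _; rewrite exprS mul0r mulr0.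
  by rewrite /hcoef addn0 expr0 fact0 expr0 !mul1r.
have c0 : pseries (@hcoef R n) 0 k.+1 @[k --> \oo] --> H n 0.
  by rewrite (cvg_shiftS (pseries (@hcoef R n) 0)); exact: (cvg_hseries R n 0).
exact: (cvg_unique (@Rhausdorff R) c0 E).
Unshelve. all: by end_near.
Qed.

Lemma H_continuous (R : realType) n : continuous (@H R n).
Proof.
move=> y; apply: differentiable_continuous; apply/derivable1_diffP.
by case: (is_derive_H n y).
Qed.

(* The energy [H n ^ 2 + y * H n.+1 ^ 2] is nonincreasing. *)
Lemma norm_H_le (R : realType) n (y : R) : 0 <= y -> `|H n y| <= H n 0.
Proof.
rewrite le_eqVlt => /orP[/eqP<-|y0].
  by rewrite ger0_norm// H_at0 invr_ge0.
pose E (y : R) := H n y * H n y + y * (H n.+1 y * H n.+1 y).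
have dE (t : R) : is_derive t 1 E (- (2 * n + 2)%:R * H n.+1 t ^+ 2).
  have d0 := is_derive_H n t; have d1 := is_derive_H n.+1 t.
  have := is_deriveD (is_deriveM d0 d0) (is_deriveM (is_derive_id t 1) (is_deriveM d1 d1)).
  move=> h; apply: (is_derive_eq h); rewrite /GRing.scale /=.
  have e3 : (2 * n + 3)%:R = 2 * n%:R + 3 :> R by rewrite natrD natrM.
  have e2 : (2 * n + 2)%:R = 2 * n%:R + 2 :> R by rewrite natrD natrM.
  have := H_rec n t; rewrite e3 e2 => hr.
  have -> : t * (H n.+1 t * (- 2^-1 * H n.+2 t) + H n.+1 t * (- 2^-1 * H n.+2 t)) =
    - H n.+1 t * (t * H n.+2 t) by field.
  have -> : t * H n.+2 t = (2 * n%:R + 3) * H n.+1 t - H n t.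
    by apply/eqP; rewrite -subr_eq0 -hr; apply/eqP; ring.
  have -> : (H n.+1 * H n.+1) t = H n.+1 t * H n.+1 t by [].
  by field.
have cE t : {for t, continuous E}.
  apply: differentiable_continuous; apply/derivable1_diffP; by case: (dE t).
have [c _ hc] := @MVT R E _ 0 y y0 (fun x _ => dE x) (continuous_subspaceT cE).
have hE : E y <= E 0.
  rewrite -subr_le0 hc subr0 mulr_le0_ge0 ?(ltW y0)// mulNr oppr_le0.
  by rewrite mulr_ge0 ?sqr_ge0.
have H0 : 0 <= H n (0 : R) by rewrite H_at0 invr_ge0.
rewrite -ler_sqr ?nnegrE// real_normK ?num_real//.
apply: le_trans (_ : E y <= _); first by rewrite /E -expr2 lerDl mulr_ge0 ?(ltW y0)// -expr2 sqr_ge0.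
by apply: le_trans hE _; rewrite /E mul0r addr0 -expr2.
Qed.

Lemma H_at0S (R : realType) n : H n.+1 (0 : R) * (2 * n + 3)%:R = H n 0.
Proof.
rewrite !H_at0 (dfacS n.+1).
have -> : (2 * n.+1 + 1 = 2 * n + 3)%N by lia.
rewrite natrM invfM mulfVK ?pnatr_eq0//; lia.
Qed.

(** The slope is at most [H n.+1 0 / 2] in absolute value, and [H n.+1 0] is [H n 0] divided by 2 n
    + 3. Over an interval of length 2 n + 3 at most half of [H n 0] is lost. *)
Lemma H_ge (R : realType) n (y : R) : 0 <= y <= (2 * n + 3)%:R -> H n 0 / 2%:R <= H n y.
Proof.
move=> /andP[]; rewrite le_eqVlt => /orP[/eqP<- _|y0 yn].
  by rewrite ler_pdivrMr// ler_peMr// ?ler1n// H_at0 invr_ge0.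
have cH t : {for t, continuous (@H R n)} by exact: H_continuous.
have [c] := @MVT R (@H R n) _ 0 y y0 (fun x _ => is_derive_H n x) (continuous_subspaceT cH).
rewrite in_itv/= subr0 -mulrA => /andP[c0 cy] hc.
have h1 := norm_H_le n.+1 (ltW c0).
have h2 : H n.+1 c * y <= H n 0.
  rewrite -(H_at0S R n); apply: le_trans (_ : `|H n.+1 c| * y <= _).
    by rewrite ler_wpM2r ?(ltW y0)// ler_norm.
  by apply: ler_pM => //; rewrite ltW.
move: hc h2; move: (H n 0) (H n.+1 c * y) => p q; lra.
Qed.

Lemma H_at0_gt0 (R : realType) n : 0 < H n (0 : R).
Proof. by rewrite H_at0 invr_gt0 ltr0n dfac_gt0. Qed.

Lemma H_gt0 (R : realType) n (y : R) : 0 <= y <= (2 * n + 3)%:R -> 0 < H n y.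
Proof. by move=> /H_ge; apply: lt_le_trans; rewrite divr_gt0// H_at0_gt0. Qed.

(** The recurrence carries two consecutive zeros at [y] up to all larger indices, against the
    positivity of [H k y] once 2 k + 3 exceeds [y]. *)
Lemma H_not_both0 (R : realType) n (y : R) : 0 < y -> H n y = 0 -> H n.+1 y = 0 -> False.
Proof.
move=> y0 h0 h1.
have hk k : H (n + k) y = 0 /\ H (n + k).+1 y = 0.
  elim: k => [|k [e0 e1]]; first by rewrite addn0.
  rewrite addnS; split=> //; have := H_rec (n + k) y.
  by rewrite e0 e1 mulr0 subr0 addr0 => /eqP; rewrite mulf_eq0 gt_eqF//= => /eqP.
pose t := (Num.truncn y).+1; have yt : y < t%:R by exact: truncnS_gt.
clearbody t; have [e _] := hk t.
have : 0 < H (n + t) y.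
  by apply: H_gt0; rewrite (ltW y0)/= (le_trans (ltW yt))// ler_nat; lia.
by rewrite e ltxx.
Qed.

(** Up to a power of z this is the derivative of psi_n in the variable y = z^2: [dpsiE] reads z
    psi_n'(z) = z^n [Phi n (z ^+ 2)]. [Phi1] and [Phi2] are its first two derivatives, simplified by
    [H_rec]. *)
Definition Phi (R : realType) n (y : R) : R := n%:R * H n y - y * H n.+1 y.
Definition Phi1 (R : realType) n (y : R) : R := 2%:R^-1 * (n.+1%:R * H n.+1 y - H n y).
Definition Phi2 (R : realType) n (y : R) : R := 4%:R^-1 * (H n.+1 y - n.+1%:R * H n.+2 y).

Lemma is_derive_Phi (R : realType) n (y : R) : is_derive y 1 (Phi n) (Phi1 n y).
Proof.
have d0 := is_derive_H n y; have d1 := is_derive_H n.+1 y.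
have := is_deriveB (is_deriveM (is_derive_cst (n%:R : R) y 1) d0)
   (is_deriveM (is_derive_id y 1) d1).
move=> h; apply: (is_derive_eq h); rewrite /GRing.scale /= /Phi1.
have -> : y * (- 2%:R^-1 * H n.+2 y) = - 2%:R^-1 * (y * H n.+2 y) by ring.
have -> : y * H n.+2 y = (2 * n + 3)%:R * H n.+1 y - H n y.
  by apply/eqP; rewrite -subr_eq0 -(H_rec n y); apply/eqP; ring.
by rewrite natrD natrM -nat1r; field.
Qed.

Lemma is_derive_Phi1 (R : realType) n (y : R) : is_derive y 1 (Phi1 n) (Phi2 n y).
Proof.
have d0 := is_derive_H n y; have d1 := is_derive_H n.+1 y.
have := is_deriveM (is_derive_cst (2%:R^-1 : R) y 1)
  (is_deriveB (is_deriveM (is_derive_cst (n.+1%:R : R) y 1) d1) d0).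
move=> h; apply: (is_derive_eq h); rewrite /GRing.scale /= /Phi2.
by field.
Qed.

(** * Accumulation and finiteness of zeros *)

Lemma derivable_cont (R : realType) (f f1 : R -> R) :
  (forall y : R, is_derive y 1 f (f1 y)) -> continuous f.
Proof.
move=> df y; apply: differentiable_continuous; apply/derivable1_diffP.
by case: (df y).
Qed.

(** Rolle's theorem puts a zero of the derivative between consecutive zeros. The conclusion about
    [f1] has the form of the hypotheses about [f], so the lemma can be iterated. *)
Lemma accumulating_zeros (R : realType) (f f1 : R -> R) (z : nat -> R) (L : R) :
  (forall y : R, is_derive y 1 f (f1 y)) -> (forall m, z m < z m.+1) ->
  z @ \oo --> L -> (forall m, f (z m) = 0) ->
  f L = 0 /\ exists z', [/\ forall m, z' m < z' m.+1, z' @ \oo --> L & forall m, f1 (z' m) = 0].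
Proof.
move=> df zlt zL fz; have cf := derivable_cont df; split.
  have h : f (z m) @[m --> \oo] --> f L by apply: continuous_cvg => //; exact: cf.
  have E : (fun m => f (z m)) = (fun=> 0) by apply/funext.
  by rewrite E in h; exact: (cvg_unique (@Rhausdorff R) h (cvg_cst 0)).
have rolle m : exists c, z m < c < z m.+1 /\ f1 c = 0.
  have dfx x : x \in `]z m, z m.+1[ -> derivable f x 1 by move=> _; case: (df x).
  have ff : f (z m) = f (z m.+1) by rewrite !fz.
  have [c cI cd] := Rolle (zlt m) dfx (continuous_subspaceT cf) ff.
  exists c; split; first by move: cI; rewrite in_itv.
  by case: cd => _ <-; case: (df c).
have [z' hz'] := choice rolle; exists z'; split.
- move=> m; have [/andP[_ h1] _] := hz' m; have [/andP[h2 _] _] := hz' m.+1.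
  exact: lt_trans h1 h2.
- apply: (squeeze_cvgr (f := z) (h := fun m => z m.+1)) => //.
    by apply: nearW => m; have [/andP[h1 h2] _] := hz' m; rewrite !ltW.
  by rewrite (cvg_shiftS z).
- by move=> m; have [_] := hz' m.
Qed.

Lemma increasing_bounded_cvg (R : realType) (z : nat -> R) (Y : R) :
  (forall m, z m < z m.+1) -> (forall m, z m <= Y) ->
  exists2 L, z @ \oo --> L & z 0 <= L.
Proof.
move=> zlt zY.
have nd : nondecreasing_seq z by apply/nondecreasing_seqP => m; exact: ltW.
have ub : has_ubound (range z) by exists Y => _ [m _ <-].
have cv := nondecreasing_cvgn nd ub; exists (sup (range z)) => //.
by apply: ub_le_sup => //; exists 0.
Qed.

(** At an accumulation point [L] the functions [Phi n], [Phi1 n] and [Phi2 n] all vanish. The first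
    two alone allow L = n (n + 1); the third, with [H_rec], asks for L = (n + 1)(n + 2). So
    [H n.+1 L = 0], and then [H n L = 0], against [H_not_both0]. *)
Lemma Phi_zeros_bounded (R : realType) n (z : nat -> R) (Y : R) :
  (forall m, z m < z m.+1) -> 0 < z 0 -> (forall m, Phi n (z m) = 0) ->
  ~ (forall m, z m <= Y).
Proof.
move=> zlt z0 fz zY; have [L zL L0] := increasing_bounded_cvg zlt zY.
have [e0 [z1 [z1lt z1L fz1]]] := accumulating_zeros (is_derive_Phi n) zlt zL fz.
have [e1 [z2 [z2lt z2L fz2]]] := accumulating_zeros (is_derive_Phi1 n) z1lt z1L fz1.
have e2 : Phi2 n L = 0.
  have c2 : continuous (@Phi2 R n).
    move=> y; apply: cvgM; first exact: cvg_cst.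
    apply: cvgB; first exact: H_continuous.
    by apply: cvgM; [exact: cvg_cst | exact: H_continuous].
  have h : Phi2 n (z2 m) @[m --> \oo] --> Phi2 n L by apply: continuous_cvg => //; exact: c2.
  have E : (fun m => Phi2 n (z2 m)) = (fun=> 0) by apply/funext.
  by rewrite E in h; exact: (cvg_unique (@Rhausdorff R) h (cvg_cst 0)).
have Lpos : 0 < L by exact: lt_le_trans L0.
have hr := H_rec n L; move: e0 e1 e2 hr; rewrite /Phi /Phi1 /Phi2.
have -> : (2 * n + 3)%:R = 2%:R * n%:R + 3%:R :> R by rewrite natrD natrM.
have -> : n.+1%:R = 1 + n%:R :> R by rewrite nat1r.
case: (pselect (H n.+1 L = 0)) => [h1|h1].
  move=> _ e1 _ _; apply: (H_not_both0 Lpos _ h1).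
  by move: e1; rewrite h1 => e1; lra.
move: (H n L) (H n.+1 L) (H n.+2 L) h1 (n%:R : R) (ler0n R n) => a b c h1 N N0 e0 e1 e2 hr.
have a1 : a = (1 + N) * b by lra.
have b1 : b = (1 + N) * c by lra.
have k1 : (N * (1 + N) - L) * b = 0 by rewrite mulrBl -mulrA -a1.
have k2 : (L - (1 + N) * (2%:R + N)) * b = 0.
  have : (1 + N) * (L * c - (2%:R * N + 3%:R) * b + a) = 0 by rewrite hr mulr0.
  have -> : (1 + N) * (L * c - (2%:R * N + 3%:R) * b + a) =
     L * ((1 + N) * c) - (1 + N) * (2%:R * N + 3%:R) * b + (1 + N) * a by ring.
  by rewrite -b1 a1 => h; rewrite -[RHS]h; ring.
have : 2%:R * (1 + N) * b = 0.
  have -> : 2%:R * (1 + N) * b = - ((N * (1 + N) - L) * b + (L - (1 + N) * (2%:R + N)) * b) by ring.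
  by rewrite k1 k2 addr0 oppr0.
move/eqP; rewrite !mulf_eq0 pnatr_eq0/= => /orP[/eqP h|/eqP//]; lra.
Qed.

Lemma H_zeros_bounded (R : realType) n (z : nat -> R) (Y : R) :
  (forall m, z m < z m.+1) -> 0 < z 0 -> (forall m, H n (z m) = 0) ->
  ~ (forall m, z m <= Y).
Proof.
move=> zlt z0 fz zY; have [L zL L0] := increasing_bounded_cvg zlt zY.
have [e0 [z1 [z1lt z1L fz1]]] := accumulating_zeros (is_derive_H n) zlt zL fz.
have c1 : continuous (fun y : R => - (2%:R^-1) * H n.+1 y).
  by move=> y; apply: cvgM; [exact: cvg_cst | exact: H_continuous].
have h : - (2%:R^-1) * H n.+1 (z1 m) @[m --> \oo] --> - (2%:R^-1) * H n.+1 L.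
  have h2 : H n.+1 (z1 m) @[m --> \oo] --> H n.+1 L.
    by apply: continuous_cvg => //; exact: H_continuous.
  by apply: cvgM => //; exact: cvg_cst.
have E : (fun m => - (2%:R^-1) * H n.+1 (z1 m)) = (fun=> 0) by apply/funext.
rewrite E in h; have e1 : 0 = - 2%:R^-1 * H n.+1 L.
  exact: (cvg_unique (@Rhausdorff R) (cvg_cst 0) h).
have Lpos : 0 < L by exact: lt_le_trans L0.
by apply: (H_not_both0 Lpos e0); lra.
Qed.

(** On this range [n * H n y] is at least 3/2 [H n 0] as soon as [n] is at least 3, while
    [y * H n.+1 y] is at most (2 n + 3) [H n.+1 0], which is [H n 0]. *)
Lemma Phi_gt0 (R : realType) n (y : R) : (3 <= n)%N -> 0 <= y <= (2 * n + 3)%:R ->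
  0 < Phi n y.
Proof.
move=> n3 hy; have h1 := H_ge hy; case/andP: hy => y0 yn.
have h2 := norm_H_le n.+1 y0.
have h3 : y * H n.+1 y <= H n 0.
  rewrite -(H_at0S R n) mulrC; apply: le_trans (_ : `|H n.+1 y| * y <= _).
    by rewrite ler_wpM2r// ler_norm.
  by apply: ler_pM.
have h0 := H_at0_gt0 R n.
have h4 : 3%:R * H n y <= n%:R * H n y.
  by rewrite ler_wpM2r ?ler_nat//; apply: le_trans h1; rewrite divr_ge0// ltW.
rewrite /Phi; move: h1 h3 h4 h0; move: (H n 0) (H n y) (y * _) (n%:R * _) => a b c d; lra.
Qed.

Lemma psi_iter (R : realType) n (z : R) : 0 < z ->
  iter n (fun (h : R -> R) w => derive1 h w / w) (fun w => sin w / w) z =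
  (- 1) ^+ n * H n (z ^+ 2).
Proof.
elim: n z => [|n IH] z z0.
  by rewrite /= sin_H expr0 mul1r mulrC mulKf// gt_eqF.
rewrite iterS derive1E.
have d1 : is_derive z 1 (fun z : R => z ^+ 2) (2%:R * z).
  have -> : (fun z : R => z ^+ 2) = id * id by apply/funext => w; rewrite expr2.
  apply: (is_derive_eq (is_deriveM (is_derive_id z 1) (is_derive_id z 1))).
  by rewrite /GRing.scale /= !mulr1 mulr2n mulrDl mul1r.
have d2 := @is_derive1_comp R (@H R n) (fun z : R => z ^+ 2) z _ _ (is_derive_H n _) d1.
have [_ d3] := is_deriveM (is_derive_cst ((- 1) ^+ n : R) z 1) d2.
rewrite -(@near_eq_derive _ _ _ (cst ((- 1) ^+ n) * (@H R n \o (fun z : R => z ^+ 2)))) ?d3.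
  have z0' : z != 0 by rewrite gt_eqF.
  transitivity ((- 1) ^+ n * (- 2^-1 * H n.+1 (z ^+ 2) * (2 * z)) / z).
    by rewrite /GRing.scale /cst /= mulr0 addr0.
  by rewrite (exprS (- 1)); move: (H n.+1 _) ((- 1) ^+ n) => a b; field.
near=> w; rewrite IH//; near: w; exact: lt_nbhsr.
Unshelve. all: by end_near.
Qed.

Lemma psiE (R : realType) n (z : R) : 0 < z -> psi n z = z ^+ n * H n (z ^+ 2).
Proof.
move=> z0; rewrite /psi psi_iter// mulrA -exprMn; congr (_ ^+ n * _); ring.
Qed.

Lemma fctX (R : realType) n (z : R) : ((id : R -> R) ^+ n) z = z ^+ n.
Proof. by elim: n => [|n IH]; rewrite ?expr0// !exprS -IH. Qed.

Lemma dpsiE (R : realType) n (z : R) : 0 < z ->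
  z * derive1 (@psi R n) z = z ^+ n * Phi n (z ^+ 2).
Proof.
move=> z0.
have d1 : is_derive z 1 (fun z : R => z ^+ 2) (2%:R * z).
  have -> : (fun z : R => z ^+ 2) = id * id by apply/funext => w; rewrite expr2.
  apply: (is_derive_eq (is_deriveM (is_derive_id z 1) (is_derive_id z 1))).
  by rewrite /GRing.scale /= !mulr1 mulr2n mulrDl mul1r.
have d2 := @is_derive1_comp R (@H R n) (fun z : R => z ^+ 2) z _ _ (is_derive_H n _) d1.
have [_ d3] := is_deriveM (is_deriveX n (is_derive_id z 1)) d2.
rewrite derive1E -(@near_eq_derive _ _ _ (id ^+ n * (@H R n \o (fun z : R => z ^+ 2)))) ?d3.
  rewrite /GRing.scale /= /Phi; case: n {d2 d3} => [|n] /=.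
    by rewrite !expr0 !mul0r !mul1r; field.
  rewrite !fctX.
  by rewrite !exprS; field.
near=> w; rewrite psiE; last by near: w; exact: lt_nbhsr.
by rewrite -[w ^+ n]fctX.
Unshelve. all: by end_near.
Qed.

Lemma dpsi_zero (R : realType) n (z : R) : 0 < z ->
  derive1 (@psi R n) z = 0 <-> Phi n (z ^+ 2) = 0.
Proof.
move=> z0; have h := dpsiE n z0; have zn : z ^+ n != 0 by rewrite expf_neq0// gt_eqF.
split=> e; move: h; rewrite e mulr0 => /esym/eqP.
  by rewrite mulf_eq0 (negPf zn) => /eqP.
by rewrite eq_sym mulf_eq0 gt_eqF//= => /eqP.
Qed.

Lemma psi_zero (R : realType) n (z : R) : 0 < z ->
  @psi R n z = 0 <-> H n (z ^+ 2) = 0.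
Proof.
move=> z0; rewrite psiE//; have zn : z ^+ n != 0 by rewrite expf_neq0// gt_eqF.
by split=> [/eqP|->]; rewrite ?mulr0// mulf_eq0 (negPf zn) => /eqP.
Qed.

Section zeros.
Variables (R : realType) (f : nat -> R -> R) (F : nat -> R -> R) (a : nat -> nat -> R).
Hypothesis fF : forall n (z : R), 0 < z -> f n z = 0 <-> F n (z ^+ 2) = 0.
Hypothesis aP : forall n, pos_zeros (f n) (a n).
Hypothesis Fbd : forall n (z : nat -> R) Y, (forall m, z m < z m.+1) -> 0 < z 0 ->
  (forall m, F n (z m) = 0) -> ~ (forall m, z m <= Y).
Hypothesis Fgt0 : forall n (y : R), (3 <= n)%N -> 0 <= y <= (2 * n + 3)%:R -> 0 < F n y.

Lemma zero_pos n m : 0 < a n m.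
Proof. by case: (aP n) => _ /(_ (a n m))[_ h]; case: h; first by exists m. Qed.

Lemma zero_F n m : F n (a n m ^+ 2) = 0.
Proof.
apply/fF; first exact: zero_pos.
by case: (aP n) => _ /(_ (a n m))[_ h]; case: h; first by exists m.
Qed.

Lemma zero_inj n : injective (a n).
Proof.
case: (aP n) => h _ m m' e; case: (ltngtP m m') => // /h; by rewrite e ltxx.
Qed.

Lemma zeros_unbounded n Y : exists m, Y < a n m.
Proof.
apply: contrapT => hY.
have le m : a n m <= Y by rewrite leNgt; apply/negP => h; apply: hY; exists m.
apply: (@Fbd n (fun m => a n m ^+ 2) (Y ^+ 2)) => [m||m|m].
- by rewrite ltr_sqr ?nnegrE ?ltW ?zero_pos//; apply: (aP n).1.
- by rewrite exprn_gt0 ?zero_pos.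
- exact: zero_F.
- by rewrite ler_sqr ?nnegrE ?(le_trans _ (le m)) ?le// ltW ?zero_pos.
Qed.

(** Positivity of [F n] up to 2 n + 3 leaves finitely many [n], and for each of them the zeros are
    unbounded, so only finitely many lie below [Y]. *)
Lemma zeros_le_finite Y : exists N, forall n m, a n m <= Y -> (n < N)%N && (m < N)%N.
Proof.
have [g hg] := choice (zeros_unbounded^~ Y).
(* The bound on the first index exceeds Y^2 and is at least 3, the threshold in the positivity
   hypothesis. *)
pose t := (Num.truncn (Y ^+ 2)).+3; have tY : Y ^+ 2 < t%:R.
  by apply: lt_le_trans (truncnS_gt (Y ^+ 2)) _; rewrite ler_nat /t !ltnS ltnW.
have t3 : (3 <= t)%N by []. 
clearbody t; exists (t + \max_(i < t) g i).+1 => n m le.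
have Y0 : 0 <= Y by apply: le_trans le; rewrite ltW ?zero_pos.
have nt : (n < t)%N.
  rewrite ltnNge; apply/negP => tn.
  have : 0 < F n (a n m ^+ 2).
    apply: Fgt0; first exact: leq_trans tn.
    rewrite sqr_ge0/=; apply: le_trans (_ : Y ^+ 2 <= _).
      by rewrite ler_sqr ?nnegrE// ltW ?zero_pos.
    by apply: le_trans (ltW tY) _; rewrite ler_nat; lia.
  by rewrite zero_F ltxx.
have hm : (m < g n)%N.
  rewrite ltnNge; apply/negP; rewrite leq_eqVlt => /orP[/eqP e|].
    by have := hg n; rewrite e ltNge le.
  by move/(aP n).1/(lt_trans (hg n)); rewrite ltNge le.
have := @leq_bigmax _ (fun i : 'I_t => g i) (Ordinal nt) => /= hb.
by apply/andP; split; lia.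
Qed.
End zeros.

(** * Transcendence of the zeros *)

Definition iC (R : realType) : R[i] := 0 +i* 1.

Lemma Re_mul (R : realType) (x y : R[i]) :
  complex.Re (x * y) = complex.Re x * complex.Re y - complex.Im x * complex.Im y.
Proof. by case: x => a b; case: y. Qed.

Lemma Im_mul (R : realType) (x y : R[i]) :
  complex.Im (x * y) = complex.Re x * complex.Im y + complex.Im x * complex.Re y.
Proof. by case: x => a b; case: y. Qed.

Lemma Re_add (R : realType) (x y : R[i]) : complex.Re (x + y) = complex.Re x + complex.Re y.
Proof. by case: x => a b; case: y. Qed.

Lemma Im_add (R : realType) (x y : R[i]) : complex.Im (x + y) = complex.Im x + complex.Im y.
Proof. by case: x => a b; case: y. Qed.

Lemma complex_ext (R : realType) (x y : R[i]) :
  complex.Re x = complex.Re y -> complex.Im x = complex.Im y -> x = y.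
Proof. by case: x => a b; case: y => c d /= -> ->. Qed.

Definition cder (R : realType) (f f' : R -> R[i]) : Prop := forall s : R,
  is_derive s 1 (fun s => complex.Re (f s)) (complex.Re (f' s)) /\
  is_derive s 1 (fun s => complex.Im (f s)) (complex.Im (f' s)).

Lemma cder_ext (R : realType) (f g f' g' : R -> R[i]) :
  (forall s, f s = g s) -> (forall s, f' s = g' s) -> cder f f' -> cder g g'.
Proof. by move=> /funext-> /funext->. Qed.

Lemma cderC (R : realType) (c : R[i]) : cder (fun=> c) (fun=> 0).
Proof. by move=> s; split; exact: is_derive_cst. Qed.

Lemma cderD (R : realType) (f g f' g' : R -> R[i]) : cder f f' -> cder g g' ->
  cder (fun s => f s + g s) (fun s => f' s + g' s).
Proof.
move=> df dg s; have [f1 f2] := df s; have [g1 g2] := dg s.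
split; [have h := is_deriveD f1 g1 | have h := is_deriveD f2 g2].
  have -> : (fun s => complex.Re (f s + g s)) =
    (fun s => complex.Re (f s)) + (fun s => complex.Re (g s)).
    by apply/funext => t; rewrite Re_add.
  by rewrite Re_add.
have -> : (fun s => complex.Im (f s + g s)) =
  (fun s => complex.Im (f s)) + (fun s => complex.Im (g s)).
  by apply/funext => t; rewrite Im_add.
by rewrite Im_add.
Qed.

Lemma cderM (R : realType) (f g f' g' : R -> R[i]) : cder f f' -> cder g g' ->
  cder (fun s => f s * g s) (fun s => f' s * g s + f s * g' s).
Proof.
move=> df dg s; have [f1 f2] := df s; have [g1 g2] := dg s.
split.
  have h := is_deriveB (is_deriveM f1 g1) (is_deriveM f2 g2).
  have -> : (fun s => complex.Re (f s * g s)) =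
    (fun s => complex.Re (f s)) * (fun s => complex.Re (g s)) -
    (fun s => complex.Im (f s)) * (fun s => complex.Im (g s)).
    by apply/funext => t; rewrite Re_mul.
  by apply: (is_derive_eq h); rewrite /GRing.scale /= Re_add !Re_mul; ring.
have h := is_deriveD (is_deriveM f1 g2) (is_deriveM f2 g1).
have -> : (fun s => complex.Im (f s * g s)) =
  (fun s => complex.Re (f s)) * (fun s => complex.Im (g s)) +
  (fun s => complex.Im (f s)) * (fun s => complex.Re (g s)).
  by apply/funext => t; rewrite Im_mul.
by apply: (is_derive_eq h); rewrite /GRing.scale /= Im_add !Im_mul; ring.
Qed.

Lemma cderZ (R : realType) (c : R[i]) (f f' : R -> R[i]) : cder f f' ->
  cder (fun s => c * f s) (fun s => c * f' s).
Proof.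
move=> df; apply: cder_ext (cderM (cderC c) df) => s //.
by rewrite mul0r add0r.
Qed.

Lemma cder_sum (R : realType) (I : Type) (l : seq I) (f f' : I -> R -> R[i]) :
  (forall i, cder (f i) (f' i)) ->
  cder (fun s => \sum_(i <- l) f i s) (fun s => \sum_(i <- l) f' i s).
Proof.
move=> df; elim: l => [|i l IH].
  by apply: cder_ext (cderC 0) => s; rewrite big_nil.
by apply: cder_ext (cderD (df i) IH) => s; rewrite big_cons.
Qed.

Lemma cder0_const (R : realType) (f : R -> R[i]) : cder f (fun=> 0) -> forall s, f s = f 0.
Proof.
move=> df s; apply: complex_ext.
  by apply: (@is_derive_0_is_cst R (fun s => complex.Re (f s))) => t; case: (df t).
by apply: (@is_derive_0_is_cst R (fun s => complex.Im (f s))) => t; case: (df t).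
Qed.

Definition cexp (R : realType) (k s : R) : R[i] := cos (k * s) +i* sin (k * s).

Lemma cexp0 (R : realType) (k : R) : cexp k 0 = 1.
Proof. by rewrite /cexp mulr0 cos0 sin0. Qed.

Lemma cexpD (R : realType) (k l s : R) : cexp k s * cexp l s = cexp (k + l) s.
Proof. by apply: complex_ext; rewrite ?Re_mul ?Im_mul /= mulrDl ?cosD ?sinD//; ring. Qed.

Lemma cexpNK (R : realType) (k s : R) : cexp k s * cexp (- k) s = 1.
Proof. by rewrite cexpD subrr /cexp mul0r cos0 sin0. Qed.

Lemma cexp_nat (R : realType) n (s : R) : cexp n%:R s = cexp 1 s ^+ n.
Proof.
elim: n => [|n IH]; first by rewrite /cexp mul0r cos0 sin0.
by rewrite exprS -IH cexpD nat1r.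
Qed.

Lemma cder_cexp (R : realType) (k : R) :
  cder (cexp k) (fun s => (0 +i* k) * cexp k s).
Proof.
move=> s; have dk : is_derive s 1 (fun s : R => k * s) k.
  apply: (is_derive_eq (is_deriveZ k (is_derive_id s 1))).
  by rewrite /GRing.scale /= mulr1.
split.
  have h := @is_derive1_comp R cos (fun s => k * s) s _ _ (is_derive_cos _) dk.
  by apply: (is_derive_eq h); rewrite Re_mul /=; ring.
have h := @is_derive1_comp R sin (fun s => k * s) s _ _ (is_derive_sin _) dk.
by apply: (is_derive_eq h); rewrite Im_mul /=; ring.
Qed.

Definition mono (R : realType) (i : nat) (s : R) : R[i] := (0 +i* s) ^+ i / i`!%:R.

Lemma mono0 (R : realType) (s : R) : mono 0 s = 1.
Proof. by rewrite /mono expr0 fact0 divr1. Qed.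

Lemma monoS (R : realType) i (s : R) :
  mono i.+1 s = i.+1%:R^-1 * ((0 +i* s) * mono i s).
Proof. by rewrite /mono factS natrM invfM exprS; ring. Qed.

Lemma cder_mono (R : realType) i : cder (@mono R i.+1) (fun s => iC R * mono i s).
Proof.
have d1 : cder (fun s : R => 0 +i* s) (fun=> iC R).
  by move=> s; split; [exact: is_derive_cst | exact: is_derive_id].
elim: i => [|i IH].
  by apply: cder_ext d1 => s; rewrite ?monoS mono0 ?invr1 ?mul1r mulr1.
apply: cder_ext (cderZ (i.+2%:R^-1) (cderM d1 IH)) => s; first by rewrite (monoS i.+1).
rewrite (monoS i).
have i1 : 1 + i%:R != 0 :> R[i] by rewrite nat1r pnatr_eq0.
have i2 : 2 + i%:R != 0 :> R[i] by rewrite -natrD pnatr_eq0.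
have -> : i.+2%:R = 2 + i%:R :> R[i] by rewrite -natrD.
have -> : i.+1%:R = 1 + i%:R :> R[i] by rewrite nat1r.
by field; rewrite ?i1 ?i2.
Qed.

(** The identities between the forms below are proved by checking that the difference of both sides
    satisfies this equation with initial value 0. *)
Lemma ode_unique (R : realType) (k : R) (y : R -> R[i]) :
  cder y (fun s => iC R * (k%:C * y s)) -> y 0 = 0 -> forall s, y s = 0.
Proof.
move=> dy y0 s.
have d := cderM dy (@cder_cexp R (- k)).
have d0 : cder (fun s => y s * cexp (- k) s) (fun=> 0).
  apply: cder_ext d => t //.
  have -> : 0 +i* - k = - (iC R * k%:C) by apply: complex_ext; rewrite /=; ring.
  ring.
have := cder0_const d0 s; rewrite y0 mul0r => e.
by rewrite -[y s]mulr1 -(cexpNK (- k) s) mulrA e mul0r.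
Qed.

Definition cbound (R : realType) (f : R -> R[i]) (M : R) (p : nat) : Prop :=
  forall t, 0 <= t -> `|complex.Re (f t)| <= M * t ^+ p /\ `|complex.Im (f t)| <= M * t ^+ p.

Lemma integral_pow_le (R : realType) (h h' : R -> R) (M : R) p :
  (forall t : R, is_derive t 1 h (h' t)) -> h 0 = 0 ->
  (forall t, 0 <= t -> `|h' t| <= M * t ^+ p) ->
  forall t, 0 <= t -> `|h t| <= M / p.+1%:R * t ^+ p.+1.
Proof.
have main (g g' : R -> R) : (forall t : R, is_derive t 1 g (g' t)) -> g 0 = 0 ->
  (forall t, 0 <= t -> g' t <= M * t ^+ p) ->
  forall t, 0 <= t -> g t <= M / p.+1%:R * t ^+ p.+1.
  move=> dg g0 gle t; rewrite le_eqVlt => /orP[/eqP <-|t0].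
    by rewrite g0 exprS mul0r mulr0.
  pose u (s : R) := M / p.+1%:R * s ^+ p.+1 - g s.
  have p1 : p.+1%:R != 0 :> R by rewrite pnatr_eq0.
  have du (s : R) : is_derive s 1 u (M * s ^+ p - g' s).
    have k := is_deriveB (is_deriveZ (M / p.+1%:R) (is_deriveX p.+1 (is_derive_id s 1))) (dg s).
    have -> : u = (M / p.+1%:R) *: (id ^+ p.+1) - g.
      apply/funext => w; rewrite /u; congr (_ - _).
      by rewrite -(fctX p.+1 w).
    apply: (is_derive_eq k); rewrite /GRing.scale /= mulr1; field.
    by rewrite nat1r.
  have cu : {within `[0, t], continuous u}.
    by apply: continuous_subspaceT; apply: (@derivable_cont R u (fun s => M * s ^+ p - g' s)).
  have [c] := MVT t0 (fun x _ => du x) cu.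
  rewrite in_itv/= => /andP[c0 _].
  have -> : u 0 = 0 by rewrite /u g0 exprS mul0r mulr0 subr0.
  rewrite !subr0 /u => e.
  by rewrite -subr_ge0 e; apply: mulr_ge0; rewrite ?(ltW t0)// subr_ge0 gle// ltW.
move=> dh h0 hle t t0; rewrite ler_norml; apply/andP; split.
  rewrite lerNl; apply: (@main (fun t => - h t) (fun t => - h' t) _ _ _ t t0).
  - by rewrite h0 oppr0.
  - by move=> s s0; apply: le_trans (ler_norm _) _; rewrite normrN hle.
by apply: (main h h') => // s s0; apply: le_trans (ler_norm _) _; exact: hle.
Qed.

Lemma cbound_mul_cexp (R : realType) (f : R -> R[i]) (k M : R) p : 0 <= M -> cbound f M p ->
  cbound (fun s => f s * cexp k s) (2%:R * M) p.
Proof.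
move=> M0 hf t t0; have [h1 h2] := hf t t0.
have hM : 0 <= M * t ^+ p by rewrite mulr_ge0// exprn_ge0.
have c1 : `|cos (k * t)| <= 1 by rewrite ler_norml cos_geN1 cos_le1.
have s1 : `|sin (k * t)| <= 1 by rewrite ler_norml sin_geN1 sin_le1.
have aux (a b c d : R) : `|a| <= M * t ^+ p -> `|b| <= M * t ^+ p -> `|c| <= 1 -> `|d| <= 1 ->
    `|a * c + b * d| <= 2%:R * M * t ^+ p.
  move=> ha hb hc hd; apply: le_trans (ler_normD _ _) _; rewrite !normrM.
  have := ler_pM (normr_ge0 a) (normr_ge0 c) ha hc.
  have := ler_pM (normr_ge0 b) (normr_ge0 d) hb hd.
  by rewrite !mulr1 => k1 k2; rewrite -mulrA mulr_natl mulr2n; apply: lerD.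
rewrite Re_mul Im_mul /=; split; last by apply: aux.
by rewrite -mulrN; apply: aux => //; rewrite normrN.
Qed.

(** Variation of constants with the factor exp(-i k s). Bounds are kept for real and imaginary part
    separately, so multiplying by this factor and by its inverse costs 2 each time, hence the 4. *)
Lemma cbound_ode (R : realType) (k : R) (y F : R -> R[i]) (M : R) p : 0 <= M ->
  cder y (fun s => iC R * (k%:C * y s + F s)) -> y 0 = 0 -> cbound F M p ->
  cbound y (4%:R * M / p.+1%:R) p.+1.
Proof.
move=> M0 dy y0 hF.
pose g s := y s * cexp (- k) s.
have dg : cder g (fun s => iC R * (F s * cexp (- k) s)).
  apply: cder_ext (cderM dy (@cder_cexp R (- k))) => t //.
  have -> : 0 +i* - k = - (iC R * k%:C) by apply: complex_ext; rewrite /=; ring.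
  ring.
have g0 : g 0 = 0 by rewrite /g y0 mul0r.
have hG := cbound_mul_cexp (- k) M0 hF.
have bg : cbound g (2%:R * M / p.+1%:R) p.+1.
  move=> t t0; split.
  - apply: (@integral_pow_le R (fun t => complex.Re (g t)) (fun t => complex.Re (iC R * (F t * cexp (- k) t)))) => //.
    + by move=> s; case: (dg s).
    + by rewrite g0.
    + move=> s s0; have [_ h] := hG s s0.
      by rewrite Re_mul /= mul0r sub0r mul1r normrN.
  - apply: (@integral_pow_le R (fun t => complex.Im (g t)) (fun t => complex.Im (iC R * (F t * cexp (- k) t)))) => //.
    + by move=> s; case: (dg s).
    + by rewrite g0.
    + move=> s s0; have [h _] := hG s s0.
      by rewrite Im_mul /= mul0r add0r mul1r.
have -> : y = (fun s => g s * cexp k s).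
  apply/funext => s; rewrite /g -mulrA [X in _ * X]mulrC cexpNK mulr1//.
have -> : 4%:R * M / p.+1%:R = 2%:R * (2%:R * M / p.+1%:R) by ring.
by apply: cbound_mul_cexp => //; rewrite divr_ge0// mulr_ge0.
Qed.

(** * Hermite-Pade approximants of the exponential function *)

Section forms.
Variables (R : realType) (m n : nat).

Definition eterm (j i : nat) (s : R) : R[i] := mono i s * cexp j%:R s.

Definition feval (f : nat -> nat -> rat) (s : R) : R[i] :=
  \sum_(j < m.+1) \sum_(i < n) ratr (f j i) * eterm j i s.

(** The equation y' = i (k y + f) between two sums [feval], read off the coefficients: the
    derivative of [eterm j i] is i times the sum of [j] times itself and the term [eterm] one index
    lower. *)
Definition oderec k (g f : nat -> nat -> rat) :=
  forall j i, (j%:R - k%:R) * g j i + g j i.+1 = f j i.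

Definition epred j i (s : R) : R[i] := if i is i'.+1 then eterm j i' s else 0.

Lemma cder_eterm j i :
  cder (eterm j i) (fun s => iC R * ((j%:R)%:C * eterm j i s + epred j i s)).
Proof.
have E (k : R) : 0 +i* k = iC R * k%:C by apply: complex_ext; rewrite /=; ring.
case: i => [|i].
  apply: cder_ext (cderM (cderC 1) (@cder_cexp R j%:R)) => s; rewrite /eterm /epred ?mono0//.
  by rewrite E; ring.
apply: cder_ext (cderM (@cder_mono R i) (@cder_cexp R j%:R)) => s; rewrite /epred /eterm//.
by rewrite E; ring.
Qed.

Lemma feval_shift (g : nat -> nat -> rat) j (s : R) : g j n = 0 ->
  \sum_(i < n) ratr (g j i) * epred j i s = \sum_(i < n) ratr (g j i.+1) * eterm j i s.
Proof.
case: n => [|n'] gn; first by rewrite !big_ord0.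
by rewrite big_ord_recl big_ord_recr /= gn rmorph0 mul0r mulr0 add0r addr0.
Qed.

Lemma feval_ode k g f : oderec k g f -> (forall j, g j n = 0) ->
  cder (feval g) (fun s => iC R * ((k%:R)%:C * feval g s + feval f s)).
Proof.
move=> gf gn.
apply: (@cder_ext R (fun s => \sum_(j < m.+1) \sum_(i < n) ratr (g j i) * eterm j i s) _
  (fun s => \sum_(j < m.+1) \sum_(i < n) ratr (g j i) *
    (iC R * ((j%:R)%:C * eterm j i s + epred j i s)))) => //; last first.
  by apply: cder_sum => j; apply: cder_sum => i; apply: cderZ; exact: cder_eterm.
move=> s; rewrite /feval mulrDr !mulr_sumr -big_split; apply: eq_bigr => j _ /=.
transitivity (iC R * (\sum_(i < n) ratr (g j i) * ((j%:R)%:C * eterm j i s) +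
   \sum_(i < n) ratr (g j i) * epred j i s)).
  by rewrite -big_split mulr_sumr; apply: eq_bigr => i _ /=; ring.
rewrite feval_shift// -big_split !mulr_sumr -big_split; apply: eq_bigr => i _ /=.
rewrite -gf rmorphD rmorphM rmorphB /= !ratr_nat !rmorph_nat; ring.
Qed.

Lemma feval_at0 g : (0 < n)%N -> feval g 0 = \sum_(j < m.+1) ratr (g j 0).
Proof.
rewrite /feval; case: n => // n' _; apply: eq_bigr => j _.
rewrite big_ord_recl big1; first by rewrite /eterm mono0 cexp0 !mulr1 addr0.
move=> i _; rewrite /eterm /= /bump /= add1n monoS.
have -> : 0 +i* 0 = 0 :> R[i] by [].
by rewrite !(mul0r, mulr0).
Qed.

(* Type I Hermite-Pade forms: [feval (cf l) s] is the sum of the residues of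
   [exp (z * (i s)) / \prod_(k <- l) (z - k)]. *)
Fixpoint bk (d : rat) (f : nat -> rat) (t i : nat) : rat :=
  if t is t'.+1 then (f i - bk d f t' i.+1) / d else 0.

Definition gk k w (f : nat -> nat -> rat) j i := bk (j%:R - k%:R) (f j) (w - i) i.

(** For [j = k] the recurrence in [oderec] reads [g k i.+1 = f k i] and leaves [g k 0] free; it is
    chosen to make the form vanish at 0. *)
Definition tk k w f j i : rat :=
  if j == k then
    (if i is i'.+1 then f k i' else - \sum_(l < m.+1 | l != k :> nat) gk k w f l 0)
  else gk k w f j i.

Fixpoint cf (l : seq nat) : nat -> nat -> rat :=
  if l is k :: r then
    (if r is [::] then fun j i => ((j == k) && (i == 0))%N%:R
     else tk k (size r) (cf r))
  else fun _ _ => 0.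

Lemma cf_cons k a r : cf [:: k, a & r] = tk k (size r).+1 (cf (a :: r)).
Proof. by []. Qed.

Lemma bk0 d f t i : (forall i', (i <= i')%N -> f i' = 0) -> bk d f t i = 0.
Proof.
elim: t i => [|t IH] i h //=; rewrite h// IH ?subr0 ?mul0r// => i' ii'.
by apply: h; exact: ltnW.
Qed.

Lemma cf_supp l j i : (count_mem j l <= i)%N -> cf l j i = 0.
Proof.
elim: l j i => [|k r IH] j i //; case: r IH => [_|a r IH].
  by rewrite /= eq_sym; case: eqP => // _; case: i.
rewrite cf_cons /tk [count_mem _ _]/= (eq_sym k).
case: eqP => [->|_] hi.
  by case: i hi => // i hi; apply: IH.
by apply: bk0 => i' ii'; apply: IH; exact: leq_trans ii'.
Qed.

Lemma cf_size l j i : (size l <= i)%N -> cf l j i = 0.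
Proof. by move=> h; apply: cf_supp; exact: leq_trans (count_size _ _) h. Qed.

Lemma natr_sub_neq0 (j k : nat) : j != k -> j%:R - k%:R != 0 :> rat.
Proof. by move=> jk; rewrite subr_eq0 eqr_nat. Qed.

Lemma cf_rec k r : oderec k (cf (k :: r)) (cf r).
Proof.
move=> j i; case: r => [|a r].
  by rewrite /= andbF addr0; case: eqP => [->|]; rewrite ?subrr ?mul0r ?mulr0.
rewrite cf_cons /tk; case: eqP => [->|/eqP jk]; first by rewrite subrr mul0r add0r.
have d0 := natr_sub_neq0 jk; rewrite /gk.
case: (ltnP i (size r).+1) => hi.
  by rewrite -(@prednK ((size r).+1 - i)) ?subn_gt0// -subnS /= mulrC divfK// subrK.
have E t i' : (i <= i')%N -> bk (j%:R - k%:R) (cf (a :: r) j) t i' = 0.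
  by move=> h; apply: bk0 => i'' h2; apply: cf_size; rewrite (leq_trans hi)// (leq_trans h).
by rewrite !E// mulr0 addr0 cf_size.
Qed.

Definition hform l := feval (cf l).

Lemma form_nil s : hform [::] s = 0.
Proof.
rewrite /hform /feval; apply: big1 => j _; apply: big1 => i _.
by rewrite rmorph0 mul0r.
Qed.

Lemma form_ode k r : (size r < n)%N ->
  cder (hform (k :: r)) (fun s => iC R * ((k%:R)%:C * hform (k :: r) s + hform r s)).
Proof.
by move=> h; apply: feval_ode; [exact: cf_rec | move=> j; exact: cf_size].
Qed.

Lemma form1_at0 k : (0 < n)%N -> (k <= m)%N -> hform [:: k] 0 = 1.
Proof.
move=> n0 km; rewrite /hform feval_at0// (bigD1 (Ordinal (km : (k < m.+1)%N)))//= eqxx rmorph1.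
rewrite big1 ?addr0// => j jk /=; case: eqP; last by rewrite rmorph0.
by move=> e; case/eqP: jk; apply: val_inj.
Qed.

Lemma form2_at0 k a r : (0 < n)%N -> (k <= m)%N -> hform [:: k, a & r] 0 = 0.
Proof.
move=> n0 km; rewrite /hform feval_at0// cf_cons (bigD1 (Ordinal (km : (k < m.+1)%N)))//=.
rewrite /tk eqxx rmorphN rmorph_sum /=; apply/eqP; rewrite addrC subr_eq0; apply/eqP.
apply: eq_big => [j|j jk]; first by rewrite -val_eqE.
by rewrite -val_eqE /= in jk; rewrite (negPf jk).
Qed.

Lemma form1 k s : (0 < n)%N -> (k <= m)%N -> hform [:: k] s = cexp k%:R s.
Proof.
move=> n0 km; apply/eqP; rewrite -subr_eq0; apply/eqP.
have E (a : R) : 0 +i* a = iC R * a%:C by apply: complex_ext; rewrite /=; ring.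
apply: (@ode_unique R k%:R (fun s => hform [:: k] s - cexp k%:R s)).
  apply: cder_ext (cderD (@form_ode k [::] n0) (cderZ (-1) (@cder_cexp R k%:R))) => t.
    by rewrite mulN1r.
  by rewrite form_nil E; ring.
by rewrite form1_at0// cexp0 subrr.
Qed.

(** In terms of residues this is 1/(z - j) - 1/(z - l) = (j - l) / ((z - j)(z - l)). *)
Lemma form_sub j l r s : (j <= m)%N -> (l <= m)%N -> (size r + 2 <= n)%N ->
  hform (j :: r) s - hform (l :: r) s = ((j%:R - l%:R : R)%:C) * hform [:: j, l & r] s.
Proof.
move=> jm lm hn; apply/eqP; rewrite -subr_eq0; apply/eqP.
have h1 : (size r < n)%N by rewrite (leq_trans _ hn)// addn2.
have h2 : (size (l :: r) < n)%N by rewrite (leq_trans _ hn)// addn2.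
pose y s := hform (j :: r) s - hform (l :: r) s - ((j%:R - l%:R : R)%:C) * hform [:: j, l & r] s.
apply: (@ode_unique R j%:R y).
  apply: cder_ext (cderD (cderD (form_ode j h1) (cderZ (-1) (form_ode l h1)))
    (cderZ (- (j%:R - l%:R : R)%:C) (form_ode j h2))) => t.
    by rewrite /y; ring.
  by rewrite /y rmorphB; ring.
have n0 : (0 < n)%N by exact: leq_ltn_trans h1.
rewrite /y form2_at0//; case: r {hn h1 h2 y} => [|a r].
  by rewrite !form1_at0// subrr mulr0 subrr.
by rewrite !form2_at0// subrr mulr0 subrr.
Qed.

Lemma form_swap j l r s : (j <= m)%N -> (l <= m)%N -> (size r + 2 <= n)%N ->
  hform [:: j, l & r] s = hform [:: l, j & r] s.
Proof.
move=> jm lm hn; case: (eqVneq j l) => [->//|jl].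
have e1 := form_sub s jm lm hn; have e2 := form_sub s lm jm hn.
have d0 : ((j%:R - l%:R : R)%:C) != 0 :> R[i].
  by rewrite (inj_eq (@complexI R)) subr_eq0 eqr_nat.
apply: (mulfI d0); rewrite -e1 -[j%:R - _]opprB rmorphN mulNr -e2; ring.
Qed.

(** The residues of the z-derivative of exp(i s z) / prod (z - k) vanish, and differentiating the
    denominator adds one more factor z - j for each member [j] of the list. *)
Lemma form_mulx r s : all (fun k => k <= m)%N r -> (size r + 2 <= n)%N ->
  (0 +i* s) * hform r s = \sum_(j <- r) hform (j :: r) s.
Proof.
elim: r s => [|k r IH] s; first by rewrite big_nil form_nil mulr0.
move=> /andP[km hr] hn; rewrite [size _]/= in hn.
have hn' : (size r + 2 <= n)%N by exact: ltnW.
have hn1 : (size r < n)%N by rewrite (leq_trans _ hn')// addn2.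
have hn3 : (size (k :: r) < n)%N by rewrite (leq_trans _ hn)//= addn2.
pose y s := (0 +i* s) * hform (k :: r) s - \sum_(j <- k :: r) hform [:: k, j & r] s.
have y0 : y s = 0.
  have d1 : cder (fun s : R => 0 +i* s) (fun=> iC R).
    by move=> t; split; [exact: is_derive_cst | exact: is_derive_id].
  apply: (@ode_unique R k%:R y).
    have dsum : cder (fun t => \sum_(j <- k :: r) hform [:: k, j & r] t)
       (fun t => \sum_(j <- k :: r) iC R * ((k%:R)%:C * hform [:: k, j & r] t + hform (j :: r) t)).
      by apply: cder_sum => j; exact: form_ode.
    apply: cder_ext (cderD (cderM d1 (form_ode k hn1)) (cderZ (-1) dsum)) => t.
      by rewrite mulN1r.
    rewrite -mulr_sumr big_split /= -mulr_sumr.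
    rewrite [\sum_(j <- k :: r) hform (j :: r) t]big_cons -IH// /y; ring.
  rewrite /y big_cons big1_seq; last by move=> j _; rewrite form2_at0// (leq_ltn_trans _ hn1).
  have -> : 0 +i* 0 = 0 :> R[i] by [].
  by rewrite mul0r form2_at0 ?addr0 ?subrr// (leq_ltn_trans _ hn1).
move/eqP: y0; rewrite /y subr_eq0 => /eqP ->.
rewrite !big_cons; congr (_ + _); apply: eq_big_seq => j jr.
by apply: form_swap => //; move/allP: hr => /(_ j jr).
Qed.

(** If all extensions of [k :: r] by one node vanished, [form_mulx] would make the form of [k :: r]
    vanish, and then [form_sub] the forms of all [l :: r]. The descent ends at the constant form
    with the single node 0, which is 1. *)
Lemma form_nonzero r s : s != 0 -> all (fun k => k <= m)%N r -> (size r + 2 <= n)%N ->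
  exists2 j, (j <= m)%N & hform (j :: r) s != 0.
Proof.
move=> s0 hr hn; apply: contrapT => H.
have {H} : forall j, (j <= m)%N -> hform (j :: r) s = 0.
  move=> j jm; apply/eqP; apply: contrapT => /negP h; apply: H; by exists j.
elim: r hr hn => [|k r IH] /=.
  move=> _ hn /(_ 0 (leq0n _)); rewrite form1 ?(leq_trans _ hn)//.
  by rewrite /cexp mul0r cos0 => -[/eqP]; rewrite oner_eq0.
move=> /andP[km hr] hn h0.
have hn' : (size r + 2 <= n)%N by exact: ltnW.
have e : hform (k :: r) s = 0.
  have := @form_mulx (k :: r) s; rewrite /= km hr => /(_ isT hn).
  rewrite big_seq big1; last first.
    move=> j; rewrite inE => /orP[/eqP->|jr]; apply: h0 => //.
    by move/allP: hr => /(_ j jr).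
  move/eqP; rewrite mulf_eq0 => /orP[/eqP[/eqP]|/eqP//].
  by rewrite (negPf s0).
apply: IH => // l lm; have := form_sub s km lm hn'.
by rewrite e sub0r form_swap// h0// mulr0 => /eqP; rewrite oppr_eq0 => /eqP.
Qed.

(** Each additional node contributes a factor 4 t / p through [cbound_ode]; the factorial in the
    denominator is what will beat the denominators of the coefficients. *)
Lemma form_bound k r : (k <= m)%N -> all (fun k => k <= m)%N r -> (size r < n)%N ->
  cbound (hform (k :: r)) (4%:R ^+ size r / (size r)`!%:R) (size r).
Proof.
elim: r k => [|a r IH] k km /=.
  move=> _ n0 t _; rewrite form1// expr0 fact0 divr1 mulr1 /=.
  by rewrite !ler_norml cos_geN1 cos_le1 sin_geN1 sin_le1.
move=> /andP[am hr] hn; have hn' : (size r < n)%N by exact: ltnW.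
have n0 : (0 < n)%N by exact: leq_ltn_trans hn'.
have M0 : 0 <= 4%:R ^+ size r / (size r)`!%:R :> R by rewrite divr_ge0// exprn_ge0.
have := cbound_ode M0 (@form_ode k (a :: r) hn) (form2_at0 a r n0 km) (IH a am hr hn').
congr (cbound _ _ _).
by rewrite factS natrM invfM exprS; ring.
Qed.

Lemma dist_ge1 (j k : nat) : j != k -> 1 <= `|j%:R - k%:R : rat|.
Proof.
wlog jk : j k / (k < j)%N.
  move=> h jk; have := jk; rewrite neq_ltn => /orP[kj|kj]; last exact: h.
  by rewrite distrC; apply: h => //; rewrite eq_sym.
by move=> _; rewrite -natrB ?(ltnW jk)// ger0_norm// ler1n subn_gt0.
Qed.

(** Weight for the size of the coefficients. Being at least 2, it closes the backward recursion [bk]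
    with a factor 2; the free coefficient in [tk] is a sum over at most m + 1 indices and so costs 2
    (m + 1), which is [K] itself. *)
Let K : rat := (2 * m + 2)%:R.

Let K2 : 2%:R <= K. Proof. by rewrite /K ler_nat addnC leq_addr. Qed.

Let K0 : 0 < K. Proof. exact: lt_le_trans K2. Qed.

Lemma bk_le d (f : nat -> rat) (M : rat) t i : 1 <= `|d| -> 0 <= M ->
  (forall i, `|f i| * K ^+ i <= M) -> `|bk d f t i| * K ^+ i <= 2%:R * M.
Proof.
move=> d1 M0 hf; elim: t i => [|t IH] i /=; first by rewrite normr0 mul0r mulr_ge0.
rewrite normrM normfV mulrAC ler_pdivrMr; last exact: lt_le_trans d1.
apply: le_trans (_ : 2%:R * M * 1 <= _); last by rewrite ler_wpM2l ?mulr_ge0.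
rewrite mulr1; apply: le_trans (_ : (`|f i| + `|bk d f t i.+1|) * K ^+ i <= _).
  by rewrite ler_wpM2r ?exprn_ge0 ?(ltW K0)// ler_normB.
rewrite mulrDl mulr_natl mulr2n; apply: lerD => //.
have h := IH i.+1; rewrite exprS mulrCA in h.
have : 2%:R * (`|bk d f t i.+1| * K ^+ i) <= 2%:R * M.
  by apply: le_trans h; rewrite ler_wpM2r// mulr_ge0// exprn_ge0// ltW.
by rewrite ler_pM2l.
Qed.

Lemma cf_le r j i : all (fun k => k <= m)%N r -> `|cf r j i| * K ^+ i <= K ^+ size r.
Proof.
elim: r j i => [|k r IH] j i; first by rewrite /= normr0 mul0r.
have K1 : 1 <= K by apply: le_trans K2; rewrite ler1n.
case: r IH => [_ _|a r IH].
  rewrite [cf _]/= [size _]/= expr1; case: andP => [[_ /eqP->]|_].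
    by rewrite expr0 normr1 mulr1.
  by rewrite normr0 mul0r ltW.
move=> /andP[km hr]; have {}IH j' i' := IH j' i' hr; rewrite cf_cons /tk.
have M0 : 0 <= K ^+ (size r).+1 by rewrite exprn_ge0// ltW.
have hg l i' : l != k -> `|gk k (size r).+1 (cf (a :: r)) l i'| * K ^+ i' <= 2%:R * K ^+ (size r).+1.
  move=> lk; apply: bk_le => //; exact: dist_ge1.
rewrite [X in _ <= X]exprS -/(size (a :: r)).
case: eqP => [_|/eqP jk]; last by apply: le_trans (hg _ _ jk) _; rewrite ler_wpM2r.
case: i => [|i]; last by rewrite exprS mulrCA; apply: ler_wpM2l (IH _ _); exact: ltW.
rewrite expr0 mulr1 normrN.
apply: le_trans (_ : \sum_(l < m.+1) 2%:R * K ^+ (size r).+1 <= _).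
  apply: le_trans (ler_norm_sum _ _ _) _.
  rewrite big_mkcond; apply: ler_sum => l _; case: ifP => lk; last by rewrite mulr_ge0.
  by have := hg l 0 lk; rewrite expr0 mulr1.
rewrite sumr_const card_ord -[X in X <= _]mulr_natl mulrA ler_wpM2r// /K -natrM ler_nat; lia.
Qed.

(** Multiplication by m! turns every division by a difference of nodes in [bk] into an integer
    factor. *)
Let D : rat := m`!%:R.

Lemma fact_div_int (j k : nat) : (j <= m)%N -> (k <= m)%N -> j != k ->
  D / (j%:R - k%:R) \is a Num.int.
Proof.
have main a b : (a <= m)%N -> (b < a)%N -> D / (a%:R - b%:R) \is a Num.int.
  move=> am ba; rewrite -natrB ?(ltnW ba)//.
  have dv : (a - b %| m`!)%N.
    by apply: dvdn_fact; rewrite subn_gt0 ba (leq_trans (leq_subr _ _)).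
  rewrite /D -(divnK dv) natrM mulfK; last by rewrite pnatr_eq0 -lt0n subn_gt0.
  exact: natr_int.
move=> jm km; rewrite neq_ltn => /orP[jk|kj]; last exact: main.
by rewrite -opprB invrN mulrN rpredN; apply: main.
Qed.

Lemma bk_int d f w t i : t = (w - i)%N -> D / d \is a Num.int ->
  (forall i, D ^+ (w - i) * f i \is a Num.int) ->
  D ^+ (w.+1 - i) * bk d f t i \is a Num.int.
Proof.
elim: t i => [|t IH] i ht hd hf /=; first by rewrite mulr0 rpred0.
have iw : (i < w)%N by rewrite -subn_gt0 -ht.
have -> : (w.+1 - i = (w - i).+1)%N by rewrite subSn// ltnW.
rewrite exprS.
have -> : D * D ^+ (w - i) * ((f i - bk d f t i.+1) / d) =
  (D / d) * (D ^+ (w - i) * f i - D ^+ (w.+1 - i.+1) * bk d f t i.+1).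
  by rewrite subSS; ring.
apply: rpredM => //; apply: rpredB => //; apply: IH => //.
by rewrite subnS -ht.
Qed.

Lemma cf_int r j i : all (fun k => k <= m)%N r -> (j <= m)%N ->
  D ^+ (size r - i) * cf r j i \is a Num.int.
Proof.
elim: r j i => [|k r IH] j i; first by rewrite /= mulr0 rpred0.
case: r IH => [_ _ _|a r IH].
  by rewrite [cf _]/= /D; apply: rpredM; [apply: rpredX | ]; exact: natr_int.
move=> /andP[km hr] jm; have {}IH j' i' := IH j' i' hr; rewrite cf_cons /tk.
have hg l i' : (l <= m)%N -> l != k ->
    D ^+ ((size r).+2 - i') * gk k (size r).+1 (cf (a :: r)) l i' \is a Num.int.
  by move=> lm lk; apply: bk_int => //; [exact: fact_div_int | move=> i''; exact: IH].
rewrite [size _]/=; case: eqP => [_|/eqP jk]; last exact: hg.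
case: i => [|i]; last by rewrite subSS; exact: IH.
rewrite mulrN rpredN mulr_sumr; apply: rpred_sum => l lk.
by apply: hg => //; rewrite -ltnS.
Qed.

End forms.

(** * Growth estimates, rational matrices and determinants *)

Definition nm (R : realType) (x : R[i]) : R := `|complex.Re x| + `|complex.Im x|.

Lemma nm_ge0 (R : realType) (x : R[i]) : 0 <= nm x.
Proof. by rewrite addr_ge0. Qed.

Lemma nmM (R : realType) (x y : R[i]) : nm (x * y) <= nm x * nm y.
Proof.
rewrite /nm Re_mul Im_mul.
apply: le_trans (lerD (ler_normB _ _) (ler_normD _ _)) _; rewrite !normrM.
move: (normr_ge0 (complex.Re x)) (normr_ge0 (complex.Im x)).
move: (normr_ge0 (complex.Re y)) (normr_ge0 (complex.Im y)).
move: `|complex.Re x| `|complex.Im x| `|complex.Re y| `|complex.Im y| => a b c d; nra.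
Qed.

Lemma nm_sum (R : realType) (I : Type) (l : seq I) (f : I -> R[i]) :
  nm (\sum_(i <- l) f i) <= \sum_(i <- l) nm (f i).
Proof.
elim: l => [|i l IH]; first by rewrite !big_nil /nm /= normr0 addr0.
rewrite !big_cons; apply: le_trans (lerD (lexx _) IH).
rewrite /nm Re_add Im_add; have := ler_normD (complex.Re (f i)) (complex.Re (\sum_(i <- l) f i)).
have := ler_normD (complex.Im (f i)) (complex.Im (\sum_(i <- l) f i)); lra.
Qed.

Lemma nm_eq0 (R : realType) (x : R[i]) : nm x = 0 -> x = 0.
Proof.
move/eqP; rewrite paddr_eq0// !normr_eq0 => /andP[/eqP h1 /eqP h2].
exact: complex_ext.
Qed.

Lemma ratr_complex (R : realType) (x : rat) : ratr x = (ratr x : R)%:C :> R[i].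
Proof.
have := @fmorph_eq_rat _ (@real_complex R \o ratr) x.
by move=> <-.
Qed.

Lemma nm_ratr (R : realType) (x : rat) (y : R[i]) : nm (ratr x * y) = ratr `|x| * nm y.
Proof.
rewrite ratr_complex ratr_norm; move: (ratr x : R) => z.
by rewrite /nm Re_mul Im_mul /= !mul0r subr0 addr0 !normrM -mulrDr.
Qed.

Lemma fact_expn_le p N : (N`! ^ p <= (p * N)`!)%N.
Proof.
elim: p => [|p IH]; first by rewrite mul0n.
rewrite expnSr mulSn; apply: leq_trans (leq_mul IH (leqnn _)) _.
have h := @bin_fact (N + p * N) N (leq_addr _ _).
rewrite addKn in h; rewrite -h mulnC leq_pmull// bin_gt0 leq_addr//.
Qed.

(** Growth at most exponential; [expbd_fact] sets it against the factorial. *)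
Definition expbd (R : realType) (g : nat -> R) : Prop :=
  exists c Y : R, [/\ 0 <= c, 0 <= Y & forall N, 0 <= g N <= c * Y ^+ N].

Lemma expbdM (R : realType) (g h : nat -> R) : expbd g -> expbd h -> expbd (fun N => g N * h N).
Proof.
move=> [c [Y [c0 Y0 hg]]] [c' [Y' [c'0 Y'0 hh]]]; exists (c * c'), (Y * Y').
split; rewrite ?mulr_ge0// => N; have /andP[g0 g1] := hg N; have /andP[h0 h1] := hh N.
by rewrite mulr_ge0//= exprMn mulrACA ler_pM.
Qed.

Lemma expbd_cst (R : realType) (c : R) : 0 <= c -> expbd (fun=> c).
Proof. by move=> c0; exists c, 1; split=> // N; rewrite expr1n mulr1 c0 lexx. Qed.

Lemma expbd_pow (R : realType) (b : R) a k : 0 <= b -> expbd (fun N => b ^+ (a * N + k)).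
Proof.
move=> b0; exists (b ^+ k), (b ^+ a); split; rewrite ?exprn_ge0// => N.
by rewrite exprn_ge0//= exprD exprM mulrC.
Qed.

Lemma expbdX (R : realType) (g : nat -> R) k : expbd g -> expbd (fun N => g N ^+ k).
Proof.
move=> hg; elim: k => [|k IH]; first by exact: expbd_cst.
have := expbdM hg IH; congr expbd; apply/funext => N; by rewrite exprS.
Qed.

Lemma expbd_nat (R : realType) a k : expbd (fun N => (a * N + k)%:R : R).
Proof.
have [c [Y [c0 Y0 h]]] := @expbd_pow R 2%:R a k (ler0n _ _).
exists c, Y; split=> // N; rewrite ler0n /=; apply: le_trans (_ : 2%:R ^+ (a * N + k) <= _).
  by rewrite -natrX ler_nat ltnW// ltn_expl.
by have /andP[] := h N.
Qed.

Lemma expbd_fact (R : realType) (g : nat -> R) (e : R) : expbd g -> 0 < e ->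
  ~ (forall N, e * N`!%:R <= g N).
Proof.
move=> [c [Y [c0 Y0 hg]]] e0 h.
have cv : c * (Y ^+ N / N`!%:R) @[N --> \oo] --> c * 0.
  apply: cvgM; first exact: cvg_cst.
  exact: (cvg_series_cvg_0 (is_cvg_series_exp_coeff Y)).
have : e <= c * 0.
  rewrite -[X in _ <= X](cvg_lim (@Rhausdorff R) cv); apply: limr_ge.
    by apply/cvg_ex; exists (c * 0).
  apply: nearW => N; rewrite mulrA ler_pdivlMr ?ltr0n ?fact_gt0//.
  by apply: le_trans (h N) _; have /andP[] := hg N.
by rewrite mulr0 leNgt e0.
Qed.

Definition mxnm (n : nat) (A : 'M[rat]_n) : rat := \sum_i \sum_j `|A i j|.

Lemma mxnm_ge0 n (A : 'M[rat]_n) : 0 <= mxnm A.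
Proof. by apply: sumr_ge0 => i _; apply: sumr_ge0. Qed.

Lemma le_mxnm n (A : 'M[rat]_n) i j : `|A i j| <= mxnm A.
Proof.
rewrite /mxnm (bigD1 i)//= (bigD1 j)//= -addrA lerDl addr_ge0//.
  by apply: sumr_ge0.
by apply: sumr_ge0 => k _; apply: sumr_ge0.
Qed.

Lemma mxnmM n (A B : 'M[rat]_n) : mxnm (A *m B) <= mxnm A * mxnm B.
Proof.
rewrite /mxnm mulr_suml; apply: ler_sum => i _.
apply: le_trans (_ : \sum_j \sum_k `|A i k| * `|B k j| <= _).
  apply: ler_sum => j _; rewrite mxE; apply: le_trans (ler_norm_sum _ _ _) _.
  by apply: ler_sum => k _; rewrite normrM.
rewrite exchange_big mulr_suml; apply: ler_sum => k _ /=.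
rewrite -mulr_sumr ler_wpM2l// [X in _ <= X](bigD1 k)//= lerDl.
by apply: sumr_ge0 => l _; apply: sumr_ge0.
Qed.

Lemma mxnmD n (A B : 'M[rat]_n) : mxnm (A + B) <= mxnm A + mxnm B.
Proof.
rewrite /mxnm -big_split; apply: ler_sum => i _; rewrite -big_split.
by apply: ler_sum => j _; rewrite mxE ler_normD.
Qed.

Lemma mxnm_sum n (I : Type) (l : seq I) (f : I -> 'M[rat]_n) :
  mxnm (\sum_(i <- l) f i) <= \sum_(i <- l) mxnm (f i).
Proof.
elim: l => [|i l IH].
  rewrite !big_nil /mxnm big1// => i _; rewrite big1// => j _.
  by rewrite mxE normr0.
by rewrite !big_cons; apply: le_trans (mxnmD _ _) _; rewrite lerD2l.
Qed.

Lemma mxnmZ n (c : rat) (A : 'M[rat]_n) : mxnm (c *: A) = `|c| * mxnm A.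
Proof.
rewrite /mxnm mulr_sumr; apply: eq_bigr => i _; rewrite mulr_sumr.
by apply: eq_bigr => j _; rewrite mxE normrM.
Qed.

Lemma mxnmX n (A : 'M[rat]_n.+1) (b : rat) i : mxnm A <= b -> mxnm (1 : 'M[rat]_n.+1) <= b ->
  mxnm (A ^+ i) <= b ^+ i.+1.
Proof.
move=> hA h1; have b0 : 0 <= b by exact: le_trans (mxnm_ge0 A) hA.
elim: i => [|i IH]; first by rewrite expr0 expr1.
rewrite exprS exprS; apply: le_trans (mxnmM _ _) _.
by apply: ler_pM => //; exact: mxnm_ge0.
Qed.

Lemma norm_det_le n (A : 'M[rat]_n) (M : rat) : (forall i j, `|A i j| <= M) ->
  `|\det A| <= n`!%:R * M ^+ n.
Proof.
move=> h; rewrite /determinant; apply: le_trans (ler_norm_sum _ _ _) _.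
apply: le_trans (_ : \sum_(s : 'S_n) M ^+ n <= _).
  apply: ler_sum => s _; rewrite normrM normrX normrN1 expr1n mul1r.
  rewrite normr_prod -[X in M ^+ X]card_ord -prodr_const.
  by apply: ler_prod => i _; rewrite normr_ge0 h.
have -> : \sum_(s : 'S_n) M ^+ n = M ^+ n *+ #|{: 'S_n}| by rewrite sumr_const.
by rewrite card_Sn mulr_natl.
Qed.

Lemma norm_adj_le n (A : 'M[rat]_n.+1) (M : rat) i j : (forall i j, `|A i j| <= M) ->
  `|(\adj A) i j| <= n`!%:R * M ^+ n.
Proof.
move=> h; rewrite mxE /cofactor normrM normrX normrN1 expr1n mul1r.
by apply: norm_det_le => k l; rewrite !mxE.
Qed.

Definition intmx n (A : 'M[rat]_n) := forall i j, A i j \is a Num.int.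

Lemma intmxM n (A B : 'M[rat]_n) : intmx A -> intmx B -> intmx (A *m B).
Proof.
by move=> hA hB i j; rewrite mxE; apply: rpred_sum => k _; exact: rpredM.
Qed.

Lemma intmxX n (A : 'M[rat]_n.+1) k : intmx A -> intmx (A ^+ k).
Proof.
move=> hA; elim: k => [|k IH]; last by rewrite exprS; exact: intmxM.
by move=> i j; rewrite expr0 mxE; exact: natr_int.
Qed.

Lemma intmx_det n (A : 'M[rat]_n) : intmx A -> \det A \is a Num.int.
Proof.
move=> hA; rewrite /determinant; apply: rpred_sum => s _; apply: rpredM.
  by rewrite rpredX// rpredN rpred1.
by apply: rpred_prod => i _; exact: hA.
Qed.

Lemma intmx_scale n (A : 'M[rat]_n) : exists2 q : nat, (0 < q)%N & intmx (q%:R *: A).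
Proof.
pose q := (\prod_i \prod_j `|denq (A i j)|)%N.
exists q; first by do 2!apply/prodn_gt0 => ?; rewrite absz_gt0 denq_neq0.
move=> i j; rewrite mxE /q (bigD1 i)//= (bigD1 j)//= !natrM.
set u := (_%:R : rat); set v := (_%:R : rat); set w := (_%:R : rat).
have -> : u * v * w * A i j = (u * A i j) * (v * w) by ring.
apply: rpredM; last by rewrite rpredM// natr_int.
rewrite /u natr_absz ger0_norm ?denq_ge0// -{2}(divq_num_den (A i j)) mulrC divfK ?intr_int//.
by rewrite intr_eq0 denq_neq0.
Qed.

(** [A] acts as multiplication by [v] on numbers [e] that are independent over the rationals. Its
    determinant, the norm of [v], is a nonzero integer and hence at least 1 in absolute value, while
    the adjugate expresses it through [v] times a bounded quantity. This keeps [v] away from 0. *)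
Lemma Liouville (R : realType) d (e : 'cV[R[i]]_d.+1) (A : 'M[rat]_d.+1) (v : R[i]) (M : rat) a :
  (forall x : 'rV[rat]_d.+1, map_mx ratr x *m e = 0 -> x = 0) ->
  map_mx ratr A *m e = v *: e -> v != 0 -> intmx A -> (forall i j, `|A i j| <= M) ->
  nm (e a 0) <= nm v * (ratr (d`!%:R * M ^+ d) * \sum_b nm (e b 0)).
Proof.
move=> free Ae v0 Aint AM.
have det0 : \det A != 0.
  apply/negP => /det0P[x x0 xA]; case/negP: x0; apply/eqP/free.
  have : map_mx ratr x *m (map_mx ratr A *m e) = 0.
    by rewrite mulmxA -map_mxM xA map_mx0 mul0mx.
  by rewrite Ae -scalemxAr => /eqP; rewrite scaler_eq0 (negPf v0) => /eqP.
have det1 : 1 <= `|\det A| by apply: norm_intr_ge1 => //; exact: intmx_det.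
have E : ratr (\det A) * e a 0 = v * \sum_b ratr ((\adj A) a b) * e b 0.
  have := congr1 (fun X => (map_mx ratr X *m e) a 0) (mul_adj_mx A).
  rewrite map_mxM -mulmxA Ae -scalemxAr map_scalar_mx mul_scalar_mx !mxE => <-.
  by congr (_ * _); apply: eq_bigr => b _; rewrite mxE.
have : nm (ratr (\det A) * e a 0) <= nm v * (ratr (d`!%:R * M ^+ d) * \sum_b nm (e b 0)).
  rewrite E; apply: le_trans (nmM _ _) _; rewrite ler_wpM2l ?nm_ge0//.
  apply: le_trans (nm_sum _ _) _; rewrite mulr_sumr; apply: ler_sum => b _.
  rewrite nm_ratr ler_wpM2r ?nm_ge0// ler_rat.
  exact: norm_adj_le.
apply: le_trans; rewrite nm_ratr -[X in X <= _]mul1r ler_wpM2r ?nm_ge0//.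
by rewrite -(rmorph1 (@ratr R)) ler_rat.
Qed.

(** The sum [feval] with matrices [B] and [C] in place of the numbers i t and exp(i t), which
    [powsum_eigen] recovers on a common eigenvector. *)
Definition powsum (d m n : nat) (cs : nat -> nat -> rat) (B C : 'M[rat]_d.+1) : 'M[rat]_d.+1 :=
  \sum_(j < m.+1) \sum_(i < n) (cs j i / i`!%:R) *: (B ^+ i *m C ^+ j).

Lemma powsum_eigen (R : realType) d m n cs (B C : 'M[rat]_d.+1) (e : 'cV[R[i]]_d.+1) (t : R) :
  map_mx ratr B *m e = (0 +i* t) *: e -> map_mx ratr C *m e = cexp 1 t *: e ->
  map_mx ratr (powsum m n cs B C) *m e = feval m n cs t *: e.
Proof.
move=> hB hC.
have pow (A : 'M[rat]_d.+1) a k : map_mx ratr A *m e = a *: e ->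
    map_mx ratr (A ^+ k) *m e = a ^+ k *: e.
  move=> hA; elim: k => [|k IH]; first by rewrite !expr0 map_mx1 mul1mx scale1r.
  by rewrite exprSr map_mxM -mulmxA hA -scalemxAr IH scalerA exprS.
rewrite /powsum /feval raddf_sum mulmx_suml scaler_suml; apply: eq_bigr => j _ /=.
rewrite raddf_sum mulmx_suml scaler_suml; apply: eq_bigr => i _ /=.
rewrite map_mxZ map_mxM -scalemxAl -mulmxA (pow C _ j hC) -scalemxAr (pow B _ i hB) !scalerA.
congr (_ *: _); rewrite /eterm /mono (cexp_nat j) fmorph_div /= ratr_nat; ring.
Qed.

Lemma powsum_le d m n N cs (B C : 'M[rat]_d.+1) (b M : rat) :
  mxnm B <= b -> mxnm C <= b -> mxnm (1 : 'M[rat]_d.+1) <= b ->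
  (forall j i, (j <= m)%N -> (N < i)%N -> cs j i = 0) -> 0 <= M ->
  (forall j i, `|cs j i| <= M) ->
  mxnm (powsum m n cs B C) <= (m.+1 * n)%:R * (M * b ^+ (N + m + 2)).
Proof.
move=> hB hC h1 cs0 M0 csM.
have b1 : 1 <= b.
  apply: le_trans h1; apply: le_trans (le_mxnm (1 : 'M[rat]_d.+1) 0 0).
  by rewrite mxE normr1.
have b0 : 0 <= b by exact: le_trans b1.
apply: le_trans (mxnm_sum _ _) _.
apply: le_trans (_ : \sum_(j < m.+1) \sum_(i < n) M * b ^+ (N + m + 2) <= _); last first.
  by rewrite sumr_const card_ord sumr_const card_ord -mulrnA mulr_natl mulnC.
apply: ler_sum => j _; apply: le_trans (mxnm_sum _ _) _; apply: ler_sum => i _.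
have jm : (j <= m)%N by rewrite -ltnS.
rewrite mxnmZ; case: (ltnP N i) => hi.
  by rewrite (cs0 _ _ jm hi) mul0r normr0 mul0r mulr_ge0// exprn_ge0.
apply: ler_pM => //; first exact: mxnm_ge0.
  rewrite normrM normfV normr_nat ler_pdivrMr ?ltr0n ?fact_gt0//.
  apply: le_trans (csM j i) _; rewrite ler_peMr// ler1n fact_gt0//.
apply: le_trans (mxnmM _ _) _.
apply: le_trans (ler_pM (mxnm_ge0 _) (mxnm_ge0 _) (mxnmX i hB h1) (mxnmX j hC h1)) _.
rewrite -exprD ler_weXn2l//; lia.
Qed.

(** [T] clears the coefficients, N! the factorials of [mono], and q^(N + m) the at most N + m matrix
    factors. *)
Lemma powsum_int d m n N cs (B C : 'M[rat]_d.+1) (q T : nat) :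
  intmx (q%:R *: B) -> intmx (q%:R *: C) ->
  (forall j i, (j <= m)%N -> (N < i)%N -> cs j i = 0) ->
  (forall j i, (j <= m)%N -> T%:R * cs j i \is a Num.int) ->
  intmx ((T * N`! * q ^ (N + m))%:R *: powsum m n cs B C).
Proof.
move=> qB qC cs0 Tcs.
have -> : (T * N`! * q ^ (N + m))%:R *: powsum m n cs B C =
   \sum_(j < m.+1) \sum_(i < n) ((T * N`! * q ^ (N + m))%:R * (cs j i / i`!%:R)) *:
     (B ^+ i *m C ^+ j).
  rewrite /powsum scaler_sumr; apply: eq_bigr => j _; rewrite scaler_sumr.
  by apply: eq_bigr => i _; rewrite scalerA.
move=> a c; rewrite summxE; apply: rpred_sum => j _; rewrite summxE; apply: rpred_sum => i _.
have jm : (j <= m)%N by rewrite -ltnS.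
case: (ltnP N i) => hi; first by rewrite (cs0 _ _ jm hi) mul0r mulr0 scale0r mxE rpred0.
have Bi : intmx (q%:R ^+ i *: (B ^+ i)) by rewrite -exprZn; exact: intmxX.
have Cj : intmx (q%:R ^+ j *: (C ^+ j)) by rewrite -exprZn; exact: intmxX.
have := intmxM Bi Cj a c.
rewrite -scalemxAl -scalemxAr scalerA mxE => h; rewrite mxE.
have f0 : i`!%:R != 0 :> rat by rewrite pnatr_eq0 -lt0n fact_gt0.
have e1 : N`!%:R = ('C(N, i) * (N - i)`!)%:R * i`!%:R :> rat.
  by rewrite -(bin_fact hi) -natrM; congr (_%:R); lia.
have e2 : (q ^ (N + m))%:R = (q ^ (N - i + (m - j)))%:R * (q%:R ^+ i * q%:R ^+ j) :> rat.
  rewrite -!natrX -!natrM -!expnD; congr ((q ^ _)%:R); lia.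
have -> : (T * N`! * q ^ (N + m))%:R * (cs j i / i`!%:R) * (B ^+ i *m C ^+ j) a c =
  (T%:R * cs j i) * ('C(N, i) * (N - i)`!)%:R * (q ^ (N - i + (m - j)))%:R *
    (q%:R ^+ i * q%:R ^+ j * (B ^+ i *m C ^+ j) a c).
  by rewrite !natrM e1 e2; field.
apply: rpredM => //; apply: rpredM; last exact: natr_int.
by apply: rpredM; [exact: Tcs | exact: natr_int].
Qed.

Lemma count_flatten_nseq (l : nat) (s : seq nat) N : (count_mem l s <= 1)%N ->
  (count_mem l (flatten (nseq N s)) <= N)%N.
Proof.
move=> hs; elim: N => [|N IH]; first by [].
have -> : flatten (nseq N.+1 s) = s ++ flatten (nseq N s) by [].
rewrite count_cat; exact: leq_add hs IH.
Qed.

(** The vector [e] represents a number field of degree d + 1 that contains i t and exp(i t). A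
    nonvanishing form with each node 0, ..., m repeated N times has size at most about 1 / N!^(m +
    1), up to exponential factors. Clearing denominators costs one N!, and [Liouville] raises this
    cost to the power d + 1 = m. One factor N! is left over, against exponential growth. *)
Theorem no_eigen_exp (R : realType) (t : R) d (e : 'cV[R[i]]_d.+1) (B C : 'M[rat]_d.+1) :
  0 < t -> (forall x : 'rV[rat]_d.+1, map_mx ratr x *m e = 0 -> x = 0) ->
  map_mx ratr B *m e = (0 +i* t) *: e -> map_mx ratr C *m e = cexp 1 t *: e -> False.
Proof.
move=> t0 free hB hC; set m := d.+1.
have [a ea] : exists a, e a 0 != 0.
  apply: contrapT => h.
  have e0 : e = 0.
    apply/matrixP => i j; rewrite ord1 mxE; apply/eqP; apply: contrapT => /negP he.
    by apply: h; exists i.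
  have := free (const_mx 1); rewrite e0 mulmx0 => /(_ erefl)/matrixP/(_ 0 0).
  by rewrite !mxE => /eqP; rewrite oner_eq0.
have nea : 0 < nm (e a 0).
  rewrite lt_neqAle nm_ge0 andbT eq_sym; apply/eqP => /nm_eq0/eqP; by rewrite (negPf ea).
have [q1 q1_gt0 hq1] := intmx_scale B; have [q2 q2_gt0 hq2] := intmx_scale C.
pose q := (q1 * q2)%N.
have qB : intmx (q%:R *: B).
  move=> i j; rewrite mxE /q natrM.
  have := hq1 i j; rewrite mxE => h.
  have -> : q1%:R * q2%:R * B i j = (q1%:R * B i j) * q2%:R by ring.
  by rewrite rpredM// natr_int.
have qC : intmx (q%:R *: C).
  move=> i j; rewrite mxE /q natrM -mulrA rpredM ?natr_int//.
  by have := hq2 i j; rewrite mxE.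
pose b : rat := mxnm B + mxnm C + mxnm (1 : 'M[rat]_d.+1).
have b_ge0 : 0 <= b by rewrite !addr_ge0 ?mxnm_ge0.
have bB : mxnm B <= b by rewrite /b -addrA lerDl addr_ge0 ?mxnm_ge0.
have bC : mxnm C <= b by rewrite /b addrAC lerDr addr_ge0 ?mxnm_ge0.
have b1 : mxnm (1 : 'M[rat]_d.+1) <= b by rewrite /b lerDr addr_ge0 ?mxnm_ge0.
pose K : rat := (2 * m + 2)%:R; have K0 : 0 <= K by exact: ler0n.
pose w N := (m.+1 * N).+1.
pose T0 N := (m`! ^ w N * q ^ (N + m))%N.
pose f N : rat := (m.+1 * (m.+1 * N + 2))%:R * (K ^+ w N * b ^+ (N + m + 2)).
have f_ge0 N : 0 <= f N by rewrite !mulr_ge0 ?exprn_ge0.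
(* [G N] collects what grows at most exponentially in the final comparison; [T0 N] is the common
   denominator without its factor N!. *)
pose G N : R := 2%:R * (4%:R * t) ^+ (m.+1 * N) *
  (d`!%:R * (T0 N)%:R ^+ d * ratr (f N) ^+ d * (T0 N)%:R * \sum_b nm (e b 0)).
have eG : expbd G.
  have eT0 : expbd (fun N => (T0 N)%:R : R).
    have := expbdM (@expbd_pow R m`!%:R m.+1 1 (ler0n _ _)) (@expbd_pow R q%:R 1 m (ler0n _ _)).
    congr expbd; apply/funext => N; rewrite /T0 natrM !natrX /w addn1 mul1n; congr (_ * _ ^+ _).
  have ef : expbd (fun N => ratr (f N) : R).
    have rb : 0 <= ratr b :> R by rewrite ler0q.
    have rK : 0 <= ratr K :> R by rewrite ler0q.
    have := expbdM (expbd_nat R (m.+1 * m.+1) (m.+1 * 2))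
      (expbdM (@expbd_pow R (ratr K) m.+1 1 rK) (@expbd_pow R (ratr b) 1 (m + 2) rb)).
    congr expbd; apply/funext => N; rewrite /f !rmorphM !rmorphXn /= ratr_nat /w addn1 mul1n addnA.
    by rewrite mulnDr mulnA.
  have e4 : expbd (fun N => (4%:R * t) ^+ (m.+1 * N)).
    have := @expbd_pow R (4%:R * t) m.+1 0 (mulr_ge0 (ler0n _ _) (ltW t0)).
    by congr expbd; apply/funext => N; rewrite addn0.
  apply: expbdM; first by apply: expbdM => //; exact: expbd_cst.
  apply: expbdM; last by apply: expbd_cst; apply: sumr_ge0 => i _; exact: nm_ge0.
  apply: expbdM => //; apply: expbdM; last exact: expbdX.
  apply: expbdM; first exact: expbd_cst.
  exact: expbdX.
apply: (expbd_fact eG nea) => N.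
pose r := flatten (nseq N (iota 0 m.+1)).
have rm : all (fun k => k <= m)%N r.
  apply/allP => k /flattenP[s]; rewrite mem_nseq => /andP[_ /eqP->].
  by rewrite mem_iota /= add0n ltnS.
have sr : size r = (m.+1 * N)%N.
  rewrite /r; elim: (N) => [|N' IH]; first by rewrite muln0.
  by rewrite /= size_cat size_iota IH mulnS.
have cr l : (count_mem l r <= N)%N.
  by apply: count_flatten_nseq; rewrite count_uniq_mem ?iota_uniq// leq_b1.
pose n := (size r + 2)%N.
have [j jm V0] := form_nonzero (n := n) (lt0r_neq0 t0) rm (leqnn _).
set l := j :: r in V0; have lm : all (fun k => k <= m)%N l by rewrite /= jm.
have sl : size l = w N by rewrite /= sr.
have cs0 l' i : (l' <= m)%N -> (N < i)%N -> cf m l l' i = 0.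
  move=> _ Ni; apply: cf_supp; apply: leq_trans Ni.
  by rewrite /= -[X in (_ <= X)%N]add1n leq_add// leq_b1.
have csM l' i : `|cf m l l' i| <= K ^+ w N.
  have := cf_le l' i lm; rewrite sl => h; apply: le_trans h.
  by rewrite ler_peMr// exprn_ege1// /K ler1n addn2.
have csT l' i : (l' <= m)%N -> (m`! ^ w N)%:R * cf m l l' i \is a Num.int.
  move=> l'm; have h := cf_int i lm l'm; rewrite sl in h.
  case: (leqP (w N) i) => iw; first by rewrite cf_size ?sl// mulr0 rpred0.
  have -> : (m`! ^ w N)%:R = m`!%:R ^+ i * m`!%:R ^+ (w N - i) :> rat.
    by rewrite -exprD subnKC ?natrX// ltnW.
  by rewrite -mulrA rpredM// rpredX// natr_int.
pose F := powsum m n (cf m l) B C.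
have FE : map_mx ratr F *m e = hform m n l t *: e by exact: powsum_eigen.
have Fle : mxnm F <= f N.
  apply: le_trans (powsum_le n bB bC b1 cs0 (exprn_ge0 _ K0) csM) _.
  by rewrite /f -sr lexx.
pose T := (m`! ^ w N * N`! * q ^ (N + m))%N.
have Fint : intmx (T%:R *: F) by exact: powsum_int.
have TFE : map_mx ratr (T%:R *: F) *m e = (T%:R * hform m n l t) *: e.
  by rewrite map_mxZ -scalemxAl FE scalerA rmorph_nat.
have T_gt0 : (0 < T)%N by rewrite !muln_gt0 !expn_gt0 fact_gt0 fact_gt0 /q muln_gt0 q1_gt0 q2_gt0.
have TV0 : T%:R * hform m n l t != 0 by rewrite mulf_neq0// pnatr_eq0 -lt0n.
have TFle i k : `|(T%:R *: F) i k| <= T%:R * f N.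
  by rewrite mxE normrM normr_nat ler_wpM2l//; apply: le_trans Fle; exact: le_mxnm.
have := Liouville a free TFE TV0 Fint TFle.
have nV : nm (hform m n l t) <= 2%:R * (4%:R ^+ (m.+1 * N) / (m.+1 * N)`!%:R * t ^+ (m.+1 * N)).
  have hn : (size r < n)%N by rewrite /n addn2.
  have [h1 h2] := form_bound jm rm hn (ltW t0).
  by rewrite sr in h1 h2; rewrite mulr_natl mulr2n; apply: lerD.
have nTV : nm (T%:R * hform m n l t) <= T%:R * nm (hform m n l t).
  by rewrite -(ratr_nat R[i]) nm_ratr normr_nat ratr_nat.
move: (hform m n l t) nV nTV => V nV nTV {TFE TV0 FE V0} hL.
have TE : T = (N`! * T0 N)%N by rewrite /T /T0 -mulnA mulnCA.
set S := \sum_b nm (e b 0) in hL *.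
have S0 : 0 <= S by apply: sumr_ge0 => i _; exact: nm_ge0.
set X := ratr (d`!%:R * (T%:R * f N) ^+ d) * S in hL.
have XE : X = d`!%:R * T%:R ^+ d * ratr (f N) ^+ d * S.
  by rewrite /X rmorphM rmorphXn rmorphM /= !ratr_nat exprMn; ring.
have X0 : 0 <= X by rewrite XE !mulr_ge0 ?exprn_ge0 ?ler0q.
have W0 : 0 < (m.+1 * N)`!%:R :> R by rewrite ltr0n fact_gt0.
have h3 : nm (e a 0) * (m.+1 * N)`!%:R <=
   T%:R * (2%:R * (4%:R * t) ^+ (m.+1 * N)) * X.
  apply: le_trans (ler_wpM2r (ltW W0) hL) _.
  apply: le_trans (_ : T%:R * nm V * X * (m.+1 * N)`!%:R <= _).
    by do 2!apply: ler_wpM2r => //; exact: ltW.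
  rewrite mulrAC; apply: ler_wpM2r => //; rewrite -mulrA; apply: ler_wpM2l => //.
  apply: le_trans (ler_wpM2r (ltW W0) nV) _.
  by rewrite exprMn le_eqVlt; apply/orP; left; apply/eqP; field; rewrite gt_eqF.
have h4 : N`!%:R ^+ m.+1 <= (m.+1 * N)`!%:R :> R by rewrite -natrX ler_nat fact_expn_le.
have F0 : 0 < N`!%:R :> R by rewrite ltr0n fact_gt0.
(* Of N!^(m + 1) on the left, N!^m is matched by the factors N! in the powers of [T]; cancelling it
   leaves the bound that [expbd_fact] excludes. *)
have h5 : nm (e a 0) * N`!%:R ^+ m.+1 <= N`!%:R ^+ m * G N.
  apply: le_trans (ler_wpM2l (nm_ge0 _) h4) _; apply: le_trans h3 _.
  rewrite XE TE natrM /G -/S le_eqVlt; apply/orP; left; apply/eqP.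
  move: ((T0 N)%:R : R) (ratr (f N) : R) (N`!%:R : R) ((4%:R * t) ^+ _) => a' b' c' k'.
  by rewrite [c' ^+ m]exprS exprMn; ring.
move: h5; rewrite exprSr mulrCA ler_pM2l ?exprn_gt0//.
Qed.

(** The powers of [b] below the degree of a minimal polynomial form [e]. Minimality makes them
    independent over the rationals, and multiplication is expressed by the remainders of [q * 'X^i]
    modulo that polynomial. *)
Lemma simple_extension (R : realType) (b : R[i]) (p : {poly rat}) : p != 0 ->
  (map_poly ratr p).[b] = 0 ->
  exists d (e : 'cV[R[i]]_d.+1),
    (forall x : 'rV[rat]_d.+1, map_mx ratr x *m e = 0 -> x = 0) /\
    forall q : {poly rat}, exists M : 'M[rat]_d.+1,
      map_mx ratr M *m e = (map_poly ratr q).[b] *: e.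
Proof.
move=> p0 pb.
pose P n := `[< exists q : {poly rat}, [/\ q != 0, size q = n & (map_poly ratr q).[b] = 0] >].
have exP : exists n, P n by exists (size p); apply/asboolP; exists p.
case: (ex_minnP exP) => n /asboolP[{p0 pb}p [p0 sp pb]] nmin.
have : (1 < n)%N.
  rewrite ltnNge -sp; apply/negP => /size1_polyC pC.
  move: pb p0; rewrite pC map_polyC hornerC /= => /eqP; rewrite fmorph_eq0 => /eqP ->.
  by rewrite eqxx.
case: n sp nmin => // -[//|d] sp nmin _.
pose e : 'cV[R[i]]_d.+1 := \col_i b ^+ i.
have he (x : nat -> rat) (A : 'rV[rat]_d.+1) : (forall j, A 0 j = x j) ->
    (map_mx ratr A *m e) 0 0 = (map_poly ratr (\poly_(i < d.+1) x i)).[b].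
  move=> hA; rewrite (@horner_coef_wide _ d.+1); last first.
    by rewrite size_map_poly size_poly.
  rewrite mxE; apply: eq_bigr => j _; rewrite !mxE coef_map coef_poly ltn_ord hA//.
exists d, e; split.
  move=> x hx; pose q := \poly_(i < d.+1) x 0 (inord i).
  have qb : (map_poly ratr q).[b] = 0.
    by rewrite -(he (fun i => x 0 (inord i)) x) ?hx ?mxE// => j; rewrite inord_val.
  case: (eqVneq q 0) => [q0|q0]; last first.
    have := nmin (size q); have -> : P (size q) by apply/asboolP; exists q.
    by move=> /(_ isT); rewrite leqNgt ltnS size_poly.
  apply/rowP => j; rewrite mxE; have := congr1 (fun q : {poly rat} => q`_j) q0.
  by rewrite coef_poly ltn_ord inord_val coef0.
move=> q; exists (\matrix_(i, j) ((q * 'X^i) %% p)`_j).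
apply/matrixP => i k; rewrite [k]ord1 !mxE.
have hm : (map_poly ratr ((q * 'X^i) %% p)).[b] = (map_poly ratr q).[b] * b ^+ i.
  have E := divp_eq (q * 'X^i) p.
  have -> : (map_poly ratr q).[b] * b ^+ i = (map_poly ratr (q * 'X^i)).[b].
    by rewrite rmorphM /= hornerM map_polyXn hornerXn.
  by rewrite {2}E rmorphD rmorphM /= hornerD hornerM pb mulr0 add0r.
rewrite -hm (@horner_coef_wide _ d.+1); last first.
  by rewrite size_map_poly -ltnS -sp ltn_modp.
by apply: eq_bigr => j _; rewrite !mxE coef_map.
Qed.

(** In the field generated by i t, division of the two values is the matrix [invmx U *m V], so exp(i
    t) would be an eigenvalue on the same vector as i t. *)
Lemma exp_not_ratio (R : realType) (t : R) (p u v : {poly rat}) : 0 < t -> p != 0 ->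
  (map_poly ratr p).[0 +i* t] = 0 -> (map_poly ratr u).[0 +i* t] != 0 ->
  cexp 1 t * (map_poly ratr u).[0 +i* t] = (map_poly ratr v).[0 +i* t] -> False.
Proof.
move=> t0 p0 pb u0 uv; have [d [e [free hM]]] := simple_extension p0 pb.
have [B hB] := hM 'X; have [U hU] := hM u; have [V hV] := hM v.
rewrite map_polyX hornerX in hB.
have Uu : U \in unitmx.
  rewrite unitmxE unitfE; apply/negP => /det0P[x x0 xU]; case/negP: x0; apply/eqP/free.
  have : map_mx ratr x *m (map_mx ratr U *m e) = 0.
    by rewrite mulmxA -map_mxM xU map_mx0 mul0mx.
  by rewrite hU -scalemxAr => /eqP; rewrite scaler_eq0 (negPf u0) => /eqP.
have Ie : map_mx ratr (invmx U) *m e = ((map_poly ratr u).[0 +i* t])^-1 *: e.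
  apply: (scalerI u0); rewrite scalemxAr -hU mulmxA -map_mxM mulVmx// map_mx1 mul1mx.
  by rewrite scalerA mulfV// scale1r.
apply: (@no_eigen_exp R t d e B (invmx U *m V)) => //.
by rewrite map_mxM -mulmxA hV -scalemxAr Ie scalerA -uv mulfK.
Qed.

(** * Elimination of sine and cosine *)

Fixpoint trec (a b : {poly rat}) n : {poly rat} * {poly rat} :=
  if n is n'.+1 then
    ((trec a b n').2, (2 * n' + 3)%:R *: (trec a b n').2 - 'X * (trec a b n').1)
  else (a, b).

(* [y ^ n * H n y = sinp n * (sin z / z) + cosp n * cos z] at [y = z ^ 2]. *)
Definition sinp n := (trec 1 1 n).1.
Definition cosp n := (trec 0 (-1) n).1.

Lemma trecSS a b n :
  (trec a b n.+2).1 = (2 * n + 3)%:R *: (trec a b n.+1).1 - 'X * (trec a b n).1.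
Proof. by []. Qed.

Definition pe (R : realType) (p : {poly rat}) (y : R) : R := (map_poly ratr p).[y].

Lemma peB (R : realType) p q (y : R) : pe (p - q) y = pe p y - pe q y.
Proof. by rewrite /pe rmorphB /= hornerD hornerN. Qed.

Lemma peZ (R : realType) c p (y : R) : pe (c *: p) y = ratr c * pe p y.
Proof. by rewrite /pe map_polyZ hornerZ. Qed.

Lemma peM (R : realType) p q (y : R) : pe (p * q) y = pe p y * pe q y.
Proof. by rewrite /pe rmorphM /= hornerM. Qed.

Lemma peX (R : realType) (y : R) : pe 'X y = y.
Proof. by rewrite /pe map_polyX hornerX. Qed.

Lemma pe_trecSS (R : realType) a b n (y : R) :
  pe (trec a b n.+2).1 y =
  (2 * n + 3)%:R * pe (trec a b n.+1).1 y - y * pe (trec a b n).1 y.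
Proof. by rewrite trecSS peB peZ peM peX ratr_nat. Qed.

Lemma sinp_cospE (R : realType) n (z : R) : 0 < z ->
  z ^+ 2 ^+ n * H n (z ^+ 2) =
  pe (sinp n) (z ^+ 2) * (sin z / z) + pe (cosp n) (z ^+ 2) * cos z.
Proof.
move=> z0; have z1 : z != 0 by rewrite gt_eqF.
have s0 : sin z / z = H 0 (z ^+ 2) by rewrite sin_H mulrC mulKf.
pose P n := z ^+ 2 ^+ n * H n (z ^+ 2) =
  pe (sinp n) (z ^+ 2) * (sin z / z) + pe (cosp n) (z ^+ 2) * cos z.
suff : P n /\ P n.+1 by case.
elim: n => [|n [IH0 IH1]].
  split; rewrite /P s0 /sinp /cosp /= /pe ?rmorphN ?rmorph1 ?rmorph0 ?hornerN ?hornerC ?horner0.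
    by rewrite expr0; ring.
  by rewrite cos_H; ring.
split=> //; rewrite /P /sinp /cosp !pe_trecSS -!/(sinp _) -!/(cosp _).
have hr : z ^+ 2 * H n.+2 (z ^+ 2) = (2 * n + 3)%:R * H n.+1 (z ^+ 2) - H n (z ^+ 2).
  by apply/eqP; rewrite -subr_eq0 -(H_rec n (z ^+ 2)); apply/eqP; ring.
transitivity ((2 * n + 3)%:R * (z ^+ 2 ^+ n.+1 * H n.+1 (z ^+ 2)) -
   z ^+ 2 * (z ^+ 2 ^+ n * H n (z ^+ 2))).
  rewrite (exprS _ n.+1) -mulrA mulrCA hr (exprS _ n); ring.
rewrite IH0 IH1; ring.
Qed.

Definition dsinp n := n%:R *: sinp n - sinp n.+1.
Definition dcosp n := n%:R *: cosp n - cosp n.+1.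

Lemma dsinp_dcospE (R : realType) n (z : R) : 0 < z ->
  z ^+ 2 ^+ n * Phi n (z ^+ 2) =
  pe (dsinp n) (z ^+ 2) * (sin z / z) + pe (dcosp n) (z ^+ 2) * cos z.
Proof.
move=> z0; rewrite /Phi /dsinp /dcosp !peB !peZ !ratr_nat.
have -> : z ^+ 2 ^+ n * (n%:R * H n (z ^+ 2) - z ^+ 2 * H n.+1 (z ^+ 2)) =
  n%:R * (z ^+ 2 ^+ n * H n (z ^+ 2)) - z ^+ 2 ^+ n.+1 * H n.+1 (z ^+ 2).
  by rewrite (exprS _ n); ring.
rewrite !sinp_cospE//; ring.
Qed.

Lemma dcosp_at0 (R : realType) n : pe (dcosp n) (0 : R) = (n.+1 * dfac n)%:R.
Proof.
have h k : pe (cosp k.+1) (0 : R) = - (dfac k.+1)%:R.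
  elim: k => [|k IH].
    by rewrite /cosp /= /pe rmorphN rmorph1 hornerN hornerC /dfac big_ord1.
  rewrite /cosp pe_trecSS mul0r subr0 -/(cosp k.+1) IH (dfacS k.+1) natrM mulrN mulrC.
  by congr (- (_ * _%:R)); lia.
rewrite /dcosp peB peZ h ratr_nat opprK; case: n => [|n].
  by rewrite mul0r add0r dfacS /dfac big_ord0.
rewrite h (dfacS n.+1) !natrM natrD natrM -!nat1r; ring.
Qed.

(** The Casoratian of the two solutions of the recurrence is multiplied by [y] at each step. It
    prevents [dsinp n] and [dcosp n] from having a common positive zero. *)
Lemma cross_trec (R : realType) n (y : R) :
  pe (sinp n) y * pe (cosp n.+1) y - pe (sinp n.+1) y * pe (cosp n) y = - y ^+ n.
Proof.
elim: n => [|n IH].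
  rewrite /sinp /cosp /= /pe !(rmorphN, rmorph1, rmorph0, hornerN, hornerC, horner0) expr0; ring.
rewrite {2}/cosp {2}/sinp !pe_trecSS -!/(sinp _) -!/(cosp _) exprS -[RHS]mulrN -IH; ring.
Qed.

Lemma pe_continuous (R : realType) p : continuous (@pe R p).
Proof. move=> y; exact: continuous_horner. Qed.

Lemma eq_at0 (R : realType) (f g : R -> R) : continuous f -> continuous g ->
  (forall y, 0 < y -> f y = g y) -> f 0 = g 0.
Proof.
move=> cf cg fg; pose u n : R := n.+1%:R^-1.
have hu : u @ \oo --> (0 : R) by exact: cvg_harmonic.
have fu : f (u n) @[n --> \oo] --> f 0 by apply: continuous_cvg => //; exact: cf.
have gu : g (u n) @[n --> \oo] --> g 0 by apply: continuous_cvg => //; exact: cg.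
have E : (fun n => f (u n)) = (fun n => g (u n)).
  by apply/funext => n; apply: fg; rewrite invr_gt0.
by rewrite E in fu; exact: (cvg_unique (@Rhausdorff R) fu gu).
Qed.

Lemma Phi_continuous (R : realType) n : continuous (@Phi R n).
Proof. exact: derivable_cont (@is_derive_Phi R n). Qed.

Lemma Phi_at0 (R : realType) n : Phi n (0 : R) = n%:R * H n 0.
Proof. by rewrite /Phi mul0r subr0. Qed.

Lemma pow_continuous (R : realType) n : continuous (fun y : R => y ^+ n).
Proof. exact: exprn_continuous. Qed.

(** If the polynomial were zero, eliminating sin z / z would relate y^n [Phi n] to y^k [Phi k] with
    the factors [dcosp k] and [dcosp n]. These are positive at 0 and [Phi n] is nonzero there for n
    > 0, so the orders of vanishing at 0 differ. *)
Lemma wronskian_neq0 (R : realType) n k : (n < k)%N ->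
  dsinp n * dcosp k - dsinp k * dcosp n != 0.
Proof.
move=> nk; apply/eqP => W0.
have key (y : R) : 0 < y ->
    pe (dcosp k) y * (y ^+ n * Phi n y) = pe (dcosp n) y * (y ^+ k * Phi k y).
  move=> y0; pose z := Num.sqrt y; have z0 : 0 < z by rewrite sqrtr_gt0.
  have -> : y = z ^+ 2 by rewrite sqr_sqrtr// ltW.
  have := congr1 (fun p => pe p (z ^+ 2)) W0; rewrite peB !peM /= => h.
  have e0 : pe 0 (z ^+ 2) = 0 by rewrite /pe rmorph0 horner0.
  rewrite !dsinp_dcospE//; rewrite e0 in h; move: h.
  move: (pe (dsinp n) _) (pe (dsinp k) _) (pe (dcosp n) _) (pe (dcosp k) _) => a b c d.
  move=> h; apply/eqP; rewrite -subr_eq0; apply/eqP.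
  have -> : d * (a * (sin z / z) + c * cos z) - c * (b * (sin z / z) + d * cos z) =
    (a * d - b * c) * (sin z / z) by ring.
  by rewrite h mul0r.
have dc l : 0 < pe (dcosp l) (0 : R) by rewrite dcosp_at0 ltr0n muln_gt0 dfac_gt0.
(* For n = 0 one has [Phi 0 y = - (y * H 1 y)], so a factor y is cancelled first. If then k = 1, the
   orders agree and the signs decide. *)
case: n nk W0 key => [|n] nk W0 key.
  have E : - (pe (dcosp k) (0 : R) * H 1 0) = pe (dcosp 0) 0 * (0 ^+ k.-1 * Phi k 0).
    apply: (@eq_at0 R (fun y => - (pe (dcosp k) y * H 1 y))
      (fun y => pe (dcosp 0) y * (y ^+ k.-1 * Phi k y))).
    - by move=> y; apply: cvgN; apply: cvgM; [exact: pe_continuous | exact: H_continuous].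
    - move=> y; apply: cvgM; first exact: pe_continuous.
      by apply: cvgM; [exact: pow_continuous | exact: Phi_continuous].
    - move=> y y0; apply: (mulfI (lt0r_neq0 y0)).
      have := key y y0; rewrite expr0 mul1r {1}/Phi mul0r sub0r.
      have -> : y ^+ k = y * y ^+ k.-1 by rewrite -exprS prednK.
      move=> h.
      transitivity (pe (dcosp k) y * - (y * H 1 y)); first by ring.
      by rewrite h; ring.
  have := mulr_gt0 (dc k) (@H_at0_gt0 R 1).
  rewrite -oppr_lt0 E; case: k nk {W0 key E} => // -[|k] _.
    rewrite expr0 mul1r Phi_at0 mul1r ltNge => /negP; apply.
    by rewrite mulr_ge0 ?ltW ?H_at0_gt0.
  by rewrite exprS !mul0r mulr0 ltxx.
have E : pe (dcosp k) (0 : R) * Phi n.+1 0 = pe (dcosp n.+1) 0 * (0 ^+ (k - n.+1) * Phi k 0).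
  apply: (@eq_at0 R (fun y => pe (dcosp k) y * Phi n.+1 y)
      (fun y => pe (dcosp n.+1) y * (y ^+ (k - n.+1) * Phi k y))).
  - by move=> y; apply: cvgM; [exact: pe_continuous | exact: Phi_continuous].
  - move=> y; apply: cvgM; first exact: pe_continuous.
    by apply: cvgM; [exact: pow_continuous | exact: Phi_continuous].
  - move=> y y0; have yn : y ^+ n.+1 != 0 by rewrite expf_neq0// gt_eqF.
    apply: (mulfI yn); rewrite mulrCA key// -{1}(subnKC (ltnW nk)) exprD; ring.
move/eqP: E; rewrite -(prednK (n := k - n.+1)) ?subn_gt0// exprS !mul0r mulr0.
by rewrite Phi_at0 !mulf_eq0 pnatr_eq0 !gt_eqF ?H_at0_gt0.
Qed.

Lemma map_poly_complex (R : realType) (p : {poly rat}) (y : R) :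
  (map_poly ratr p).[y%:C] = (pe p y)%:C.
Proof.
rewrite /pe -horner_map /=; congr (_.[_]).
by rewrite -map_poly_comp; apply: eq_map_poly => x; rewrite /= ratr_complex.
Qed.

(* Eliminating [sin z / z] and [cos z] from the two equations shows that [z] is
   algebraic; then [exp (2 i z)] would be algebraic as well. *)
Lemma Phi_zeros_disjoint (R : realType) n k (y : R) : 0 < y ->
  Phi n y = 0 -> Phi k y = 0 -> n = k.
Proof.
move=> y0; wlog nk : n k / (n < k)%N.
  by move=> h h1 h2; case: (ltngtP n k) => // ? ; [|symmetry]; apply: h.
move=> hn hk; exfalso.
pose z := Num.sqrt y; have z0 : 0 < z by rewrite sqrtr_gt0.
have yz : y = z ^+ 2 by rewrite sqr_sqrtr// ltW.
have z1 : z != 0 by rewrite gt_eqF.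
have := dsinp_dcospE n z0; have := dsinp_dcospE k z0.
rewrite -yz hn hk !mulr0.
set u := pe (dsinp n) y; set v := pe (dcosp n) y.
set u' := pe (dsinp k) y; set v' := pe (dcosp k) y => e2 e1.
have sc := cos2Dsin2 z.
have w0 : u * v' - u' * v = 0.
  have a1 : (u * v' - u' * v) * sin z = 0.
    transitivity (z * (v' * (u * (sin z / z) + v * cos z) - v * (u' * (sin z / z) + v' * cos z))).
      by field.
    by rewrite -e1 -e2 !mulr0 subrr mulr0.
  have a2 : (u * v' - u' * v) * cos z = 0.
    transitivity (u * (u' * (sin z / z) + v' * cos z) - u' * (u * (sin z / z) + v * cos z)).
      by ring.
    by rewrite -e1 -e2 !mulr0 subrr.
  rewrite -[LHS]mulr1 -sc mulrDr !expr2 !mulrA a1 a2 !mul0r addr0//.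
pose W := dsinp n * dcosp k - dsinp k * dcosp n.
have W0 : W != 0 by exact: (wronskian_neq0 R).
(* The doubled argument gives exp(2 i z), and the polynomial [s2] recovers y = z^2 from the value 2
   i z. *)
pose t := 2%:R * z; have t0 : 0 < t by rewrite mulr_gt0.
pose s2 : {poly rat} := - (4%:R^-1) *: 'X^2.
have s2t (p : {poly rat}) : (map_poly ratr (p \Po s2)).[0 +i* t] = (pe p y)%:C.
  rewrite map_comp_poly horner_comp -map_poly_complex; congr (_.[_]).
  rewrite /s2 map_polyZ hornerZ map_polyXn hornerXn rmorphN /= fmorphV /= ratr_nat yz.
  apply: complex_ext.
    have -> : (0 +i* t) ^+ 2 = (- t ^+ 2)%:C.
      by apply: complex_ext; rewrite expr2 ?Re_mul ?Im_mul /= ?expr2; ring.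
    have -> : - 4%:R^-1 = (- 4%:R^-1)%:C :> R[i] by rewrite rmorphN fmorphV rmorph_nat.
    by rewrite Re_mul /= /t; field.
  have -> : (0 +i* t) ^+ 2 = (- t ^+ 2)%:C.
    by apply: complex_ext; rewrite expr2 ?Re_mul ?Im_mul /= ?expr2; ring.
  have -> : - 4%:R^-1 = (- 4%:R^-1)%:C :> R[i] by rewrite rmorphN fmorphV rmorph_nat.
  by rewrite Im_mul /=; ring.
have half : (map_poly ratr ((2%:R^-1 : rat) *: 'X)).[0 +i* t] = 0 +i* z.
  rewrite map_polyZ hornerZ map_polyX hornerX fmorphV /= ratr_nat.
  have -> : 2%:R^-1 = (2%:R^-1)%:C :> R[i] by rewrite fmorphV rmorph_nat.
  by apply: complex_ext; rewrite ?Re_mul ?Im_mul /= /t; field.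
have eU : (map_poly ratr ((dsinp n \Po s2) + ((2%:R^-1 : rat) *: 'X) * (dcosp n \Po s2))).[0 +i* t] =
    u%:C + (0 +i* z) * v%:C by rewrite rmorphD rmorphM /= hornerD hornerM !s2t half.
have eV : (map_poly ratr ((dsinp n \Po s2) - ((2%:R^-1 : rat) *: 'X) * (dcosp n \Po s2))).[0 +i* t] =
    u%:C - (0 +i* z) * v%:C by rewrite rmorphB rmorphM /= hornerD hornerN hornerM !s2t half.
apply: (@exp_not_ratio R t (W \Po s2)
  ((dsinp n \Po s2) + ((2%:R^-1 : rat) *: 'X) * (dcosp n \Po s2))
  ((dsinp n \Po s2) - ((2%:R^-1 : rat) *: 'X) * (dcosp n \Po s2))) => //.
- rewrite comp_poly_eq0//.
  by rewrite /s2 size_scale ?size_polyXn// oppr_eq0 invr_eq0 pnatr_eq0.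
- by rewrite s2t /W peB !peM -/u -/v -/u' -/v' w0.
(* Otherwise u = v = 0, which [cross_trec] excludes for y > 0. *)
- rewrite eU; apply/eqP => h.
  have := congr1 (@complex.Re R) h; have := congr1 (@complex.Im R) h.
  rewrite Im_add Re_add Re_mul Im_mul /= !mul0r !mulr0 subr0 !addr0 !add0r => /eqP.
  rewrite mulf_eq0 (negPf z1) /= => /eqP v0 u0.
  have := cross_trec n y; move: u0 v0; rewrite /u /v /dsinp /dcosp !peB !peZ !ratr_nat.
  move: (pe (sinp n) y) (pe (sinp n.+1) y) (pe (cosp n) y) (pe (cosp n.+1) y) => a b c d.
  move=> /eqP; rewrite subr_eq0 => /eqP <- /eqP; rewrite subr_eq0 => /eqP <-.
  have -> : a * (n%:R * c) - n%:R * a * c = 0 by ring.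
  by move/esym/eqP; rewrite oppr_eq0 expf_eq0 gt_eqF// andbF.
(* Because u sin z + z v cos z = 0, the number exp(i z) (u + i z v) is real; comparison with its
   conjugate gives exp(2 i z) (u + i z v) = u - i z v. *)
- rewrite eU eV.
  have e3 : u * sin z + z * v * cos z = 0.
    transitivity (z * (u * (sin z / z) + v * cos z)); first by field.
    by rewrite -e1 mulr0.
  have cs2 : cos z ^+ 2 = 1 - sin z ^+ 2 by rewrite -sc; ring.
  have st : sin t = 2%:R * (sin z * cos z) by rewrite /t mulr_natl mulr2n sinD; ring.
  have ct : cos t = 1 - 2%:R * sin z ^+ 2.
    rewrite /t mulr_natl mulr2n cosD -!expr2 cs2; ring.
  apply: complex_ext; rewrite ?Re_add ?Im_add !(Re_mul, Im_mul) /= mul1r st ct.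
    transitivity (u - 2%:R * sin z * (u * sin z + z * v * cos z)); first by ring.
    by rewrite e3; ring.
  transitivity (- (z * v) + 2%:R * cos z * (u * sin z + z * v * cos z) +
     2%:R * z * v * (1 - sin z ^+ 2 - cos z ^+ 2)); first by ring.
  by rewrite e3 cs2; ring.
Qed.

(** * Solid harmonics *)

Definition bpoly (R : realType) n : {poly R} := ('X^2 - 1) ^+ n.

Lemma bpoly_ode (R : realType) n :
  ('X^2 - 1) * (bpoly R n)^`() = (2 * n)%:R *: ('X * bpoly R n).
Proof.
rewrite /bpoly; case: n => [|n]; first by rewrite expr0 derivC mulr0 scale0r.
rewrite deriv_exp /= derivB derivXn derivC subr0 /= expr1 (exprS ('X^2 - 1)).
have -> : (2 * n.+1)%:R *: ('X * (('X^2 - 1) * ('X^2 - 1) ^+ n)) =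
    2%:R * n.+1%:R * ('X * (('X^2 - 1) * ('X^2 - 1) ^+ n)) :> {poly R}.
  by rewrite -mul_polyC natrM rmorphM /= !rmorph_nat.
move: (('X^2 - 1) ^+ n) => q.
have -> : 'X *+ 2 * q *+ n.+1 = 2%:R * n.+1%:R * ('X * q) :> {poly R}.
  by rewrite -(mulr_natl _ n.+1) -(mulr_natl 'X 2); ring.
ring.
Qed.

Lemma bpoly_coef1 (R : realType) n i :
  (('X^2 - 1) * (bpoly R n)^`())`_i.+1 =
  i%:R * (bpoly R n)`_i - i.+2%:R * (bpoly R n)`_i.+2.
Proof.
rewrite mulrBl mul1r coefB coef_deriv; congr (_ - _); last by rewrite mulr_natl.
rewrite coefXnM; case: i => [|i]; first by rewrite mul0r.
by rewrite !subSS subn0 /= coef_deriv mulr_natl.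
Qed.

Lemma bpoly_coefSS (R : realType) n i :
  i.+2%:R * (bpoly R n)`_i.+2 = (i%:R - (2 * n)%:R) * (bpoly R n)`_i.
Proof.
have := bpoly_coef1 R n i; rewrite bpoly_ode coefZ coefXM /= mulrBl => ->; ring.
Qed.

Lemma bpoly_odd (R : realType) n i : odd i -> (bpoly R n)`_i = 0.
Proof.
have c1 : (bpoly R n)`_1 = 0.
  have := congr1 (fun p : {poly R} => p`_0) (bpoly_ode R n).
  rewrite coefZ coefXM /= mulr0 mulrBl mul1r coefB coef_deriv coefXnM /=.
  by rewrite sub0r mulr1n => /eqP; rewrite oppr_eq0 => /eqP.
elim/ltn_ind: i => -[//|[//|i]] IH oi.
have := bpoly_coefSS R n i; rewrite (IH i)//; last by move: oi; rewrite /= negbK.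
by rewrite mulr0 => /eqP; rewrite mulf_eq0 pnatr_eq0 => /eqP.
Qed.

Definition lcoef (R : realType) n l i : R := ((legendre R n)^`(l))`_i.

Lemma lcoefE (R : realType) n l i :
  lcoef R n l i = (2%:R ^+ n * n`!%:R)^-1 * ((bpoly R n)`_(n + l + i) * ((n + l + i) ^_ (n + l))%:R).
Proof.
rewrite /lcoef /legendre derivnZ coefZ -/(bpoly R n) {1 2}/derivn -iterD -/(derivn _ _).
congr (_ * _); rewrite (addnC l n) coef_derivn.
by rewrite -[LHS]mulr_natr.
Qed.

(** Legendre's differential equation, differentiated l times and read off the coefficients. It is
    the cancellation that makes [solid_ab] harmonic. *)
Lemma lcoef_rec (R : realType) n l i : 
  i.+2%:R * i.+1%:R * lcoef R n l i.+2 =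
  - ((n%:R - l%:R - i%:R) * (n%:R + l%:R + i%:R + 1)) * lcoef R n l i.
Proof.
rewrite !lcoefE; set N := (n + l)%N; set c := (_ ^-1 : R).
have e1 : i.+2%:R * i.+1%:R * ((N + i.+2) ^_ N)%:R =
    (N + i).+2%:R * (N + i).+1%:R * ((N + i) ^_ N)%:R :> R.
  rewrite -!natrM; congr (_%:R).
  have h k : (((N + k) ^_ N) * k`! = (N + k)`!)%N.
    by have := @ffact_fact (N + k) N; rewrite leq_addr addKn => ->.
  apply/eqP; rewrite -(eqn_pmul2r (fact_gt0 i)); apply/eqP.
  transitivity ((N + i.+2) ^_ N * i.+2`!)%N; first by rewrite !factS; lia.
  by rewrite h -!mulnA h !addnS !factS; lia.
have := bpoly_coefSS R n (N + i); rewrite !addnS -!addnS.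
have -> : (N + i)%:R - (2 * n)%:R = - (n%:R - l%:R - i%:R) :> R.
  have -> : (2 * n)%:R = 2%:R * n%:R :> R by rewrite natrM.
  by rewrite /N !natrD; ring.
have e2 : (N + i).+1%:R = n%:R + l%:R + i%:R + 1 :> R by rewrite /N -natr1 !natrD.
rewrite addnS addnS => h.
transitivity (c * ((N + i).+2%:R * (bpoly R n)`_(N + i).+2) * ((N + i).+1%:R * ((N + i) ^_ N)%:R)).
  transitivity (c * (bpoly R n)`_(N + i).+2 * (i.+2%:R * i.+1%:R * ((N + i.+2) ^_ N)%:R)).
    by rewrite !addnS; ring.
  by rewrite e1; ring.
by rewrite h e2; ring.
Qed.

Lemma lcoef_odd (R : realType) n l i : odd (n + l + i) -> lcoef R n l i = 0.
Proof. by move=> h; rewrite lcoefE bpoly_odd// mul0r mulr0. Qed.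

Lemma lcoef_big (R : realType) n l i : (n < l + i)%N -> lcoef R n l i = 0.
Proof.
move=> h; rewrite lcoefE nth_default ?mul0r ?mulr0//.
rewrite /bpoly; apply: leq_trans (size_poly_exp_leq _ _) _.
have -> : size ('X^2 - 1 : {poly R}) = 3%N by rewrite size_XnsubC.
lia.
Qed.

Section smooth_calculus.
Variable R : realType.

Lemma sd0 j : sd j (0 : smooth R) = 0.
Proof. exact: raddf0. Qed.

Implicit Types f g u : smooth R.

Definition sdot f g : smooth R := \sum_j sd j f * sd j g.

Lemma sdXn j f n : sd j (f ^+ n.+1) = n.+1%:R * (f ^+ n * sd j f).
Proof.
elim: n => [|n IH]; first by rewrite !expr1 expr0; ring.
rewrite (exprS f n.+1) sdM IH (exprS f n) -(natr1 n.+1); ring.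
Qed.

Lemma eulM f g : eul (f * g) = f * eul g + g * eul f.
Proof. rewrite /eul !sum3 !sdM; ring. Qed.

Lemma eulD f g : eul (f + g) = eul f + eul g.
Proof. rewrite /eul !sum3 !sdD; ring. Qed.

Lemma eulC c : eul (sC c) = 0 :> smooth R.
Proof. by rewrite /eul !sum3 !sd_sC; ring. Qed.

Lemma lapM f g : lap (f * g) = f * lap g + g * lap f + 2%:R * sdot f g.
Proof. rewrite /lap /sdot !sum3 !sdM !sdD !sdM; ring. Qed.

Lemma lapD f g : lap (f + g) = lap f + lap g.
Proof. by rewrite /lap !sum3 !sdD; ring. Qed.

Lemma lapC c : lap (sC c) = 0 :> smooth R.
Proof. by rewrite /lap !sum3 !sd_sC !sd0; ring. Qed.

Lemma eul0 : eul (0 : smooth R) = 0.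
Proof. by rewrite /eul !sum3 !sd0 !mulr0 !addr0. Qed.

Lemma lap0 : lap (0 : smooth R) = 0.
Proof. by rewrite /lap !sum3 !sd0 !addr0. Qed.

Lemma eul_sum (I : Type) (s : seq I) (F : I -> smooth R) :
  eul (\sum_(i <- s) F i) = \sum_(i <- s) eul (F i).
Proof.
elim: s => [|i s IH]; last by rewrite !big_cons eulD IH.
by rewrite !big_nil eul0.
Qed.

Lemma lap_sum (I : Type) (s : seq I) (F : I -> smooth R) :
  lap (\sum_(i <- s) F i) = \sum_(i <- s) lap (F i).
Proof.
elim: s => [|i s IH]; last by rewrite !big_cons lapD IH.
by rewrite !big_nil lap0.
Qed.

Lemma eulZ c f : eul (sC c * f) = sC c * eul f.
Proof. by rewrite eulM eulC mulr0 addr0. Qed.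

Lemma lapZ c f : lap (sC c * f) = sC c * lap f.
Proof.
rewrite lapM lapC mulr0 addr0 /sdot big1 ?mulr0 ?addr0// => j _.
by rewrite sd_sC mul0r.
Qed.

Lemma eulXn f n : eul (f ^+ n.+1) = n.+1%:R * (f ^+ n * eul f).
Proof. by rewrite /eul !sum3 !sdXn; ring. Qed.

Lemma sdotC f g : sdot f g = sdot g f.
Proof. by apply: eq_bigr => j _; rewrite mulrC. Qed.

Lemma sdot_s2 f : sdot (s2 R) f = 2%:R * eul f.
Proof.
rewrite /sdot /eul /s2 !sum3 !sdD !expr2 !sdM !sdX3 !ord3_eqE !eqxx /=; ring.
Qed.

Lemma sdotXl f g n : sdot (f ^+ n.+1) g = n.+1%:R * f ^+ n * sdot f g.
Proof. by rewrite /sdot !sum3 !sdXn; ring. Qed.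

Lemma sdotMl f g u : sdot (f * g) u = f * sdot g u + g * sdot f u.
Proof. by rewrite /sdot !sum3 !sdM; ring. Qed.

Lemma eul_s2 : eul (s2 R) = 2%:R * s2 R.
Proof. rewrite /eul /s2 !sum3 !sdD !expr2 !sdM !sdX3 !ord3_eqE !eqxx /=; ring. Qed.

Lemma lap_s2 : lap (s2 R) = 6%:R.
Proof.
rewrite /lap /s2 !sum3 !sdD !expr2 !sdM !sdX3 !ord3_eqE !eqxx /= !(mulr0, mulr1, add0r, addr0).
by rewrite !sdD !sdX3 !eqxx /=; ring.
Qed.

Lemma eul_sX i : eul (sX R i) = sX R i.
Proof. by elim/ord3_ind: i; rewrite /eul !sum3 !sdX3 !ord3_eqE !eqxx /=; ring. Qed.

(* real and imaginary part of (x_1 + i x_2)^l *)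
Fixpoint cpow l : smooth R * smooth R :=
  if l is l'.+1 then
    (sX R 0 * (cpow l').1 - sX R 1 * (cpow l').2,
     sX R 0 * (cpow l').2 + sX R 1 * (cpow l').1)
  else (1, 0).

Lemma cpow_eul l : eul (cpow l).1 = l%:R * (cpow l).1 /\ eul (cpow l).2 = l%:R * (cpow l).2.
Proof.
elim: l => [|l [IH1 IH2]].
  by rewrite /= eul0 -(rmorph1 (@sC R)) eulC !mul0r.
have N f : eul (- f) = - eul f by rewrite -mulN1r -(rmorph1 (@sC R)) -rmorphN eulZ rmorphN rmorph1 mulN1r.
rewrite /= !eulD N !eulM !eul_sX IH1 IH2 -natr1; split; ring.
Qed.

Lemma cpow_cr l : [/\ sd 0 (cpow l).1 = sd 1 (cpow l).2, sd 1 (cpow l).1 = - sd 0 (cpow l).2,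
  sd 2%:R (cpow l).1 = 0 & sd 2%:R (cpow l).2 = 0].
Proof.
elim: l => [|l [h0 h1 h2 h3]]; first by rewrite /= !sd0 !sd1 oppr0.
rewrite /= !sdD !sdN !sdM !sdX3 !ord3_eqE !eqxx h0 h1 h2 h3 /=; split; ring.
Qed.

Lemma cpow_lap l : lap (cpow l).1 = 0 /\ lap (cpow l).2 = 0.
Proof.
have [h0 h1 h2 h3] := cpow_cr l.
rewrite /lap !sum3 h2 h3 !sd0 !addr0; split.
  by rewrite h0 h1 sdN sd_comm subrr.
have -> : sd 0 (cpow l).2 = - sd 1 (cpow l).1 by rewrite h1 opprK.
by rewrite -h0 sdN sd_comm addNr.
Qed.

Definition cpart l (b : bool) : smooth R := if b then (cpow l).1 else (cpow l).2.

Lemma eul_cpart l b : eul (cpart l b) = l%:R * cpart l b.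
Proof. by case: b; case: (cpow_eul l). Qed.

Lemma lap_cpart l b : lap (cpart l b) = 0.
Proof. by case: b; case: (cpow_lap l). Qed.

Lemma sd2_cpart l b : sd 2%:R (cpart l b) = 0.
Proof. by case: b; case: (cpow_cr l). Qed.

Lemma cpartE l x :
  cpart l true x +i* cpart l false x = (coord x 0 +i* coord x 1) ^+ l.
Proof.
elim: l => [|l IH]; first by rewrite expr0.
have e1 : cpart l.+1 true x = coord x 0 * cpart l true x - coord x 1 * cpart l false x.
  by rewrite -!sXE.
have e2 : cpart l.+1 false x = coord x 0 * cpart l false x + coord x 1 * cpart l true x.
  by rewrite -!sXE.
rewrite exprS -IH e1 e2; apply: complex_ext.
  by rewrite Re_mul.
by rewrite Im_mul.
Qed.

Let Z := sX R 2%:R.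

Lemma sdot_Z f : sdot Z f = sd 2%:R f.
Proof. by rewrite /sdot !sum3 /Z !sdX3 !ord3_eqE !eqxx /=; ring. Qed.

Lemma lap_Z : lap Z = 0.
Proof. by rewrite /lap !sum3 /Z !sdX3 !ord3_eqE !eqxx /= !sd0 sd1; ring. Qed.

Lemma lap_Zn i : lap (Z ^+ i) = (i * i.-1)%:R * Z ^+ i.-2.
Proof.
case: i => [|[|i]]; first by rewrite expr0 -(rmorph1 (@sC R)) lapC mul0r.
  by rewrite expr1 lap_Z mul0r.
elim: i => [|i IH]; first by rewrite expr2 lapM lap_Z sdot_Z /Z sd_sX eqxx; ring.
rewrite exprS lapM IH lap_Z sdot_Z sdXn /Z sd_sX eqxx /= (exprS _ i) !natrM -!(natr1 i.+2) -!natr1; ring.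
Qed.

Lemma eul_Zn i : eul (Z ^+ i) = i%:R * Z ^+ i.
Proof.
case: i => [|i]; first by rewrite expr0 -(rmorph1 (@sC R)) eulC mul0r.
by rewrite eulXn /Z eul_sX exprSr.
Qed.

Lemma eul_s2n j : eul (s2 R ^+ j) = (2 * j)%:R * s2 R ^+ j.
Proof.
case: j => [|j]; first by rewrite expr0 -(rmorph1 (@sC R)) eulC mul0r.
rewrite eulXn eul_s2 exprSr natrM; ring.
Qed.

Lemma lap_s2n j : lap (s2 R ^+ j) = (2 * j * (2 * j + 1))%:R * s2 R ^+ j.-1.
Proof.
case: j => [|j]; first by rewrite expr0 -(rmorph1 (@sC R)) lapC mul0r.
elim: j => [|j IH]; first by rewrite expr1 lap_s2 expr0 mulr1.
rewrite exprS lapM IH lap_s2 sdotC sdotXl sdot_s2 eul_s2 /= (exprS _ j).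
rewrite !natrM !natrD !natrM -!(natr1 j.+1) -!natr1; ring.
Qed.

Lemma lap_term i j : lap (Z ^+ i * s2 R ^+ j) =
  (i * i.-1)%:R * (Z ^+ i.-2 * s2 R ^+ j) +
  (2 * j * (2 * i + 2 * j + 1))%:R * (Z ^+ i * s2 R ^+ j.-1).
Proof.
rewrite lapM lap_Zn lap_s2n; case: j => [|j].
  have -> : sdot (Z ^+ i) (s2 R ^+ 0) = 0.
    by rewrite /sdot big1// => j _; rewrite expr0 sd1 mulr0.
  rewrite !muln0 !mul0n; ring.
rewrite sdotC sdotXl sdot_s2 eul_Zn /= !natrM !natrD !natrM; ring.
Qed.

Lemma term_cpart l b i j : lap (Z ^+ i * s2 R ^+ j * cpart l b) =
  ((i * i.-1)%:R * (Z ^+ i.-2 * s2 R ^+ j) +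
  (2 * j * (2 * i + 2 * j + 1 + 2 * l))%:R * (Z ^+ i * s2 R ^+ j.-1)) * cpart l b.
Proof.
rewrite lapM lap_cpart lap_term mulr0 add0r sdotMl.
have -> : sdot (Z ^+ i) (cpart l b) = 0.
  case: i => [|i]; last by rewrite sdotXl sdot_Z sd2_cpart mulr0.
  by rewrite /sdot big1// => k _; rewrite expr0 sd1 mul0r.
case: j => [|j].
  have -> : sdot (s2 R ^+ 0) (cpart l b) = 0.
    by rewrite /sdot big1// => k _; rewrite expr0 sd1 mul0r.
  rewrite !muln0 !mul0n; ring.
rewrite sdotXl sdot_s2 eul_cpart /= !natrM !natrD !natrM; ring.
Qed.

(** Up to the choice of index this is |x|^n times [sph_harm], written as a polynomial: each power of
    cos t in the derivative of the Legendre polynomial is completed to degree n - l by powers of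
    |x|^2. The halving is exact where it matters, since coefficients with n - l - i odd vanish by
    [lcoef_odd]. *)
Definition solid_ab n l (b : bool) : smooth R :=
  \sum_(i < (n - l).+1) sC (lcoef R n l i) * (Z ^+ i * s2 R ^+ ((n - l - i)./2) * cpart l b).

Lemma eul_solid_ab n l b : (l <= n)%N -> eul (solid_ab n l b) = n%:R * solid_ab n l b.
Proof.
move=> ln; rewrite /solid_ab eul_sum mulr_sumr; apply: eq_bigr => i _.
have im : (i <= n - l)%N by rewrite -ltnS.
rewrite eulZ; case: (boolP (odd (n + l + i))) => hi.
  by rewrite lcoef_odd// rmorph0 !mul0r mulr0.
rewrite !eulM eul_cpart eul_s2n eul_Zn; set j := (_./2).
have -> : n%:R = l%:R + (2 * j)%:R + i%:R :> smooth R.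
  by rewrite -!natrD; congr (_%:R); rewrite /j; move: hi; lia.
ring.
Qed.

Lemma lap_solid_ab n l b : (l <= n)%N -> lap (solid_ab n l b) = 0.
Proof.
move=> ln; rewrite /solid_ab lap_sum; set m := (n - l)%N.
under eq_bigr do rewrite lapZ term_cpart mulrA mulrDr.
rewrite -mulr_suml; transitivity (0 * cpart l b); last by rewrite mul0r.
congr (_ * _); rewrite big_split /=.
pose F i : smooth R := sC (i%:R * i.-1%:R * lcoef R n l i) * (Z ^+ i.-2 * s2 R ^+ ((m - i)./2)).
have -> : \sum_(i < m.+1) sC (lcoef R n l i) * ((i * i.-1)%:R * (Z ^+ i.-2 * s2 R ^+ ((m - i)./2))) =
    \sum_(i < m.+1) F i.
  by apply: eq_bigr => i _; rewrite /F natrM !rmorphM /= !rmorph_nat; ring.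
(* After this shift the terms that come from differentiating the power of [Z] twice carry the same
   monomials as those that come from the power of |x|^2, and [lcoef_rec] cancels them. *)
have -> : \sum_(i < m.+1) F i = \sum_(i < m.+1) F i.+2.
  have f0 : F 0 = 0 by rewrite /F !mul0r rmorph0 mul0r.
  have f1 : F 1 = 0 by rewrite /F mulr0 mul0r rmorph0 mul0r.
  have fb i : (m < i)%N -> F i = 0.
    move=> mi; have nl : (n < l + i)%N by rewrite /m in mi; lia.
    by rewrite /F lcoef_big// mulr0 rmorph0 mul0r.
  transitivity (\sum_(i < m.+3) F i).
    by rewrite [RHS]big_ord_recr [in RHS]big_ord_recr /= (fb m.+1) // (fb m.+2) // !addr0.
  by rewrite 2!big_ord_recl /= f0 f1 !add0r.
rewrite -big_split big1// => i _ /=.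
have im : (i <= m)%N by rewrite -ltnS.
rewrite /F /= lcoef_rec; case: (boolP (odd (n + l + i))) => hi.
  by rewrite lcoef_odd// mulr0 rmorph0 !mul0r addr0.
case: (ltnP i m) => im'; last first.
  have -> : i = m :> nat by apply/eqP; rewrite eqn_leq im.
  rewrite subnn /= !muln0 !mul0n mul0r mulr0 addr0.
  have -> : n%:R - l%:R - m%:R = 0 :> R by rewrite /m natrB//; ring.
  by rewrite mul0r oppr0 mul0r rmorph0 mul0r.
have -> : (m - i.+2)./2 = ((m - i)./2).-1 by rewrite /m in im' *; lia.
set j := (m - i)./2.
have ej : (2 * j)%:R = n%:R - l%:R - i%:R :> R.
  have -> : (2 * j = n - l - i)%N by rewrite /j /m in im' hi *; lia.
  by rewrite !natrB// ltnW.
have -> : (2 * j * (2 * i + 2 * j + 1 + 2 * l))%:R =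
    sC ((n%:R - l%:R - i%:R) * (n%:R + l%:R + i%:R + 1)) :> smooth R.
  rewrite -(rmorph_nat (@sC R)); congr sC; rewrite natrM ej; congr (_ * _).
  have -> : (2 * i + 2 * j + 1 + 2 * l)%:R = 2%:R * i%:R + (2 * j)%:R + 1 + 2%:R * l%:R :> R.
    by rewrite (natrD _ _ (2 * l)) (natrD _ _ 1) (natrD _ (2 * i) (2 * j)) (natrM _ 2 i) (natrM _ 2 l).
  by rewrite ej; ring.
rewrite rmorphM rmorphN /=; ring.
Qed.

End smooth_calculus.

(** * Radial factors and separated eigenfunctions of the Laplacian *)

Section radial.
Variable R : realType.

Lemma Htower n : tower (fun k (y : R) => (- (2%:R^-1)) ^+ k * H (n + k) y).
Proof.
move=> k y; have d := is_deriveZ ((- (2%:R^-1)) ^+ k) (is_derive_H (n + k) y).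
apply: (is_derive_eq d); rewrite /GRing.scale /= addnS exprS; ring.
Qed.

Definition rad n (t : R) : smooth R := scomp (Htower n) 0 (sC t * s2 R).

Lemma radE n t x : rad n t x = H n (t * s2 R x).
Proof. by rewrite /rad scompE expr0 mul1r addn0 smfM sCE. Qed.

Lemma sd_s2 j : sd j (s2 R) = 2%:R * sX R j.
Proof.
rewrite /s2 !sum3 !sdD !expr2 !sdM.
by elim/ord3_ind: j; rewrite !sdX3 !ord3_eqE !eqxx /=; ring.
Qed.

Lemma sd_rad n t j : sd j (rad n t) = - (sC t * sX R j * rad n.+1 t).
Proof.
apply: smooth_ext => x; rewrite /rad sd_scomp sdM sd_sC sd_s2.
rewrite smfN !smfM smfD !smfM smf0 smf_nat !scompE !smfM sXE !sCE expr1 expr0 mul1r addn0 addn1.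
by field.
Qed.

Lemma rad_rec n t :
  sC t * s2 R * rad n.+2 t = (2 * n + 3)%:R * rad n.+1 t - rad n t.
Proof.
apply: smooth_ext => x; rewrite smfM smfD smfN !smfM smf_nat !radE sCE.
have := H_rec n (t * s2 R x); move=> h.
by apply/eqP; rewrite -subr_eq0 -h; apply/eqP; ring.
Qed.

Lemma eul_rad n t : eul (rad n t) = - (sC t * s2 R * rad n.+1 t).
Proof. rewrite /eul /s2 !sum3 !sd_rad; ring. Qed.

Lemma sdot_rad n t f : sdot (rad n t) f = - (sC t * rad n.+1 t * eul f).
Proof. rewrite /sdot /eul !sum3 !sd_rad; ring. Qed.

Lemma ang_rad a n t : ang a (rad n t) = 0.
Proof. rewrite /ang !sd_rad; ring. Qed.

Lemma lap_rad n t :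
  lap (rad n t) = - (3%:R * sC t * rad n.+1 t) + sC t * (sC t * s2 R * rad n.+2 t).
Proof.
rewrite /lap !sum3 !sd_rad !sdN !sdM !sd_rad !sd_sC !sdX3 !eqxx /= /s2 !sum3; ring.
Qed.

Definition solid n (k : int) : smooth R := solid_ab R n `|k|%N (0 <= k)%R.

Lemma eul_solid n k : (`|k| <= n)%N -> eul (solid n k) = n%:R * solid n k.
Proof. exact: eul_solid_ab. Qed.

Lemma lap_solid n k : (`|k| <= n)%N -> lap (solid n k) = 0.
Proof. exact: lap_solid_ab. Qed.

Definition gsol n (t : R) k : smooth R := rad n t * solid n k.

(** The radial factor of the radial derivative of [gsol]; on the sphere of radius r its value is
    [Phi n (t * r ^+ 2)], which expresses the Neumann condition. *)
Definition nfac n (t : R) : smooth R := n%:R * rad n t - sC t * s2 R * rad n.+1 t.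

Lemma nfacE n t x : nfac n t x = Phi n (t * s2 R x).
Proof. by rewrite /nfac smfD smfN !smfM smf_nat !radE sCE. Qed.

Lemma eul_gsol n t k : (`|k| <= n)%N -> eul (gsol n t k) = nfac n t * solid n k.
Proof. by move=> kn; rewrite /gsol eulM eul_solid// eul_rad /nfac; ring. Qed.

Lemma ang_nfac a n t : ang a (nfac n t) = 0.
Proof. by rewrite /nfac /ang !sdB !sdM !sd_nat !sd_sC !sd_s2 !sd_rad; ring. Qed.

Lemma lap_gsol n t k : (`|k| <= n)%N -> lap (gsol n t k) = - (sC t * gsol n t k).
Proof.
move=> kn; rewrite /gsol lapM lap_solid// sdot_rad eul_solid// lap_rad rad_rec.
rewrite natrD natrM; ring.
Qed.

Lemma s2E x : s2 R x = enorm x ^+ 2.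
Proof. by rewrite enorm_sqr /s2 sum3 !smfD !smfX !sXE. Qed.

Lemma solidE n k x : (`|k| <= n)%N -> enorm x != 0 ->
  enorm x ^+ n * sph_harm n k (x.1.1 / enorm x, x.1.2 / enorm x, x.2 / enorm x) = solid n k x.
Proof.
move=> kn; set s := enorm x => s0; rewrite /sph_harm /=; set l := `|k|%N.
have -> : (x.1.1 / s +i* (x.1.2 / s)) ^+ l = (s^-1 ^+ l)%:C * (coord x 0 +i* coord x 1) ^+ l.
  rewrite rmorphXn -exprMn; congr (_ ^+ _).
  by apply: complex_ext; rewrite ?Re_mul ?Im_mul /= /coord /tnth /=; ring.
rewrite -cpartE.
have -> : (if (0 <= k)%R
   then complex.Re ((s^-1 ^+ l)%:C * (cpart R l true x +i* cpart R l false x))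
   else complex.Im ((s^-1 ^+ l)%:C * (cpart R l true x +i* cpart R l false x))) =
   s^-1 ^+ l * cpart R l (0 <= k)%R x.
  by case: ifP => _; rewrite ?Re_mul ?Im_mul /=; ring.
rewrite (@horner_coef_wide _ (n - l).+1); last first.
  by apply/leq_sizeP => j hj; apply: (@lcoef_big R n l j); rewrite /l in hj *; lia.
rewrite /solid /solid_ab smf_sum mulr_suml mulr_sumr; apply: eq_bigr => i _.
rewrite !smfM !smfX sXE sCE s2E -/s -/l -[in LHS]/(lcoef R n l i).
have im : (i <= n - l)%N by rewrite -ltnS.
case: (boolP (odd (n + l + i))) => hi; first by rewrite lcoef_odd// !(mul0r, mulr0).
rewrite -exprM; set j := (_./2).
have -> : s ^+ n = s ^+ (2 * j) * s ^+ i * s ^+ l.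
  by rewrite -!exprD; congr (_ ^+ _); rewrite /j; move: hi; rewrite /l in im *; lia.
have -> : coord x 2%:R = x.2 by [].
rewrite !exprMn !exprVn.
by field; rewrite !expf_neq0.
Qed.

Lemma gpotE (r : R) alpha c n m k x : 0 < r -> 0 < alpha n m -> (`|k| <= n)%N -> 0 < enorm x ->
  gpot r alpha c n m k x =
  (sC (c n m k * (alpha n m / r) ^+ n) * gsol n ((alpha n m / r) ^+ 2) k) x.
Proof.
move=> r0 a0 kn s0; rewrite /gpot.
have -> : alpha n m * enorm x / r = alpha n m / r * enorm x by ring.
rewrite psiE; last by rewrite mulr_gt0// divr_gt0.
by rewrite smfM sCE /gsol smfM radE s2E -solidE ?gt_eqF// !exprMn; ring.
Qed.

(** [gpot] divides by |x| and is compared with the smooth potential only away from the origin; the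
    derivative at [x] sees only points close to [x]. *)
Lemma pd_eq_off0 (f g : R3 R -> R) j x : (forall y, 0 < enorm y -> f y = g y) ->
  0 < enorm x -> pd j f x = pd j g x.
Proof.
move=> fg x0.
have near0 : \forall t \near (0 : R), f (t *: evec R j + x) = g (t *: evec R j + x).
  have cl : {for (0 : R), continuous (fun t : R => enorm (t *: evec R j + x))}.
    by apply: continuous_comp; [exact: line_continuous | exact: enorm_continuous].
  have /cl : nbhs (enorm ((0 : R) *: evec R j + x)) [set y | 0 < y].
    by rewrite scale0r add0r; apply: open_nbhs_nbhs; split; [exact: open_gt|].
  by move=> H; near=> t; apply/fg; near: t; exact: H.
Local Transparent pd.
rewrite /pd !derive_line; exact: near_eq_derive.
Unshelve. all: by end_near.
Qed.
Local Opaque pd.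

Lemma vb_radial (r : R) (h : R -> R) (h' : R -> R) (f : smooth R) :
  (forall y : R, is_derive y 1 h (h' y)) -> continuous h' -> h (r ^+ 2) = 0 ->
  (forall x, f x = h (s2 R x)) -> vb r f.
Proof.
move=> dh ch' hr fE.
have : compact (h' @` `[0, r ^+ 2]%classic).
  apply: continuous_compact; last exact: segment_compact.
  by apply: continuous_subspaceT.
move/compact_bounded => [M [_ hM]]; exists (M + 1) => x Bx.
have y0 : 0 <= s2 R x by rewrite s2E sqr_ge0.
have yr : s2 R x < r ^+ 2 by have := eta_gt0 Bx; rewrite etaE s2E subr_gt0.
have -> : bdist r x = r ^+ 2 - s2 R x by rewrite etaE s2E.
rewrite fE; move: (s2 R x) y0 yr => y y0 yr.
have [c] := MVT yr (fun t _ => dh t) (continuous_subspaceT (derivable_cont dh)).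
rewrite in_itv/= hr sub0r => /andP[c1 c2] e.
rewrite -normrN e normrM (ger0_norm (x := r ^+ 2 - y)); last by rewrite subr_ge0 ltW.
apply: ler_wpM2r; first by rewrite subr_ge0 ltW.
apply: (hM (M + 1)); first by rewrite ltrDl.
exists c => //=; rewrite in_itv/=; apply/andP; split; last exact: ltW.
by apply: ltW; exact: le_lt_trans c1.
Qed.

Lemma vb_nfac (r t : R) n : Phi n (t * r ^+ 2) = 0 -> vb r (nfac n t).
Proof.
move=> h0; have dt (y : R) : is_derive y 1 (fun y : R => t * y) t.
  apply: (is_derive_eq (is_deriveZ t (is_derive_id y 1))).
  by rewrite /GRing.scale /= mulr1.
apply: (@vb_radial r (fun y => Phi n (t * y)) (fun y => Phi1 n (t * y) * t)) => //.
- move=> y; exact: (@is_derive1_comp R (Phi n) (fun y => t * y) y _ _ (is_derive_Phi n _) (dt y)).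
- move=> y; apply: cvgM; last exact: cvg_cst.
  apply: (@continuous_comp _ _ _ (fun y : R => t * y) (@Phi1 R n)).
    by apply: cvgM; [exact: cvg_cst | exact: cvg_id].
  exact: (derivable_cont (@is_derive_Phi1 R n)).
- by move=> x; rewrite nfacE.
Qed.

Lemma vb_rad (r t : R) n : H n (t * r ^+ 2) = 0 -> vb r (rad n t).
Proof.
move=> h0; have dt (y : R) : is_derive y 1 (fun y : R => t * y) t.
  apply: (is_derive_eq (is_deriveZ t (is_derive_id y 1))).
  by rewrite /GRing.scale /= mulr1.
apply: (@vb_radial r (fun y => H n (t * y)) (fun y => (- (2%:R^-1) * H n.+1 (t * y)) * t)) => //.
- move=> y; exact: (@is_derive1_comp R (H n) (fun y => t * y) y _ _ (is_derive_H n _) (dt y)).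
- move=> y; apply: cvgM; last exact: cvg_cst.
  apply: cvgM; first exact: cvg_cst.
  apply: (@continuous_comp _ _ _ (fun y : R => t * y) (@H R n.+1)).
    by apply: cvgM; [exact: cvg_cst | exact: cvg_id].
  exact: H_continuous.
- by move=> x; rewrite radE.
Qed.

(* The boundary conditions of the a priori estimate [neumann_D3]. *)
Definition neumann3 (r : R) (u : smooth R) : Prop :=
  [/\ vb r (eul u), forall a, vb r (ang a (eul u)) &
      forall a b, vb r (ang b (ang a (eul u)))].

Lemma angD a (f g : smooth R) : ang a (f + g) = ang a f + ang a g.
Proof. rewrite /ang !sdD; ring. Qed.

Lemma angC a c : ang a (sC c : smooth R) = 0.
Proof. by rewrite /ang !sd_sC; ring. Qed.

Lemma neumann3D r u v : neumann3 r u -> neumann3 r v -> neumann3 r (u + v).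
Proof.
move=> [u1 u2 u3] [v1 v2 v3]; split; rewrite eulD; first exact: vbD.
  by move=> a; rewrite angD; exact: vbD.
by move=> a b; rewrite (angD a) (angD b); exact: vbD.
Qed.

Lemma neumann3Z r c u : neumann3 r u -> neumann3 r (sC c * u).
Proof.
move=> [u1 u2 u3]; split; rewrite eulZ; first exact: vbM.
  by move=> a; rewrite angM angC mulr0 addr0; exact: vbM.
by move=> a b; rewrite (angM a) angC mulr0 addr0 angM angC mulr0 addr0; exact: vbM.
Qed.

Lemma neumann3_0 r : neumann3 r 0.
Proof.
have a0 a : ang a (0 : smooth R) = 0 by rewrite -(rmorph0 (@sC R)) angC rmorph0.
by split; rewrite eul0; [exact: vb0 | move=> a; rewrite a0; exact: vb0 |
  move=> a b; rewrite !a0; exact: vb0].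
Qed.

Lemma neumann3_gsol r t n k : (`|k| <= n)%N -> Phi n (t * r ^+ 2) = 0 ->
  neumann3 r (gsol n t k).
Proof.
move=> kn h0; have vn := vb_nfac h0; split; rewrite eul_gsol//; first exact: vbMr.
  by move=> a; rewrite angM ang_nfac mulr0 addr0; exact: vbMr.
by move=> a b; rewrite angM ang_nfac mulr0 addr0 angM ang_nfac mulr0 addr0; exact: vbMr.
Qed.

End radial.

(** * Square-integrable functions and orthogonal expansions *)

Lemma ae_mono (R : realType) (P Q : R3 R -> Prop) : (forall x, P x -> Q x) ->
  {ae @leb3 R, forall x, P x} -> {ae @leb3 R, forall x, Q x}.
Proof. by move=> PQ; apply: negligibleS => x /= nQ Px; apply/nQ/PQ. Qed.

Lemma ae_conj (R : realType) (P Q : R3 R -> Prop) : {ae @leb3 R, forall x, P x} ->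
  {ae @leb3 R, forall x, Q x} -> {ae @leb3 R, forall x, P x /\ Q x}.
Proof.
move=> hP hQ; apply: negligibleS (negligibleU hP hQ) => x /= /not_andP[] h.
  by left.
by right.
Qed.

Lemma ae_triv (R : realType) (P : R3 R -> Prop) : (forall x, P x) -> {ae @leb3 R, forall x, P x}.
Proof. by move=> h; apply: negligibleS (@negligible_set0 _ _ _ (@leb3 R)) => x /=. Qed.

Lemma rint_ae (R : realType) (r : R) (f g : R3 R -> R) : mfb r f -> mfb r g ->
  ae_eq_ball r f g -> rint r f = rint r g.
Proof.
move=> mf mg fg; rewrite /rint /Rintegral; congr fine.
apply: ae_eq_integral => //; first by apply/measurable_EFinP.
  by apply/measurable_EFinP.
by apply: ae_mono fg => x h Bx; rewrite h.
Qed.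

Lemma bint_ge0_fin (R : realType) (r M : R) (f : R3 R -> R) : mfb r f ->
  (forall x, eball r x -> 0 <= f x) ->
  (\int[@leb3 R]_(x in eball r) (f x)%:E <= M%:E)%E -> bint r f /\ rint r f <= M.
Proof.
move=> mf f0 fM.
have i0 : (0 <= \int[@leb3 R]_(x in eball r) (f x)%:E)%E.
  by apply: integral_ge0 => x Bx; rewrite lee_fin f0.
have E : (\int[@leb3 R]_(x in eball r) `|(EFin \o f) x| =
    \int[@leb3 R]_(x in eball r) (f x)%:E)%E.
  by apply: eq_integral => x; rewrite inE => Bx /=; rewrite ger0_norm ?f0.
split.
  apply/integrableP; split; first by apply/measurable_EFinP.
  by rewrite E; apply: le_lt_trans fM _; rewrite ltry.
rewrite /rint /Rintegral -lee_fin fineK//.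
by rewrite ge0_fin_numE//; apply: le_lt_trans fM _; rewrite ltry.
Qed.

Lemma rint_sqr_eq0 (R : realType) (r : R) (f : R3 R -> R) : rL2 r f ->
  rint r (fun x => f x ^+ 2) = 0 -> ae_eq_ball r f (fun=> 0).
Proof.
move=> [mf if2] f0.
have mf2 : measurable_fun (eball r : set (M3 R)) (EFin \o (fun x => f x ^+ 2)).
  by apply/measurable_EFinP; apply: measurable_funX.
have := @ae_eq_integral_abs _ _ _ (@leb3 R) (eball r) (measurable_eball r) _ mf2.
case=> [+ _]; have -> : (\int[@leb3 R]_(x in eball r) `|(EFin \o (fun x => (f x ^+ 2)%R)) x| = 0)%E.
  have fin : (\int[@leb3 R]_(x in eball r) (f x ^+ 2)%:E)%E \is a fin_num.
    exact: integrable_fin_num.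
  rewrite -[RHS]/(0%R%:E) -f0 /rint /Rintegral fineK//.
  by apply: eq_integral => x _ /=; rewrite ger0_norm ?sqr_ge0.
move=> /(_ erefl); apply: ae_mono => x h Bx; have := h Bx => -[/eqP].
by rewrite sqrf_eq0 => /eqP.
Qed.

Lemma rint_CS (R : realType) (r : R) (f g : R3 R -> R) : rL2 r f -> rL2 r g ->
  rint r (fun x => f x * g x) ^+ 2 <= rint r (fun x => f x ^+ 2) * rint r (fun x => g x ^+ 2).
Proof.
move=> hf hg; set a := rint r (fun x => f x ^+ 2); set b := rint r _; set c := rint r _.
have quad t : 0 <= t ^+ 2 * a + 2%:R * t * b + c.
  have -> : t ^+ 2 * a + 2%:R * t * b + c =
      rint r (fun x => (t * f x + g x) ^+ 2).
    rewrite /a /b /c -rintZ; last exact: hf.2.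
    rewrite -rintZ; last exact: rL2M.
    rewrite -rintD; [|apply: bintZ; exact: hf.2|apply: bintZ; exact: rL2M].
    rewrite -rintD; last 2 first.
    - by apply: bintD; apply: bintZ; [exact: hf.2 | exact: rL2M].
    - exact: hg.2.
    by apply: eq_rint => x _; ring.
  by apply: rint_ge0 => x _; exact: sqr_ge0.
have a0 : 0 <= a by apply: rint_ge0 => x _; exact: sqr_ge0.
move: a0; rewrite le_eqVlt => /orP[/eqP a0|a0].
  (* In the degenerate case a = 0 the quadratic is linear, and this value of [t] would give it the
     value -1 unless b = 0. *)
  have := quad (- (c + 1) / (2%:R * b)); rewrite -a0 mulr0 add0r mul0r.
  case: (eqVneq b 0) => [-> _|b0]; first by rewrite expr0n.
  have -> : 2%:R * (- (c + 1) / (2%:R * b)) * b + c = - 1 by field; rewrite b0.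
  by rewrite leNgt oppr_lt0 ltr01.
have := quad (- b / a).
have -> : (- b / a) ^+ 2 * a + 2%:R * (- b / a) * b + c = (a * c - b ^+ 2) / a.
  by field; rewrite gt_eqF.
by rewrite pmulr_lge0 ?invr_gt0// subr_ge0.
Qed.

Lemma sqrD_le (R : realType) (a b : R) : (a + b) ^+ 2 <= 2%:R * a ^+ 2 + 2%:R * b ^+ 2.
Proof. by have := sqr_ge0 (a - b); rewrite !expr2; lra. Qed.

Lemma rint_sqrD_le (R : realType) (r : R) (f g h : R3 R -> R) : rL2 r f -> rL2 r g -> rL2 r h ->
  rint r (fun x => (f x - h x) ^+ 2) <=
  2%:R * rint r (fun x => (f x - g x) ^+ 2) + 2%:R * rint r (fun x => (g x - h x) ^+ 2).
Proof.
move=> hf hg hh.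
have i1 := (rL2B hf hg).2; have i2 := (rL2B hg hh).2; have i3 := (rL2B hf hh).2.
rewrite -!rintZ// -rintD; [|exact: bintZ..].
apply: le_rint => //; first by apply: bintD; exact: bintZ.
move=> x _; apply: le_trans (sqrD_le _ _).
by rewrite addrA subrK lexx.
Qed.

(** * Completeness of the square-integrable functions *)

Lemma geometric_cauchy (R : realType) (u : nat -> R) (c : R) : 0 <= c ->
  (forall k, `|u k.+1 - u k| <= c * 2%:R^-1 ^+ k) ->
  exists l, u @ \oo --> l /\ forall k, `|u k - l| <= 2%:R * c * 2%:R^-1 ^+ k.
Proof.
(* [p k] is the tail of the geometric series, so [u - p] increases, [u + p] decreases, and the limit
   lies between them. *)
move=> c0 hu; pose p k : R := 2%:R * c * 2%:R^-1 ^+ k.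
have pS k : p k = p k.+1 + c * 2%:R^-1 ^+ k.
  by rewrite /p exprS; field.
have p0 k : 0 <= p k by rewrite !mulr_ge0// exprn_ge0// invr_ge0.
have pc : p @ \oo --> 0.
  have -> : 0 = 2%:R * c * 0 :> R by rewrite mulr0.
  apply: cvgM; first exact: cvg_cst.
  by apply: cvg_expr; rewrite ger0_norm ?invr_ge0// invf_lt1// ltr1n.
pose a k := u k - p k; pose b k := u k + p k.
have and_ : nondecreasing_seq a.
  apply/nondecreasing_seqP => k; rewrite /a (pS k).
  by have := hu k; rewrite ler_norml => /andP[]; lra.
have bni : nonincreasing_seq b.
  apply/nonincreasing_seqP => k; rewrite /b (pS k).
  by have := hu k; rewrite ler_norml => /andP[]; lra.
have ab k m : a k <= b m.
  apply: le_trans (_ : a (k + m)%N <= _); first by apply: and_; exact: leq_addr.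
  apply: le_trans (_ : b (k + m)%N <= _); last by apply: bni; exact: leq_addl.
  by rewrite /a /b; have := p0 (k + m)%N; lra.
have ca : cvgn a.
  by apply: nondecreasing_is_cvgn => //; exists (b 0) => _ [k _ <-].
pose l := limn a.
have al k : a k <= l by apply: nondecreasing_cvgn_le.
have lb k : l <= b k by apply: limr_le => //; apply: nearW => m; exact: ab.
exists l; split; last first.
  by move=> k; rewrite ler_norml -/(p k); have := al k; have := lb k; rewrite /a /b; lra.
have -> : u = (fun k => a k + p k) by apply/funext => k; rewrite /a subrK.
by rewrite -[l]addr0; apply: cvgD.
Qed.

Lemma half_sum_le (R : realType) n : \sum_(0 <= k < n) (2%:R^-1 ^+ k) <= 2%:R :> R.
Proof.
have -> : \sum_(0 <= k < n) (2%:R^-1 ^+ k) = 2%:R - 2%:R * 2%:R^-1 ^+ n :> R.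
  elim: n => [|n IH]; first by rewrite big_geq// expr0; ring.
  by rewrite big_nat_recr//= IH exprS; field.
by rewrite gerBl mulr_ge0// exprn_ge0// invr_ge0.
Qed.

(** The weight 4^k in [V] meets two demands: the integral of [V] is at most the sum of 4^k 8^-k =
    2^-k, hence finite, and where [V] is finite the increments are at most the square root of [V]
    times 2^-k, hence summable. *)
Lemma rL2_complete_fast (R : realType) (r : R) (F : nat -> R3 R -> R) :
  (forall k, rL2 r (F k)) ->
  (forall k, rint r (fun x => (F k.+1 x - F k x) ^+ 2) <= 8%:R^-1 ^+ k) ->
  exists2 f, rL2 r f & rint r (fun x => (F k x - f x) ^+ 2) @[k --> \oo] --> 0.
Proof.
move=> hF hd.
pose g k x : R := 4%:R ^+ k * (F k.+1 x - F k x) ^+ 2.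
have g0 k x : 0 <= g k x by rewrite /g; apply: mulr_ge0; [exact: exprn_ge0 | exact: sqr_ge0].
have ig k : bint r (g k) by apply: bintZ; exact: (rL2B (hF k.+1) (hF k)).2.
pose V x := (\sum_(k <oo) (g k x)%:E)%E.
have V0 x : (0 <= V x)%E by apply: nneseries_ge0 => k _ _; rewrite lee_fin.
have mV : measurable_fun (eball r : set (M3 R)) V.
  apply: ge0_emeasurable_sum => k; first by move=> x _ _; rewrite lee_fin.
  by move=> _; apply/measurable_EFinP; exact: bint_mfb (ig k).
have IV : (\int[@leb3 R]_(x in eball r) V x <= 2%:E)%E.
  rewrite integral_nneseries//; last 2 first.
  - by move=> k; apply/measurable_EFinP; exact: bint_mfb (ig k).
  - by move=> k x _; rewrite lee_fin.
  apply: lime_le.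
    by apply: is_cvg_nneseries => k _ _; apply: integral_ge0 => x _; rewrite lee_fin.
  apply: nearW => n; apply: (@le_trans _ _ (\sum_(0 <= k < n) (2%:R^-1 ^+ k)%:E)%E).
    apply: lee_sum => k _.
    have fin : (\int[@leb3 R]_(x in eball r) (g k x)%:E)%E \is a fin_num.
      by apply: integrable_fin_num => //; exact: ig.
    rewrite -(fineK fin) lee_fin -[fine _]/(rint r (g k)) /g rintZ; last first.
      exact: (rL2B (hF k.+1) (hF k)).2.
    apply: le_trans (ler_wpM2l _ (hd k)) _; first by rewrite exprn_ge0.
    rewrite -exprMn le_eqVlt; apply/orP; left; apply/eqP; congr (_ ^+ _); by field.
  by rewrite sumEFin lee_fin half_sum_le.
have iV : (@leb3 R).-integrable (eball r) V.
  apply/integrableP; split=> //.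
  have -> : (\int[@leb3 R]_(x in eball r) `|V x| = \int[@leb3 R]_(x in eball r) V x)%E.
    by apply: eq_integral => x _; rewrite gee0_abs.
  by apply: le_lt_trans IV _; rewrite ltry.
have aeV := integrable_ae (measurable_eball r) iV.
(* On the null set where [V] is infinite the sequence is replaced by 0, so that it converges at
   every point of the ball and its limit is measurable. *)
pose G k x := if V x \is a fin_num then F k x else 0.
have mG k : mfb r (G k).
  apply: measurable_fun_if => //.
  - apply: (measurable_fun_bool true) => /=.
    by have := emeasurable_fin_num (measurable_eball r) mV.
  - by apply: measurable_funS (hF k).1 => //; exact: subIsetl.
have gV k x : V x \is a fin_num -> g k x <= fine (V x).
  move=> Vx; rewrite -lee_fin fineK//.
  apply: le_trans (@nneseries_lim_ge R (fun k => (g k x)%:E) predT 0%N k.+1 _); last first.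
    by move=> i _ _; rewrite lee_fin.
  by rewrite big_nat_recr//= leeDr// sume_ge0// => i _; rewrite lee_fin.
have step k x : `|G k.+1 x - G k x| <= Num.sqrt (fine (V x)) * 2%:R^-1 ^+ k.
  rewrite /G; case: ifP => Vx; last by rewrite subrr normr0 mulr_ge0 ?exprn_ge0 ?invr_ge0 ?sqrtr_ge0.
  rewrite -ler_sqr ?nnegrE// ?mulr_ge0 ?exprn_ge0 ?invr_ge0 ?sqrtr_ge0//.
  rewrite real_normK ?num_real// exprMn sqr_sqrtr; last by rewrite fine_ge0.
  have h := gV k x Vx; have p4 : 0 < 4%:R ^+ k :> R by rewrite exprn_gt0.
  have -> : (2%:R^-1 ^+ k) ^+ 2 = (4%:R ^+ k)^-1 :> R.
    by rewrite -exprM mulnC exprM -exprVn; congr (_ ^+ _); field.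
  by rewrite ler_pdivlMr// mulrC.
have lim x : exists l, G k x @[k --> \oo] --> l /\
    forall k, `|G k x - l| <= 2%:R * Num.sqrt (fine (V x)) * 2%:R^-1 ^+ k.
  by apply: geometric_cauchy => [|k]; [exact: sqrtr_ge0 | exact: step].
have [f hf] : {f : R3 R -> R & forall x, G k x @[k --> \oo] --> f x /\
    forall k, `|G k x - f x| <= 2%:R * Num.sqrt (fine (V x)) * 2%:R^-1 ^+ k} := choice lim.
have mf : mfb r f.
  apply/measurable_EFinP; apply: (emeasurable_fun_cvg (fun k x => (G k x)%:E)) => //.
    by move=> k; apply/measurable_EFinP; exact: mG.
  by move=> x _; apply: cvg_EFin; [exact: nearW | exact: (hf x).1].
have key k : bint r (fun x => (G k x - f x) ^+ 2) /\
    rint r (fun x => (G k x - f x) ^+ 2) <= 8%:R * 4%:R^-1 ^+ k.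
  apply: bint_ge0_fin.
  - by apply: measurable_funX; apply: measurable_funB; [exact: mG | exact: mf].
  - by move=> x _; exact: sqr_ge0.
  apply: (@le_trans _ _ (\int[@leb3 R]_(x in eball r) ((4%:R * 4%:R^-1 ^+ k)%:E * V x))%E).
    apply: ge0_le_integral => //.
    - by move=> x _; rewrite lee_fin sqr_ge0.
    - by apply/measurable_EFinP; apply: measurable_funX; apply: measurable_funB; [exact: mG | exact: mf].
    - by apply: emeasurable_funM => //; exact: measurable_cst.
    move=> x _; case: (boolP (V x \is a fin_num)) => Vx; last first.
      have G0 j : G j x = 0 by rewrite /G (negPf Vx).
      have f0 : f x = 0.
        have h := (hf x).1; have E : (fun k => G k x) = (fun=> 0) by apply/funext.
        by rewrite E in h; apply: (cvg_unique (@Rhausdorff R) h (cvg_cst 0)).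
      rewrite G0 f0 subrr expr0n /= mule_ge0// lee_fin mulr_ge0// exprn_ge0// invr_ge0//.
    rewrite -(fineK Vx) -EFinM lee_fin -real_normK ?num_real//.
    have h := (hf x).2 k; apply: le_trans (_ : (2%:R * Num.sqrt (fine (V x)) * 2%:R^-1 ^+ k) ^+ 2 <= _).
      by rewrite ler_sqr ?nnegrE// (le_trans _ h).
    rewrite !exprMn sqr_sqrtr; last by rewrite fine_ge0.
    have -> : (2%:R^-1 ^+ k) ^+ 2 = 4%:R^-1 ^+ k :> R.
      by rewrite -exprM mulnC exprM; congr (_ ^+ _); field.
    by rewrite le_eqVlt; apply/orP; left; apply/eqP; ring.
  rewrite ge0_integralZl//; try by rewrite lee_fin mulr_ge0// exprn_ge0// invr_ge0.
  apply: (@le_trans _ _ ((4%:R * 4%:R^-1 ^+ k)%:E * 2%:E)%E).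
    by apply: lee_wpmul2l => //; rewrite lee_fin mulr_ge0// exprn_ge0// invr_ge0.
  by rewrite -EFinM lee_fin le_eqVlt; apply/orP; left; apply/eqP; ring.
have hG k : rL2 r (G k).
  split; first exact: mG.
  apply: bint_le (hF k).2 _; first by apply: measurable_funX; exact: mG.
  by move=> x _; rewrite /G; case: ifP => _; rewrite ger0_norm ?sqr_ge0// expr0n /= sqr_ge0.
have hGf : rL2 r (fun x => G 0%N x - f x).
  by split; [apply: measurable_funB; [exact: mG | exact: mf] | exact: (key 0%N).1].
have hf2 : rL2 r f.
  have := rL2B (hG 0%N) hGf; congr (rL2 r _); apply/funext => x; ring.
exists f => //.
have E k : rint r (fun x => (F k x - f x) ^+ 2) = rint r (fun x => (G k x - f x) ^+ 2).
  apply: rint_ae.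
  - by apply: measurable_funX; apply: measurable_funB; [exact: (hF k).1 | exact: mf].
  - by apply: measurable_funX; apply: measurable_funB; [exact: mG | exact: mf].
  by apply: ae_mono aeV => x h Bx; rewrite /G h.
apply: (@squeeze_cvgr _ _ _ _ (fun=> 0) (fun k => 8%:R * 4%:R^-1 ^+ k)).
- apply: nearW => k; rewrite E (key k).2 andbT.
  by apply: rint_ge0 => x _; exact: sqr_ge0.
- exact: cvg_cst.
- have -> : 0 = 8%:R * 0 :> R by rewrite mulr0.
  apply: cvgM; first exact: cvg_cst.
  by apply: cvg_expr; rewrite ger0_norm ?invr_ge0// invf_lt1// ltr1n.
Qed.

Definition l2cvg (R : realType) (r : R) (F : nat -> R3 R -> R) (f : R3 R -> R) : Prop :=
  [/\ forall n, rL2 r (F n), rL2 r f &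
      rint r (fun x => (F n x - f x) ^+ 2) @[n --> \oo] --> 0].

Lemma rL2_complete (R : realType) (r : R) (F : nat -> R3 R -> R) : (forall n, rL2 r (F n)) ->
  (forall e, 0 < e -> exists N, forall n m, (N <= n)%N -> (N <= m)%N ->
     rint r (fun x => (F n x - F m x) ^+ 2) <= e) ->
  exists f, l2cvg r F f.
Proof.
move=> hF cF.
have e8 k : 0 < 8%:R^-1 ^+ k :> R by rewrite exprn_gt0// invr_gt0.
have [N hN] := choice (fun k => cF _ (e8 k)).
(* Partial sums make the indices of the subsequence nondecreasing, at least [N k] and at least
   [k]. *)
pose M k := (\sum_(i < k.+1) (N i).+1)%N.
have MN k : (N k <= M k)%N by rewrite /M big_ord_recr /= (leq_trans (leqnSn _))// leq_addl.
have MS k : (M k <= M k.+1)%N by rewrite {2}/M big_ord_recr /= leq_addr.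
have kM k : (k <= M k)%N.
  elim: k => // k IH; rewrite /M big_ord_recr /= -/(M k).
  by rewrite addnS ltnS (leq_trans IH)// leq_addr.
have [f hf cf] : exists2 f, rL2 r f & rint r (fun x => (F (M k) x - f x) ^+ 2) @[k --> \oo] --> 0.
  apply: rL2_complete_fast => // k; apply: hN => //.
  exact: leq_trans (MN k) (MS k).
exists f; split=> //; apply/cvgrPdist_le => e e0.
have e4 : 0 < e / 4%:R by rewrite divr_gt0.
have [N0 hN0] := cF _ e4.
have /cvgrPdist_le/(_ _ e4)[N1 _ hN1] := cf.
pose k := (N0 + N1)%N.
near=> n.
have nN : (N0 <= n)%N by near: n; exists N0.
have h1 : rint r (fun x => (F n x - F (M k) x) ^+ 2) <= e / 4%:R.
  by apply: hN0 => //; apply: leq_trans (kM k); exact: leq_addr.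
have h2 : rint r (fun x => (F (M k) x - f x) ^+ 2) <= e / 4%:R.
  have := hN1 k (leq_addl _ _); rewrite /= sub0r normrN ger0_norm//.
  by apply: rint_ge0 => x _; exact: sqr_ge0.
rewrite sub0r normrN ger0_norm; last by apply: rint_ge0 => x _; exact: sqr_ge0.
apply: le_trans (rint_sqrD_le (hF n) (hF (M k)) hf) _; lra.
Unshelve. all: by end_near.
Qed.

(** * Rules for convergence in the quadratic mean *)

Section l2cvg_theory.
Variables (R : realType) (r : R).
Implicit Types (f g : R3 R -> R) (F G : nat -> R3 R -> R).

Lemma eq_l2cvg F G f g : (forall n x, eball r x -> F n x = G n x) ->
  (forall n, rL2 r (G n)) -> rL2 r g -> (forall x, eball r x -> f x = g x) ->
  l2cvg r F f -> l2cvg r G g.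
Proof.
move=> FG hG hg fg [_ _ c]; split=> //.
have -> : (fun n => rint r (fun x => (G n x - g x) ^+ 2)) =
    (fun n => rint r (fun x => (F n x - f x) ^+ 2)) => //.
by apply/funext => n; apply: eq_rint => x Bx; rewrite FG// fg.
Qed.

Lemma l2cvg_cst f : rL2 r f -> l2cvg r (fun=> f) f.
Proof.
move=> hf; split=> //.
have -> : (fun n : nat => rint r (fun x => (f x - f x) ^+ 2)) = fun=> 0.
  apply/funext => n; rewrite -[RHS](rint0 r); apply: eq_rint => x _.
  by rewrite subrr expr0n.
exact: cvg_cst.
Qed.

Lemma l2cvgD F G f g : l2cvg r F f -> l2cvg r G g ->
  l2cvg r (fun n x => F n x + G n x) (fun x => f x + g x).
Proof.
move=> [hF hf cF] [hG hg cG]; split.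
- by move=> n; exact: rL2D.
- exact: rL2D.
apply: (@squeeze_cvgr _ _ _ _ (fun=> 0) (fun n =>
  2%:R * rint r (fun x => (F n x - f x) ^+ 2) + 2%:R * rint r (fun x => (G n x - g x) ^+ 2))).
- apply: nearW => n; apply/andP; split; first by apply: rint_ge0 => x _; exact: sqr_ge0.
  have i1 := (rL2B (hF n) hf).2; have i2 := (rL2B (hG n) hg).2.
  rewrite -!rintZ// -rintD; [|exact: bintZ..].
  apply: le_rint.
  + exact: (rL2B (rL2D (hF n) (hG n)) (rL2D hf hg)).2.
  + by apply: bintD; exact: bintZ.
  + by move=> x _; rewrite opprD addrACA; exact: sqrD_le.
- exact: cvg_cst.
- have -> : 0 = 2%:R * 0 + 2%:R * 0 :> R by rewrite mulr0 addr0.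
  by apply: cvgD; apply: cvgM => //; exact: cvg_cst.
Qed.

Lemma l2cvgZ c F f : l2cvg r F f -> l2cvg r (fun n x => c * F n x) (fun x => c * f x).
Proof.
move=> [hF hf cF]; split; [by move=> n; exact: rL2Z | exact: rL2Z |].
have -> : (fun n => rint r (fun x => (c * F n x - c * f x) ^+ 2)) =
    (fun n => c ^+ 2 * rint r (fun x => (F n x - f x) ^+ 2)).
  apply/funext => n; rewrite -rintZ; last exact: (rL2B (hF n) hf).2.
  by apply: eq_rint => x _; rewrite -mulrBr exprMn.
have -> : 0 = c ^+ 2 * 0 :> R by rewrite mulr0.
by apply: cvgM => //; exact: cvg_cst.
Qed.

Lemma l2cvg_sum (I : Type) (s : seq I) (F : I -> nat -> R3 R -> R) (f : I -> R3 R -> R) :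
  (forall i, l2cvg r (F i) (f i)) ->
  l2cvg r (fun n x => \sum_(i <- s) F i n x) (fun x => \sum_(i <- s) f i x).
Proof.
move=> h; elim: s => [|i s IH].
  have -> : (fun n x => \sum_(i <- [::]) F i n x) = fun n x => 0.
    by apply/funext => n; apply/funext => x; rewrite big_nil.
  have -> : (fun x => \sum_(i <- [::]) f i x) = fun x => 0.
    by apply/funext => x; rewrite big_nil.
  exact: l2cvg_cst (rL2_0 r).
have -> : (fun n x => \sum_(j <- i :: s) F j n x) = fun n x => F i n x + \sum_(j <- s) F j n x.
  by apply/funext => n; apply/funext => x; rewrite big_cons.
have -> : (fun x => \sum_(j <- i :: s) f j x) = fun x => f i x + \sum_(j <- s) f j x.
  by apply/funext => x; rewrite big_cons.
exact: l2cvgD.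
Qed.

Lemma sqr_cvg0 (u : nat -> R) : (fun n => u n ^+ 2) @ \oo --> 0 -> u @ \oo --> 0.
Proof.
move=> h; apply/cvgrPdist_le => e e0.
have e2 : 0 < e ^+ 2 by rewrite exprn_gt0.
have /cvgrPdist_le/(_ _ e2) := h; apply: filterS => n.
rewrite !sub0r !normrN normrX => h2; have := h2.
by rewrite ler_sqr ?nnegrE// ltW.
Qed.

Lemma l2cvg_pair F f g : l2cvg r F f -> rL2 r g ->
  rint r (fun x => F n x * g x) @[n --> \oo] --> rint r (fun x => f x * g x).
Proof.
move=> [hF hf cF] hg.
have E n : rint r (fun x => F n x * g x) =
    rint r (fun x => (F n x - f x) * g x) + rint r (fun x => f x * g x).
  rewrite -rintD; [|by apply: rL2M => //; exact: rL2B|exact: rL2M].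
  by apply: eq_rint => x _; ring.
have -> : (fun n => rint r (fun x => F n x * g x)) =
   fun n => rint r (fun x => (F n x - f x) * g x) + rint r (fun x => f x * g x).
  by apply/funext => n; exact: E.
rewrite -[X in _ --> X]add0r; apply: cvgD; last exact: cvg_cst.
apply: sqr_cvg0.
apply: (@squeeze_cvgr _ _ _ _ (fun=> 0) (fun n =>
  rint r (fun x => (F n x - f x) ^+ 2) * rint r (fun x => g x ^+ 2))).
- apply: nearW => n; apply/andP; split; first exact: sqr_ge0.
  by apply: rint_CS => //; exact: rL2B.
- exact: cvg_cst.
- rewrite -[X in _ --> X](mul0r (rint r (fun x => g x ^+ 2))).
  by apply: cvgM => //; exact: cvg_cst.
Qed.

Lemma l2cvg_pair_eq F G f g p q : l2cvg r F f -> l2cvg r G g -> rL2 r p -> rL2 r q ->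
  (forall n, rint r (fun x => F n x * p x) = rint r (fun x => G n x * q x)) ->
  rint r (fun x => f x * p x) = rint r (fun x => g x * q x).
Proof.
move=> cF cG hp hq e; have h1 := l2cvg_pair cF hp; have h2 := l2cvg_pair cG hq.
have E : (fun n => rint r (fun x => F n x * p x)) = (fun n => rint r (fun x => G n x * q x)).
  by apply/funext.
by rewrite E in h1; exact: (cvg_unique (@Rhausdorff R) h1 h2).
Qed.

Lemma l2cvg_ae F f g : rL2 r g -> ae_eq_ball r f g -> l2cvg r F f -> l2cvg r F g.
Proof.
move=> hg fg [hF hf c]; split=> //.
have -> : (fun n => rint r (fun x => (F n x - g x) ^+ 2)) =
    (fun n => rint r (fun x => (F n x - f x) ^+ 2)) => //.
apply/funext => n; apply: rint_ae.
- exact: bint_mfb (rL2B (hF n) hg).2.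
- exact: bint_mfb (rL2B (hF n) hf).2.
by apply: ae_mono fg => x h Bx; rewrite h.
Qed.

Lemma l2cvg_rweak_pd j F G f g : (forall n, rweak_pd r j (F n) (G n)) ->
  l2cvg r F f -> l2cvg r G g -> rweak_pd r j f g.
Proof.
move=> w cF cG phi tphi.
have bp : rL2 r phi by apply: bdm_rL2; apply: continuous_bdm; exact: test_continuous tphi.
have bd : rL2 r (pd j phi).
  by apply: bdm_rL2; apply: continuous_bdm; exact: test_pd_continuous tphi.
have gN : rint r (fun x => g x * - phi x) = - rint r (fun x => g x * phi x).
  rewrite -rintN; last by apply: rL2M => //; case: cG.
  by apply: eq_rint => x _; rewrite mulrN.
rewrite -gN; apply: (l2cvg_pair_eq cF cG) => //; first exact: rL2N.
move=> n; rewrite w// -rintN; last by apply: rL2M => //; case: cG.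
by apply: eq_rint => x _; rewrite mulrN.
Qed.

End l2cvg_theory.

(** * Complex fields through their real and imaginary parts *)

Definition cpt (R : realType) (b : bool) (z : R[i]) : R :=
  if b then complex.Im z else complex.Re z.

Lemma cptD (R : realType) b (z w : R[i]) : cpt b (z + w) = cpt b z + cpt b w.
Proof. by case: b; rewrite /cpt ?Re_add ?Im_add. Qed.

Lemma cptN (R : realType) b (z : R[i]) : cpt b (- z) = - cpt b z.
Proof. by case: b; case: z. Qed.

Lemma cpt0 (R : realType) b : cpt b (0 : R[i]) = 0.
Proof. by case: b. Qed.

Lemma cptMr (R : realType) b (z : R[i]) (t : R) : cpt b (z * t%:C) = cpt b z * t.
Proof. by case: b; rewrite /cpt ?Re_mul ?Im_mul /= ?mulr0 ?subr0 ?add0r ?addr0. Qed.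

Lemma cpt_sum (R : realType) b (I : Type) (s : seq I) (f : I -> R[i]) :
  cpt b (\sum_(i <- s) f i) = \sum_(i <- s) cpt b (f i).
Proof. by elim: s => [|i s IH]; rewrite ?big_nil ?cpt0// !big_cons cptD IH. Qed.

Lemma cpt_ext (R : realType) (z w : R[i]) : (forall b, cpt b z = cpt b w) -> z = w.
Proof. by move=> h; apply: complex_ext; [exact: (h false) | exact: (h true)]. Qed.

Lemma cpt_integral (R : realType) (r : R) b (f : sfield R) :
  cpt b (cintegral r f) = rint r (fun x => cpt b (f x)).
Proof. by case: b. Qed.

Lemma L2sP (R : realType) (r : R) (u : sfield R) :
  L2s r u <-> forall b, rL2 r (fun x => cpt b (u x)).
Proof.
split=> [[m1 m2 i]|h]; last first.
  by split; [exact: (h false).1 | exact: (h true).1 | exact: bintD (h false).2 (h true).2].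
case; split=> //; apply: bint_le i _; try exact: measurable_funX.
  by move=> x _; rewrite ger0_norm ?sqr_ge0// lerDr sqr_ge0.
by move=> x _; rewrite ger0_norm ?sqr_ge0// lerDl sqr_ge0.
Qed.

Lemma L2P (R : realType) (r : R) (v : vfield R) :
  L2 r v <-> forall j b, rL2 r (fun x => cpt b (v x 0 j)).
Proof. by split=> h j; [move=> b; apply: (L2sP _ _).1; exact: h | apply/L2sP; exact: h]. Qed.

Lemma weak_pdP (R : realType) (r : R) j (u w : sfield R) :
  weak_pd r j u w <-> forall b, rweak_pd r j (fun x => cpt b (u x)) (fun x => cpt b (w x)).
Proof.
have E b (f : sfield R) (g : R3 R -> R) :
    cpt b (cintegral r (fun x => f x * (g x)%:C)) = rint r (fun x => cpt b (f x) * g x).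
  by rewrite cpt_integral; apply: eq_rint => x _; rewrite cptMr.
split=> [h b phi tphi|h phi tphi].
  by have := congr1 (cpt b) (h phi tphi); rewrite cptN !E.
by apply: cpt_ext => b; rewrite cptN !E h.
Qed.

Definition cbint (R : realType) (r : R) (f : sfield R) := forall b, bint r (fun x => cpt b (f x)).

Lemma cintD (R : realType) (r : R) (f g : sfield R) : cbint r f -> cbint r g ->
  cintegral r (fun x => f x + g x) = cintegral r f + cintegral r g.
Proof.
move=> hf hg; apply: cpt_ext => b; rewrite cptD !cpt_integral -rintD//.
by apply: eq_rint => x _; rewrite cptD.
Qed.

Lemma cintZ (R : realType) (r : R) (c : R[i]) (f : sfield R) : cbint r f ->
  cintegral r (fun x => c * f x) = c * cintegral r f.
Proof.
move=> hf; have h0 := hf false; have h1 := hf true.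
have e0 (g : sfield R) : complex.Re (cintegral r g) = rint r (fun x => cpt false (g x)) by [].
have e1 (g : sfield R) : complex.Im (cintegral r g) = rint r (fun x => cpt true (g x)) by [].
apply: complex_ext; rewrite ?Re_mul ?Im_mul !e0 !e1 -!rintZ//.
  rewrite -rintB; [|exact: bintZ..].
  by apply: eq_rint => x _; rewrite /cpt Re_mul.
rewrite -rintD; [|exact: bintZ..].
by apply: eq_rint => x _; rewrite /cpt Im_mul.
Qed.

Lemma cbintZ (R : realType) (r : R) (c : R[i]) (f : sfield R) : cbint r f ->
  cbint r (fun x => c * f x).
Proof.
move=> hf b; have h0 := hf false; have h1 := hf true.
case: b.
  have := bintD (bintZ (complex.Re c) h1) (bintZ (complex.Im c) h0).
  by congr (bint r _); apply/funext => x; rewrite /cpt Im_mul.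
have := bintB (bintZ (complex.Re c) h0) (bintZ (complex.Im c) h1).
by congr (bint r _); apply/funext => x; rewrite /cpt Re_mul.
Qed.

Lemma cbintD (R : realType) (r : R) (f g : sfield R) : cbint r f -> cbint r g ->
  cbint r (fun x => f x + g x).
Proof.
move=> hf hg b; have := bintD (hf b) (hg b).
by congr (bint r _); apply/funext => x; rewrite cptD.
Qed.

Lemma eq_cint (R : realType) (r : R) (f g : sfield R) : (forall x, eball r x -> f x = g x) ->
  cintegral r f = cintegral r g.
Proof.
move=> fg; apply: cpt_ext => b; rewrite !cpt_integral.
by apply: eq_rint => x Bx; rewrite fg.
Qed.

Lemma cint0 (R : realType) (r : R) : cintegral r (fun=> 0) = 0.
Proof.
by apply: cpt_ext => b; rewrite cpt_integral !cpt0 rint0.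
Qed.

Lemma cbintM (R : realType) (r : R) (f g : sfield R) :
  L2s r f -> L2s r g -> cbint r (fun x => f x * g x).
Proof.
move=> /L2sP hf /L2sP hg [].
  have := bintD (rL2M (hf false) (hg true)) (rL2M (hf true) (hg false)).
  by congr (bint r _); apply/funext => x; rewrite /cpt Im_mul.
have := bintB (rL2M (hf false) (hg false)) (rL2M (hf true) (hg true)).
by congr (bint r _); apply/funext => x; rewrite /cpt Re_mul.
Qed.

Lemma L2s_conj (R : realType) (r : R) (f : sfield R) : L2s r f -> L2s r (fun x => conjc (f x)).
Proof.
move=> /L2sP hf; apply/L2sP => -[]; last first.
  by have := hf false; congr (rL2 r _); apply/funext => x; case: (f x).
by have := rL2N (hf true); congr (rL2 r _); apply/funext => x; case: (f x).
Qed.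

Lemma L2sD (R : realType) (r : R) (f g : sfield R) : L2s r f -> L2s r g ->
  L2s r (fun x => f x + g x).
Proof.
move=> /L2sP hf /L2sP hg; apply/L2sP => b; have := rL2D (hf b) (hg b).
by congr (rL2 r _); apply/funext => x; rewrite cptD.
Qed.

Lemma L2sZ (R : realType) (r : R) (c : R[i]) (f : sfield R) : L2s r f ->
  L2s r (fun x => c * f x).
Proof.
move=> /L2sP hf; apply/L2sP => -[].
  have := rL2D (rL2Z (complex.Re c) (hf true)) (rL2Z (complex.Im c) (hf false)).
  by congr (rL2 r _); apply/funext => x; rewrite /cpt Im_mul.
have := rL2B (rL2Z (complex.Re c) (hf false)) (rL2Z (complex.Im c) (hf true)).
by congr (rL2 r _); apply/funext => x; rewrite /cpt Re_mul.
Qed.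

Lemma L2s0 (R : realType) (r : R) : L2s r (fun=> 0).
Proof.
apply/L2sP => b; have := rL2_0 r; congr (rL2 r _); apply/funext => x.
by rewrite cpt0.
Qed.

Lemma L2D (R : realType) (r : R) (u v : vfield R) : L2 r u -> L2 r v ->
  L2 r (fun x => u x + v x).
Proof.
move=> hu hv j; have := L2sD (hu j) (hv j); congr (L2s r _).
by apply/funext => x; rewrite /vcomp mxE.
Qed.

Lemma L2Z (R : realType) (r : R) c (u : vfield R) : L2 r u -> L2 r (fun x => c *: u x).
Proof.
move=> hu j; have := L2sZ c (hu j); congr (L2s r _).
by apply/funext => x; rewrite /vcomp mxE.
Qed.

Lemma L20 (R : realType) (r : R) : L2 r (fun=> 0).
Proof.
move=> j; have := L2s0 r; congr (L2s r _); apply/funext => x.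
by rewrite /vcomp mxE.
Qed.

Lemma L2B (R : realType) (r : R) (u v : vfield R) : L2 r u -> L2 r v ->
  L2 r (fun x => u x - v x).
Proof.
move=> hu hv; have := L2D hu (L2Z (-1) hv); congr (L2 r _).
by apply/funext => x; rewrite scaleN1r.
Qed.

Lemma L2_sum (R : realType) (r : R) (I : Type) (s : seq I) (a : I -> R[i]) (q : I -> vfield R) :
  (forall i, L2 r (q i)) -> L2 r (fun x => \sum_(i <- s) a i *: q i x).
Proof.
move=> h; elim: s => [|i s IH].
  have := L20 r; congr (L2 r _); apply/funext => x; by rewrite big_nil.
have := L2D (L2Z (a i) (h i)) IH; congr (L2 r _); apply/funext => x.
by rewrite big_cons.
Qed.

Lemma L2_pair (R : realType) (r : R) (u v : vfield R) : L2 r u -> L2 r v ->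
  cbint r (fun x => \sum_j u x 0 j * conjc (v x 0 j)).
Proof.
move=> hu hv b.
have h j : bint r (fun x => cpt b (u x 0 j * conjc (v x 0 j))).
  exact: (cbintM (hu j) (L2s_conj (hv j)) b).
have := bint_sum (index_enum 'I_3) h; congr (bint r _).
by apply/funext => x; rewrite cpt_sum.
Qed.

Lemma innerDl (R : realType) (r : R) (u v w : vfield R) : L2 r u -> L2 r v -> L2 r w ->
  inner r (fun x => u x + v x) w = inner r u w + inner r v w.
Proof.
move=> hu hv hw; rewrite /inner -cintD; [|exact: L2_pair..].
apply: eq_cint => x _; rewrite -big_split; apply: eq_bigr => j _.
by rewrite mxE mulrDl.
Qed.

Lemma innerZl (R : realType) (r : R) c (u w : vfield R) : L2 r u -> L2 r w ->
  inner r (fun x => c *: u x) w = c * inner r u w.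
Proof.
move=> hu hw; rewrite /inner -cintZ; last exact: L2_pair.
apply: eq_cint => x _; rewrite mulr_sumr; apply: eq_bigr => j _.
by rewrite mxE mulrA.
Qed.

Lemma inner0l (R : realType) (r : R) (w : vfield R) : inner r (fun=> 0) w = 0.
Proof.
rewrite -[RHS](cint0 r); apply: eq_cint => x _; apply: big1 => j _.
by rewrite mxE mul0r.
Qed.

Lemma innerBl (R : realType) (r : R) (u v w : vfield R) : L2 r u -> L2 r v -> L2 r w ->
  inner r (fun x => u x - v x) w = inner r u w - inner r v w.
Proof.
move=> hu hv hw.
have -> : (fun x => u x - v x) = (fun x => u x + (-1) *: v x).
  by apply/funext => x; rewrite scaleN1r.
by rewrite (innerDl hu (L2Z (-1) hv) hw) (innerZl (-1) hv hw) mulN1r.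
Qed.

Lemma inner_suml (R : realType) (r : R) (I : Type) (s : seq I) (a : I -> R[i])
    (q : I -> vfield R) (w : vfield R) : (forall i, L2 r (q i)) -> L2 r w ->
  inner r (fun x => \sum_(i <- s) a i *: q i x) w = \sum_(i <- s) a i * inner r (q i) w.
Proof.
move=> hq hw; elim: s => [|i s IH].
  rewrite big_nil -[RHS](inner0l r w); congr (inner r _ _); apply/funext => x.
  by rewrite big_nil.
rewrite big_cons -IH -innerZl// -innerDl//; [|exact: L2Z|exact: L2_sum].
by congr (inner r _ _); apply/funext => x; rewrite big_cons.
Qed.

Lemma inner_conj (R : realType) (r : R) (u v : vfield R) : L2 r u -> L2 r v ->
  inner r v u = conjc (inner r u v).
Proof.
move=> hu hv.
have h b := L2_pair hu hv b.
have E x : \sum_j v x 0 j * conjc (u x 0 j) = conjc (\sum_j u x 0 j * conjc (v x 0 j)).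
  rewrite rmorph_sum; apply: eq_bigr => j _.
  by rewrite rmorphM /= conjcK mulrC.
rewrite /inner; apply: complex_ext.
  rewrite -[LHS]/(rint r (fun x => cpt false _)).
  have -> : complex.Re (conjc (cintegral r (fun x => \sum_j u x 0 j * conjc (v x 0 j)))) =
     rint r (fun x => cpt false (\sum_j u x 0 j * conjc (v x 0 j))) by [].
  by apply: eq_rint => x _; rewrite E; case: (\sum_j _).
rewrite -[LHS]/(rint r (fun x => cpt true _)).
have -> : complex.Im (conjc (cintegral r (fun x => \sum_j u x 0 j * conjc (v x 0 j)))) =
   - rint r (fun x => cpt true (\sum_j u x 0 j * conjc (v x 0 j))) by [].
rewrite -rintN; last exact: (h true).
by apply: eq_rint => x _; rewrite E; case: (\sum_j _).
Qed.

Definition nrm2 (R : realType) (r : R) (v : vfield R) : R :=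
  \sum_j \sum_(b <- [:: false; true]) rint r (fun x => cpt b (v x 0 j) ^+ 2).

Lemma nrm2E (R : realType) (r : R) (v : vfield R) : L2 r v ->
  inner r v v = (nrm2 r v)%:C.
Proof.
move=> /L2P hv; apply: complex_ext.
  rewrite -[LHS]/(rint r (fun x => cpt false (\sum_j v x 0 j * conjc (v x 0 j)))) /=.
  rewrite /nrm2 (eq_bigr (fun j => rint r (fun x => \sum_(b <- [:: false; true]) cpt b (v x 0 j) ^+ 2))).
    rewrite -(rint_sum (index_enum 'I_3) (f := fun j x => \sum_(b <- [:: false; true]) cpt b (v x 0 j) ^+ 2)).
      apply: eq_rint => x _; rewrite -[complex.Re _]/(cpt false _) cpt_sum; apply: eq_bigr => j _.
      by rewrite !big_cons big_nil addr0 /cpt Re_mul; case: (v x 0 j) => a b /=; ring.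
    by move=> j; apply: bint_sum => b; exact: (hv j b).2.
  move=> j _; rewrite -(rint_sum _ (f := fun b x => cpt b (v x 0 j) ^+ 2))//.
  by move=> b; exact: (hv j b).2.
rewrite -[LHS]/(rint r (fun x => cpt true (\sum_j v x 0 j * conjc (v x 0 j)))) /= -[RHS](rint0 r).
apply: eq_rint => x _; rewrite -[complex.Im _]/(cpt true _) cpt_sum big1// => j _.
by rewrite /cpt Im_mul; case: (v x 0 j) => a b /=; ring.
Qed.

Lemma nrm2_ge0 (R : realType) (r : R) (v : vfield R) : 0 <= nrm2 r v.
Proof.
by apply: sumr_ge0 => j _; apply: sumr_ge0 => b _; apply: rint_ge0 => x _; exact: sqr_ge0.
Qed.

Lemma rint_cpt_le_nrm2 (R : realType) (r : R) (v : vfield R) j b :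
  rint r (fun x => cpt b (v x 0 j) ^+ 2) <= nrm2 r v.
Proof.
have p0 (i : 'I_3) c : 0 <= rint r (fun x => cpt c (v x 0 i) ^+ 2).
  by apply: rint_ge0 => x _; exact: sqr_ge0.
rewrite /nrm2 (bigD1 j)//= !big_cons big_nil addr0.
have : 0 <= \sum_(i < 3 | i != j) \sum_(b0 <- [:: false; true]) rint r (fun x => cpt b0 (v x 0 i) ^+ 2).
  by apply: sumr_ge0 => i _; apply: sumr_ge0 => c _.
by have := p0 j false; have := p0 j true; case: b; lra.
Qed.

Lemma ae_cpt (R : realType) (r : R) (u v : vfield R) : ae_eq_ball r u v ->
  forall j b, ae_eq_ball r (fun x => cpt b (u x 0 j)) (fun x => cpt b (v x 0 j)).
Proof. by move=> uv j b; apply: ae_mono uv => x h Bx; rewrite h. Qed.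

Lemma cint_ae (R : realType) (r : R) (f g : sfield R) : cbint r f -> cbint r g ->
  ae_eq_ball r f g -> cintegral r f = cintegral r g.
Proof.
move=> hf hg fg; apply: cpt_ext => b; rewrite !cpt_integral; apply: rint_ae.
- exact: bint_mfb.
- exact: bint_mfb.
- by apply: ae_mono fg => x h Bx; rewrite h.
Qed.

Lemma inner_ae (R : realType) (r : R) (u u' v : vfield R) : L2 r u -> L2 r u' -> L2 r v ->
  ae_eq_ball r u u' -> inner r u v = inner r u' v.
Proof.
move=> hu hu' hv uu'; apply: cint_ae; [exact: L2_pair..|].
by apply: ae_mono uu' => x h Bx; rewrite h.
Qed.

Definition sqn (R : realType) (z : R[i]) : R := complex.Re z ^+ 2 + complex.Im z ^+ 2.

Lemma sqn_ge0 (R : realType) (z : R[i]) : 0 <= sqn z.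
Proof. by rewrite addr_ge0 ?sqr_ge0. Qed.

Lemma sqnE (R : realType) (z : R[i]) : z * conjc z = (sqn z)%:C.
Proof. by apply: complex_ext; rewrite /sqn ?Re_mul ?Im_mul; case: z => a b /=; ring. Qed.

Lemma sqn_eq0 (R : realType) (z : R[i]) : sqn z = 0 -> z = 0.
Proof.
move/eqP; rewrite paddr_eq0 ?sqr_ge0// !sqrf_eq0 => /andP[/eqP h1 /eqP h2].
exact: complex_ext.
Qed.

(** * Orthonormal systems and Fourier series *)

Section orthonormal.
Variables (R : realType) (r : R) (I : choiceType) (q : I -> vfield R).
Hypothesis hq : forall i, L2 r (q i).
Hypothesis on : orthonormal_sys r q.

Definition psum (a : I -> R[i]) (A : {fset I}) : vfield R :=
  fun x => \sum_(i <- A) a i *: q i x.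

Lemma psum_L2 a A : L2 r (psum a A). Proof. exact: L2_sum. Qed.

Lemma inner_psum a A k : inner r (psum a A) (q k) = if k \in A then a k else 0.
Proof.
rewrite inner_suml//; case: ifP => kA.
  rewrite (big_rem k)//= on eqxx mulr1 big1_seq ?addr0// => i /andP[_ iA].
  have ik : i != k by apply: contraTneq iA => ->; rewrite mem_rem_uniqF// fset_uniq.
  by rewrite on (negPf ik) mulr0.
rewrite big1_seq// => i /andP[_ iA]; rewrite on.
case: eqVneq => [e|_]; last by rewrite mulr0.
by rewrite e kA in iA.
Qed.

Lemma inner_psumr f a A : L2 r f -> inner r f (psum a A) = \sum_(i <- A) conjc (a i) * inner r f (q i).
Proof.
move=> hf; rewrite (inner_conj (psum_L2 a A) hf) inner_suml// rmorph_sum.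
apply: eq_bigr => i _; rewrite (inner_conj (hq i) hf).
exact: rmorphM.
Qed.

Lemma nrm2_psum a A : nrm2 r (psum a A) = \sum_(i <- A) sqn (a i).
Proof.
have : (nrm2 r (psum a A))%:C = (\sum_(i <- A) sqn (a i))%:C.
  rewrite -nrm2E; last exact: psum_L2.
  rewrite inner_psumr; last exact: psum_L2.
  rewrite rmorph_sum; apply: eq_big_seq => i iA.
  by rewrite inner_psum iA mulrC sqnE.
by move/complexI.
Qed.

Lemma nrm2_resid f A : L2 r f ->
  nrm2 r (fun x => f x - psum (fun i => inner r f (q i)) A x) =
  nrm2 r f - \sum_(i <- A) sqn (inner r f (q i)).
Proof.
move=> hf; set a := fun i => inner r f (q i); have hp := psum_L2 a A.
have hfp := L2B hf hp.
apply: (@complexI R); rewrite -nrm2E// rmorphB /= -nrm2E//.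
have e1 : inner r f (psum a A) = (\sum_(i <- A) sqn (a i))%:C.
  rewrite inner_psumr// rmorph_sum; apply: eq_bigr => i _.
  by rewrite mulrC sqnE.
have e2 : inner r (psum a A) (psum a A) = (\sum_(i <- A) sqn (a i))%:C.
  by rewrite nrm2E// nrm2_psum.
have e3 : inner r (psum a A) f = (\sum_(i <- A) sqn (a i))%:C.
  by rewrite (inner_conj hf hp) e1 conjc_real.
have c0 : conjc (0 : R[i]) = 0 by apply: complex_ext; rewrite /= ?oppr0.
rewrite (innerBl hf hp hfp) (inner_conj hfp hf) (inner_conj hfp hp).
rewrite (innerBl hf hp hf) (innerBl hf hp hp) e1 e2 e3 (nrm2E hf) subrr c0 subr0 -rmorphB.
exact: conjc_real.
Qed.

Lemma bessel f (A : {fset I}) : L2 r f -> \sum_(i <- A) sqn (inner r f (q i)) <= nrm2 r f.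
Proof. by move=> hf; rewrite -subr_ge0 -nrm2_resid// nrm2_ge0. Qed.

End orthonormal.

Lemma sum_fsetD (V : zmodType) (I : choiceType) (A B : {fset I}) (f : I -> V) :
  (B `<=` A)%fset -> \sum_(i <- A) f i = \sum_(i <- B) f i + \sum_(i <- (A `\` B)%fset) f i.
Proof.
move=> BA; rewrite -big_cat; apply: perm_big; apply: uniq_perm => /=.
- exact: fset_uniq.
- rewrite cat_uniq !fset_uniq andbT /=; apply/hasPn => i.
  by rewrite inE => /andP[].
move=> i; rewrite mem_cat in_fsetD; case: (boolP (i \in B)) => iB /=; last by [].
exact: (fsubsetP BA).
Qed.

(** The indices form an arbitrary [choiceType]. Finite sets whose sums approach the supremum, united
    increasingly, reduce unconditional summation to a sequence. *)
Lemma fset_exhaustion (R : realType) (I : choiceType) (s : I -> R) (M : R) :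
  (forall i, 0 <= s i) -> (forall A : {fset I}, \sum_(i <- A) s i <= M) ->
  exists A : nat -> {fset I}, (forall n, (A n `<=` A n.+1)%fset) /\
    forall e, 0 < e -> exists N, forall B : {fset I}, (A N `<=` B)%fset ->
      \sum_(i <- (B `\` A N)%fset) s i <= e.
Proof.
move=> s0 sM.
pose S : set R := [set t | exists A : {fset I}, t = \sum_(i <- A) s i].
have hS : has_sup S.
  split; first by exists (\sum_(i <- (fset0 : {fset I})) s i), fset0.
  by exists M => _ [A ->].
have /choice[A hA] n : exists A : {fset I}, sup S - n.+1%:R^-1 < \sum_(i <- A) s i.
  have n0 : 0 < n.+1%:R^-1 :> R by rewrite invr_gt0.
  by have [_ [A ->] h] := sup_adherent n0 hS; exists A.
pose B n := (\bigcup_(i <- iota 0 n.+1) A i)%fset.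
have BS n : (B n `<=` B n.+1)%fset.
  apply/bigfcupsP => i; rewrite mem_iota add0n => /andP[_ i1] _.
  by apply: bigfcup_sup => //; rewrite mem_iota add0n /= ltnW.
have AB n : (A n `<=` B n)%fset.
  by apply: bigfcup_sup => //; rewrite mem_iota /= add0n ltnSn.
exists B; split=> // e e0.
pose N := Num.truncn e^-1; have hN : N.+1%:R^-1 < e.
  by rewrite invf_plt ?posrE// truncnS_gt.
exists N => C BC.
have h1 := sum_fsetD s BC; have h2 := sum_fsetD s (AB N).
have h3 : \sum_(i <- C) s i <= sup S by apply: ub_le_sup => //; [exact: hS.2 | exists C].
have h4 : 0 <= \sum_(i <- (B N `\` A N)%fset) s i by apply: sumr_ge0.
have h5 := hA N.
move: h1 h2 h3 h4 h5 hN; move: (N.+1%:R^-1) => t; lra.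
Qed.

Definition vcvg (R : realType) (r : R) (v : nat -> vfield R) (w : vfield R) : Prop :=
  forall j b, l2cvg r (fun n x => cpt b (v n x 0 j)) (fun x => cpt b (w x 0 j)).

Section limits.
Variables (R : realType) (r : R).
Implicit Types (v : nat -> vfield R) (w g : vfield R).

Lemma vcvg_L2 v w : vcvg r v w -> L2 r w.
Proof. by move=> h; apply/L2P => j b; case: (h j b). Qed.

Lemma vcvg_L2n v w n : vcvg r v w -> L2 r (v n).
Proof. by move=> h; apply/L2P => j b; case: (h j b). Qed.

Lemma vcvg_ae v w g : L2 r g -> ae_eq_ball r w g -> vcvg r v w -> vcvg r v g.
Proof.
move=> /L2P hg wg h j b; apply: l2cvg_ae (h j b); first exact: hg.
exact: ae_cpt.
Qed.

Lemma inner_re (u g : vfield R) : L2 r u -> L2 r g -> complex.Re (inner r u g) =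
  \sum_j (rint r (fun x => cpt false (u x 0 j) * cpt false (g x 0 j)) +
          rint r (fun x => cpt true (u x 0 j) * cpt true (g x 0 j))).
Proof.
move=> /L2P hu /L2P hg.
rewrite (eq_bigr (fun j => rint r (fun x => cpt false (u x 0 j) * cpt false (g x 0 j) +
    cpt true (u x 0 j) * cpt true (g x 0 j)))); last first.
  by move=> j _; rewrite rintD//; exact: rL2M.
rewrite -(rint_sum _ (f := fun j x => cpt false (u x 0 j) * cpt false (g x 0 j) +
    cpt true (u x 0 j) * cpt true (g x 0 j))); last first.
  by move=> j; apply: bintD; exact: rL2M.
apply: eq_rint => x _; rewrite -[complex.Re _]/(cpt false _) cpt_sum; apply: eq_bigr => j _.
by rewrite /cpt Re_mul; case: (g x 0 j) => a b /=; ring.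
Qed.

Lemma inner_im (u g : vfield R) : L2 r u -> L2 r g -> complex.Im (inner r u g) =
  \sum_j (rint r (fun x => cpt true (u x 0 j) * cpt false (g x 0 j)) -
          rint r (fun x => cpt false (u x 0 j) * cpt true (g x 0 j))).
Proof.
move=> /L2P hu /L2P hg.
rewrite (eq_bigr (fun j => rint r (fun x => cpt true (u x 0 j) * cpt false (g x 0 j) -
    cpt false (u x 0 j) * cpt true (g x 0 j)))); last first.
  by move=> j _; rewrite rintB//; exact: rL2M.
rewrite -(rint_sum _ (f := fun j x => cpt true (u x 0 j) * cpt false (g x 0 j) -
    cpt false (u x 0 j) * cpt true (g x 0 j))); last first.
  by move=> j; apply: bintB; exact: rL2M.
apply: eq_rint => x _; rewrite -[complex.Im _]/(cpt true _) cpt_sum; apply: eq_bigr => j _.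
by rewrite /cpt Im_mul; case: (g x 0 j) => a b /=; ring.
Qed.

Lemma cvg_sum3 (u : 'I_3 -> nat -> R) (l : 'I_3 -> R) : (forall j, u j @ \oo --> l j) ->
  \sum_j u j n @[n --> \oo] --> \sum_j l j.
Proof.
move=> h; rewrite sum3.
have -> : (fun n => \sum_j u j n) = (fun n => u 0 n + u 1 n + u 2%:R n).
  by apply/funext => n; rewrite sum3.
by apply: cvgD; [apply: cvgD|].
Qed.

Lemma vcvg_inner v w g : vcvg r v w -> L2 r g ->
  (forall b, cpt b (inner r (v n) g) @[n --> \oo] --> cpt b (inner r w g)).
Proof.
move=> h hg; have hw := vcvg_L2 h; have gP := (L2P r g).1 hg.
have p b c j : rint r (fun x => cpt b (v n x 0 j) * cpt c (g x 0 j)) @[n --> \oo] -->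
    rint r (fun x => cpt b (w x 0 j) * cpt c (g x 0 j)).
  exact: l2cvg_pair (h j b) (gP j c).
case.
  rewrite [cpt true _]inner_im//.
  have -> : (fun n => cpt true (inner r (v n) g)) = (fun n =>
      \sum_j (rint r (fun x => cpt true (v n x 0 j) * cpt false (g x 0 j)) -
          rint r (fun x => cpt false (v n x 0 j) * cpt true (g x 0 j)))).
    by apply/funext => n; rewrite [LHS]inner_im//; exact: vcvg_L2n h.
  apply: (@cvg_sum3 (fun j n => rint r (fun x => cpt true (v n x 0 j) * cpt false (g x 0 j)) -
          rint r (fun x => cpt false (v n x 0 j) * cpt true (g x 0 j)))) => j.
  by apply: cvgB; exact: p.
rewrite [cpt false _]inner_re//.
have -> : (fun n => cpt false (inner r (v n) g)) = (fun n =>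
    \sum_j (rint r (fun x => cpt false (v n x 0 j) * cpt false (g x 0 j)) +
        rint r (fun x => cpt true (v n x 0 j) * cpt true (g x 0 j)))).
  by apply/funext => n; rewrite [LHS]inner_re//; exact: vcvg_L2n h.
apply: (@cvg_sum3 (fun j n => rint r (fun x => cpt false (v n x 0 j) * cpt false (g x 0 j)) +
        rint r (fun x => cpt true (v n x 0 j) * cpt true (g x 0 j)))) => j.
by apply: cvgD; exact: p.
Qed.

Lemma vcvg_nrm2 v w : vcvg r v w -> nrm2 r (fun x => w x - v n x) @[n --> \oo] --> 0.
Proof.
move=> h.
have E n : nrm2 r (fun x => w x - v n x) =
    \sum_j (rint r (fun x => (cpt false (v n x 0 j) - cpt false (w x 0 j)) ^+ 2) +
            rint r (fun x => (cpt true (v n x 0 j) - cpt true (w x 0 j)) ^+ 2)).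
  apply: eq_bigr => j _; rewrite !big_cons big_nil addr0.
  by congr (_ + _); apply: eq_rint => x _; rewrite !mxE cptD cptN; ring.
have -> : (fun n => nrm2 r (fun x => w x - v n x)) = (fun n =>
    \sum_j (rint r (fun x => (cpt false (v n x 0 j) - cpt false (w x 0 j)) ^+ 2) +
            rint r (fun x => (cpt true (v n x 0 j) - cpt true (w x 0 j)) ^+ 2))).
  by apply/funext.
rewrite [X in _ --> X](_ : 0 = \sum_(j < 3) (0 + 0)); last by rewrite big1// => j _; rewrite addr0.
apply: (@cvg_sum3 (fun j n => rint r (fun x => (cpt false (v n x 0 j) - cpt false (w x 0 j)) ^+ 2) +
            rint r (fun x => (cpt true (v n x 0 j) - cpt true (w x 0 j)) ^+ 2))) => j.
by apply: cvgD; [case: (h j false) | case: (h j true)].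
Qed.

End limits.

Lemma increasing_fset (I : choiceType) (A : nat -> {fset I}) :
  (forall n, (A n `<=` A n.+1)%fset) -> forall n m, (n <= m)%N -> (A n `<=` A m)%fset.
Proof.
move=> h n m /subnKC <-; elim: (m - n)%N => [|k IH]; first by rewrite addn0.
by rewrite addnS; exact: fsubset_trans IH (h _).
Qed.

Section riesz_fischer.
Variables (R : realType) (r : R) (I : choiceType) (q : I -> vfield R).
Hypothesis hq : forall i, L2 r (q i).
Hypothesis on : orthonormal_sys r q.

Lemma le_sum_fset (s : I -> R) (A B : {fset I}) : (forall i, 0 <= s i) -> (B `<=` A)%fset ->
  \sum_(i <- B) s i <= \sum_(i <- A) s i.
Proof. by move=> s0 BA; rewrite (sum_fsetD s BA) lerDl sumr_ge0. Qed.

Lemma psumB a (A B : {fset I}) x : (B `<=` A)%fset ->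
  psum q a A x - psum q a B x = psum q a (A `\` B)%fset x.
Proof. by move=> BA; rewrite /psum (sum_fsetD _ BA) addrC addKr. Qed.

Lemma riesz_fischer (a : I -> R[i]) (M : R) :
  (forall A : {fset I}, \sum_(i <- A) sqn (a i) <= M) ->
  exists (A : nat -> {fset I}) (w : vfield R),
    [/\ forall n, (A n `<=` A n.+1)%fset,
        forall e, 0 < e -> exists N, forall B : {fset I}, (A N `<=` B)%fset ->
          \sum_(i <- (B `\` A N)%fset) sqn (a i) <= e,
        vcvg r (fun n => psum q a (A n)) w &
        forall i, inner r w (q i) = a i].
Proof.
move=> aM; have [A [AS tail]] := fset_exhaustion (fun i => sqn_ge0 (a i)) aM.
have AM := increasing_fset AS.
have hp B : L2 r (psum q a B) by exact: psum_L2.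
have cauchy (jb : 'I_3 * bool) : exists f : R3 R -> R,
    l2cvg r (fun n x => cpt jb.2 (psum q a (A n) x 0 jb.1)) f.
  apply: rL2_complete; first by move=> n; apply: (L2P r _).1; exact: hp.
  move=> e e0; have [N hN] := tail e e0; exists N => n m Nn Nm.
  wlog nm : n m Nn Nm / (n <= m)%N.
    move=> h; case: (leqP n m) => [|/ltnW] le; first exact: h.
    have := h m n Nm Nn le; congr (_ <= _); apply: eq_rint => x _.
    by rewrite -sqrrN opprB.
  have E : rint r (fun x => (cpt jb.2 (psum q a (A n) x 0 jb.1) - cpt jb.2 (psum q a (A m) x 0 jb.1)) ^+ 2) =
      rint r (fun x => cpt jb.2 (psum q a (A m `\` A n)%fset x 0 jb.1) ^+ 2).
    apply: eq_rint => x _; rewrite -psumB; last exact: AM.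
    by rewrite !mxE cptD cptN -sqrrN opprB.
  rewrite E; apply: le_trans (rint_cpt_le_nrm2 _ _ _ _) _; rewrite nrm2_psum//.
  apply: le_trans (hN (A m) (AM _ _ Nm)); apply: le_sum_fset; first by move=> i; exact: sqn_ge0.
  by apply: fsetDS; exact: AM.
have [W hW] := choice cauchy.
pose w : vfield R := fun x => \row_j (W (j, false) x +i* W (j, true) x).
have wv : vcvg r (fun n => psum q a (A n)) w.
  move=> j b; have := hW (j, b); congr (l2cvg r _ _).
  by apply/funext => x; rewrite /w mxE; case: b.
exists A, w; split=> // i.
have E n : inner r (psum q a (A n)) (q i) = if i \in A n then a i else 0 by exact: inner_psum.
have [[N iN]|noN] := pselect (exists N, i \in A N).
  apply: cpt_ext => b; have cv := vcvg_inner wv (hq i) (b := b).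
  apply: (cvg_unique (@Rhausdorff R) cv).
  apply: cvg_near_cst; near=> n.
  rewrite E; have -> // : i \in A n.
  by apply: (fsubsetP (AM N n _)) => //; near: n; exists N.
(* An index outside every [A n] has coefficient 0: adding it to [A N] would violate the tail
   bound. *)
have a0 : a i = 0.
  apply: sqn_eq0; apply/eqP; rewrite eq_le sqn_ge0 andbT leNgt; apply/negP => a0.
  have a2 : 0 < sqn (a i) / 2%:R by rewrite divr_gt0.
  have [N hN] := tail _ a2.
  have := hN (A N `|` [fset i])%fset (fsubsetUl _ _).
  have iA : i \notin A N by apply/negP => iA; apply: noN; exists N.
  have -> : ((A N `|` [fset i]) `\` A N)%fset = [fset i]%fset.
    apply/fsetP => k; rewrite in_fsetD in_fsetU !inE.
    by case: (eqVneq k i) => [->|_]; rewrite ?iA ?orbT// orbF andNb.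
  by rewrite big_seq_fset1; lra.
apply: cpt_ext => b; have cv := vcvg_inner wv (hq i) (b := b).
apply: (cvg_unique (@Rhausdorff R) cv).
apply: cvg_near_cst; near=> n; rewrite E; case: ifP => // _; by rewrite a0.
Unshelve. all: by end_near.
Qed.

Lemma sqn_inner_le u i : L2 r u -> sqn (inner r u (q i)) <= nrm2 r u.
Proof. by move=> hu; have := bessel hq on [fset i]%fset hu; rewrite big_seq_fset1. Qed.

Hypothesis cs : complete_sys r q.

Lemma complete_ae u v : L2 r u -> L2 r v -> (forall i, inner r u (q i) = inner r v (q i)) ->
  ae_eq_ball r u v.
Proof.
move=> hu hv uv; have h := cs (L2B hu hv); apply: ae_mono (h _) => [x e Bx|i].
  by apply/eqP; rewrite -subr_eq0 e.
by rewrite innerBl// uv subrr.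
Qed.

Lemma fourier_expansion f : L2 r f -> exists A : nat -> {fset I},
    [/\ forall n, (A n `<=` A n.+1)%fset,
        forall e, 0 < e -> exists N, forall B : {fset I}, (A N `<=` B)%fset ->
          \sum_(i <- (B `\` A N)%fset) sqn (inner r f (q i)) <= e &
        vcvg r (fun n => psum q (fun i => inner r f (q i)) (A n)) f].
Proof.
move=> hf; have [A [w [AS tail wv wq]]] := riesz_fischer (fun A => bessel hq on A hf).
have hw := vcvg_L2 wv.
exists A; split=> //; apply: (vcvg_ae hf _ wv); exact: complete_ae hw hf wq.
Qed.

Lemma fourier_sum_full f : L2 r f -> fourier_sum r q f f.
Proof.
move=> hf; split=> // e e0; have [A [_ _ cv]] := fourier_expansion hf.
have /cvgrPdist_lt/(_ _ e0)[N _ hN] := vcvg_nrm2 cv.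
exists (A N); move=> B AB; cbv zeta.
have e1 (t : R) : complex.Re (t%:C) = t by [].
rewrite nrm2E; last by apply: L2B => //; exact: psum_L2.
have h : `|0 - nrm2 r (fun x => f x - psum q (fun i => inner r f (q i)) (A N) x)| < e.
  exact: hN N (leqnn N).
rewrite sub0r normrN (ger0_norm (nrm2_ge0 _ _)) (nrm2_resid hq on (A N) hf) in h.
rewrite e1; refine (le_lt_trans _ h).
have -> : nrm2 r (fun x => f x - \sum_(i <- B) inner r f (q i) *: q i x) =
  nrm2 r f - \sum_(i <- B) sqn (inner r f (q i)) by have := @nrm2_resid R r I q hq on f B hf; rewrite /psum; exact.
by rewrite lerD2l lerN2; apply: le_sum_fset => // i; exact: sqn_ge0.
Qed.

End riesz_fischer.

Section subsystem.
Variables (R : realType) (r : R) (K J : choiceType) (q : (K + J)%type -> vfield R).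
Hypothesis hq : forall i, L2 r (q i).
Hypothesis on : orthonormal_sys r q.
Hypothesis cs : complete_sys r q.
Let p (j : J) := q (inr j).

Lemma fourier_sum_sub f w : L2 r w -> (forall k, inner r w (q (inl k)) = 0) ->
  (forall j, inner r w (q (inr j)) = inner r f (q (inr j))) -> fourier_sum r p f w.
Proof.
move=> hw w0 wf; split=> // e e0.
have [_ /(_ e e0)[A0 hA0]] := fourier_sum_full hq on cs hw.
(* [A0'] keeps the indices of [A0] from the second summand. The coefficients on the first summand
   vanish, so summing over [A0] together with the image of [A'] is summing over [A']. *)
pose A0' : {fset J} := seq_fset tt (pmap (fun i : K + J => if i is inr j then Some j else None) A0).
exists A0'; move=> A' AA'.
pose B : {fset (K + J)%type} := [fset inr j | j in A']%fset.
have sub : (A0 `<=` A0 `|` B)%fset by exact: fsubsetUl.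
have h := hA0 _ sub; cbv zeta in h.
have E : (fun x => w x - \sum_(i <- (A0 `|` B)%fset) inner r w (q i) *: q i x) =
    (fun x => w x - \sum_(i <- A') inner r f (p i) *: p i x).
  apply/funext => x; congr (_ - _); rewrite (sum_fsetD _ (fsubsetUr A0 B)).
  rewrite [X in _ + X]big1_seq ?addr0; last first.
    move=> [k|j] /andP[_]; first by rewrite w0 scale0r.
    rewrite in_fsetD in_fsetU => /andP[jB]; rewrite (negPf jB) orbF => jA0.
    case/negP: jB; apply/imfsetP; exists j => //=; apply: (fsubsetP AA').
    by rewrite seq_fsetE mem_pmap; apply/mapP; exists (inr j).
  rewrite /B big_imfset /=; last by move=> i j _ _ [].
  by apply: eq_bigr => j _; rewrite wf.
by rewrite E in h.
Qed.

(** By Bessel's inequality each coefficient of the remainder is as small as its norm, while the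
    coefficient of a partial sum is constant once the index set is large enough. *)
Lemma fourier_coef f w : fourier_sum r p f w ->
  (forall k, inner r w (q (inl k)) = 0) /\
  (forall j, inner r w (q (inr j)) = inner r f (q (inr j))).
Proof.
move=> [hw hs].
have hp (A : {fset J}) : L2 r (fun x => \sum_(j <- A) inner r f (p j) *: p j x).
  by apply: L2_sum => j; exact: hq.
have small (i : K + J) (c : R[i]) (A1 : {fset J}) :
    (forall A : {fset J}, (A1 `<=` A)%fset ->
      inner r (fun x => \sum_(j <- A) inner r f (p j) *: p j x) (q i) = c) ->
    inner r w (q i) = c.
  move=> hc; apply/eqP; rewrite -subr_eq0; apply/eqP/sqn_eq0/eqP.
  rewrite eq_le sqn_ge0 andbT leNgt; apply/negP => s0.
  have [A0 hA0] := hs _ s0.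
  have := hA0 (A0 `|` A1)%fset (fsubsetUl _ _); apply/negP; rewrite -leNgt.
  rewrite nrm2E; last exact: L2B.
  have := sqn_inner_le hq on i (L2B hw (hp (A0 `|` A1)%fset)).
  by rewrite innerBl// hc ?fsubsetUr.
have E (i : K + J) (A : {fset J}) : inner r (fun x => \sum_(j <- A) inner r f (p j) *: p j x) (q i) =
    \sum_(j <- A) inner r f (p j) * (inr j == i)%:R.
  rewrite inner_suml//; first by apply: eq_bigr => j _; rewrite on.
  by move=> j; exact: hq.
split=> [k|j].
  apply: (small _ _ fset0) => A _; rewrite E big1// => j _.
  by rewrite mulr0.
apply: (small _ _ [fset j]%fset) => A; rewrite fsub1set => jA; rewrite E.
rewrite (big_rem j)//= eqxx mulr1 big1_seq ?addr0// => i /andP[_ iA].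
have ij : i != j by apply: contraTneq iA => ->; rewrite mem_rem_uniqF// fset_uniq.
by rewrite (inj_eq (@inr_inj _ _)) (negPf ij) mulr0.
Qed.

End subsystem.

Lemma ae_enorm_gt0 (R : realType) : {ae @leb3 R, forall x, 0 < enorm x}.
Proof.
pose A : set (M3 R) := setT `*` [set 0].
exists A; split.
- by apply: measurableX => //; exact: measurable_set1.
- have m0 : measurable ([set 0] : set (measurableTypeR R)) by exact: measurable_set1.
  by rewrite /A (leb3_prod measurableT m0) lebesgue_measure_set1 mule0.
move=> x /= h; split=> //=.
have e0 : enorm x = 0.
  by apply/eqP; rewrite eq_le enorm_ge0 andbT leNgt; apply/negP.
have := coord_le_enorm x 2%:R.
by rewrite e0 normr_le0 => /eqP.
Qed.

Lemma enorm_eq0 (R : realType) (x : R3 R) : (enorm x == 0) = (x == 0).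
Proof.
apply/eqP/eqP => [e0|->].
  have c0 i : coord x i = 0.
    by apply/eqP; rewrite -normr_le0 -e0 coord_le_enorm.
  by case: x {e0} c0 => [[a b] c] c0; have := (c0 0, c0 1, c0 2%:R); rewrite /coord /= !(tnth_nth 0) /= => -[[-> ->] ->].
apply/eqP; rewrite -sqrf_eq0 enorm_sqr.
have c0 i : coord (0 : R3 R) i = 0 by elim/ord3_ind: i.
by rewrite !c0 !expr0n /= !addr0.
Qed.

Lemma ae_off0 (R : realType) (r : R) (T : Type) (f g : R3 R -> T) :
  (forall x, 0 < enorm x -> f x = g x) -> ae_eq_ball r f g.
Proof. by move=> h; apply: ae_mono (ae_enorm_gt0 R) => x x0 _; exact: h. Qed.

(** Measurability does not pass to almost everywhere equal functions in general. Here [f] differs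
    from [g] only at the origin, by a multiple of the indicator of a measurable point. *)
Lemma rL2_off0 (R : realType) (r : R) (f g : R3 R -> R) : rL2 r g ->
  (forall x, 0 < enorm x -> f x = g x) -> rL2 r f.
Proof.
move=> hg fg; pose N : set (M3 R) := setT `*` [set 0].
pose O : set (M3 R) := ([set 0] `*` [set 0]) `*` [set 0].
have mO : measurable O.
  by apply: measurableX; [apply: measurableX|]; exact: measurable_set1.
have OE (x : R3 R) : (x \in O) = (x == 0).
  apply/idP/eqP => [|->]; first by rewrite inE; case: x => [[a b] c] [[/= -> ->] ->].
  by rewrite inE.
have -> : f = fun x => g x + (f 0 - g 0) * \1_O x.
  apply/funext => x; rewrite indicE OE; case: eqVneq => [->|x0].
    by rewrite mulr1 subrKC.
  by rewrite mulr0 addr0 fg// lt_def enorm_eq0 x0 enorm_ge0.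
apply: rL2D => //; apply: rL2Z; apply: bdm_rL2; split.
  by apply: measurable_funTS; exact: measurable_indic.
by exists 1 => x _; rewrite indicE; case: (x \in O); rewrite ?normr1 ?normr0 ?ler01.
Qed.

Definition rweak_div (R : realType) (r : R) (V : 'I_3 -> R3 R -> R) (D : R3 R -> R) : Prop :=
  forall phi, test_fun r phi ->
    rint r (fun x => \sum_j V j x * pd j phi x) = - rint r (fun x => D x * phi x).

Definition rtrace0 (R : realType) (r : R) (V : 'I_3 -> R3 R -> R) (D : R3 R -> R) : Prop :=
  forall h p, rL2 r h -> (forall j, rL2 r (p j)) -> (forall j, rweak_pd r j h (p j)) ->
    rint r (fun x => \sum_j V j x * p j x + D x * h x) = 0.

Definition cplx (R : realType) (f : bool -> R3 R -> R) : sfield R :=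
  fun x => f false x +i* f true x.

Lemma cpt_cplx (R : realType) b (f : bool -> R3 R -> R) x : cpt b (cplx f x) = f b x.
Proof. by case: b. Qed.

(** * Real parts and limits of the weak relations *)

Section weak_forms.
Variables (R : realType) (r : R).
Implicit Types (v p : vfield R) (d h : sfield R) (V : 'I_3 -> R3 R -> R) (D : R3 R -> R).

Lemma weak_divP v d : weak_div r v d <->
  forall b, rweak_div r (fun j x => cpt b (v x 0 j)) (fun x => cpt b (d x)).
Proof.
have E1 b (phi : R3 R -> R) :
    cpt b (cintegral r (fun x => d x * (phi x)%:C)) = rint r (fun x => cpt b (d x) * phi x).
  by rewrite cpt_integral; apply: eq_rint => x _; rewrite cptMr.
have E2 b (phi : R3 R -> R) :
    cpt b (cintegral r (fun x => \sum_j v x 0 j * (pd j phi x)%:C)) =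
    rint r (fun x => \sum_j cpt b (v x 0 j) * pd j phi x).
  rewrite cpt_integral; apply: eq_rint => x _; rewrite cpt_sum.
  by apply: eq_bigr => j _; rewrite cptMr.
split=> [h b phi tphi|h phi tphi].
  by have := congr1 (cpt b) (h phi tphi); rewrite cptN E1 E2.
by apply: cpt_ext => b; rewrite cptN E1 E2 h.
Qed.

Lemma weak_rotP v w : weak_rot r v w <-> forall b phi, test_fun r phi -> forall i : 'I_3,
  rint r (fun x => cpt b (v x 0 (i + 1)) * pd (i + 2%:R) phi x
                 - cpt b (v x 0 (i + 2%:R)) * pd (i + 1) phi x) =
  rint r (fun x => cpt b (w x 0 i) * phi x).
Proof.
have E1 b i (phi : R3 R -> R) :
    cpt b (cintegral r (fun x => w x 0 i * (phi x)%:C)) = rint r (fun x => cpt b (w x 0 i) * phi x).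
  by rewrite cpt_integral; apply: eq_rint => x _; rewrite cptMr.
have E2 b (i : 'I_3) (phi : R3 R -> R) :
    cpt b (cintegral r (fun x => v x 0 (i + 1) * (pd (i + 2%:R) phi x)%:C
                               - v x 0 (i + 2%:R) * (pd (i + 1) phi x)%:C)) =
    rint r (fun x => cpt b (v x 0 (i + 1)) * pd (i + 2%:R) phi x
                   - cpt b (v x 0 (i + 2%:R)) * pd (i + 1) phi x).
  by rewrite cpt_integral; apply: eq_rint => x _; rewrite cptD cptN !cptMr.
split=> [h b phi tphi i|h phi tphi i].
  by have := congr1 (cpt b) (h phi tphi i); rewrite E1 E2.
by apply: cpt_ext => b; rewrite E1 E2 h.
Qed.

Lemma normal_trace0_cpt v d : L2 r v -> L2s r d -> weak_div r v d ->
  (forall b, rtrace0 r (fun j x => cpt b (v x 0 j)) (fun x => cpt b (d x))) ->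
  normal_trace0 r v.
Proof.
move=> /L2P hv /L2sP hd wd tr; exists d; split=> //; first exact/L2sP.
move=> h p /L2sP hh /L2P hp hw.
pose T b b' x := \sum_j cpt b (v x 0 j) * cpt b' (p x 0 j) + cpt b (d x) * cpt b' (h x).
have T0 b b' : rint r (T b b') = 0.
  apply: (tr b (fun x => cpt b' (h x)) (fun j x => cpt b' (p x 0 j))).
  - exact: hh.
  - by move=> j; exact: hp.
  - by move=> j; have /weak_pdP/(_ b') := hw j.
have iT b b' : bint r (T b b').
  apply: bintD; last exact: rL2M.
  by apply: bint_sum => j; exact: rL2M.
apply: cpt_ext => b; rewrite cpt_integral cpt0; case: b.
  rewrite -[RHS]addr0 -{1}(T0 false true) -(T0 true false) -rintD//.
  apply: eq_rint => x _; rewrite /T cptD cpt_sum addrACA -big_split /cpt Im_mul; congr (_ + _).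
  by apply: eq_bigr => j _; rewrite Im_mul.
rewrite -[RHS]subr0 -{1}(T0 false false) -(T0 true true) -rintB//.
apply: eq_rint => x _; rewrite /T cptD cpt_sum opprD addrACA -sumrB /cpt Re_mul; congr (_ + _).
by apply: eq_bigr => j _; rewrite Re_mul.
Qed.

Lemma l2cvg_pair0 (I : finType) (F : I -> nat -> R3 R -> R) (f p : I -> R3 R -> R) :
  (forall i, l2cvg r (F i) (f i)) -> (forall i, rL2 r (p i)) ->
  (forall n, rint r (fun x => \sum_i F i n x * p i x) = 0) ->
  rint r (fun x => \sum_i f i x * p i x) = 0.
Proof.
move=> cF hp h0.
have hF i n : rL2 r (F i n) by case: (cF i) => + _ _; exact.
have hf i : rL2 r (f i) by case: (cF i).
have E n : \sum_i rint r (fun x => F i n x * p i x) = 0.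
  rewrite -[RHS](h0 n) -[LHS](@rint_sum R r I (index_enum I) (fun i x => F i n x * p i x))//.
  by move=> i; exact: rL2M.
rewrite rint_sum; last by move=> i; exact: rL2M.
have c : \sum_i rint r (fun x => F i n x * p i x) @[n --> \oo] -->
         \sum_i rint r (fun x => f i x * p i x).
  elim: (index_enum I) => [|i s IH].
    by under eq_fun do rewrite big_nil; rewrite big_nil; exact: cvg_cst.
  under eq_fun do rewrite big_cons.
  by rewrite big_cons; apply: cvgD IH; exact: l2cvg_pair.
have c0 : (fun n => \sum_i rint r (fun x => F i n x * p i x)) = fun=> 0 := funext E.
by rewrite c0 in c; apply: cvg_unique c _; [exact: Rhausdorff|exact: cvg_cst].
Qed.

Lemma l2cvg_off0 (F G : nat -> R3 R -> R) (f : R3 R -> R) :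
  (forall n x, 0 < enorm x -> G n x = F n x) -> l2cvg r F f -> l2cvg r G f.
Proof.
move=> FG [hF hf cF]; have hG n : rL2 r (G n) by exact: rL2_off0 (hF n) (FG n).
split=> //; have E n : rint r (fun x => (G n x - f x) ^+ 2) = rint r (fun x => (F n x - f x) ^+ 2).
  apply: rint_ae; [exact: bint_mfb (rL2B (hG n) hf).2|exact: bint_mfb (rL2B (hF n) hf).2|].
  by apply: ae_off0 => x x0; rewrite FG.
by rewrite (funext E : (fun n => rint r (fun x => (G n x - f x) ^+ 2)) = _).
Qed.

Lemma l2cvg_choice (J : Type) (F : J -> nat -> R3 R -> R) :
  (forall j, exists f, l2cvg r (F j) f) -> {f : J -> R3 R -> R | forall j, l2cvg r (F j) (f j)}.
Proof. by move=> h; have [f hf] := choice h; exists f. Qed.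

Lemma rtrace0_limit (F : nat -> 'I_3 -> R3 R -> R) (E : nat -> R3 R -> R) V D :
  (forall n, rtrace0 r (F n) (E n)) -> (forall j, l2cvg r (fun n => F n j) (V j)) ->
  l2cvg r E D -> rtrace0 r V D.
Proof.
move=> tr cF cE h p hh hp hw.
(* The divergence term is treated as a fourth component, at index [ord0], so that the limit is taken
   in a single sum of products. *)
pose F' (i : 'I_4) n := if unlift ord0 i is Some j then F n j else E n.
pose V' (i : 'I_4) := if unlift ord0 i is Some j then V j else D.
pose p' (i : 'I_4) := if unlift ord0 i is Some j then p j else h.
have split4 (f g : 'I_4 -> R3 R -> R) x : \sum_(i < 4) f i x * g i x =
    \sum_j f (lift ord0 j) x * g (lift ord0 j) x + f ord0 x * g ord0 x.
  by rewrite big_ord_recl addrC.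
have := @l2cvg_pair0 'I_4 F' V' p'.
rewrite (_ : (fun x => \sum_i V' i x * p' i x) = fun x => \sum_j V j x * p j x + D x * h x).
  apply.
  - by move=> i; rewrite /F' /V'; case: unliftP => [j _|_]; [exact: cF|exact: cE].
  - by move=> i; rewrite /p'; case: unliftP => [j _|_].
  - move=> n; rewrite -[RHS](tr n h p hh hp hw); apply: eq_rint => x _.
    rewrite (split4 (fun i => F' i n) p') /F' /p' unlift_none; congr (_ + _).
    by apply: eq_bigr => j _; rewrite !liftK.
apply/funext => x; rewrite split4 /V' /p' unlift_none; congr (_ + _).
by apply: eq_bigr => j _; rewrite !liftK.
Qed.

Lemma rtrace0_smooth (F : 'I_3 -> smooth R) : 0 < r -> vb r (\sum_j sX R j * F j) ->
  rtrace0 r F (\sum_j sd j (F j)).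
Proof.
move=> r0 hF h p hh hp hw; rewrite -[RHS](sphere_parts_grad r0 hh hp hw hF).
apply: eq_rint => x _; rewrite smfE mulr_suml -big_split /=; apply: eq_bigr => j _; ring.
Qed.

Lemma rweak_div_pd V (W : 'I_3 -> R3 R -> R) : (forall j, rL2 r (V j)) ->
  (forall j, rL2 r (W j)) -> (forall j, rweak_pd r j (V j) (W j)) ->
  rweak_div r V (fun x => \sum_j W j x).
Proof.
move=> hV hW hw phi tphi.
have bphi : rL2 r phi by apply: bdm_rL2; apply: continuous_bdm; exact: test_continuous tphi.
have bpd j : rL2 r (pd j phi).
  by apply: bdm_rL2; apply: continuous_bdm; exact: test_pd_continuous tphi.
rewrite rint_sum; last by move=> j; exact: rL2M.
rewrite (eq_bigr _ (fun j _ => hw j phi tphi)) sumrN; congr (- _).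
rewrite -rint_sum; last by move=> j; exact: rL2M.
by apply: eq_rint => x _; rewrite mulr_suml.
Qed.

Lemma rL2_cptC b (f : R3 R -> R) : rL2 r f -> rL2 r (fun x => cpt b (f x)%:C).
Proof. by case: b => // _; exact: rL2_0. Qed.

Definition cvec (F : 'I_3 -> smooth R) : vfield R := fun x => \row_j (F j x)%:C.

Lemma cvecE F x j : cvec F x 0 j = (F j x)%:C.
Proof. by rewrite mxE. Qed.

Lemma L2_cvec F : L2 r (cvec F).
Proof.
apply/L2P => j b; have := rL2_cptC b (smooth_rL2 r (F j)); congr (rL2 r _).
by apply/funext => x; rewrite cvecE.
Qed.

Lemma inner_cvec v F b :
  cpt b (inner r v (cvec F)) = rint r (fun x => \sum_j cpt b (v x 0 j) * F j x).
Proof.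
rewrite cpt_integral; apply: eq_rint => x _; rewrite cpt_sum; apply: eq_bigr => j _.
have -> : conjc (cvec F x 0 j) = (F j x)%:C.
  by rewrite cvecE; apply: complex_ext => //=; exact: oppr0.
by rewrite cptMr.
Qed.

Definition cgrad (u : smooth R) : vfield R := cvec (fun j => sd j u).

Lemma cgradE u x j : cgrad u x 0 j = (sd j u x)%:C.
Proof. exact: cvecE. Qed.

Lemma L2_cgrad u : L2 r (cgrad u).
Proof. exact: L2_cvec. Qed.

Lemma inner_cgrad f u b :
  cpt b (inner r f (cgrad u)) = rint r (fun x => \sum_j cpt b (f x 0 j) * sd j u x).
Proof. exact: inner_cvec. Qed.

End weak_forms.

(** * Gradient fields *)

Lemma sum_pair_bound (R : realType) (N : nat) (B : nat -> nat -> R) n m :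
  (forall n m, 0 <= B n m) -> (n < N)%N -> (m < N)%N ->
  B n m <= \sum_(i < N) \sum_(j < N) B i j.
Proof.
move=> B0 nN mN; rewrite (bigD1 (Ordinal nN))//= (bigD1 (Ordinal mN))//= -addrA lerDl.
by apply: addr_ge0; rewrite sumr_ge0// => i _; rewrite sumr_ge0.
Qed.

Section gradient_fields.
Variables (R : realType) (r : R) (alpha : nat -> nat -> R) (c : nat -> nat -> int -> R).
Variable qpm : bool -> nat -> nat -> int -> vfield R.
Hypothesis r_gt0 : 0 < r.
Hypothesis alphaP : forall n, pos_zeros (derive1 (@psi R n)) (alpha n).
Hypothesis qpm_L2 : forall s n m k, (0 < n)%N -> (`|k| <= n)%N -> L2 r (qpm s n m k).
Let I := (kappa 0 + (bool * kappa 1))%type.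
Let q : I -> vfield R := full_sys (qgrad r alpha c) qpm.

Definition nufreq (p : kappa 0) : R := alpha (sval p).1.1 (sval p).1.2 / r.

Definition gfun (p : kappa 0) : smooth R :=
  sC (c (sval p).1.1 (sval p).1.2 (sval p).2 * nufreq p ^+ (sval p).1.1) *
  gsol (sval p).1.1 (nufreq p ^+ 2) (sval p).2.

Lemma kappa_le n0 (p : kappa n0) : (`|(sval p).2| <= (sval p).1.1)%N.
Proof. by case: p => p /= /andP[]. Qed.

Lemma kappa_ge n0 (p : kappa n0) : (n0 <= (sval p).1.1)%N.
Proof. by case: p => p /= /andP[]. Qed.

Lemma alpha_gt0 n m : 0 < alpha n m.
Proof. exact: (zero_pos alphaP). Qed.

Lemma nu_gt0 p : 0 < nufreq p.
Proof. by rewrite /nufreq divr_gt0// alpha_gt0. Qed.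

Lemma nu_Phi p : Phi (sval p).1.1 (nufreq p ^+ 2 * r ^+ 2) = 0.
Proof.
rewrite -exprMn /nufreq divfK ?gt_eqF//.
exact: (zero_F (@dpsi_zero R) alphaP).
Qed.

Lemma neumann_gfun p : neumann3 r (gfun p).
Proof. by apply: neumann3Z; apply: neumann3_gsol; [exact: kappa_le|exact: nu_Phi]. Qed.

Lemma lap_gfun p : lap (gfun p) = - (sC (nufreq p ^+ 2) * gfun p).
Proof. by rewrite /gfun lapZ lap_gsol ?kappa_le//; ring. Qed.

Lemma qgrad_cgrad p x : 0 < enorm x -> q (inl p) x = cgrad (gfun p) x.
Proof.
move=> x0; apply/rowP => j; rewrite !mxE; congr (_%:C).
rewrite sdE; apply: pd_eq_off0 => // y y0.
by rewrite gpotE ?alpha_gt0 ?kappa_le.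
Qed.

Lemma L2_off0 (f g : vfield R) : L2 r g -> (forall x, 0 < enorm x -> f x = g x) -> L2 r f.
Proof.
move=> /L2P hg fg; apply/L2P => j b; apply: rL2_off0 (hg j b) _ => x x0.
by rewrite fg.
Qed.

Lemma full_L2 i : L2 r (q i).
Proof.
case: i => [p|[s p]]; first exact: L2_off0 (L2_cgrad r (gfun p)) (@qgrad_cgrad p).
by apply: qpm_L2; [exact: kappa_ge|exact: kappa_le].
Qed.

Lemma inner_qgrad f p : L2 r f -> inner r f (q (inl p)) = inner r f (cgrad (gfun p)).
Proof.
move=> hf.
have h1 := full_L2 (inl p); have h2 := L2_cgrad r (gfun p).
rewrite (inner_conj h1 hf) (inner_conj h2 hf); congr conjc.
by apply: inner_ae => //; apply: ae_off0; exact: qgrad_cgrad.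
Qed.

Hypothesis on : orthonormal_sys r q.
Hypothesis cs : complete_sys r q.

(** Extension of the potentials by 0 to the curl indices. Partial Fourier sums over the whole index
    set, of a field without curl components, are then gradients of the single function [gsum]. *)
Definition gfull (i : I) : smooth R := if i is inl p then gfun p else 0.

Definition gsum (t : I -> R) (A : {fset I}) : smooth R := \sum_(i <- A) sC (t i) * gfull i.

Lemma sd_gsum t A j : sd j (gsum t A) = \sum_(i <- A) sC (t i) * sd j (gfull i).
Proof.
rewrite /gsum sd_sum; apply: eq_bigr => i _.
by rewrite sdM sd_sC mulr0 addr0.
Qed.

Lemma cpt_psum (a : I -> R[i]) A b j x : (forall i, a (inr i) = 0) -> 0 < enorm x ->
  cpt b (psum q a A x 0 j) = sd j (gsum (fun i => cpt b (a i)) A) x.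
Proof.
move=> a0 x0; rewrite sd_gsum smf_sum /psum summxE cpt_sum.
apply: eq_bigr => -[p|i] _; last first.
  by rewrite a0 scale0r mxE cpt0 smfM sCE mul0r.
have -> : (a (inl p) *: q (inl p) x) 0 j = a (inl p) * (sd j (gfun p) x)%:C.
  by rewrite qgrad_cgrad// mxE cgradE.
by rewrite cptMr smfM sCE.
Qed.

(** Parseval's identity: away from the origin the gradient of the sum of potentials is a combination
    of the orthonormal fields. *)
Lemma rint_G2_gsum t A : (forall i, t (inr i) = 0) ->
  rint r (G2 (gsum t A)) = \sum_(i <- A) t i ^+ 2.
Proof.
move=> t0; pose a i := (t i)%:C.
have a0 i : a (inr i) = 0 by rewrite /a t0.
transitivity (nrm2 r (psum q a A)); last first.
  rewrite (nrm2_psum full_L2 on); apply: eq_bigr => i _.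
  by rewrite /sqn /= expr0n addr0.
rewrite /nrm2 /G2 sint_sum; apply: eq_bigr => j _.
rewrite big_cons big_seq1.
have E b : rint r (fun x => cpt b (psum q a A x 0 j) ^+ 2) =
    rint r (sd j (gsum (fun i => cpt b (a i)) A) ^+ 2).
  apply: rint_ae.
  - have := L2_sum A a full_L2; move=> /L2P/(_ j b)[_ ib]; exact: bint_mfb ib.
  - exact: bint_mfb (smooth_bint _ _).
  - by apply: ae_off0 => x x0; rewrite cpt_psum// smfX.
rewrite !E (_ : gsum (fun i => cpt true (a i)) A = 0).
  rewrite raddf0 expr0n /=.
  have -> : rint r (0 : smooth R) = 0.
    by rewrite -[RHS](rint0 r); apply: eq_rint => x _; rewrite smf0.
  by rewrite addr0.
by rewrite /gsum big1// => i _; rewrite /= /a /= raddf0 mul0r.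
Qed.

Lemma neumann_gsum t A : neumann3 r (gsum t A).
Proof.
apply: (big_ind (neumann3 r)); [exact: neumann3_0|exact: neumann3D|].
move=> [p|i] _; apply: neumann3Z; [exact: neumann_gfun|exact: neumann3_0].
Qed.

Definition nuf (i : I) : R := if i is inl p then nufreq p else 0.

Lemma lap_gsum t A : lap (gsum t A) = gsum (fun i => - (nuf i ^+ 2 * t i)) A.
Proof.
rewrite /gsum lap_sum; apply: eq_bigr => -[p|i] _; last by rewrite lapZ lap0 !mulr0.
by rewrite lapZ lap_gfun raddfN rmorphM /=; ring.
Qed.

Lemma gsumB t A B : (B `<=` A)%fset -> gsum t A - gsum t B = gsum t (A `\` B)%fset.
Proof. by move=> BA; rewrite /gsum (sum_fsetD _ BA) addrC addKr. Qed.

(** The weight 1 + nu^4 arises because [neumann_D3] involves the gradients of u and of [lap u], and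
    [lap] multiplies the coefficients by - nu^2. *)
Lemma gsum_D3 : exists2 C : R, 0 <= C & forall t A, (forall i, t (inr i) = 0) ->
  rint r (G2 (gsum t A)) + (rint r (D2 (gsum t A)) + rint r (D3 (gsum t A))) <=
  C * \sum_(i <- A) (t i ^+ 2 * (1 + nuf i ^+ 4)).
Proof.
have [C C0 h] := neumann_D3 r_gt0.
exists (1 + C); first by rewrite addr_ge0.
move=> t A t0; have [n1 n2 n3] := neumann_gsum t A.
have := h _ n1 n2 n3.
rewrite lap_gsum rint_G2_gsum// rint_G2_gsum; last by move=> i; rewrite t0 mulr0 oppr0.
rewrite -big_split /=.
have -> : \sum_(i <- A) (t i ^+ 2 + (- (nuf i ^+ 2 * t i)) ^+ 2) =
    \sum_(i <- A) (t i ^+ 2 * (1 + nuf i ^+ 4)) by apply: eq_bigr => i _; ring.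
move=> h1; rewrite mulrDl mul1r lerD// ler_sum// => i _.
by rewrite ler_peMr ?sqr_ge0// lerDl exprn_even_ge0.
Qed.

(** By [zeros_le_finite] only finitely many frequencies are at most 2 |lam| + 1, and for these the
    quotient is bounded by the double sum of all its values. Above that bound the constant 4
    suffices. *)
Lemma nu_gap (lam : R) : exists2 K : R, 0 <= K & forall p, nufreq p ^+ 2 != lam ->
  1 + nufreq p ^+ 4 <= K * (lam - nufreq p ^+ 2) ^+ 2.
Proof.
pose B n m := (1 + (alpha n m / r) ^+ 4) / (lam - (alpha n m / r) ^+ 2) ^+ 2.
have B0 n m : 0 <= B n m by rewrite divr_ge0 ?sqr_ge0 ?addr_ge0 ?ler01 ?exprn_even_ge0.
have [N hN] := zeros_le_finite (@dpsi_zero R) alphaP (@Phi_zeros_bounded R) (@Phi_gt0 R)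
  (r * (2%:R * `|lam| + 1)).
have S0 : 0 <= \sum_(i < N) \sum_(j < N) B i j by rewrite sumr_ge0// => i _; rewrite sumr_ge0.
exists (4%:R + \sum_(i < N) \sum_(j < N) B i j); first by rewrite addr_ge0.
move=> p pl; have d0 : 0 < (lam - nufreq p ^+ 2) ^+ 2.
  by rewrite lt_def sqr_ge0 andbT sqrf_eq0 subr_eq0 eq_sym.
rewrite -ler_pdivrMr//.
have [le|gt] := leP (alpha (sval p).1.1 (sval p).1.2) (r * (2%:R * `|lam| + 1)).
  have /andP[h1 h2] := hN _ _ le.
  by apply: le_trans (sum_pair_bound B0 h1 h2) _; rewrite lerDr.
apply: (@le_trans _ _ 4%:R); last by rewrite lerDl.
rewrite ler_pdivrMr//.
have nl : 2%:R * `|lam| + 1 < nufreq p by rewrite /nufreq ltr_pdivlMr// mulrC.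
have l0 := normr_ge0 lam; have ll := ler_norm lam.
set v := nufreq p in nl *; set L := `|lam| in nl l0 ll *.
have v1 : 1 < v by lra.
have vL : 2%:R * L + 1 < v ^+ 2 by rewrite expr2; nra.
(* Squaring this and using 1 + v^4 <= (1 + v^2)^2 gives the factor 4. *)
have h : 0 <= (1 + v ^+ 2) / 2%:R <= v ^+ 2 - lam by apply/andP; split; lra.
have : ((1 + v ^+ 2) / 2%:R) ^+ 2 <= (v ^+ 2 - lam) ^+ 2.
  by case/andP: h => h1 h2; rewrite lerXn2r// nnegrE//; lra.
rewrite (_ : v ^+ 4 = v ^+ 2 * v ^+ 2); last by ring.
set w := v ^+ 2 in vL h *; rewrite !expr2; nra.
Qed.

Lemma gsum_cvg (L : smooth R -> smooth R) (t s : I -> R) (A : nat -> {fset I}) :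
  (forall u v, L (u - v) = L u - L v) ->
  (forall B, rint r (L (gsum t B) ^+ 2) <= \sum_(i <- B) s i) ->
  (forall n, (A n `<=` A n.+1)%fset) ->
  (forall e, 0 < e -> exists N, forall B : {fset I}, (A N `<=` B)%fset ->
     \sum_(i <- (B `\` A N)%fset) s i <= e) ->
  exists w, l2cvg r (fun n => L (gsum t (A n))) w.
Proof.
move=> LB Ls AS tail; apply: rL2_complete => [n|e e0]; first exact: smooth_rL2.
have [N hN] := tail (e / 4%:R) (divr_gt0 e0 (ltr0Sn R 3)).
have small n : (N <= n)%N ->
    rint r (fun x => (L (gsum t (A n)) x - L (gsum t (A N)) x) ^+ 2) <= e / 4%:R.
  move=> Nn; have AA := increasing_fset AS Nn.
  apply: le_trans (hN _ AA); apply: le_trans (Ls _).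
  rewrite -gsumB// LB le_eqVlt; apply/orP; left; apply/eqP.
  by apply: eq_rint => x _; rewrite !smfE.
exists N => n m Nn Nm.
apply: le_trans (rint_sqrD_le (smooth_rL2 r (L (gsum t (A n))))
  (smooth_rL2 r (L (gsum t (A N)))) (smooth_rL2 r (L (gsum t (A m))))) _.
have h1 := small n Nn; have h2 := small m Nm.
have E : rint r (fun x => (L (gsum t (A N)) x - L (gsum t (A m)) x) ^+ 2) =
    rint r (fun x => (L (gsum t (A m)) x - L (gsum t (A N)) x) ^+ 2).
  by apply: eq_rint => x _; rewrite -sqrrN opprB.
rewrite E; lra.
Qed.

Lemma cpt_sqr_le b (z : R[i]) : cpt b z ^+ 2 <= sqn z.
Proof. by rewrite /sqn; case: b; rewrite /= ?lerDr ?lerDl sqr_ge0. Qed.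

(** For partial sums the equation holds exactly, since [lap] acts diagonally on the potentials.
    [gsum_D3] and [nu_gap] make the first, second and third derivatives of the potentials converge
    in L^2; the limits are v and its derivatives up to order 2. The limit is taken for these
    derivatives only, not for the potentials. *)
Lemma gradient_solution (lam : R) (f : vfield R) : L2 r f ->
  (forall j, inner r f (q (inr j)) = 0) ->
  (forall p, nufreq p ^+ 2 = lam -> inner r f (q (inl p)) = 0) ->
  exists2 v, solves_H2 r lam f v & forall j, inner r v (q (inr j)) = 0.
Proof.
move=> hf f0 fres.
pose a i := inner r f (q i).
pose m i := lam - nuf i ^+ 2.
(* At a resonant frequency numerator and denominator are both 0, and so is the quotient. *)
pose t b i := cpt b (a i) / m i.
have a0 i : a (inr i) = 0 by exact: f0.
have t0 b i : t b (inr i) = 0 by rewrite /t a0 cpt0 mul0r.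
have [A [AS tail cvf]] := fourier_expansion full_L2 on cs hf.
have [C C0 hC] := gsum_D3.
have [K K0 hK] := nu_gap lam.
have wt b i : t b i ^+ 2 * (1 + nuf i ^+ 4) <= K * sqn (a i).
  case: i => [p|i]; last by rewrite t0 expr0n mul0r mulr_ge0 ?sqn_ge0.
  have [pl|pl] := eqVneq (nufreq p ^+ 2) lam.
    have -> : t b (inl p) = 0 by rewrite /t /a fres// cpt0 mul0r.
    by rewrite expr0n mul0r mulr_ge0 ?sqn_ge0.
  have d0 : 0 < m (inl p) ^+ 2.
    by rewrite lt_def sqr_ge0 andbT sqrf_eq0 subr_eq0 eq_sym.
  rewrite /t expr_div_n -mulrAC ler_pdivrMr//.
  apply: (@le_trans _ _ (sqn (a (inl p)) * (1 + nuf (inl p) ^+ 4))).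
    by rewrite ler_wpM2r ?cpt_sqr_le// addr_ge0 ?ler01 ?exprn_even_ge0.
  by rewrite [K * _]mulrC -mulrA; apply: ler_wpM2l; [exact: sqn_ge0|exact: hK].
have tail' e : 0 < e -> exists N, forall B : {fset I}, (A N `<=` B)%fset ->
    \sum_(i <- (B `\` A N)%fset) (C * (K * sqn (a i))) <= e.
  move=> e0; have CK1 : 0 < C * K + 1 by rewrite ltr_wpDl// mulr_ge0.
  have [N hN] := tail _ (divr_gt0 e0 CK1).
  exists N => B AB; have := hN B AB; rewrite ler_pdivlMr// -2!mulr_sumr.
  set S := \sum_(i <- _) _; have S0 : 0 <= S by apply: sumr_ge0 => i _; exact: sqn_ge0.
  by move=> h; apply: le_trans h; rewrite mulrA mulrDr mulr1 [S * _]mulrC lerDl.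
have bd b B (L : smooth R -> smooth R) :
    (forall u x, L u x ^+ 2 <= (G2 u + (D2 u + D3 u)) x) ->
    rint r (L (gsum (t b) B) ^+ 2) <= \sum_(i <- B) (C * (K * sqn (a i))).
  move=> hL; apply: (@le_trans _ _ (rint r (G2 (gsum (t b) B) +
      (D2 (gsum (t b) B) + D3 (gsum (t b) B))))).
    by apply: le_sint => x _; rewrite smfX.
  rewrite !sintD; apply: le_trans (hC _ _ (t0 b)) _.
  by rewrite mulr_sumr ler_sum// => i _; rewrite ler_wpM2l.
pose U b n := gsum (t b) (A n).
have cv b (L : smooth R -> smooth R) : (forall u v, L (u - v) = L u - L v) ->
    (forall u x, L u x ^+ 2 <= (G2 u + (D2 u + D3 u)) x) ->
    exists w, l2cvg r (fun n => L (U b n)) w.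
  by move=> LB hL; refine (gsum_cvg LB _ AS tail') => B; exact: bd.
have bd1 j (u : smooth R) x : sd j u x ^+ 2 <= (G2 u + (D2 u + D3 u)) x.
  by rewrite !smfD; have := comp_le_G2 u x j; have := D2_ge0 u x; have := D3_ge0 u x; lra.
have bd2 i j (u : smooth R) x : sd i (sd j u) x ^+ 2 <= (G2 u + (D2 u + D3 u)) x.
  by rewrite !smfD; have := comp_le_D2 u x i j; have := G2_ge0 u x; have := D3_ge0 u x; lra.
have bd3 k i j (u : smooth R) x : sd k (sd i (sd j u)) x ^+ 2 <= (G2 u + (D2 u + D3 u)) x.
  rewrite !smfD; have := G2_ge0 u x; have := D2_ge0 u x.
  have := comp_le_D2 (sd j u) x k i.
  have : D2 (sd j u) x <= D3 u x.
    by rewrite D3_D2 (bigD1 j)//= lerDl sumr_ge0// => l _; exact: D2_ge0.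
  lra.
have [W1 hW1] := l2cvg_choice (fun bj : bool * 'I_3 =>
  cv bj.1 _ (@sdB R bj.2) (bd1 bj.2)).
have sB2 i j (u w : smooth R) : sd i (sd j (u - w)) = sd i (sd j u) - sd i (sd j w).
  by rewrite !sdB.
have sB3 k i j (u w : smooth R) :
    sd k (sd i (sd j (u - w))) = sd k (sd i (sd j u)) - sd k (sd i (sd j w)).
  by rewrite !sdB.
have [W2 hW2] := l2cvg_choice (fun bij : bool * 'I_3 * 'I_3 =>
  cv bij.1.1 (fun u => sd bij.1.2 (sd bij.2 u)) (sB2 bij.1.2 bij.2) (bd2 bij.1.2 bij.2)).
have [W3 hW3] := l2cvg_choice (fun bij : bool * 'I_3 * 'I_3 * 'I_3 =>
  cv bij.1.1.1 (fun u => sd bij.1.1.2 (sd bij.1.2 (sd bij.2 u)))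
     (sB3 bij.1.1.2 bij.1.2 bij.2) (bd3 bij.1.1.2 bij.1.2 bij.2)).
pose v : vfield R := fun x => \row_j cplx (fun b => W1 (b, j)) x.
have vE b j x : cpt b (v x 0 j) = W1 (b, j) x by rewrite mxE cpt_cplx.
pose w2 i j : sfield R := cplx (fun b => W2 (b, i, j)).
pose w3 k i j : sfield R := cplx (fun b => W3 (b, k, i, j)).
have lL2 F g : l2cvg r F g -> rL2 r g by case.
have cL2 (F : bool -> R3 R -> R) : (forall b, rL2 r (F b)) -> L2s r (cplx F).
  by move=> h; apply/L2sP => b; rewrite (funext (cpt_cplx b F)).
have hv : L2 r v.
  by apply/L2P => j b; rewrite (funext (vE b j)); exact: lL2 (hW1 (b, j)).
have hw2 i j : L2s r (w2 i j) by apply: cL2 => b; exact: lL2 (hW2 (b, i, j)).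
have hw3 k i j : L2s r (w3 k i j) by apply: cL2 => b; exact: lL2 (hW3 (b, k, i, j)).
have d12 i j : weak_pd r i (vcomp v j) (w2 i j).
  apply/weak_pdP => b; rewrite (funext (vE b j)) (funext (cpt_cplx b _)).
  by apply: l2cvg_rweak_pd (hW1 (b, j)) (hW2 (b, i, j)) => n; exact: smooth_rweak_pd.
have d23 k i j : weak_pd r k (w2 i j) (w3 k i j).
  apply/weak_pdP => b; rewrite (funext (cpt_cplx b _)) (funext (cpt_cplx b _)).
  by apply: l2cvg_rweak_pd (hW2 (b, i, j)) (hW3 (b, k, i, j)) => n; exact: smooth_rweak_pd.
have hHk : Hk r 2 v.
  move=> j; split; first exact: hv.
  move=> i; exists (w2 i j); first exact: d12.
  split; first exact: hw2.
  by move=> k; exists (w3 k i j); [exact: d23|split].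
pose D b x := \sum_i W2 (b, i, i) x.
pose d := cplx D.
have cD b : l2cvg r (fun n => lap (U b n)) (D b).
  have := l2cvg_sum (index_enum 'I_3) (fun i => hW2 (b, i, i)).
  apply: eq_l2cvg => //= [n x _|n|]; first by rewrite smf_sum.
    exact: smooth_rL2.
  by apply: rL2_sum => i; exact: lL2 (hW2 (b, i, i)).
have hd : L2s r d by apply: cL2 => b; exact: lL2 (cD b).
have wd : weak_div r v d.
  apply/weak_divP => b; rewrite (funext (cpt_cplx b _)).
  rewrite (_ : (fun j x => cpt b (v x 0 j)) = fun j => W1 (b, j)); last first.
    by apply/funext => j; exact: funext (vE b j).
  apply: rweak_div_pd => [j|j|j]; [exact: lL2 (hW1 (b, j))|exact: lL2 (hW2 (b, j, j))|].
  by apply: l2cvg_rweak_pd (hW1 (b, j)) (hW2 (b, j, j)) => n; exact: smooth_rweak_pd.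
have hfc b j : l2cvg r (fun n => sd j (gsum (fun i => cpt b (a i)) (A n))) (fun x => cpt b (f x 0 j)).
  apply: l2cvg_off0 (cvf j b) => n x x0; by rewrite -cpt_psum.
have lapU b n : lap (U b n) = gsum (fun i => cpt b (a i)) (A n) - sC lam * U b n.
  rewrite /U lap_gsum /gsum mulr_sumr -sumrB; apply: eq_bigr => i _.
  rewrite mulrA -mulrBl -rmorphM -rmorphB; congr (sC _ * _).
  rewrite /t; have [m0|m0] := eqVneq (m i) 0; last by rewrite /m in m0 *; field.
  have -> : a i = 0; last by rewrite cpt0 mul0r !mulr0 subrr oppr0.
  case: i m0 => [p|i] m0; last exact: a0.
  by apply: fres; move/eqP: m0; rewrite subr_eq0 => /eqP.
have nt : normal_trace0 r v.
  apply: (normal_trace0_cpt hv hd wd) => b; rewrite (funext (cpt_cplx b _)).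
  rewrite (_ : (fun j x => cpt b (v x 0 j)) = fun j => W1 (b, j)); last first.
    by apply/funext => j; exact: funext (vE b j).
  apply: (@rtrace0_limit R r (fun n j => sd j (U b n)) (fun n => lap (U b n))) => //.
    by move=> n; apply: rtrace0_smooth => //; have [] := neumann_gsum (t b) (A n).
  by move=> j; exact: hW1 (b, j).
exists v; last first.
  (* [ab] joins the two real families of coefficients into a complex one, the point 0 being a dummy
     argument. The field v is the limit of the corresponding partial sums, which have no curl
     components. *)
  move=> i; pose ab k := cplx (fun b _ => t b k) 0.
  have ab0 j : ab (inr j) = 0 by apply: cpt_ext => b; rewrite cpt_cplx t0 cpt0.
  have cv' : vcvg r (fun n => psum q ab (A n)) v.
    move=> j b; rewrite (funext (vE b j)).
    apply: l2cvg_off0 (hW1 (b, j)) => n x x0; rewrite cpt_psum//= /U /gsum.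
    by congr (sd _ _ _); apply: eq_bigr => k _; rewrite cpt_cplx.
  apply: cpt_ext => b; rewrite cpt0.
  have := @vcvg_inner _ _ _ _ _ cv' (full_L2 (inr i)) b.
  have E n : cpt b (inner r (psum q ab (A n)) (q (inr i))) = 0.
    by rewrite (inner_psum full_L2 on) ab0 if_same cpt0.
  rewrite (funext E : (fun n => cpt b (inner r (psum q ab (A n)) (q (inr i)))) = fun=> 0).
  move=> h; apply: cvg_unique h _; first exact: Rhausdorff.
  exact: cvg_cst.
split=> //; split=> //; exists d, (fun x => f x - lam%:C *: v x); split=> //.
- by apply: L2B => //; exact: L2Z.
- move=> j; apply/weak_pdP => b; rewrite (funext (cpt_cplx b _)).
  have cG : l2cvg r (fun n => sd j (lap (U b n))) (fun x => cpt b (f x 0 j) - lam * W1 (b, j) x).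
    have := l2cvgD (hfc b j) (l2cvgZ (- lam) (hW1 (b, j))).
    apply: eq_l2cvg => [n x _|n||x _].
    - rewrite lapU sdB sdM sd_sC mulr0 addr0 !smfE; ring.
    - exact: smooth_rL2.
    - apply: rL2B; first exact: lL2 (hfc b j).
      by apply: rL2Z; exact: lL2 (hW1 (b, j)).
    - by rewrite mulNr.
  have := l2cvg_rweak_pd (fun n => @smooth_rweak_pd R r j (lap (U b n))) (cD b) cG.
  congr (rweak_pd _ _ _ _); apply/funext => x; rewrite /vcomp -vE !mxE cptD cptN.
  by congr (_ - _); rewrite (mulrC lam%:C) cptMr mulrC.
- by apply: ae_triv => x _; rewrite subrK.
Qed.

(** The partial sums are gradients of smooth functions, whose mixed second derivatives commute, and
    the weak identity passes to the L^2 limit. *)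
Lemma curl_free_of_orthogonal (f : vfield R) : L2 r f ->
  (forall j, inner r f (q (inr j)) = 0) -> weak_rot r f (fun=> 0).
Proof.
move=> hf f0; pose a i := inner r f (q i).
have a0 i : a (inr i) = 0 by exact: f0.
have [A [_ _ cvf]] := fourier_expansion full_L2 on cs hf.
have hfc b j : l2cvg r (fun n => sd j (gsum (fun i => cpt b (a i)) (A n))) (fun x => cpt b (f x 0 j)).
  by apply: l2cvg_off0 (cvf j b) => n x x0; rewrite -cpt_psum.
have /L2P hfr := hf.
apply/weak_rotP => b phi tphi i.
have bpd j : rL2 r (pd j phi).
  by apply: bdm_rL2; apply: continuous_bdm; exact: test_pd_continuous tphi.
rewrite rintB; [|exact: rL2M..].
rewrite (l2cvg_pair_eq (hfc b (i + 1)) (hfc b (i + 2%:R)) (bpd (i + 2%:R)) (bpd (i + 1))).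
  by rewrite subrr -[LHS](rint0 r); apply: eq_rint => x _; rewrite mxE cpt0 mul0r.
by move=> n; rewrite (@smooth_rweak_pd R r (i + 2%:R) _ phi tphi) (@smooth_rweak_pd R r (i + 1) _ phi tphi) sd_comm.
Qed.

End gradient_fields.

(** * Eigenfields of the curl *)

Section curl_algebra.
Variable R : realType.
Implicit Types (u v : smooth R) (A : 'I_3 -> smooth R).

Definition srot A (i : 'I_3) : smooth R :=
  sd (i + 1) (A (i + 2%:R)) - sd (i + 2%:R) (A (i + 1)).

Lemma div_srot A : \sum_i sd i (srot A i) = 0.
Proof. rewrite sum3 /srot !ord3E !sdB !sdO; ring. Qed.

Lemma srot_radial u i : srot (fun j => sX R j * u) i = - ang i u.
Proof.
elim/ord3_ind: i; rewrite /srot !angE !ord3E !sdM !sdX3 !ord3_eqE ?eqxx /=; ring.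
Qed.

Lemma srot_ang u i : srot (fun a => ang a u) i = sX R i * lap u - sd i (u + eul u).
Proof.
rewrite sdD sd_eul /lap !sum3.
elim/ord3_ind: i; rewrite /srot !ord3E !angE !sdB !sdM !sdX3 !ord3_eqE ?eqxx /= ?sdO.
all: ring.
Qed.

Lemma sX_ang u : \sum_i sX R i * ang i u = 0.
Proof. rewrite sum3 !angE; ring. Qed.

Lemma srotD A B i : srot (fun j => A j + B j) i = srot A i + srot B i.
Proof. rewrite /srot !sdD; ring. Qed.

Lemma srotZ c A i : srot (fun j => sC c * A j) i = sC c * srot A i.
Proof. rewrite /srot !sdM !sd_sC; ring. Qed.

Lemma srot_sum (I : Type) (s : seq I) (A : I -> 'I_3 -> smooth R) i :
  srot (fun j => \sum_(k <- s) A k j) i = \sum_(k <- s) srot (A k) i.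
Proof. by rewrite /srot !sd_sum -sumrB. Qed.

(* [efield l u] is, up to a factor, the field rot rot (x u) + l rot (x u), and
   [epot l u] is a vector potential of it that vanishes with u on the sphere. *)
Definition epot (l : R) u i : smooth R := sX R i * u + sC (- l^-1) * ang i u.
Definition efield (l : R) u := srot (epot l u).

(** [srot_radial] and [srot_ang] give the curls of the two parts of the potential. The equation for
    [u] turns [lap u] back into [u], so the curl of [epot l u] is l times [epot l u] up to a
    gradient. *)
Lemma efieldE l u i : l != 0 -> lap u = - (sC (l ^+ 2) * u) ->
  efield l u i = sC l * epot l u i + sC l^-1 * sd i (u + eul u).
Proof.
move=> l0 hu; rewrite /efield srotD srotZ srot_radial srot_ang hu /epot.
have E1 : sC l * sC (- l^-1) = -1 :> smooth R.
  by rewrite -rmorphM mulrN divff// rmorphN rmorph1.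
have E2 : sC (- l^-1) * sC (l ^+ 2) = - sC l :> smooth R.
  by rewrite -rmorphM expr2 mulNr mulKf// rmorphN.
have E3 : sC l^-1 = - sC (- l^-1) :> smooth R by rewrite rmorphN opprK.
rewrite E3; set D := sd i _.
transitivity (- ang i u - sC (- l^-1) * sC (l ^+ 2) * (sX R i * u) - sC (- l^-1) * D); first by ring.
rewrite E2; transitivity (sC l * (sX R i * u) + (sC l * sC (- l^-1)) * ang i u - sC (- l^-1) * D).
  rewrite E1; ring.
ring.
Qed.

Lemma sX_efield l u (n : nat) : l != 0 -> lap u = - (sC (l ^+ 2) * u) ->
  \sum_a ang a (ang a u) = - (n * n.+1)%:R * u ->
  \sum_i sX R i * efield l u i = sC (l^-1 * (n * n.+1)%:R) * u.
Proof.
move=> l0 hu hn.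
have E i : sX R i * efield l u i = sC l * (sX R i ^+ 2 * u) +
    sC l * sC (- l^-1) * (sX R i * ang i u) + sC l^-1 * (sX R i * sd i (u + eul u)).
  rewrite (efieldE i l0 hu) /epot; ring.
rewrite (eq_bigr _ (fun i _ => E i)) !big_split /= -!mulr_sumr sX_ang mulr0 addr0.
rewrite -mulr_suml -/(s2 R) -/(eul (u + eul u)) eulD.
have := s2_lap u; rewrite hu hn => h.
have -> : eul u + eul (eul u) = (n * n.+1)%:R * u - s2 R * (sC (l ^+ 2) * u).
  transitivity (s2 R * - (sC (l ^+ 2) * u) + (n * n.+1)%:R * u); last by ring.
  rewrite h; ring.
have E2 : sC l^-1 * sC (l ^+ 2) = sC l :> smooth R by rewrite -rmorphM expr2 mulKf.
have -> : sC (l^-1 * (n * n.+1)%:R) = sC l^-1 * (n * n.+1)%:R :> smooth R.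
  by rewrite rmorphM; congr (_ * _); rewrite rmorph_nat.
rewrite mulrBr.
transitivity (sC l * (s2 R * u) + (sC l^-1 * ((n * n.+1)%:R * u) - sC l^-1 * sC (l ^+ 2) * (s2 R * u))).
  ring.
rewrite E2; ring.
Qed.

(** By [s2_lap] the angular Laplacian of a harmonic function is -(E^2 + E) with E the operator
    [eul], and E is multiplication by n on homogeneous polynomials of degree n. *)
Lemma ang_ang_solid n k : (`|k| <= n)%N ->
  \sum_a ang a (ang a (solid R n k)) = - (n * n.+1)%:R * solid R n k.
Proof.
move=> kn; have := s2_lap (solid R n k).
rewrite lap_solid// mulr0 !eul_solid//.
have -> : eul (n%:R * solid R n k) = n%:R * (n%:R * solid R n k).
  by have := eulZ n%:R (solid R n k); rewrite rmorph_nat eul_solid.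
move=> h; apply/eqP; rewrite -subr_eq0; apply/eqP.
rewrite natrM -natr1; set S := \sum_a _ in h *; set P := solid R n k in h *.
rewrite [LHS](_ : _ = n%:R * (n%:R * P) + n%:R * P + S); last by ring.
by rewrite -h.
Qed.

Lemma ang_gsol a n (t : R) k : ang a (gsol n t k) = rad n t * ang a (solid R n k).
Proof. by rewrite /gsol angM ang_rad mulr0 addr0. Qed.

Lemma ang_ang_gsol n (t : R) k : (`|k| <= n)%N ->
  \sum_a ang a (ang a (gsol n t k)) = - (n * n.+1)%:R * gsol n t k.
Proof.
move=> kn; rewrite (eq_bigr (fun a => rad n t * ang a (ang a (solid R n k)))).
  by rewrite -mulr_sumr ang_ang_solid// /gsol; ring.
by move=> a _; rewrite ang_gsol angM ang_rad mulr0 addr0.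
Qed.

Lemma solid_homogeneous n k (a : R) x : (`|k| <= n)%N -> 0 < a -> 0 < enorm x ->
  solid R n k (a *: x) = a ^+ n * solid R n k x.
Proof.
move=> kn a0 x0.
have ex : enorm (a *: x) = a * enorm x.
  apply: (@pexpIrn _ 2) => //; rewrite ?nnegrE ?mulr_ge0 ?enorm_ge0 ?ltW//.
  by rewrite exprMn !enorm_sqr !coordZ !exprMn -!mulrDr.
have a0' := lt0r_neq0 a0; have x0' := lt0r_neq0 x0.
rewrite -solidE// ex ?mulf_neq0// -solidE// exprMn -mulrA; congr (_ * (_ * sph_harm n k _)).
by case: x x0' {ex x0} => [[x y] z] x0' /=; congr (_, _, _); rewrite /GRing.scale /=; field;
  rewrite x0' a0'.
Qed.

End curl_algebra.

(** * Weak curls and orthogonality relations *)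

Section curl_weak.
Variables (R : realType) (r : R).
Hypothesis r_gt0 : 0 < r.
Implicit Types (v w : vfield R) (A E F : 'I_3 -> smooth R) (u f g : smooth R).

(** Each component of the weak curl is a divergence identity with a scalar test function, so
    [sphere_parts_scalar] admits components [A i] that vanish on the sphere only to first order. *)
Lemma rot_parts v w A b : L2 r v -> L2 r w -> weak_rot r v w -> (forall i, vb r (A i)) ->
  rint r (fun x => \sum_i cpt b (v x 0 i) * srot A i x) =
  rint r (fun x => \sum_i cpt b (w x 0 i) * A i x).
Proof.
move=> /L2P hv /L2P hw /weak_rotP hr hA.
pose U (i k : 'I_3) : R3 R -> R :=
  if k == i + 2%:R then (fun x => cpt b (v x 0 (i + 1)))
  else if k == i + 1 then (fun x => - cpt b (v x 0 (i + 2%:R))) else (fun=> 0).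
have hU i k : rL2 r (U i k).
  rewrite /U; case: ifP => _; first exact: hv.
  by case: ifP => _; [exact: rL2N|exact: rL2_0].
have US (i : 'I_3) (x : R3 R) (g : 'I_3 -> R) : \sum_k U i k x * g k =
    cpt b (v x 0 (i + 1)) * g (i + 2%:R) - cpt b (v x 0 (i + 2%:R)) * g (i + 1).
  rewrite sum3 /U; elim/ord3_ind: i; rewrite !ord3E ?ord3_eqE ?eqxx /=; ring.
have E i : rint r (fun x => cpt b (v x 0 (i + 1)) * sd (i + 2%:R) (A i) x
       - cpt b (v x 0 (i + 2%:R)) * sd (i + 1) (A i) x) = rint r (fun x => cpt b (w x 0 i) * A i x).
  have := @sphere_parts_scalar R r (U i) (fun x => - cpt b (w x 0 i)) (A i) r_gt0 (hU i)
    (rL2N (hw i b)) (hA i).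
  have i1 (s : 'I_3) (g : R3 R -> R) : rL2 r g -> bint r (fun x => cpt b (v x 0 s) * g x).
    by move=> hg; exact: rL2M.
  have i2 (g : R3 R -> R) : rL2 r g -> bint r (fun x => cpt b (w x 0 i) * g x).
    by move=> hg; exact: rL2M.
  have sp (g : 'I_3 -> R3 R -> R) (h : R3 R -> R) : (forall k, rL2 r (g k)) -> rL2 r h ->
      rint r (fun x => \sum_k U i k x * g k x + - cpt b (w x 0 i) * h x) =
      rint r (fun x => cpt b (v x 0 (i + 1)) * g (i + 2%:R) x
                     - cpt b (v x 0 (i + 2%:R)) * g (i + 1) x)
      - rint r (fun x => cpt b (w x 0 i) * h x).
    move=> hg hh; rewrite -rintB; [|by apply: bintB; exact: i1|exact: i2].
    by apply: eq_rint => x _; rewrite (US i x (fun k => g k x)) mulNr.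
  move=> H; apply/eqP; rewrite -subr_eq0; apply/eqP.
  rewrite -(sp (fun k => sd k (A i)) (A i)).
  - apply: H => phi tphi; rewrite (sp (fun k => pd k phi) phi).
    + by rewrite (hr b phi tphi i) subrr.
    + by move=> k; apply: bdm_rL2; apply: continuous_bdm; exact: test_pd_continuous tphi.
    + by apply: bdm_rL2; apply: continuous_bdm; exact: test_continuous tphi.
  - by move=> k; exact: smooth_rL2.
  - exact: smooth_rL2.
have iE i : bint r (fun x => cpt b (v x 0 (i + 1)) * sd (i + 2%:R) (A i) x
       - cpt b (v x 0 (i + 2%:R)) * sd (i + 1) (A i) x).
  by apply: bintB; apply: rL2M => //; exact: smooth_rL2.
rewrite [RHS]rint_sum; last by move=> i; apply: rL2M => //; exact: smooth_rL2.
rewrite -(eq_bigr _ (fun i _ => E i)) -rint_sum//.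
apply: eq_rint => x _; rewrite !sum3 /srot !ord3E !smfE; ring.
Qed.

Lemma test_sd (f : smooth R) i : test_fun r f -> test_fun r (sd i f).
Proof.
move=> [_ [s sr f0]]; split; first by move=> n; apply: Sn_Cn; exact: smooth_Sn.
exists ((s + r) / 2%:R); first by rewrite midf_lt.
move=> x sx; rewrite sdE; apply: test_pd0 f0 _.
by apply: lt_le_trans sx; rewrite midf_lt.
Qed.

Lemma chi_vanish (P : R3 R -> R) : bint r P ->
  (forall k, rint r (fun x => chi r k x * P x) = 0) -> rint r P = 0.
Proof.
move=> hP h; apply: (@cut_limit R r P (fun=> 0)) => //.
  by have := rL2_bint (rL2_0 r).
by move=> k; rewrite -[RHS](h k); apply: eq_rint => x _; rewrite mulr0 addr0.
Qed.

(** div rot = 0 rests on the symmetry of second derivatives, which [Cn] does not record; hence the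
    bundled smooth test function. *)
Lemma weak_rot_div0 v w b (f : smooth R) : L2 r v -> L2 r w -> weak_rot r v w ->
  test_fun r f -> rint r (fun x => \sum_i cpt b (w x 0 i) * sd i f x) = 0.
Proof.
move=> /L2P hv /L2P hw /weak_rotP hr tf.
rewrite rint_sum; last by move=> i; apply: rL2M => //; exact: smooth_rL2.
have E i : rint r (fun x => cpt b (w x 0 i) * sd i f x) =
    rint r (fun x => cpt b (v x 0 (i + 1)) * sd (i + 2%:R) (sd i f) x
                   - cpt b (v x 0 (i + 2%:R)) * sd (i + 1) (sd i f) x).
  by rewrite -hr; [rewrite !sdE|exact: test_sd].
rewrite (eq_bigr _ (fun i _ => E i)) -rint_sum.
  rewrite -[RHS](rint0 r); apply: eq_rint => x _.
  by rewrite sum3 !ord3E !sdO; ring.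
by move=> i; apply: bintB; apply: rL2M => //; exact: smooth_rL2.
Qed.

Lemma rweak_div_vanish (V : 'I_3 -> R3 R -> R) D (f : smooth R) : rL2 r D ->
  rweak_div r V D ->
  (forall k, rint r (fun x => \sum_i V i x * sd i (chi r k * f) x) = 0) ->
  rint r (fun x => D x * f x) = 0.
Proof.
move=> hD wD h; apply: chi_vanish; first by apply: rL2M => //; exact: smooth_rL2.
move=> k; have t := chi_test k f r_gt0.
have := wD _ t.
have -> : rint r (fun x => \sum_j V j x * pd j (chi r k * f) x) = 0.
  by rewrite -[RHS](h k); apply: eq_rint => x _; apply: eq_bigr => j _; rewrite sdE.
move=> /eqP; rewrite eq_sym oppr_eq0 => /eqP e.
by rewrite -[RHS]e; apply: eq_rint => x _; rewrite smfM; ring.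
Qed.

Lemma weak_grad_smooth (f : smooth R) : weak_grad r (fun x => (f x)%:C) (cgrad f).
Proof.
move=> j; apply/weak_pdP => -[].
  rewrite (_ : (fun x => cpt true (vcomp (cgrad f) j x)) = fun=> 0); last first.
    by apply/funext => x; rewrite /vcomp cgradE.
  move=> phi _; have E (g : R3 R -> R) : rint r (fun x => 0 * g x) = 0.
    by rewrite -[RHS](rint0 r); apply: eq_rint => x _; rewrite mul0r.
  by rewrite [in RHS]E oppr0 -[RHS](E (pd j phi)); apply: eq_rint.
have := @smooth_rweak_pd R r j f; congr (rweak_pd _ _ _ _).
by apply/funext => x; rewrite /vcomp cgradE.
Qed.

Lemma normal_trace0_smooth v d (f : smooth R) b : L2 r v -> L2s r d ->
  (forall h p, L2s r h -> L2 r p -> weak_grad r h p ->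
      cintegral r (fun x => \sum_j v x 0 j * p x 0 j + d x * h x) = 0) ->
  rint r (fun x => \sum_j cpt b (v x 0 j) * sd j f x) + rint r (fun x => cpt b (d x) * f x) = 0.
Proof.
move=> /L2P hv /L2sP hd tr.
have hf : L2s r (fun x => (f x)%:C).
  by apply/L2sP => b'; exact: rL2_cptC (smooth_rL2 r f).
have := congr1 (cpt b) (tr _ _ hf (L2_cgrad r f) (weak_grad_smooth f)).
rewrite cpt_integral cpt0 => e; rewrite -[RHS]e -rintD.
- apply: eq_rint => x _; rewrite cptD cpt_sum cptMr; congr (_ + _).
  by apply: eq_bigr => j _; rewrite cgradE cptMr.
- by apply: bint_sum => j; apply: rL2M => //; exact: smooth_rL2.
- by apply: rL2M => //; exact: smooth_rL2.
Qed.

Section eigenfield.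
Variables (q : vfield R) (m : R).
Hypotheses (hq : L2 r q) (m0 : m != 0) (rq : weak_rot r q (fun x => m%:C *: q x)).
Hypothesis nq : normal_trace0 r q.

Lemma cpt_scale b (v : vfield R) (a : R) x j : cpt b ((a%:C *: v x) 0 j) = a * cpt b (v x 0 j).
Proof. by rewrite mxE mulrC cptMr mulrC. Qed.

(** As a curl divided by [m] the field is divergence free, and Green's formula in [normal_trace0]
    then leaves only its pairing with the gradient. *)
Lemma eigenfield_grad (f : smooth R) b : rint r (fun x => \sum_j cpt b (q x 0 j) * sd j f x) = 0.
Proof.
have [d [hd /weak_divP wd tr]] := nq; have /L2P hqr := hq; have /L2sP hdr := hd.
have := normal_trace0_smooth f b hq hd tr.
rewrite (rweak_div_vanish (f := f) (hdr b) (wd b)) ?addr0// => k.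
have t := chi_test k f r_gt0.
have := weak_rot_div0 b hq (L2Z m%:C hq) rq t.
rewrite (_ : rint r _ = m * rint r (fun x => \sum_i cpt b (q x 0 i) * sd i (chi r k * f) x)).
  by move/eqP; rewrite mulf_eq0 (negPf m0) => /eqP.
rewrite -rintZ.
  apply: eq_rint => x _; rewrite mulr_sumr; apply: eq_bigr => i _.
  by rewrite cpt_scale mulrA.
by apply: bint_sum => i; apply: rL2M => //; exact: smooth_rL2.
Qed.

(* Both [rot (epot l u) = l * epot l u + gradient] and [rot q = m * q] move onto
   the same integral, with the factors [l] and [m]. *)
Lemma eigenfield_orthogonal (l : R) u : l != 0 -> l != m -> lap u = - (sC (l ^+ 2) * u) ->
  (forall i, vb r (epot l u i)) -> inner r q (cvec (efield l u)) = 0.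
Proof.
move=> l0 lm hu va; apply: cpt_ext => b; rewrite inner_cvec cpt0.
have /L2P hqr := hq.
pose X := rint r (fun x => \sum_i cpt b (q x 0 i) * epot l u i x).
have iX (F : 'I_3 -> smooth R) : bint r (fun x => \sum_i cpt b (q x 0 i) * F i x).
  by apply: bint_sum => i; apply: rL2M => //; exact: smooth_rL2.
have e1 : rint r (fun x => \sum_i cpt b (q x 0 i) * efield l u i x) = m * X.
  rewrite (rot_parts b hq (L2Z m%:C hq) rq va) /X -rintZ//.
  apply: eq_rint => x _; rewrite mulr_sumr; apply: eq_bigr => i _.
  by rewrite cpt_scale mulrA.
have e2 : rint r (fun x => \sum_i cpt b (q x 0 i) * efield l u i x) = l * X.
  have := eigenfield_grad (u + eul u) b => g0.
  transitivity (l * X + l^-1 * rint r (fun x => \sum_j cpt b (q x 0 j) * sd j (u + eul u) x));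
    last by rewrite g0 mulr0 addr0.
  rewrite /X -!rintZ// -rintD; [|exact: bintZ..].
  apply: eq_rint => x _; rewrite !mulr_sumr -big_split; apply: eq_bigr => i _.
  rewrite (efieldE i l0 hu) smfD !smfM !sCE.
  set P := epot l u i x; set Q := cpt b _; set D := sd i _ x.
  transitivity (l * (Q * P) + l^-1 * (Q * D)) => //; ring.
rewrite e1; have : (l - m) * X = 0 by rewrite mulrBl -e1 -e2 subrr.
by move/eqP; rewrite mulf_eq0 subr_eq0 (negPf lm) /= => /eqP ->; rewrite mulr0.
Qed.

End eigenfield.

Lemma solenoidal_orthogonal F (f : smooth R) : \sum_i sd i (F i) = 0 ->
  vb r (\sum_i sX R i * F i) -> inner r (cvec F) (cgrad f) = 0.
Proof.
move=> dF vF; apply: cpt_ext => b; rewrite inner_cgrad cpt0; case: b.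
  rewrite -[RHS](rint0 r); apply: eq_rint => x _; rewrite big1// => j _.
  by rewrite cvecE mul0r.
have := @divergence_theorem R r (fun i => f * F i) r_gt0.
have -> : \sum_i sX R i * (f * F i) = f * \sum_i sX R i * F i.
  by rewrite mulr_sumr; apply: eq_bigr => i _; ring.
have -> : \sum_i sd i (f * F i) = \sum_i F i * sd i f.
  transitivity (\sum_i (f * sd i (F i) + F i * sd i f)).
    by apply: eq_bigr => i _; rewrite sdM.
  by rewrite big_split /= -mulr_sumr dF mulr0 add0r.
move=> e; rewrite -[RHS]e; last exact: vbM.
by apply: eq_rint => x _; rewrite smf_sum; apply: eq_bigr => j _; rewrite cvecE smfM.
Qed.

Lemma ang_parts (a : 'I_3) f g : rint r (ang a f * g) = - rint r (f * ang a g).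
Proof.
pose F (j : 'I_3) : smooth R := if j == a + 2%:R then sX R (a + 1) * (f * g)
  else if j == a + 1 then - (sX R (a + 2%:R) * (f * g)) else 0.
have := @divergence_theorem R r F r_gt0.
have -> : \sum_j sX R j * F j = 0.
  rewrite sum3 /F; elim/ord3_ind: a {F}; rewrite !ord3E ?ord3_eqE ?eqxx /=; ring.
have -> : \sum_j sd j (F j) = ang a f * g + f * ang a g.
  rewrite sum3 /F; elim/ord3_ind: a {F}; rewrite !angE !ord3E ?ord3_eqE ?eqxx /= ?sdN !sdM !sdX3
    !ord3_eqE /= ?raddf0; ring.
by move=> /(_ (vb0 r)); rewrite sintD => /eqP; rewrite addr_eq0 => /eqP.
Qed.

Lemma angular_orthogonal (a b : R) f g : \sum_i ang i (ang i f) = sC a * f ->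
  \sum_i ang i (ang i g) = sC b * g -> a != b -> rint r (f * g) = 0.
Proof.
move=> ef eg ab.
have e1 : rint r ((\sum_i ang i (ang i f)) * g) = rint r (f * \sum_i ang i (ang i g)).
  rewrite mulr_suml mulr_sumr !sint_sum; apply: eq_bigr => i _.
  by rewrite (ang_parts i (ang i f) g) (mulrC f) (ang_parts i (ang i g) f) (mulrC (ang i g)).
have : (a - b) * rint r (f * g) = 0.
  apply/eqP; rewrite mulrBl subr_eq0 -!sintZ; apply/eqP.
  rewrite mulrA -ef e1 eg; congr (rint r _); congr smooth_fun; ring.
by move/eqP; rewrite mulf_eq0 subr_eq0 (negPf ab) => /eqP.
Qed.

Lemma smooth_ae0 f : ae_eq_ball r f (fun=> 0) -> forall x, eball r x -> f x = 0.
Proof.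
move=> [N [mN N0 sN]] x Bx; apply/eqP/negPn/negP => fx0.
pose O := [set y : R3 R | f y != 0] `&` eball r.
have oO : open O.
  apply: openI.
    rewrite (_ : [set y | _] = f @^-1` [set y | y != 0]) //.
    by apply: open_comp; [move=> y _; exact: smooth_continuous|exact: open_neq].
  have -> : eball r = @enorm R @^-1` `]-oo, r[%classic.
    by apply/seteqP; split=> y; rewrite /eball /= in_itv.
  by apply: open_comp; [move=> y _; exact: enorm_continuous | exact: interval_open].
have nO : nbhs x O by apply: open_nbhs_nbhs; split=> //; split.
have [e e0 be] : exists2 e : R, 0 < e & box3 x e `<=` O.
  have /nbhs_ballP[e /= e0 be] := nO.
  by exists e => // y [[y1 y2] y3]; apply: be.
have ON : O `<=` N by move=> y [fy By]; apply: sN => /(_ By) f0; rewrite /= f0 eqxx in fy.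
have : (@leb3 R (box3 x e) <= 0)%E.
  rewrite -N0; apply: le_measure; rewrite ?inE//; first exact: measurable_box3.
  exact: subset_trans be ON.
rewrite /box3 leb3_prod; [|by apply: measurableX; exact: measurable_ball|exact: measurable_ball].
rewrite product_measure1E; [|exact: measurable_ball..].
have E : (@lebesgue_measure R (ball x.1.1 e) * @lebesgue_measure R (ball x.1.2 e) *
    @lebesgue_measure R (ball x.2 e) = ((e *+ 2) * (e *+ 2) * (e *+ 2))%:E)%E.
  by rewrite !lebesgue_measure_ball ?ltW// !EFinM.
move=> h; have {h} : (@lebesgue_measure R (ball x.1.1 e) * @lebesgue_measure R (ball x.1.2 e) *
    @lebesgue_measure R (ball x.2 e) <= 0)%E := h.
by rewrite E lee_fin leNgt => /negP; apply; rewrite !mulr_gt0 ?pmulrn_lgt0.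
Qed.

End curl_weak.

(** * The span of the explicit curl eigenfields *)

Section curl_fields.
Variables (R : realType) (r : R) (alpha rho : nat -> nat -> R) (c : nat -> nat -> int -> R).
Variable qpm : bool -> nat -> nat -> int -> vfield R.
Hypothesis r_gt0 : 0 < r.
Hypothesis alphaP : forall n, pos_zeros (derive1 (@psi R n)) (alpha n).
Hypothesis rhoP : forall n, pos_zeros (@psi R n) (rho n).
Hypothesis qpmP : forall s n m k, (0 < n)%N -> (`|k| <= n)%N ->
    [/\ L2 r (qpm s n m k),
        weak_rot r (qpm s n m k)
          (fun x => ((-1) ^+ s * (rho n m / r))%:C *: qpm s n m k x) &
        normal_trace0 r (qpm s n m k)].
Let I := (kappa 0 + (bool * kappa 1))%type.
Let J := (bool * kappa 1)%type.
Let q : I -> vfield R := full_sys (qgrad r alpha c) qpm.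
Hypothesis on : orthonormal_sys r q.
Hypothesis cs : complete_sys r q.

Lemma qpm_L2 s n m k : (0 < n)%N -> (`|k| <= n)%N -> L2 r (qpm s n m k).
Proof. by move=> n0 kn; have [] := qpmP s m n0 kn. Qed.

Let qL2 i : L2 r (q i) := full_L2 c r_gt0 alphaP qpm_L2 i.

Definition cev (j : J) : R := (-1) ^+ j.1 * (rho (sval j.2).1.1 (sval j.2).1.2 / r).
Definition ufun (j : J) : smooth R := gsol (sval j.2).1.1 (cev j ^+ 2) (sval j.2).2.
Definition efun (j : J) : 'I_3 -> smooth R := efield (cev j) (ufun j).

Lemma rho_gt0 n m : 0 < rho n m.
Proof. exact: (zero_pos rhoP). Qed.

Lemma ev_neq0 j : cev j != 0.
Proof. by rewrite mulf_neq0 ?signr_eq0// gt_eqF// divr_gt0// rho_gt0. Qed.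

Lemma ev_sqr j : cev j ^+ 2 = (rho (sval j.2).1.1 (sval j.2).1.2 / r) ^+ 2.
Proof. by rewrite exprMn sqrr_sign mul1r. Qed.

Lemma vb_ev j : vb r (rad (sval j.2).1.1 (cev j ^+ 2)).
Proof.
apply: vb_rad; rewrite ev_sqr -exprMn divfK ?gt_eqF//.
exact: (zero_F (@psi_zero R) rhoP).
Qed.

Lemma epot_vb j i : vb r (epot (cev j) (ufun j) i).
Proof.
apply: vbD; first by apply: vbM; apply: vbMr; exact: vb_ev.
by apply: vbM; rewrite ang_gsol; apply: vbMr; exact: vb_ev.
Qed.

Lemma lap_ufun j : lap (ufun j) = - (sC (cev j ^+ 2) * ufun j).
Proof. by rewrite lap_gsol// kappa_le. Qed.

Lemma sX_efun j : \sum_i sX R i * efun j i =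
  sC ((cev j)^-1 * ((sval j.2).1.1 * (sval j.2).1.1.+1)%:R) * ufun j.
Proof. by apply: sX_efield; [exact: ev_neq0|exact: lap_ufun|apply: ang_ang_gsol; exact: kappa_le]. Qed.

Lemma vb_sX_efun j : vb r (\sum_i sX R i * efun j i).
Proof. by rewrite sX_efun; apply: vbM; apply: vbMr; exact: vb_ev. Qed.

Lemma efun_inl j p : inner r (cvec (efun j)) (q (inl p)) = 0.
Proof.
rewrite (inner_qgrad c r_gt0 alphaP qpm_L2)//; last exact: L2_cvec.
by apply: solenoidal_orthogonal => //; [exact: div_srot|exact: vb_sX_efun].
Qed.

Lemma eigen_q (j : J) : [/\ L2 r (q (inr j)), weak_rot r (q (inr j)) (fun x => (cev j)%:C *: q (inr j) x) &
  normal_trace0 r (q (inr j))].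
Proof. by case: j => s p; apply: qpmP; [exact: kappa_ge|exact: kappa_le]. Qed.

Lemma efun_inr i j : cev j != cev i -> inner r (cvec (efun j)) (q (inr i)) = 0.
Proof.
move=> ij; have [h1 h2 h3] := eigen_q i.
rewrite (inner_conj h1 (L2_cvec r (efun j))).
rewrite (eigenfield_orthogonal r_gt0 h1 (ev_neq0 i) h2 h3 (ev_neq0 j) ij (lap_ufun j) (@epot_vb j)).
by apply: complex_ext => //=; exact: oppr0.
Qed.

(** The sign of the eigenvalue determines the Boolean, and the zeros of one psi_n are distinct.
    Equal eigenvalues for different n remain possible, which is why whole eigenspaces are compared
    below. *)
Lemma ev_inj i j : cev i = cev j -> (sval i.2).1.1 = (sval j.2).1.1 ->
  (sval i.2).2 = (sval j.2).2 -> i = j.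
Proof.
case: i => s [[[n m] k] hp]; case: j => s' [[[n' m'] k'] hp'] /= h nn kk; subst n' k'.
have a1 : 0 < rho n m / r by rewrite divr_gt0// rho_gt0.
have a2 : 0 < rho n m' / r by rewrite divr_gt0// rho_gt0.
have [ss mm] : s = s' /\ m = m'.
  have D := mulIf (invr_neq0 (lt0r_neq0 r_gt0)).
  move: h; rewrite /cev /=; case: s; case: s'; rewrite ?expr1 ?expr0 ?mulN1r ?mul1r => h.
  - by split=> //; apply: (zero_inj rhoP); apply: D; exact: (oppr_inj h).
  - by move: a2; rewrite -h oppr_gt0 ltNge ltW.
  - by move: a1; rewrite h oppr_gt0 ltNge ltW.
  - by split=> //; apply: (zero_inj rhoP); exact: (D _ _ h).
by subst s' m'; congr (s, _); exact: val_inj.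
Qed.

Lemma ev_finite (l : R) : exists S : {fset J}, forall j, (j \in S) = (cev j == l).
Proof.
have [N hN] := zeros_le_finite (@psi_zero R) rhoP (@H_zeros_bounded R)
  (fun n y (_ : (3 <= n)%N) => @H_gt0 R n y) (r * `|l|).
pose key (j : J) := (j.1, (sval j.2)).
have key_inj : injective key.
  by move=> [s p] [s' p'] [-> h]; congr (_, _); exact: val_inj.
have fin : finite_set [set j : J | cev j = l].
  pose D : set (bool * (nat * nat * int)) := [set: bool] `*` ((`I_N `*` `I_N) `*`
     ((fun i : nat => i%:Z - N%:Z) @` `I_(2 * N + 1))).
  have fD : finite_set D.
    apply: finite_setX; first exact: finite_finset.
    apply: finite_setX; first by apply: finite_setX; exact: finite_II.
    by apply: finite_image; exact: finite_II.
  have : finite_set (key @^-1` D).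
    by apply: finite_preimage fD => x y _ _; exact: key_inj.
  apply: sub_finite_set => -[s p] /= evl; split=> //=.
  have rl : rho (sval p).1.1 (sval p).1.2 <= r * `|l|.
    have nl : `|cev (s, p)| = rho (sval p).1.1 (sval p).1.2 / r.
      by rewrite normrM normr_sign mul1r ger0_norm// ltW// divr_gt0// rho_gt0.
    by rewrite -evl nl mulrC divfK ?gt_eqF.
  have /andP[h1 h2] := hN _ _ rl; have hk := kappa_le p.
  split; first by split.
  exists `|((sval p).2 + N%:Z)%R|%N => /=; move: h1 hk; case: (sval p) => [[n m] k] /=; lia.
exists (fset_set [set j : J | cev j = l]) => j.
rewrite in_fset_set//; apply/idP/eqP; by rewrite inE.
Qed.

Section independence.
Variables (K : nat) (s : 'I_K -> J) (l : R).
Hypothesis s_inj : injective s.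
Hypothesis evs : forall a, cev (s a) = l.
Let sn a := (sval (s a).2).1.1.
Let sk a := (sval (s a).2).2.

Lemma ufun_orthogonal a b : sn a != sn b -> rint r (ufun (s a) * ufun (s b)) = 0.
Proof.
move=> ab; apply: (@angular_orthogonal R r r_gt0 (- (sn a * (sn a).+1)%:R) (- (sn b * (sn b).+1)%:R)).
- by rewrite ang_ang_gsol ?kappa_le// rmorphN rmorph_nat.
- by rewrite ang_ang_gsol ?kappa_le// rmorphN rmorph_nat.
rewrite eqr_opp eqr_nat; apply: contra ab => /eqP e; apply/eqP; nia.
Qed.

(** Independence of the solid harmonics of degree n is inherited from the assumed orthonormality of
    the gradient fields: those with indices (n, 0, k) share one radial factor, and multiplying the
    given relation by it yields a relation between their potentials. *)
Lemma solid_indep (n : nat) (b : 'I_K -> R) :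
  (forall x, 0 < enorm x -> \sum_(a | sn a == n) b a * solid R n (sk a) x = 0) ->
  forall a, sn a = n -> b a = 0.
Proof.
move=> h a0 a0n.
(* Indices [a] of another degree are sent to the dummy order 0; their coefficient [T a] is 0. *)
have fP (a : 'I_K) : (0 <= n)%N && (`|if sn a == n then sk a else 0| <= n)%N.
  by case: eqP => // <-; rewrite kappa_le.
have [/eqP N0|] := boolP (n == 0%N).
  by have := kappa_ge (s a0).2; rewrite -/(sn a0) a0n N0.
move=> n0.
pose fwd (a : 'I_K) : kappa 0 := exist _ ((n, 0%N), if sn a == n then sk a else 0) (fP a).
have fwd_inj a b0 : sn a = n -> sn b0 = n -> fwd a = fwd b0 -> a = b0.
  move=> an bn /(congr1 (fun p => (sval p).2)) /=; rewrite an bn eqxx => kk.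
  by apply: s_inj; apply: ev_inj; [rewrite !evs|rewrite -/(sn a) -/(sn b0) an bn|].
pose nu0 := alpha n 0 / r; pose g a := c n 0 (sk a) * nu0 ^+ n.
(* The normalizing constant is nonzero because a vanishing field cannot have norm 1. *)
have g0 a : sn a = n -> g a != 0.
  move=> an; apply/eqP => g0; have := on (inl (fwd a)) (inl (fwd a)).
  rewrite eqxx (inner_qgrad c r_gt0 alphaP qpm_L2)//.
  have -> : gfun r alpha c (fwd a) = 0.
    rewrite /gfun /= an eqxx -/nu0 /nufreq /= -/nu0.
    by rewrite (g0 : c n 0 (sk a) * nu0 ^+ n = 0) rmorph0 mul0r.
  have -> : inner r (q (inl (fwd a))) (cgrad 0) = 0.
    apply: cpt_ext => b0; rewrite inner_cgrad cpt0 -[RHS](rint0 r).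
    by apply: eq_rint => x _; rewrite big1// => j _; rewrite raddf0 smf0 mulr0.
  by move/eqP; rewrite eq_sym oner_eq0.
pose T a := if sn a == n then (b a / g a)%:C else 0.
have qE : ae_eq_ball r (fun x => \sum_(a <- index_enum 'I_K) T a *: q (inl (fwd a)) x) (fun=> 0).
  apply: ae_off0 => x x0.
  pose Q : smooth R := \sum_(a | sn a == n) sC (b a) * solid R n (sk a).
  have Q0 : Q = 0.
    have Qx y : 0 < enorm y -> Q y = 0.
      move=> y0; rewrite /Q smf_sum -[RHS](h y y0); apply: eq_bigr => a _.
      by rewrite smfM sCE.
    apply: smooth_ext => y; rewrite smf0; have [y0|] := boolP (0 < enorm y); first exact: Qx.
    rewrite lt_def enorm_eq0 enorm_ge0 andbT negbK => /eqP ->.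
    apply: (@smooth_ae0 R r Q); first exact: ae_off0.
    by rewrite /eball /= (_ : enorm 0 = 0)//; apply/eqP; rewrite enorm_eq0.
  transitivity (cgrad (rad n (nu0 ^+ 2) * Q) x); last first.
    by rewrite Q0 mulr0; apply/rowP => j; rewrite cgradE raddf0 smf0 mxE.
  apply/rowP => j; rewrite summxE cgradE /Q mulr_sumr sd_sum smf_sum.
  rewrite [RHS](raddf_sum (real_complex R)) /= [RHS]big_mkcond /=.
  apply: eq_bigr => a _; rewrite mxE /T; case: ifP => [/eqP an|_]; last by rewrite mul0r.
  rewrite (qgrad_cgrad c qpm r_gt0 alphaP (fwd a) x0 : at_kappa (qgrad r alpha c) (fwd a) x = _).
  rewrite cgradE -rmorphM /=; congr (_%:C).
  have -> : gfun r alpha c (fwd a) = sC (g a) * gsol n (nu0 ^+ 2) (sk a).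
    by rewrite /gfun /= an eqxx /nufreq /=.
  have -> : rad n (nu0 ^+ 2) * (sC (b a) * solid R n (sk a)) = sC (b a) * gsol n (nu0 ^+ 2) (sk a).
    by rewrite /gsol; ring.
  rewrite !sdM !sd_sC !mulr0 !addr0 !smfM !sCE mulrA divfK//; exact: g0.
have := inner_ae (L2_sum (index_enum 'I_K) T (fun a => qL2 (inl (fwd a)))) (L20 r) (qL2 (inl (fwd a0))) qE.
rewrite inner0l inner_suml => [|a|]; [|exact: qL2|exact: qL2].
rewrite (bigD1 a0 isT) big1 => [|a aa0]; last first.
  rewrite on /T; case: ifP => [/eqP an|_]; last by rewrite mul0r.
  rewrite (_ : (_ == _) = false) ?mulr0//; apply/negbTE/eqP => h0.
  have e := fwd_inj _ _ an a0n (@inl_inj _ _ _ _ h0).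
  by move: aa0; rewrite e eqxx.
move=> e; have {e} : T a0 * inner r (q (inl (fwd a0))) (q (inl (fwd a0))) + 0 = 0 := e.
rewrite addr0 on eqxx mulr1 /T a0n eqxx => /(congr1 (fun z => complex.Re z)) /= /eqP.
by rewrite mulf_eq0 invr_eq0 (negPf (g0 _ a0n)) orbF => /eqP.
Qed.

(* The radial components of the fields are multiples of the [ufun]. Those with
   distinct [n] are orthogonal, being eigenfunctions of the angular Laplacian. *)
Lemma efun_indep (t : 'I_K -> R) :
  (forall i, ae_eq_ball r (fun x => \sum_a t a * efun (s a) i x) (fun=> 0)) -> forall a, t a = 0.
Proof.
move=> h a0; pose n := sn a0.
have l0 : l != 0 by rewrite -(evs a0) ev_neq0.
pose b a := t a * (l^-1 * (sn a * (sn a).+1)%:R).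
pose w : smooth R := \sum_a sC (b a) * ufun (s a).
have w0 : ae_eq_ball r w (fun=> 0).
  have hi := ae_conj (h 0) (ae_conj (h 1) (h 2%:R)).
  apply: ae_mono hi => x [h0 [h1 h2]] Bx; rewrite /w smf_sum.
  transitivity (\sum_i sX R i x * \sum_a t a * efun (s a) i x).
    transitivity (\sum_a t a * (\sum_i sX R i * efun (s a) i) x).
      apply: eq_bigr => a _; rewrite sX_efun evs smfM [in RHS]smfM !sCE /b mulrA.
      by [].
    rewrite (eq_bigr (fun i => \sum_a sX R i x * (t a * efun (s a) i x))); last first.
      by move=> i _; rewrite mulr_sumr.
    rewrite exchange_big; apply: eq_bigr => a _; rewrite smf_sum mulr_sumr.
    by apply: eq_bigr => i _; rewrite smfM mulrCA.
  by rewrite sum3 h0// h1// h2// !mulr0 !addr0.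
pose v : smooth R := \sum_(a | sn a == n) sC (b a) * ufun (s a).
pose v' : smooth R := \sum_(a | sn a != n) sC (b a) * ufun (s a).
have wE : w = v + v' by rewrite /w (bigID (fun a => sn a == n)).
have wx := smooth_ae0 w0.
(* Eigenfunctions of the angular Laplacian for different degrees are orthogonal; as w = v + v'
   vanishes on the ball, the integral of v^2 is then 0. *)
have vv' : rint r (v' * v) = 0.
  have E : v' * v = \sum_(ab : 'I_K * 'I_K | (sn ab.1 != n) && (sn ab.2 == n))
      sC (b ab.1 * b ab.2) * (ufun (s ab.1) * ufun (s ab.2)).
    rewrite /v' /v big_distrlr /= pair_big /=; apply: eq_bigr => -[a1 a2] _ /=.
    by rewrite (rmorphM (@sC R) (b a1) (b a2)) mulrACA.
  rewrite E -big_filter sint_sum big1_seq// => -[a1 a2] /=.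
  rewrite mem_filter /= => /andP[/andP[h1 /eqP h2] _].
  apply: etrans (@sintZ R r (b a1 * b a2) (ufun (s a1) * ufun (s a2))) _.
  by rewrite ufun_orthogonal ?mulr0// h2.
have v2 : rint r (fun x => v x ^+ 2) = 0.
  have : rint r (w * v) = 0.
    by rewrite -[RHS](rint0 r); apply: eq_rint => x Bx; rewrite smfM wx// mul0r.
  rewrite wE mulrDl sintD vv' addr0 => e; rewrite -[RHS]e; apply: eq_rint => x _.
  by rewrite smfM expr2.
have vx := smooth_ae0 (rint_sqr_eq0 (smooth_rL2 r v) v2).
have Q0 x : 0 < enorm x -> \sum_(a | sn a == n) b a * solid R n (sk a) x = 0.
  (* The point x is shrunk to y = x / d with d so large that y lies in the ball and l^2 |y|^2 <= 1,
     where the radial factor [H n] is positive. Homogeneity brings the relation back to x. *)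
  move=> x0; pose d := 1 + s2 R x * (l ^+ 2 + 1 + (r ^+ 2)^-1).
  have s20 : 0 < s2 R x by rewrite s2E exprn_gt0.
  have l20 : 0 < l ^+ 2 by rewrite lt_def sqrf_eq0 l0 sqr_ge0.
  have ri0 : 0 < (r ^+ 2)^-1 by rewrite invr_gt0 exprn_gt0.
  have d1 : 1 < d by rewrite /d ltrDl mulr_gt0// !addr_gt0.
  have d0 : 0 < d := lt_trans ltr01 d1.
  pose y := d^-1 *: x.
  have s2y : s2 R y = d^-1 ^+ 2 * s2 R x.
    by rewrite !s2E !enorm_sqr !coordZ !exprMn -!mulrDr.
  have sy : s2 R y <= d^-1 * s2 R x.
    have d1' : d^-1 <= 1 by rewrite invf_le1 ?ltW.
    rewrite s2y expr2; apply: ler_wpM2r; first exact: ltW.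
    by rewrite ler_piMr// invr_ge0 ltW.
  have sd1 z : 0 <= z -> z <= l ^+ 2 + 1 + (r ^+ 2)^-1 -> d^-1 * s2 R x * z < 1.
    move=> z0 zl; rewrite -mulrA mulrC ltr_pdivrMr// mul1r /d.
    by rewrite ltr_pwDl// ler_wpM2l// ltW.
  have Ly : l ^+ 2 * s2 R y <= 1.
    apply: le_trans (ler_wpM2l (ltW l20) sy) _; rewrite mulrC ltW// sd1 ?ltW//.
    by rewrite -addrA ltrDl addr_gt0.
  have By : eball r y.
    have : s2 R y < r ^+ 2.
      apply: le_lt_trans sy _; rewrite -[X in _ < X]mul1r -ltr_pdivrMr ?exprn_gt0//.
      by apply: sd1; [exact: ltW|rewrite lerDr addr_ge0 ?ler01// ltW].
    rewrite s2E /eball /= => h2; rewrite ltNge; apply/negP => h3; move: h2; apply/negP; rewrite -leNgt.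
    by apply: lerXn2r; rewrite // nnegrE ?enorm_ge0// ltW.
  have := vx y By; rewrite /v smf_sum.
  have E a : sn a == n -> (sC (b a) * ufun (s a)) y =
      H n (l ^+ 2 * s2 R y) * d^-1 ^+ n * (b a * solid R n (sk a) x).
    move=> /eqP an; rewrite smfM sCE /ufun /gsol evs -/(sn a) an smfM radE.
    by rewrite solid_homogeneous ?invr_gt0// -?an ?kappa_le//; ring.
  rewrite (eq_bigr _ E) -mulr_sumr => /eqP; rewrite mulf_eq0 => /orP[|/eqP//].
  rewrite mulf_eq0 expf_eq0 invr_eq0 (gt_eqF d0) andbF orbF gt_eqF//.
  apply: H_gt0; apply/andP; split; first by rewrite mulr_ge0 ?sqr_ge0// s2E sqr_ge0.
  by apply: le_trans Ly _; rewrite ler1n addn3.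
have := solid_indep Q0 (erefl (sn a0)).
move/eqP; rewrite /b mulf_eq0 => /orP[/eqP//|].
rewrite mulf_eq0 invr_eq0 (negPf l0) /= pnatr_eq0 muln_eq0 orbF => /eqP n0.
by have := kappa_ge (s a0).2; rewrite -/(sn a0) n0.
Qed.

End independence.

(* The explicit fields [efun] with the eigenvalue of [q (inr j)] are independent,
   lie in the span of the given eigenfields with the same eigenvalue, and there
   are as many of the former as of the latter. *)
Lemma curl_eigenfield_span (j : J) : exists (K : nat) (s : 'I_K -> J) (d : 'I_K -> R[i]),
  ae_eq_ball r (q (inr j)) (fun x => \sum_a d a *: cvec (efun (s a)) x).
Proof.
have [S hS] := ev_finite (cev j).
pose K := size (enum_fset S); pose s (a : 'I_K) : J := nth j (enum_fset S) a.
have sS a : s a \in S by exact: mem_nth.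
have s_inj : injective s.
  move=> a b /eqP; rewrite nth_uniq ?fset_uniq// => /eqP ab; exact: val_inj.
have evs a : cev (s a) = cev j by apply/eqP; rewrite -hS.
have hE a : L2 r (cvec (efun (s a))) by exact: L2_cvec.
pose M : 'M[R[i]]_K := \matrix_(a, b) inner r (cvec (efun (s a))) (q (inr (s b))).
have innerX (d : 'I_K -> R[i]) i :
    inner r (fun x => \sum_a d a *: cvec (efun (s a)) x) (q i) =
    \sum_a d a * inner r (cvec (efun (s a))) (q i).
  by apply: inner_suml.
have Mfree : row_free M.
  (* A combination of the explicit fields that is orthogonal to the basis fields of this eigenvalue
     is orthogonal to the whole basis, hence zero by completeness, and [efun_indep] makes its
     coefficients zero. *)
  apply: inj_row_free => v vM.
  have z : ae_eq_ball r (fun x => \sum_a v 0 a *: cvec (efun (s a)) x) (fun=> 0).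
    apply: cs; first exact: L2_sum.
    move=> [p|i]; rewrite innerX.
      by rewrite big1// => a _; rewrite efun_inl mulr0.
    have [iS|iS] := boolP (i \in S).
      have iK : (index i (enum_fset S) < K)%N by rewrite index_mem.
      have := congr1 (fun A : 'rV[R[i]]_K => A 0 (Ordinal iK)) vM; rewrite !mxE => e; rewrite -[RHS]e.
      by apply: eq_bigr => a _; rewrite mxE /s /= nth_index.
    rewrite big1// => a _; rewrite efun_inr ?mulr0// evs eq_sym.
    by apply: contra iS => /eqP e; rewrite hS e.
  apply/rowP => a; rewrite mxE; apply: cpt_ext => b; rewrite cpt0.
  apply: (efun_indep s_inj evs (t := fun a => cpt b (v 0 a))) => i.
  apply: ae_mono (ae_cpt z i b) => x h Bx.
  have := h Bx; rewrite summxE cpt_sum mxE cpt0 => e; rewrite -[RHS]e.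
  by apply: eq_bigr => a' _; rewrite mxE cvecE cptMr.
have Mu : M \in unitmx by rewrite -row_free_unit.
have jS : j \in S by rewrite hS.
have jK : (index j (enum_fset S) < K)%N by rewrite index_mem.
pose b0 := Ordinal jK; have sb0 : s b0 = j by rewrite /s /= nth_index.
(* The row [b0] of the inverse of [M] gives the combination the same Fourier coefficients as
   [q (inr j)]. *)
exists K, s, (fun a => invmx M b0 a).
apply: (@complete_ae R r I q qL2 cs); [exact: qL2|exact: L2_sum|].
move=> i; rewrite innerX on.
case: i => [p|i].
  by rewrite big1 ?mulr0// => a _; rewrite efun_inl mulr0.
have [iS|iS] := boolP (i \in S).
  have iK : (index i (enum_fset S) < K)%N by rewrite index_mem.
  have := congr1 (fun A : 'M[R[i]]_K => A b0 (Ordinal iK)) (mulVmx Mu); rewrite !mxE.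
  rewrite (_ : \sum_a _ = \sum_a invmx M b0 a * inner r (cvec (efun (s a))) (q (inr i))); last first.
    by apply: eq_bigr => a _; rewrite mxE /s /= nth_index.
  move=> ->; rewrite (inj_eq (@inr_inj _ _)); congr (_%:R); congr nat_of_bool.
  apply/eqP/eqP => [ji|e]; first by apply: val_inj; rewrite /= ji.
  by rewrite -(nth_index j jS) -(nth_index j iS); have := congr1 val e => /= ->.
rewrite big1 => [|a _].
  rewrite (inj_eq (@inr_inj _ _)) (_ : (j == i) = false)//.
  by apply: contraNF iS => /eqP <-.
rewrite efun_inr ?mulr0// evs eq_sym.
by apply: contra iS => /eqP e; rewrite hS e.
Qed.

End curl_fields.

(** * Solutions of the boundary value problem *)

Section transfer.
Variables (R : realType) (r : R).
Hypothesis r_gt0 : 0 < r.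
Implicit Types (u h d : sfield R) (v w p : vfield R).

Lemma test_rL2 phi : test_fun r phi -> rL2 r phi.
Proof. by move=> t; apply: bdm_rL2; apply: continuous_bdm; exact: test_continuous t. Qed.

Lemma test_pd_rL2 phi j : test_fun r phi -> rL2 r (pd j phi).
Proof. by move=> t; apply: bdm_rL2; apply: continuous_bdm; exact: test_pd_continuous t. Qed.

Lemma test_weak_pd phi j : test_fun r phi -> rweak_pd r j phi (pd j phi).
Proof.
move=> tphi f tf.
have i1 := rL2M (test_rL2 tphi) (test_pd_rL2 j tf).
have i2 := rL2M (test_rL2 tf) (test_pd_rL2 j tphi).
apply/eqP; rewrite -subr_eq0 opprK; apply/eqP.
have -> : rint r (fun x => pd j phi x * f x) = rint r (fun x => f x * pd j phi x).
  by apply: eq_rint => x _; rewrite mulrC.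
rewrite -rintD//; have [_ [s sr phi0]] := tphi.
pose s' := (s + r) / 2%:R.
have [ss sr'] : s < s' /\ s' < r by rewrite /s' !midf_lt.
apply: (@rint_pd0 R r j (fun x => phi x * f x) _ s' sr').
- have c1 := test_continuous tphi; have c2 := test_continuous tf.
  have c3 := test_pd_continuous (j := j) tphi; have c4 := test_pd_continuous (j := j) tf.
  by move=> x; exact: (continuousD (continuousM (c1 x) (c4 x)) (continuousM (c2 x) (c3 x))).
- by move=> x; exact: is_deriveM (test_is_derive j x tphi) (test_is_derive j x tf).
- move=> x sx; have sx' := lt_le_trans ss sx.
  by rewrite phi0 ?ltW// (test_pd0 j phi0 sx') !mul0r mulr0 addr0.
Qed.

Lemma test_weak_grad phi : test_fun r phi ->
  weak_grad r (fun x => (phi x)%:C) (fun x => \row_j (pd j phi x)%:C).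
Proof.
move=> tphi j; apply/weak_pdP => -[]; last first.
  have := test_weak_pd j tphi; congr (rweak_pd _ _ _ _).
  by apply/funext => x; rewrite /vcomp mxE.
move=> psi tpsi; have E (g g' : R3 R -> R) : (forall x, g x = 0) -> rint r (fun x => g x * g' x) = 0.
  by move=> h; rewrite -[RHS](rint0 r); apply: eq_rint => x _; rewrite h mul0r.
by rewrite !E ?oppr0// => x; rewrite /vcomp mxE.
Qed.

Lemma rint_ae_mul (f f' g : R3 R -> R) : rL2 r f -> rL2 r f' -> rL2 r g -> ae_eq_ball r f f' ->
  rint r (fun x => f x * g x) = rint r (fun x => f' x * g x).
Proof.
move=> hf hf' hg ff'; apply: rint_ae; [exact: bint_mfb (rL2M hf hg)|exact: bint_mfb (rL2M hf' hg)|].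
by apply: ae_mono ff' => x h Bx; rewrite h.
Qed.

Lemma rweak_pd_ae j (f f' g : R3 R -> R) : rL2 r f -> rL2 r f' -> ae_eq_ball r f f' ->
  rweak_pd r j f g -> rweak_pd r j f' g.
Proof.
move=> hf hf' ff' hw phi tphi; rewrite -hw//; apply/esym.
by apply: rint_ae_mul => //; exact: test_pd_rL2.
Qed.

Lemma rint_sum_ae (V V' P : 'I_3 -> R3 R -> R) : (forall j, rL2 r (V j)) -> (forall j, rL2 r (V' j)) ->
  (forall j, rL2 r (P j)) -> (forall j, ae_eq_ball r (V j) (V' j)) ->
  rint r (fun x => \sum_j V j x * P j x) = rint r (fun x => \sum_j V' j x * P j x).
Proof.
move=> hV hV' hP VV'; rewrite !rint_sum; [|by move=> j; exact: rL2M..].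
by apply: eq_bigr => j _; exact: rint_ae_mul.
Qed.

Lemma Hks_L2s k u : Hks r k u -> L2s r u.
Proof. by case: k => [|k] []. Qed.

Lemma Hks_ae k u u' : L2s r u' -> ae_eq_ball r u u' -> Hks r k u -> Hks r k u'.
Proof.
move=> hu' uu'; case: k => [|k] [hu H]; split=> // j.
have [w hw Hw] := H j; exists w => //; apply/weak_pdP => b.
have /weak_pdP/(_ b) := hw; apply: rweak_pd_ae; [by have /L2sP := hu|by have /L2sP := hu'|].
by apply: ae_mono uu' => x e Bx; rewrite e.
Qed.

Lemma Hks_smooth k (f : bool -> smooth R) : Hks r k (cplx (fun b => smooth_fun (f b))).
Proof.
have L (g : bool -> smooth R) : L2s r (cplx (fun b => smooth_fun (g b))).
  by apply/L2sP => b; rewrite (funext (cpt_cplx b _)); exact: smooth_rL2.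
elim: k f => [|k IH] f; first by split=> //; exact: L.
split; first exact: L.
move=> j; exists (cplx (fun b => smooth_fun (sd j (f b)))); last exact: IH.
apply/weak_pdP => b; rewrite (funext (cpt_cplx b _)) (funext (cpt_cplx b _)).
exact: smooth_rweak_pd.
Qed.

Lemma rweak_pdD j (f g f' g' : R3 R -> R) : rL2 r f -> rL2 r g -> rL2 r f' -> rL2 r g' ->
  rweak_pd r j f f' -> rweak_pd r j g g' ->
  rweak_pd r j (fun x => f x + g x) (fun x => f' x + g' x).
Proof.
move=> hf hg hf' hg' wf wg phi tphi.
have D (a b c : R3 R -> R) : rL2 r a -> rL2 r b -> rL2 r c ->
    rint r (fun x => (a x + b x) * c x) = rint r (fun x => a x * c x) + rint r (fun x => b x * c x).
  move=> ha hb hc; rewrite -rintD; [|exact: rL2M..].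
  by apply: eq_rint => x _; rewrite mulrDl.
rewrite !D ?wf ?wg ?opprD//; [exact: test_rL2|exact: test_pd_rL2].
Qed.

Lemma rweak_pdZ j (a : R) (f f' : R3 R -> R) : rL2 r f -> rL2 r f' -> rweak_pd r j f f' ->
  rweak_pd r j (fun x => a * f x) (fun x => a * f' x).
Proof.
move=> hf hf' wf phi tphi.
have Z (g c : R3 R -> R) : rL2 r g -> rL2 r c ->
    rint r (fun x => a * g x * c x) = a * rint r (fun x => g x * c x).
  move=> hg hc; rewrite -rintZ; last exact: rL2M.
  by apply: eq_rint => x _; rewrite mulrA.
by rewrite !Z ?wf ?mulrN//; [exact: test_rL2|exact: test_pd_rL2].
Qed.

Lemma cptZ b (a : R) (z : R[i]) : cpt b (a%:C * z) = a * cpt b z.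
Proof. by rewrite mulrC cptMr mulrC. Qed.

Lemma Hks_lin k u u' (a : R) : Hks r k u -> Hks r k u' -> Hks r k (fun x => u x + a%:C * u' x).
Proof.
have L g g' : L2s r g -> L2s r g' -> L2s r (fun x => g x + a%:C * g' x).
  by move=> hg hg'; apply: L2sD => //; exact: L2sZ.
elim: k u u' => [|k IH] u u' [hu H] [hu' H']; first by split=> //; exact: L.
split; first exact: L.
move=> j; have [w hw Hw] := H j; have [w' hw' Hw'] := H' j.
exists (fun x => w x + a%:C * w' x); last exact: IH.
have /L2sP lu := hu; have /L2sP lu' := hu'.
have /L2sP lw := Hks_L2s Hw; have /L2sP lw' := Hks_L2s Hw'.
apply/weak_pdP => b.
have E (g g' : sfield R) : (fun x => cpt b (g x + a%:C * g' x)) = (fun x => cpt b (g x) + a * cpt b (g' x)).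
  by apply/funext => x; rewrite cptD cptZ.
rewrite !E; apply: rweak_pdD => //; [exact: rL2Z|exact: rL2Z|by have /weak_pdP := hw|].
by apply: rweak_pdZ => //; have /weak_pdP := hw'.
Qed.

Lemma Hk_L2 k v : Hk r k v -> L2 r v.
Proof. by move=> h j; exact: Hks_L2s (h j). Qed.

Lemma Hk_lin k v w (a : R) : Hk r k v -> Hk r k w -> Hk r k (fun x => v x + a%:C *: w x).
Proof.
move=> hv hw j; have := Hks_lin a (hv j) (hw j); congr (Hks r k _).
by apply/funext => x; rewrite /vcomp !mxE.
Qed.

Lemma weak_div_ae v v' d : L2 r v -> L2 r v' -> ae_eq_ball r v v' ->
  weak_div r v d -> weak_div r v' d.
Proof.
move=> /L2P hv /L2P hv' vv' /weak_divP h; apply/weak_divP => b phi tphi.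
rewrite -(h b phi tphi); apply/esym.
apply: rint_sum_ae => j; [exact: hv|exact: hv'|exact: test_pd_rL2|exact: ae_cpt].
Qed.

Lemma normal_trace0_ae v v' : L2 r v -> L2 r v' -> ae_eq_ball r v v' ->
  normal_trace0 r v -> normal_trace0 r v'.
Proof.
move=> hv hv' vv' [d [hd wd tr]]; exists d; split=> //; first exact: weak_div_ae wd.
move=> h p hh hp hw; rewrite -[RHS](tr h p hh hp hw).
have I (w : vfield R) : L2 r w -> cbint r (fun x => \sum_j w x 0 j * p x 0 j + d x * h x).
  move=> hw'; apply: cbintD; last exact: cbintM.
  move=> b; rewrite (_ : (fun x => _) = fun x => \sum_j cpt b (w x 0 j * p x 0 j)); last first.
    by apply/funext => x; rewrite cpt_sum.
  apply: bint_sum => j; exact: (cbintM (hw' j) (hp j)).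
apply: cint_ae; [exact: I|exact: I|].
by apply: ae_mono vv' => x e Bx; rewrite e.
Qed.

Lemma solves_H2_ae lam f v v' : L2 r v' -> ae_eq_ball r v v' ->
  solves_H2 r lam f v -> solves_H2 r lam f v'.
Proof.
move=> hv' vv' [Hv [hv nv [d [g [hd hg wd wg e]]]]]; split.
  move=> j; apply: (Hks_ae (hv' j) _ (Hv j)).
  by apply: ae_mono vv' => x h Bx; rewrite /vcomp h.
split=> //; first exact: normal_trace0_ae nv.
exists d, g; split=> //; first exact: weak_div_ae wd.
by apply: ae_mono (ae_conj vv' e) => x [h1 h2] Bx; rewrite -h1// h2.
Qed.

Definition cfield (F : bool -> 'I_3 -> smooth R) : vfield R :=
  fun x => \row_i cplx (fun b => smooth_fun (F b i)) x.

Lemma cpt_cfield F b i x : cpt b (cfield F x 0 i) = F b i x.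
Proof. by rewrite mxE cpt_cplx. Qed.

Lemma L2_cfield F : L2 r (cfield F).
Proof. by apply/L2P => i b; rewrite (funext (cpt_cfield F b i)); exact: smooth_rL2. Qed.

Lemma solves_H2_smooth lam (F : bool -> 'I_3 -> smooth R) :
  (forall b, vb r (\sum_i sX R i * F b i)) ->
  (forall b i, sd i (\sum_j sd j (F b j)) = - (sC lam * F b i)) ->
  solves_H2 r lam (fun=> 0) (cfield F).
Proof.
move=> vF dF; pose D b : smooth R := \sum_j sd j (F b j).
pose d := cplx (fun b => smooth_fun (D b)).
pose g := cfield (fun b i => sd i (D b)).
have hF := L2_cfield F.
have hd : L2s r d by exact: Hks_L2s (Hks_smooth 0 D).
have EF b : (fun j x => cpt b (cfield F x 0 j)) = fun j => smooth_fun (F b j).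
  by apply/funext => j; exact: funext (cpt_cfield F b j).
have wd : weak_div r (cfield F) d.
  apply/weak_divP => b; rewrite EF (funext (cpt_cplx b _)).
  rewrite (_ : smooth_fun (D b) = fun x => \sum_j sd j (F b j) x); last first.
    by apply/funext => x; rewrite smf_sum.
  by apply: rweak_div_pd => j; [exact: smooth_rL2|exact: smooth_rL2|exact: smooth_rweak_pd].
split.
  move=> i; have := Hks_smooth 2 (fun b => F b i); congr (Hks r 2 _).
  by apply/funext => x; rewrite /vcomp mxE.
split=> //.
  apply: (normal_trace0_cpt hF hd wd) => b; rewrite EF (funext (cpt_cplx b _)).
  exact: rtrace0_smooth.
exists d, g; split=> //; first exact: L2_cfield.
  move=> j; apply/weak_pdP => b; rewrite (funext (cpt_cplx b _)).
  rewrite (_ : (fun x => cpt b (vcomp g j x)) = sd j (D b)); first exact: smooth_rweak_pd.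
  by apply/funext => x; rewrite /vcomp cpt_cfield.
apply: ae_triv => x _; apply/rowP => i; rewrite !mxE; apply: cpt_ext => b.
by rewrite cptD cptZ !cpt_cplx dF cpt0 !smfE addNr.
Qed.

Lemma inner_eq0 v w : L2 r v -> L2 r w ->
  (forall b b', rint r (fun x => \sum_i cpt b (v x 0 i) * cpt b' (w x 0 i)) = 0) ->
  inner r v w = 0.
Proof.
move=> hv hw h0; have /L2P lv := hv; have /L2P lw := hw.
have S b b' : \sum_i rint r (fun x => cpt b (v x 0 i) * cpt b' (w x 0 i)) = 0.
  by rewrite -[RHS](h0 b b') rint_sum// => i; exact: rL2M.
apply: complex_ext.
  apply: etrans (inner_re hv hw) _; apply: etrans (big_split _ _ _ _ _) _.
  by apply: etrans (congr2 +%R (S false false) (S true true)) _; rewrite addr0.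
by rewrite (inner_im hv hw) sumrB (S true false) (S false true) subrr.
Qed.

Lemma conj_cpt b (z : R[i]) : cpt b (conjc z) = (if b then -1 else 1) * cpt b z.
Proof. by case: z => z1 z2; case: b => /=; rewrite ?mulN1r ?mul1r. Qed.

Lemma weak_grad_conj h p : L2s r h -> L2 r p -> weak_grad r h p ->
  weak_grad r (fun x => conjc (h x)) (fun x => \row_j conjc (p x 0 j)).
Proof.
move=> /L2sP hh /L2P hp hw j; apply/weak_pdP => b; have /weak_pdP/(_ b) hb := hw j.
have := rweak_pdZ (if b then -1 else 1) (hh b) (hp j b) hb; congr (rweak_pd _ _ _ _).
  by apply/funext => x; rewrite conj_cpt.
by apply/funext => x; rewrite /vcomp mxE conj_cpt.
Qed.

End transfer.

Lemma orthonormal_lin_indep (R : realType) (r : R) (I : choiceType) (q : I -> vfield R) :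
  (forall i, L2 r (q i)) -> orthonormal_sys r q -> lin_indep r q.
Proof.
move=> hq on A b b0 i iA.
have := inner_ae (L2_sum A b hq) (L20 r) (hq i) b0.
by rewrite inner0l -/(psum q b A) (inner_psum hq on) iA.
Qed.

Lemma card_curl_index : ([set: bool * kappa 1] #= [set: nat])%card.
Proof.
apply: eq_card_nat.
  apply/countable_injP; exists (fun j : bool * kappa 1 => choice.pickle (j.1, sval j.2)).
  move=> [b p] [b' p'] _ _ /(pcan_inj choice.pickleK) [-> h]; congr (_, _); exact: val_inj.
pose f (m : nat) : bool * kappa 1 := (false, exist _ ((1%N, m), 0) isT).
have f_inj : injective f by move=> m m' [].
move=> fin; apply: infinite_nat.
have := @finite_preimage _ _ setT f (fun m m' _ _ => @f_inj m m') fin.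
by rewrite preimage_setT.
Qed.

Lemma kord_le n (j : 'I_(n.*2.+1)) : (`|kord j| <= n)%N.
Proof. by rewrite /kord; have := ltn_ord j; lia. Qed.

Definition kapord n m (j : 'I_(n.*2.+1)) : kappa 0 := exist _ ((n, m), kord j) (kord_le j).

Lemma kapord_inj n m : injective (@kapord n m).
Proof.
move=> j j' /(congr1 (fun p => (sval p).2)) /= h; apply: val_inj; move: h; rewrite /kord /=; lia.
Qed.

(** * Pairings with the basis fields and solvability *)

Section assembly.
Variables (R : realType) (r : R) (alpha rho : nat -> nat -> R) (c : nat -> nat -> int -> R).
Variable qpm : bool -> nat -> nat -> int -> vfield R.
Hypothesis r_gt0 : 0 < r.
Hypothesis alphaP : forall n, pos_zeros (derive1 (@psi R n)) (alpha n).
Hypothesis rhoP : forall n, pos_zeros (@psi R n) (rho n).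
Hypothesis qpmP : forall s n m k, (0 < n)%N -> (`|k| <= n)%N ->
    [/\ L2 r (qpm s n m k),
        weak_rot r (qpm s n m k)
          (fun x => ((-1) ^+ s * (rho n m / r))%:C *: qpm s n m k x) &
        normal_trace0 r (qpm s n m k)].
Let I := (kappa 0 + (bool * kappa 1))%type.
Let J := (bool * kappa 1)%type.
Let q : I -> vfield R := full_sys (qgrad r alpha c) qpm.
Hypothesis on : orthonormal_sys r q.
Hypothesis cs : complete_sys r q.

Lemma sys_L2 i : L2 r (q i).
Proof. exact (full_L2 c r_gt0 alphaP (qpm_L2 qpmP) i). Qed.
Let qL2 := sys_L2.

Lemma curl_eigenfield_smooth (j : J) : exists A : bool -> 'I_3 -> smooth R,
  [/\ forall b i, vb r (A b i), forall b, vb r (\sum_i sX R i * srot (A b) i) &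
      ae_eq_ball r (q (inr j)) (cfield (fun b => srot (A b)))].
Proof.
have [K [s [d e]]] := curl_eigenfield_span r_gt0 alphaP rhoP qpmP on cs j.
pose A b i : smooth R := \sum_(a < K) sC (cpt b (d a)) *
  epot (cev r rho (s a)) (ufun r rho (s a)) i.
have AE b i : srot (A b) i = \sum_(a < K) sC (cpt b (d a)) * efun r rho (s a) i.
  rewrite /A srot_sum; apply: eq_bigr => a _; exact: srotZ.
exists A; split.
- by move=> b i; apply: vb_sum => a; apply: vbM; exact: epot_vb r_gt0 rhoP _ _.
- move=> b; rewrite (eq_bigr (fun i => \sum_(a < K) sC (cpt b (d a)) * (sX R i * efun r rho (s a) i))).
    rewrite exchange_big; apply: vb_sum => a; rewrite -mulr_sumr; apply: vbM.
    exact: vb_sX_efun r_gt0 rhoP _.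
  by move=> i _; rewrite AE mulr_sumr; apply: eq_bigr => a _; ring.
apply: ae_mono e => x h Bx; apply: etrans (h Bx) _; apply/rowP => i; apply: cpt_ext => b.
rewrite cpt_cfield AE smf_sum summxE cpt_sum; apply: eq_bigr => a _.
by rewrite mxE cvecE cptMr smfM sCE.
Qed.

Lemma curl_sys_solves j : solves_H2 r 0 (fun=> 0) (q (inr j)).
Proof.
have [A [vA vx e]] := curl_eigenfield_smooth j.
apply: (solves_H2_ae (v := cfield (fun b => srot (A b)))); first exact: qL2.
  by apply: ae_mono e => x h Bx; rewrite h.
apply: solves_H2_smooth => // b i.
by rewrite div_srot raddf0 rmorph0 mul0r oppr0.
Qed.

(** Two boundary properties of the smooth representative are offered because the uses differ:
    [curl_free_orthogonal] takes the vanishing of the potential on the sphere, [gradient_orthogonal]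
    the tangency of its curl. *)
Lemma inner_curl_eq0 f (j : J) : L2 r f ->
  (forall A : 'I_3 -> smooth R, (forall i, vb r (A i)) -> vb r (\sum_i sX R i * srot A i) ->
     forall b, rint r (fun x => \sum_i cpt b (f x 0 i) * srot A i x) = 0) ->
  inner r f (q (inr j)) = 0.
Proof.
move=> hf h; have [A [vA vx e]] := curl_eigenfield_smooth j.
have e' := ae_cpt e; have /L2P hfr := hf; have /L2P hqr := qL2 (inr j).
apply: inner_eq0 => // b b'; rewrite -[RHS](h _ (vA b') (vx b') b).
have C (V W : 'I_3 -> R3 R -> R) :
    rint r (fun x => \sum_i V i x * W i x) = rint r (fun x => \sum_i W i x * V i x).
  by apply: eq_rint => x _; apply: eq_bigr => i _; rewrite mulrC.
rewrite C [RHS]C; apply: rint_sum_ae => i; [exact: hqr|exact: smooth_rL2|exact: hfr|].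
by apply: ae_mono (e' i b') => x hx Bx; rewrite hx// cpt_cfield.
Qed.

Lemma curl_free_orthogonal f j : L2 r f -> weak_rot r f (fun=> 0) -> inner r f (q (inr j)) = 0.
Proof.
move=> hf hr; apply: inner_curl_eq0 => // A vA _ b.
rewrite (rot_parts r_gt0 b hf (L20 r) hr vA) -[RHS](rint0 r).
by apply: eq_rint => x _; rewrite big1// => i _; rewrite mxE cpt0 mul0r.
Qed.

Lemma gradient_orthogonal d g j : L2s r d -> L2 r g -> weak_grad r d g ->
  inner r g (q (inr j)) = 0.
Proof.
move=> /L2sP hd hg hw; have /L2P hgr := hg; apply: inner_curl_eq0 => // A _ vx b.
have hwb i : rweak_pd r i (fun x => cpt b (d x)) (fun x => cpt b (g x 0 i)).
  by have /weak_pdP := hw i.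
rewrite -[RHS](sphere_parts_grad r_gt0 (hd b) (fun i => hgr i b) hwb vx).
apply: eq_rint => x _; rewrite big_split -mulr_sumr.
have -> : \sum_i sd i (srot A i) x = 0 by rewrite -smf_sum div_srot smf0.
by rewrite mulr0; symmetry; exact: add0r.
Qed.

(** The divergences in [normal_trace0] and in [solves] come from separate existential quantifiers;
    this identifies them against smooth functions that need not vanish on the sphere. *)
Lemma weak_div_pair v d d' (f : smooth R) b : L2s r d -> L2s r d' ->
  weak_div r v d -> weak_div r v d' ->
  rint r (fun x => cpt b (d x) * f x) = rint r (fun x => cpt b (d' x) * f x).
Proof.
move=> /L2sP hd /L2sP hd' /weak_divP/(_ b) wd /weak_divP/(_ b) wd'.
have i1 := rL2M (hd b) (smooth_rL2 r f); have i2 := rL2M (hd' b) (smooth_rL2 r f).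
apply/eqP; rewrite -subr_eq0 -rintB//; apply/eqP; apply: chi_vanish => //; first exact: bintB.
move=> k; have t := chi_test k f r_gt0.
have := oppr_inj (etrans (esym (wd _ t)) (wd' _ t)).
move=> /eqP; rewrite -subr_eq0 -rintB; [|by apply: rL2M => //; exact: smooth_rL2..].
move=> /eqP e; rewrite -[RHS]e; apply: eq_rint => x _; rewrite smfM; ring.
Qed.

Let nu := nufreq r alpha.

(** Two integrations by parts move grad div onto the potential G. In the first, the boundary term
    vanishes because the normal derivative of G is 0, in the second because the normal trace of v is
    0; between them the Laplacian of G is - nu^2 G. *)
Lemma grad_div_pairing v d g p : L2 r v -> normal_trace0 r v -> L2s r d -> L2 r g ->
  weak_div r v d -> weak_grad r d g ->
  inner r g (q (inl p)) = (- nu p ^+ 2)%:C * inner r v (q (inl p)).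
Proof.
move=> hv [d' [hd' wd' tr]] hd hg wd wg.
rewrite (inner_qgrad c r_gt0 alphaP (qpm_L2 qpmP))// (inner_qgrad c r_gt0 alphaP (qpm_L2 qpmP))//.
set G := gfun r alpha c p; have /L2P hgr := hg; have /L2sP hdr := hd.
apply: cpt_ext => b; rewrite cptZ !inner_cgrad.
have hwb i : rweak_pd r i (fun x => cpt b (d x)) (fun x => cpt b (g x 0 i)).
  by have /weak_pdP := wg i.
have [vE _ _] := neumann_gfun c r_gt0 alphaP p.
have e1 := sphere_parts_grad r_gt0 (hdr b) (fun i => hgr i b) hwb vE.
have e2 := normal_trace0_smooth G b hv hd' tr.
rewrite -(weak_div_pair G b hd hd' wd wd') in e2.
have iG := rL2M (hdr b) (smooth_rL2 r G).
have i2 : bint r (fun x => \sum_j cpt b (g x 0 j) * sd j G x).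
  by apply: bint_sum => j; apply: rL2M => //; exact: smooth_rL2.
have e3 : - nu p ^+ 2 * rint r (fun x => cpt b (d x) * G x) +
    rint r (fun x => \sum_j cpt b (g x 0 j) * sd j G x) = 0.
  rewrite -rintZ// -rintD//; last exact: bintZ.
  rewrite -[RHS]e1; apply: eq_rint => x _; rewrite big_split -mulr_sumr.
  have -> : \sum_i sd i (sd i G) x = - nu p ^+ 2 * G x.
    by rewrite -smf_sum -/(lap G) lap_gfun !smfE mulNr.
  by rewrite mulrCA.
move/eqP: e2; rewrite addr_eq0 => /eqP ->.
move/eqP: e3; rewrite addrC addr_eq0 => /eqP ->; ring.
Qed.

Lemma solves_pairing lam f v i : L2 r f -> solves r lam f v ->
  inner r f (q i) = (if i is inl p then lam - nu p ^+ 2 else lam)%:C * inner r v (q i).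
Proof.
move=> hf [hv nv [d [g [hd hg wd wg e]]]].
have hs := L2D hg (L2Z lam%:C hv).
rewrite -(inner_ae hs hf (qL2 i) e) innerDl//; last exact: L2Z.
rewrite innerZl//; case: i => [p|j].
  by rewrite (grad_div_pairing p hv nv hd hg wd wg) -mulrDl -rmorphD addrC.
by rewrite (gradient_orthogonal j hd hg wg) add0r.
Qed.

Lemma nu2_neq0 p : nu p ^+ 2 != 0.
Proof. by rewrite gt_eqF// exprn_gt0// (nu_gt0 r_gt0 alphaP). Qed.

Lemma orth_vanish u g : L2 r u -> L2 r g ->
  (forall i, inner r u (q i) = 0 \/ inner r g (q i) = 0) -> inner r u g = 0.
Proof.
move=> hu hg h; have [A [_ _ cv]] := fourier_expansion qL2 on cs hu.
apply: cpt_ext => b; rewrite cpt0.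
have cvb := @vcvg_inner _ _ _ _ _ cv hg b.
have E n : cpt b (inner r (psum q (fun i => inner r u (q i)) (A n)) g) = 0.
  rewrite (inner_conj hg (psum_L2 qL2 _ _)) (inner_psumr qL2)// big1 ?conjc0 ?cpt0// => i _.
  by case: (h i) => ->; rewrite ?conjc0 ?mul0r ?mulr0.
rewrite (funext E : (fun n => cpt b (inner r _ g)) = fun=> 0) in cvb.
by apply: cvg_unique cvb _; [exact: Rhausdorff|exact: cvg_cst].
Qed.

(** A gradient has no components along the curl fields by [gradient_orthogonal], and [w] has none
    along the gradient fields, so their expansions share no index. Conjugating [p] turns the
    bilinear pairing into [inner]. *)
Lemma solenoidal_of_orthogonal w : L2 r w -> (forall p, inner r w (q (inl p)) = 0) ->
  forall h p, L2s r h -> L2 r p -> weak_grad r h p ->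
    cintegral r (fun x => \sum_j w x 0 j * p x 0 j) = 0.
Proof.
move=> hw w0 h p hh hp hg.
pose pc : vfield R := fun x => \row_j conjc (p x 0 j).
have hpc : L2 r pc.
  move=> j; have := L2s_conj (hp j); congr (L2s r _).
  by apply/funext => x; rewrite /vcomp mxE.
have E : inner r w pc = cintegral r (fun x => \sum_j w x 0 j * p x 0 j).
  by apply: eq_cint => x _; apply: eq_bigr => j _; rewrite /pc mxE conjcK.
rewrite -E; apply: orth_vanish => // -[k|j]; first by left.
by right; apply: (gradient_orthogonal j (L2s_conj hh) hpc); exact: weak_grad_conj.
Qed.

(** Being orthogonal to all gradients, those of test functions included, [w] changes neither the
    divergence nor the normal trace of [v]; it enters only through the term of order zero. *)
Lemma solves_add lam f v w (a : R) : L2 r w -> (forall p, inner r w (q (inl p)) = 0) ->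
  solves r lam f v -> solves r lam (fun x => f x + (lam * a)%:C *: w x) (fun x => v x + a%:C *: w x).
Proof.
move=> hw w0 [hv [d' [hd' wd' tr]] [d [g [hd hg wd wg e]]]].
have div0 h p : L2s r h -> L2 r p -> weak_grad r h p ->
    cintegral r (fun x => \sum_j w x 0 j * p x 0 j) = 0.
  exact: solenoidal_of_orthogonal.
have pairE (h : sfield R) (p : vfield R) : L2s r h -> L2 r p -> weak_grad r h p ->
    cintegral r (fun x => \sum_j (v x + a%:C *: w x) 0 j * p x 0 j) =
    cintegral r (fun x => \sum_j v x 0 j * p x 0 j).
  move=> hh hp hg'.
  have iP u : L2 r u -> cbint r (fun x => \sum_j u x 0 j * p x 0 j).
    move=> hu b; rewrite (_ : (fun x => _) = fun x => \sum_j cpt b (u x 0 j * p x 0 j)).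
      by apply: bint_sum => j; exact: (cbintM (hu j) (hp j)).
    by apply/funext => x; rewrite cpt_sum.
  transitivity (cintegral r (fun x => \sum_j v x 0 j * p x 0 j) +
      a%:C * cintegral r (fun x => \sum_j w x 0 j * p x 0 j)); last first.
    by rewrite (div0 h p hh hp hg') mulr0 addr0.
  rewrite -cintZ; last exact: iP.
  rewrite -cintD; [|exact: iP|by apply: cbintZ; exact: iP].
  apply: eq_cint => x _; rewrite mulr_sumr -big_split; apply: eq_bigr => j _.
  by rewrite !mxE mulrDl mulrA.
have wdv dd : weak_div r v dd -> weak_div r (fun x => v x + a%:C *: w x) dd.
  move=> wdd phi tphi; rewrite -wdd//.
  have := pairE _ _ _ _ (test_weak_grad tphi).
  have hp : L2 r (fun x => \row_j (pd j phi x)%:C).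
    apply/L2P => j b; have := rL2_cptC b (test_pd_rL2 j tphi); congr (rL2 r _).
    by apply/funext => x; rewrite mxE.
  have hh : L2s r (fun x => (phi x)%:C).
    by apply/L2sP => b; exact: rL2_cptC (test_rL2 tphi).
  move=> /(_ hh hp) E.
  have R1 (u : vfield R) : cintegral r (fun x => \sum_j u x 0 j * (pd j phi x)%:C) =
      cintegral r (fun x => \sum_j u x 0 j * (\row_j (pd j phi x)%:C) 0 j).
    by apply: eq_cint => x _; apply: eq_bigr => j _; rewrite mxE.
  by rewrite R1 E -R1.
split; first by apply: L2D => //; exact: L2Z.
  exists d'; split=> //; first exact: wdv.
  move=> h p hh hp hgp; rewrite -[RHS](tr h p hh hp hgp).
  have iP u : L2 r u -> cbint r (fun x => \sum_j u x 0 j * p x 0 j).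
    move=> hu b; rewrite (_ : (fun x => _) = fun x => \sum_j cpt b (u x 0 j * p x 0 j)).
      by apply: bint_sum => j; exact: (cbintM (hu j) (hp j)).
    by apply/funext => x; rewrite cpt_sum.
  rewrite cintD; [|by apply: iP; apply: L2D => //; exact: L2Z|exact: cbintM].
  by rewrite cintD; [rewrite (pairE h p)|exact: iP|exact: cbintM].
exists d, g; split=> //; first exact: wdv.
apply: ae_mono e => x h Bx; rewrite -h// scalerDr scalerA -rmorphM; exact: addrA.
Qed.

Lemma curl_part f : L2 r f -> exists fB, [/\ L2 r fB, forall p, inner r fB (q (inl p)) = 0 &
  forall j, inner r fB (q (inr j)) = inner r f (q (inr j))].
Proof.
move=> hf; pose a (i : I) := if i is inr j then inner r f (q (inr j)) else 0.
have aM (A : {fset I}) : \sum_(i <- A) sqn (a i) <= nrm2 r f.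
  apply: le_trans (bessel qL2 on A hf); apply: ler_sum => -[p|j] _ //.
  have -> : sqn (a (inl p)) = 0 by rewrite /sqn /a /= !expr0n /= addr0.
  exact: sqn_ge0.
have [A [w [_ _ cv wa]]] := riesz_fischer qL2 on aM.
by exists w; split; [exact: vcvg_L2 cv|move=> p; rewrite wa|move=> j; rewrite wa].
Qed.

(** [gradient_solution] is applied to f - f_B. The summand f_B / lam is kept apart because it is
    only as regular as f_B, so that one construction serves both classes of solutions. *)
Lemma resonant_solution lam f fB : lam != 0 -> L2 r f -> L2 r fB ->
  (forall p, inner r fB (q (inl p)) = 0) ->
  (forall j, inner r fB (q (inr j)) = inner r f (q (inr j))) ->
  (forall p, nu p ^+ 2 = lam -> inner r f (q (inl p)) = 0) ->
  exists2 v1, Hk r 2 v1 & solves r lam f (fun x => v1 x + (lam^-1)%:C *: fB x).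
Proof.
move=> l0 hf hB B0 Bf fres.
have hfB : L2 r (fun x => f x - fB x) by exact: L2B.
have c0 j : inner r (fun x => f x - fB x) (q (inr j)) = 0 by rewrite innerBl// Bf subrr.
have c1 p : nu p ^+ 2 = lam -> inner r (fun x => f x - fB x) (q (inl p)) = 0.
  by move=> pl; rewrite innerBl// B0 subr0 fres.
have [v1 [H1 s1] _] := gradient_solution r_gt0 alphaP (qpm_L2 qpmP) on cs hfB c0 c1.
exists v1 => //; have := solves_add lam^-1 hB B0 s1.
rewrite divff// (_ : (fun x => f x - fB x + 1%:C *: fB x) = f)//.
by apply/funext => x; rewrite scale1r subrK.
Qed.

Lemma gradient_sys_solves p : solves_H2 r (nu p ^+ 2) (fun=> 0) (q (inl p)).
Proof.
set G := gfun r alpha c p.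
pose F (b : bool) i : smooth R := if b then 0 else sd i G.
have FE x : cfield F x = cgrad G x.
  apply/rowP => i; apply: cpt_ext => b; apply: etrans (cpt_cfield F b i x) _; rewrite cgradE.
  by case: b; rewrite /F /= ?smf0.
apply: (solves_H2_ae (v := cfield F)); first exact: qL2.
  by apply: ae_off0 => x x0; apply: etrans (FE x) _; symmetry; exact: (qgrad_cgrad c qpm r_gt0 alphaP p x0).
have [vE _ _] := neumann_gfun c r_gt0 alphaP p.
apply: solves_H2_smooth => // -[|].
- by rewrite big1 => [|i _]; [exact: vb0|rewrite /F mulr0].
- exact: vE.
- by move=> i; rewrite big1 => [|j _]; rewrite /F raddf0// mulr0 oppr0.
- move=> i; rewrite /F -/(lap G) lap_gfun.
  by rewrite sdN sdM sd_sC mulr0 addr0.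
Qed.

Lemma solves_homogeneous_inl lam v p : solves r lam (fun=> 0) v -> nu p ^+ 2 != lam ->
  inner r v (q (inl p)) = 0.
Proof.
move=> s pl; have := solves_pairing (inl p) (L20 r) s.
rewrite inner0l => /esym/eqP; rewrite mulf_eq0 => /orP[/eqP/(congr1 (cpt false)) /= e|/eqP//].
by move/eqP: e; rewrite subr_eq0 eq_sym (negPf pl).
Qed.

Lemma curl_coefs_of_solution f v : L2 r f -> solves r 0 f v ->
  forall j, inner r f (q (inr j)) = 0.
Proof. by move=> hf s j; rewrite (solves_pairing (inr j) hf s) rmorph0 mul0r. Qed.

Lemma fourier_sum_curl_zero f : L2 r f ->
  (forall j, inner r f (q (inr j)) = 0) <-> fourier_sum r (curl_sys qpm) f (fun=> 0).
Proof.
move=> hf; split=> [h|h].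
  apply: (fourier_sum_sub qL2 on cs); first exact: L20.
    by move=> k; rewrite inner0l.
  by move=> j; rewrite inner0l h.
have [_ e] := @fourier_coef R r _ _ q qL2 on f (fun=> 0) h.
by move=> j; rewrite -e inner0l.
Qed.

(** With g = grad div v, a field w in H^2 without curl components and with grad div w = g is built
    from the gradient fields. Then v - w has no gradient components, and lam (v - w) has the curl
    coefficients of f, so it is f_B and lies in H^2. *)
Lemma curl_part_of_solution lam f v : L2 r f -> lam != 0 -> solves_H2 r lam f v ->
  exists2 fB, fourier_sum r (curl_sys qpm) f fB & Hk r 2 fB.
Proof.
move=> hf l0 [Hv s]; have [hv nv [d [g [hd hg wd wg e]]]] := s.
have g0 j : inner r g (q (inr j)) = 0 by exact: gradient_orthogonal hd hg wg.
have g1 p : nu p ^+ 2 = 0 -> inner r g (q (inl p)) = 0.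
  by move=> e0; have := nu2_neq0 p; rewrite e0 eqxx.
have [w [Hw sw] w0] := gradient_solution r_gt0 alphaP (qpm_L2 qpmP) on cs hg g0 g1.
have hw := Hk_L2 Hw.
have hB : Hk r 2 (fun x => (lam%:C *: v x) + (- lam)%:C *: w x).
  have h0 : Hk r 2 (fun=> 0).
    move=> j; have := Hks_smooth r 2 (fun=> 0); congr (Hks r 2 _).
    by apply/funext => x; rewrite /vcomp mxE /cplx smf0.
  apply: Hk_lin => //; have := Hk_lin lam h0 Hv; congr (Hk r 2 _).
  by apply/funext => x; exact: add0r.
exists (fun x => (lam%:C *: v x) + (- lam)%:C *: w x) => //.
have B i : inner r (fun x => (lam%:C *: v x) + (- lam)%:C *: w x) (q i) =
    lam%:C * inner r v (q i) - lam%:C * inner r w (q i).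
  rewrite innerDl; [|exact: L2Z|exact: L2Z|exact: qL2].
  by rewrite !innerZl// rmorphN mulNr.
apply: (fourier_sum_sub qL2 on cs); first exact: Hk_L2 hB.
  move=> p; rewrite B -mulrBr.
  have e1 := grad_div_pairing p hv nv hd hg wd wg.
  have e2 := solves_pairing (inl p) hg sw; rewrite sub0r in e2.
  have n0 : (- nu p ^+ 2)%:C != 0 :> R[i].
    by apply/eqP => /(congr1 (cpt false)) /= /eqP; rewrite oppr_eq0 (negPf (nu2_neq0 p)).
  by rewrite (mulfI n0 (etrans (esym e1) e2)) subrr mulr0.
by move=> j; rewrite B w0 mulr0 subr0 (solves_pairing (inr j) hf s).
Qed.

(** Equality of the first indices is the transcendence result [Phi_zeros_disjoint]; within one n the
    zeros are distinct. *)
Lemma nu_resonance p n m : nu p ^+ 2 = (alpha n m / r) ^+ 2 ->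
  (sval p).1 = (n, m).
Proof.
move=> e; have a1 := alpha_gt0 alphaP (sval p).1.1 (sval p).1.2; have a2 := alpha_gt0 alphaP n m.
have en : nu p = alpha n m / r.
  apply: (@pexpIrn _ 2) => //; rewrite nnegrE ltW// ?(nu_gt0 r_gt0 alphaP)//.
  by rewrite divr_gt0.
have ea : alpha (sval p).1.1 (sval p).1.2 = alpha n m.
  exact: mulIf (invr_neq0 (lt0r_neq0 r_gt0)) _ _ en.
have nn : (sval p).1.1 = n.
  apply: (@Phi_zeros_disjoint R _ _ (alpha n m ^+ 2)); first by rewrite exprn_gt0.
    by rewrite -ea; exact: (zero_F (@dpsi_zero R) alphaP).
  exact: (zero_F (@dpsi_zero R) alphaP).
move: ea; rewrite nn => /(zero_inj alphaP) mm.
by move: nn mm; case: (sval p) => -[n' m'] k /= -> ->.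
Qed.

Lemma kapord_resonance p n m : nu p ^+ 2 = (alpha n m / r) ^+ 2 ->
  exists j : 'I_(n.*2.+1), p = kapord m j.
Proof.
move=> /nu_resonance; have := kappa_le p; case: p => -[nm k] hp /= h e.
move: h hp; rewrite e /= => h hp.
have jP : (`|(k + n%:Z)%R|%N < n.*2.+1)%N by lia.
exists (Ordinal jP); apply: val_inj => /=; congr (_, _); rewrite /kord /=; lia.
Qed.

Lemma resonant_kernel n m v : solves r ((alpha n m / r) ^+ 2) (fun=> 0) v ->
  exists b : 'I_(n.*2.+1) -> R[i],
    ae_eq_ball r v (fun x => \sum_j b j *: q (inl (kapord m j)) x).
Proof.
move=> s; have hv : L2 r v by case: s.
have l0 : (alpha n m / r) ^+ 2 != 0.
  by rewrite gt_eqF// exprn_gt0// divr_gt0// (alpha_gt0 alphaP).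
exists (fun j => inner r v (q (inl (kapord m j)))).
have hS := L2_sum (index_enum 'I_(n.*2.+1)) (fun j => inner r v (q (inl (kapord m j))))
  (fun j => qL2 (inl (kapord m j))).
apply: (complete_ae qL2 cs hv hS) => i.
rewrite inner_suml; [|by move=> j; exact: qL2|exact: qL2].
have E (j : 'I_(n.*2.+1)) : inner r (q (inl (kapord m j))) (q i) = (inl (kapord m j) == i)%:R by exact: on.
rewrite (eq_bigr _ (fun j _ => congr1 _ (E j))).
case: i {E} => [p|j']; last first.
  rewrite big1; last by move=> j _; rewrite mulr0.
  have := solves_pairing (inr j') (L20 r) s; rewrite inner0l => /esym/eqP.
  rewrite mulf_eq0 => /orP[/eqP/(congr1 (cpt false)) /= /eqP|/eqP//].
  by rewrite (negPf l0).
have [/kapord_resonance[j0 ->]|pl] := eqVneq (nu p ^+ 2) ((alpha n m / r) ^+ 2).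
  rewrite (bigD1 j0)// big1 => [|j /negPf jj].
    by rewrite eqxx mulr1; symmetry; exact: addr0.
  rewrite (_ : (_ == _) = false) ?mulr0//.
  by rewrite (inj_eq (@inl_inj _ _)) (inj_eq (@kapord_inj n m)).
rewrite (solves_homogeneous_inl s pl) big1// => j _.
rewrite (_ : (_ == _) = false) ?mulr0//; apply/eqP => e.
have e' := @inl_inj _ _ _ _ e; by rewrite -e' eqxx in pl.
Qed.

End assembly.

Theorem mainTheorem6 (R : realType) (r : R) (r_gt0 : 0 < r)
  (alpha rho : nat -> nat -> R)
  (alphaP : forall n, pos_zeros (derive1 (@psi R n)) (alpha n))
  (rhoP : forall n, pos_zeros (@psi R n) (rho n))
  (c : nat -> nat -> int -> R)
  (cP : forall n m k, (`|k| <= n)%N ->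
    inner r (qgrad r alpha c n m k) (qgrad r alpha c n m k) = 1)
  (qpm : bool -> nat -> nat -> int -> vfield R)
  (qpmP : forall s n m k, (0 < n)%N -> (`|k| <= n)%N ->
    [/\ L2 r (qpm s n m k),
        weak_rot r (qpm s n m k)
          (fun x => ((-1) ^+ s * (rho n m / r))%:C *: qpm s n m k x) &
        normal_trace0 r (qpm s n m k)])
  (sys_orthonormal : orthonormal_sys r (full_sys (qgrad r alpha c) qpm))
  (sys_complete : complete_sys r (full_sys (qgrad r alpha c) qpm)) :
  (* lambda = 0 *)
  ([/\ ([set: bool * kappa 1] #= [set: nat])%card,
       lin_indep r (curl_sys qpm),
       forall i, solves_H2 r 0 (fun=> 0) (curl_sys qpm i) &
       forall v, solves_H2 r 0 (fun=> 0) v -> fourier_sum r (curl_sys qpm) v v]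
   /\
   forall f, L2 r f ->
     [/\ (exists v, solves_H2 r 0 f v) <->
           (forall i, inner r f (curl_sys qpm i) = 0),
         (forall i, inner r f (curl_sys qpm i) = 0) <->
           fourier_sum r (curl_sys qpm) f (fun=> 0) &
         fourier_sum r (curl_sys qpm) f (fun=> 0) <->
           weak_rot r f (fun=> 0)])
  /\
  (* lambda = nu_{n,m}^2 *)
  (forall n m : nat,
     let nu := alpha n m / r in
     let q := fun j : 'I_(n.*2.+1) => qgrad r alpha c n m (kord j) in
     [/\ lin_indep r q,
         forall j, solves_H2 r (nu ^+ 2) (fun=> 0) (q j) &
         forall v, solves r (nu ^+ 2) (fun=> 0) v ->
           exists b : 'I_(n.*2.+1) -> R[i],
             ae_eq_ball r v (fun x => \sum_j b j *: q j x)]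
     /\
     forall f, L2 r f ->
       [/\ (exists v, solves r (nu ^+ 2) f v) <->
             (forall j, inner r f (q j) = 0),
           (exists2 fB, fourier_sum r (curl_sys qpm) f fB & Hk r 2 fB) ->
             ((exists v, solves_H2 r (nu ^+ 2) f v) <->
              (forall j, inner r f (q j) = 0)) &
           (exists v, solves_H2 r (nu ^+ 2) f v) ->
             exists2 fB, fourier_sum r (curl_sys qpm) f fB & Hk r 2 fB]).
Proof.
have qL2 := sys_L2 c r_gt0 alphaP qpmP.
have hqL2 := full_L2 c r_gt0 alphaP (qpm_L2 qpmP).
split; last first.
  move=> n m nu q.
  have nu0 : nu ^+ 2 != 0 by rewrite gt_eqF// exprn_gt0// divr_gt0// (alpha_gt0 alphaP).
  have qE j : q j = full_sys (qgrad r alpha c) qpm (inl (kapord m j)) by [].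
  have coef f v : L2 r f -> solves r (nu ^+ 2) f v -> forall j, inner r f (q j) = 0.
    move=> hf s j.
    by rewrite qE (solves_pairing r_gt0 alphaP rhoP qpmP sys_orthonormal sys_complete (inl (kapord m j)) hf s)
      subrr rmorph0 mul0r.
  have res f : (forall j, inner r f (q j) = 0) -> forall p, nufreq r alpha p ^+ 2 = nu ^+ 2 ->
      inner r f (full_sys (qgrad r alpha c) qpm (inl p)) = 0.
    by move=> h p /(kapord_resonance r_gt0 alphaP)[j ->]; exact: h.
  split.
    split.
    - apply: orthonormal_lin_indep => [j|i j]; first by rewrite qE; exact: qL2.
      rewrite !qE sys_orthonormal (inj_eq (@inl_inj _ _)).
      by rewrite (inj_eq (@kapord_inj n m)).
    - move=> j; exact: (gradient_sys_solves c r_gt0 alphaP qpmP (kapord m j)).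
    - exact: (resonant_kernel r_gt0 alphaP rhoP qpmP sys_orthonormal sys_complete).
  move=> f hf; split.
  - split=> [[v s]|h]; first exact: coef s.
    have [fB [hB B0 Bf]] := curl_part r_gt0 alphaP qpmP sys_orthonormal hf.
    have [v1 _ s] := resonant_solution r_gt0 alphaP rhoP qpmP sys_orthonormal sys_complete
      nu0 hf hB B0 Bf (res f h).
    by exists (fun x => v1 x + ((nu ^+ 2)^-1)%:C *: fB x).
  - move=> [fB fsB HB]; split=> [[v [_ s]]|h]; first exact: coef s.
    have [B0 Bf] := fourier_coef qL2 sys_orthonormal fsB.
    have [v1 H1 s] := resonant_solution r_gt0 alphaP rhoP qpmP sys_orthonormal sys_complete
      nu0 hf (Hk_L2 HB) B0 Bf (res f h).
    exists (fun x => v1 x + ((nu ^+ 2)^-1)%:C *: fB x); split=> //.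
    exact: Hk_lin.
  - move=> [v s].
    exact: (curl_part_of_solution r_gt0 alphaP rhoP qpmP sys_orthonormal sys_complete hf nu0 s).
split.
  split.
  - exact: card_curl_index.
  - apply: orthonormal_lin_indep => [j|i j]; first exact: (qL2 (inr j)).
    have := sys_orthonormal (inr i) (inr j); by rewrite (inj_eq (@inr_inj _ _)).
  - exact: (curl_sys_solves r_gt0 alphaP rhoP qpmP sys_orthonormal sys_complete).
  - move=> v [_ s]; have hv : L2 r v by case: s.
    apply: (fourier_sum_sub qL2 sys_orthonormal sys_complete) => // p.
    apply: (solves_homogeneous_inl r_gt0 alphaP rhoP qpmP sys_orthonormal sys_complete s).
    by rewrite (nu2_neq0 r_gt0 alphaP).
move=> f hf.
have fs := fourier_sum_curl_zero r_gt0 alphaP qpmP sys_orthonormal sys_complete hf.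
split=> //.
- split=> [[v [_ s]]|h].
    exact: (curl_coefs_of_solution r_gt0 alphaP rhoP qpmP sys_orthonormal sys_complete hf s).
  (* All frequencies are positive, so for lambda = 0 the resonance condition of [gradient_solution]
     is empty. *)
  have h0 p : nufreq r alpha p ^+ 2 = 0 -> inner r f (full_sys (qgrad r alpha c) qpm (inl p)) = 0.
    by move/eqP; rewrite (negPf (nu2_neq0 r_gt0 alphaP p)).
  have [v s _] := gradient_solution r_gt0 alphaP (qpm_L2 qpmP) sys_orthonormal sys_complete hf h h0.
  by exists v.
- split=> [/fs h|h].
    exact: (curl_free_of_orthogonal r_gt0 alphaP (qpm_L2 qpmP) sys_orthonormal sys_complete hf h).
  apply/fs => j.
  exact: (curl_free_orthogonal r_gt0 alphaP rhoP qpmP sys_orthonormal sys_complete j hf h).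
Qed.
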